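(* Let $D$ be a $C^1$-Dini domain in $\mathbb{R}^2$ with $0\in\partial D$. Let $R>0$ and let $u$ be a non-trivial harmonic function in $D\cap B_{2R}(0)$ such that $u=0$ on $\partial D\cap B_{2R}(0)$. Then the critical set $$\mathcal{C}(u):=\{x\in\overline{D}:\ \nabla u(x)=0\}$$ satisfies $$\#\big(\mathcal{C}(u)\cap B_R(0)\big)\le C,$$ where the constant $C$ depends on the Dini parameter of the domain $D$ and on $N(0,2R)$, the frequency function of $u$ in the ball $B_{2R}(0)$.
   Context: $B_r(p)$ is the Euclidean ball of center $p$ and radius $r$; $\#$ denotes cardinality; $\mathcal{H}^{k}$ is $k$-dimensional Hausdorff measure. Let $\theta\ge0$ be a nondecreasing function on $[0,\infty)$, positive on $(0,\infty)$, with $\int_0\frac{\theta(r)}{r}\,dr<\infty$ (convergence near $0$). A connected domain $D\subset\mathbb{R}^d$ is a ($C^1$-)Dini domain with (Dini) parameter $\theta$ if for each point $X_0\in\partial D$ there are a coordinate system $X=(x,x_d)$, $x\in\mathbb{R}^{d-1}$, $x_d\in\mathbb{R}$, in which $X_0=(0,0)$, a ball $B$ centered at $X_0$ and a Lipschitz function $\varphi:\mathbb{R}^{d-1}\to\mathbb{R}$ with: $\|\nabla\varphi\|_{L^\infty(\mathbb{R}^{d-1})}\le C_0$ for some $C_0>0$; $|\nabla\varphi(x)-\nabla\varphi(y)|\le\theta(|x-y|)$ for all $x,y\in\mathbb{R}^{d-1}$; and $D\cap B=\{(x,x_d)\in B:\ x_d>\varphi(x)\}$. Here $d=2$. In such domains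 a harmonic function vanishing on $\partial D\cap B_{2R}(0)$ is continuously differentiable up to that part of the boundary, so $\nabla u$ makes sense on $\overline D\cap B_{2R}(0)$. The frequency function of $u$ is $$N(p,r)=\frac{r\int_{B_r(p)\cap D}|\nabla u|^2\,dX}{\int_{\partial B_r(p)\cap D}u^2\,d\mathcal{H}^{d-1}}.$$
   Formalization: D∩B_2R(0) is assumed connected (else u may vanish on a component); C depends only on the Dini parameter and N(0,2R) when R is small for θ and D∩B_2R(0) lies above one Dini graph, otherwise also on D and R (thin necks, tiny holes); u is continuous up to D∩∂B_2R(0). *)

(* Defs.v *)
From HB Require Import structures.
From mathcomp Require Import all_boot all_order all_algebra.
From mathcomp Require Import all_classical all_reals all_analysis.
Set Implicit Arguments.
Unset Strict Implicit.
Unset Printing Implicit Defensive.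
Import Order.TTheory GRing.Theory Num.Theory.
Import numFieldNormedType.Exports.
Local Open Scope classical_set_scope.
Local Open Scope ring_scope.

(* The plane is [R * R].  Its canonical norm is the sup norm, which gives the
   right topology; Euclidean lengths and balls are therefore defined here. *)

Section euclidean_plane.
Context {R : realType}.
Implicit Types (X Y p : R * R) (r : R) (A : set (R * R)).

Definition dot X Y : R := X.1 * Y.1 + X.2 * Y.2.

Definition enorm X : R := Num.sqrt (dot X X).

Definition eball p r : set (R * R) := [set X | enorm (X - p) < r].

Definition ecball p r : set (R * R) := [set X | enorm (X - p) <= r].

Definition esphere p r : set (R * R) := [set X | enorm (X - p) = r].

Definition boundary A : set (R * R) := closure A `\` A°.

End euclidean_plane.

Section hausdorff_measure.
Context {R : realType}.
Implicit Types (U A : set (R * R)) (delta : R).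
Local Open Scope ereal_scope.

(* The added 0 makes the diameter of the empty set 0 instead of -oo. *)
Definition diameter U : \bar R :=
  ereal_sup (0 |` [set (enorm (X.1 - X.2))%:E | X in U `*` U]).

Definition gauge1 delta U : \bar R :=
  if `[< diameter U <= delta%:E >] then diameter U else +oo.

(* Infimum of the sums of diameters over the countable covers by Borel sets of
   diameter at most [delta]; a set and its closure have the same diameter, so
   covers by arbitrary sets would give the same value. *)
Definition hausdorff1_delta delta A : \bar R := mu_ext (gauge1 delta) A.

Definition hausdorff1 A : \bar R :=
  ereal_sup [set hausdorff1_delta delta A | delta in [set t : R | (0 < t)%R]].

Lemma diameter_ge0 U : 0 <= diameter U.
Proof. by apply: ereal_sup_ubound; left. Qed.

Lemma diameter0 : diameter set0 = 0.
Proof.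
rewrite /diameter set0X image_set0 setU0.
exact: ereal_sup1.
Qed.

Lemma gauge1_ge0 delta U : 0 <= gauge1 delta U.
Proof. by rewrite /gauge1; case: ifP => // _; exact: diameter_ge0. Qed.

Lemma gauge1_set0 delta : (0 < delta)%R -> gauge1 delta set0 = 0.
Proof.
move=> d0; rewrite /gauge1 diameter0; case: ifPn => // /asboolPn.
by rewrite lee_fin (ltW d0).
Qed.

Lemma hausdorff1_ge0 A : 0 <= hausdorff1 A.
Proof.
apply: (@le_trans _ _ (hausdorff1_delta 1 A)).
  exact/mu_ext_ge0/gauge1_ge0.
by apply: ereal_sup_ubound; exists 1%R => //=.
Qed.

Lemma hausdorff1_set0 : hausdorff1 set0 = 0.
Proof.
apply/eqP; rewrite eq_le hausdorff1_ge0 andbT.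
apply: ge_ereal_sup => _ [delta /= d0 <-].
rewrite /hausdorff1_delta mu_ext0//; first exact: gauge1_set0.
exact: gauge1_ge0.
Qed.

Lemma le_hausdorff1 : {homo hausdorff1 : A B / A `<=` B >-> A <= B}.
Proof.
move=> A B AB; apply: ge_ereal_sup => _ [delta /= d0 <-].
apply: (@le_trans _ _ (hausdorff1_delta delta B)).
  exact: le_mu_ext.
by apply: ereal_sup_ubound; exists delta.
Qed.

Lemma hausdorff1_sigma_subadditive : sigma_subadditive hausdorff1.
Proof.
move=> F; apply: ge_ereal_sup => _ [delta /= d0 <-].
apply: (le_trans (mu_ext_sigma_subadditive (gauge1_ge0 delta) F)).
apply: lee_nneseries => [n _ _|n _]; first exact/mu_ext_ge0/gauge1_ge0.
by apply: ereal_sup_ubound; exists delta.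
Qed.

HB.instance Definition _ := isOuterMeasure.Build R (R * R)%type hausdorff1
  hausdorff1_set0 hausdorff1_ge0 le_hausdorff1 hausdorff1_sigma_subadditive.

Definition hausdorff1_outer : {outer_measure set (R * R) -> \bar R} :=
  hausdorff1.

(* The one-dimensional Hausdorff measure, on the Caratheodory sigma-algebra. *)
Definition H1 : {measure set (caratheodory_type hausdorff1_outer) -> \bar R} :=
  (hausdorff1_outer : set (caratheodory_type hausdorff1_outer) -> \bar R).

End hausdorff_measure.

Section dini_domains.
Context {R : realType}.
Implicit Types (theta : R -> R) (D : set (R * R)) (p : R * R) (rho : R).

(* Only the values of [theta] on the nonnegative half-line matter. *)
Definition dini_parameter theta : Prop :=
  [/\ forall s, 0 <= s -> 0 <= theta s,
      forall s, 0 < s -> 0 < theta s,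
      forall s t, 0 <= s -> s <= t -> theta s <= theta t &
      (\int[@lebesgue_measure R]_(s in `]0%R, 1%R]) (theta s / s)%:E < +oo)%E].

(* [dini_graph theta D p rho]: in the ball of center [p] and radius [rho], the
   set [D] is the region above a graph.  The coordinates of [X] are
   [dot (X - p) e] and [dot (X - p) f], with (e, f) orthonormal. *)
Definition dini_graph theta D p rho : Prop :=
  exists (e f : R * R) (phi : R -> R) (C0 : R),
  [/\ [/\ dot e e = 1, dot f f = 1 & dot e f = 0],
      [/\ lipschitz (phi : R^o -> R^o), forall x, derivable phi x 1,
          0 < C0 & forall x, `|derive1 phi x| <= C0],
      forall x y, `|derive1 phi x - derive1 phi y| <= theta `|x - y| &
      forall X, eball p rho X -> (D X <-> phi (dot (X - p) e) < dot (X - p) f)].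

Definition dini_domain theta D : Prop :=
  [/\ open D, connected D &
      forall p, boundary D p -> exists2 rho, 0 < rho & dini_graph theta D p rho].

End dini_domains.

Section harmonic_functions.
Context {R : realType}.
Implicit Types (u : R * R -> R) (D A : set (R * R)) (p X : R * R) (r : R).

Definition e1 : R * R := (1, 0).
Definition e2 : R * R := (0, 1).

Definition grad u X : R * R := ('D_e1 u X, 'D_e2 u X).

Definition laplacian u X : R := 'D_e1 ('D_e1 u) X + 'D_e2 ('D_e2 u) X.

(* [C2_on u A]: on the open set [A], [u] has continuous partial derivatives up
   to order 2. *)
Definition C2_on u A : Prop :=
  forall X, A X ->
    {for X, continuous u} /\
    forall v, v = e1 \/ v = e2 ->
      [/\ derivable u X v, {for X, continuous ('D_v u)} &
          forall w, w = e1 \/ w = e2 ->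
            derivable ('D_v u) X w /\ {for X, continuous ('D_w ('D_v u))}].

Definition harmonic_on u A : Prop :=
  C2_on u A /\ forall X, A X -> laplacian u X = 0.

(* The gradient of [u] on the closure of [D] is the continuous extension of the
   gradient in [D], so it vanishes at [X] iff [grad u] tends to 0 at [X] from
   within [D]; for [X] in [D] this says [grad u X = 0]. *)
Definition critical_set D u : set (R * R) :=
  [set X | closure D X /\ grad u @ within D (nbhs X) --> (0 : R * R)].

Local Open Scope ereal_scope.

Definition dirichlet_energy D u p r : \bar R :=
  \int[(@lebesgue_measure R \x @lebesgue_measure R)%E]_(X in eball p r `&` D)
    (dot (grad u X) (grad u X))%:E.

Definition sphere_mass D u p r : \bar R :=
  \int[H1]_(X in (esphere p r `&` D : set (caratheodory_type hausdorff1_outer)))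
    (u X ^+ 2)%:E.

Definition frequency D u p r : \bar R :=
  r%:E * dirichlet_energy D u p r / sphere_mass D u p r.

End harmonic_functions.

(* Main.v *)
(* In the part of the domain near a boundary point the graph is almost flat, so
   the domain can be completed to an unbounded one whose Perron function H is
   monotone along a cone.  With its conjugate K, the map K + iH is injective up
   to the boundary and straightens it; in these coordinates u vanishes on the
   real axis and extends harmonically by odd reflection.  Critical points of u
   then become zeros of a holomorphic function, boundary ones included because
   the Dini condition gives a Hopf lemma, i.e. a nonzero derivative of K + iH.
   A holomorphic function with many zeros is small compared with its supremum,
   so the number of critical points near any point is controlled by a doubling
   quantity.  The frequency bounds it: the spherical mass is at most a constant
   times r m^2 plus a small multiple of the energy, m being the maximum of |u|
   on a slightly smaller ball, while the energy controls u pointwise because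
   the complement of the domain contains a disc near 0.  Hence u attains a
   definite fraction of its supremum inside, and propagation of smallness
   (along a star-shaped chain when the whole ball is one chart, by connectedness
   and compactness otherwise) transports this lower bound to every point. *)

From HB Require Import structures.
Require Import Defs.
From mathcomp Require Import all_boot all_order all_algebra all_field.
From mathcomp Require Import all_classical all_reals all_analysis.
From mathcomp Require Import measurable_realfun complex ring lra zify.
Set Implicit Arguments.
Unset Strict Implicit.
Unset Printing Implicit Defensive.
Import Order.TTheory GRing.Theory Num.Theory.
Import numFieldNormedType.Exports.
Local Open Scope classical_set_scope.
Local Open Scope card_scope.
Local Open Scope ring_scope.

(** * Polynomials on circles *)

Section complex_modulus.
Context {R : realType}.
Implicit Types (z w : R[i]) (p q : {poly R[i]}).

(** Analysis on discs is polynomial algebra: a function is harmonic when it is locally a uniform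
    limit of real parts of complex polynomials, and coefficient bounds come from exact averages over
    roots of unity, in place of contour integrals and Poisson kernels. The obstacle to a uniform
    count is that the Hopf constant and the modulus of continuity of the flattening map depend on
    the domain. Both are used only qualitatively, to see that critical points become zeros; the
    quantitative input is where the flattened points lie, which the thin strip of [cone_domain]
    controls. Throughout, u is replaced by its extension by zero, so that estimates can cross the
    boundary. The predicate [regular] isolates what the count needs of a domain: charts of a
    definite size and propagation of smallness. A ball lying in one chart of small tilt has it with
    universal functions, so [theta] enters the first constant only through r0; an arbitrary ball has
    it by compactness, with functions depending on D and r. *)

Definition cn z : R := Normc.normc z.

Lemma cnE z : cn z = Num.sqrt (complex.Re z ^+ 2 + complex.Im z ^+ 2).
Proof. by case: z. Qed.

Lemma cn_ge0 z : 0 <= cn z. Proof. by rewrite cnE sqrtr_ge0. Qed.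
Lemma cn0 : cn 0 = 0. Proof. exact: Normc.normc0. Qed.
Lemma cn1 : cn 1 = 1. Proof. exact: Normc.normc1. Qed.
Lemma cn_eq0 z : cn z = 0 -> z = 0. Proof. exact: Normc.eq0_normc. Qed.
Lemma cnM z w : cn (z * w) = cn z * cn w. Proof. exact: Normc.normcM. Qed.
Lemma cnV z : cn z^-1 = (cn z)^-1. Proof. exact: Normc.normcV. Qed.
Lemma cnD z w : cn (z + w) <= cn z + cn w. Proof. exact: (@le_normcD R z w). Qed.
Lemma cnN z : cn (- z) = cn z. Proof. exact: (@normcN R z). Qed.
Lemma cnB z w : cn (z - w) <= cn z + cn w. Proof. by rewrite -(cnN w) cnD. Qed.
Lemma cnX z n : cn (z ^+ n) = cn z ^+ n.
Proof. by elim: n => [|n IH]; rewrite ?expr0 ?cn1// !exprS cnM IH. Qed.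
Lemma cn_real (x : R) : cn x%:C%C = `|x|.
Proof. by rewrite cnE /= expr0n/= addr0 sqrtr_sqr. Qed.
Lemma cn_conj z : cn (conjc z) = cn z. Proof. by case: z => a b; rewrite !cnE/= sqrrN. Qed.
Lemma cn_nat n : cn n%:R = n%:R.
Proof. by rewrite -(rmorph_nat (real_complex R)) cn_real ger0_norm. Qed.

Lemma cn_sum (I : Type) (r : seq I) (P : pred I) (F : I -> R[i]) :
  cn (\sum_(i <- r | P i) F i) <= \sum_(i <- r | P i) cn (F i).
Proof.
elim/big_rec2: _ => [|i y x _ h]; first by rewrite cn0.
by apply: le_trans (cnD _ _) _; rewrite lerD2l.
Qed.

Lemma cn_Re z : `|complex.Re z| <= cn z.
Proof. by rewrite cnE -sqrtr_sqr ler_wsqrtr// lerDl sqr_ge0. Qed.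

Lemma cn_Im z : `|complex.Im z| <= cn z.
Proof. by rewrite cnE -sqrtr_sqr ler_wsqrtr// lerDr sqr_ge0. Qed.

Lemma cn_ReIm z : cn z <= `|complex.Re z| + `|complex.Im z|.
Proof.
rewrite cnE -[leRHS]ger0_norm ?addr_ge0// -sqrtr_sqr ler_wsqrtr//.
by rewrite sqrrD !real_normK ?num_real// lerD2r lerDl mulrn_wge0 ?mulr_ge0.
Qed.

Lemma cn_gt0 z : (0 < cn z) = (z != 0).
Proof.
rewrite lt_neqAle cn_ge0 andbT eq_sym; apply/idP/idP; apply: contraNN => /eqP.
  by move=> ->; rewrite cn0.
by move/cn_eq0 => ->.
Qed.

Lemma ReD z w : complex.Re (z + w) = complex.Re z + complex.Re w.
Proof. by case: z w => [? ?] [? ?]. Qed.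
Lemma ReN z : complex.Re (- z) = - complex.Re z.
Proof. by case: z. Qed.
Lemma ReB z w : complex.Re (z - w) = complex.Re z - complex.Re w.
Proof. by rewrite ReD ReN. Qed.
Lemma ReZ (x : R) z : complex.Re (x%:C%C * z) = x * complex.Re z.
Proof. by case: z => a b /=; rewrite mul0r subr0. Qed.
Lemma Re_sum (I : Type) (r : seq I) (P : pred I) (F : I -> R[i]) :
  complex.Re (\sum_(i <- r | P i) F i) = \sum_(i <- r | P i) complex.Re (F i).
Proof. by apply: big_morph => //; exact: ReD. Qed.
Lemma Re_conj z : complex.Re (conjc z) = complex.Re z.
Proof. by case: z. Qed.

(** ['X^n - 1] splits into distinct linear factors over the algebraically closed field R[i], and n
    distinct n-th roots of unity in a field include a primitive one. *)
Lemma prim_root_ex n : (0 < n)%N -> exists w : R[i], n.-primitive_root w.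
Proof.
pose p : {poly R[i]} := 'X^n - 1; have [r Dp] := closed_field_poly_normal p.
move=> n_gt0; rewrite (monicP _) ?monicXnsubC // scale1r in Dp.
have rn1: all n.-unity_root r by apply/allP=> z; rewrite -root_prod_XsubC -Dp.
have sz_r: (n < (size r).+1)%N.
  by rewrite -(size_prod_XsubC r id) -Dp size_XnsubC.
have [|z] := hasP (cyclic.has_prim_root n_gt0 rn1 _ sz_r); last by exists z.
by rewrite -separable_prod_XsubC -Dp separable_Xn_sub_1 // pnatr_eq0 -lt0n.
Qed.

Lemma cn_prim n w : n.-primitive_root w -> cn w = 1.
Proof.
move=> wp; have n0 := prim_order_gt0 wp.
have := congr1 cn (prim_expr_order wp); rewrite cnX cn1 => /eqP.
by rewrite pexpr_eq1 ?cn_ge0// => /eqP.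
Qed.

Lemma sum_prim n w m : n.-primitive_root w ->
  \sum_(j < n) w ^+ (j * m) = if (n %| m)%N then n%:R else 0.
Proof.
move=> wp; have [/(dvdnP) [k ->]|nd] := boolP (n %| m)%N.
  under eq_bigr => j _ do rewrite mulnA mulnC exprM (prim_expr_order wp) expr1n.
  by rewrite sumr_const card_ord.
have w1 : w ^+ m != 1 by rewrite -(prim_order_dvd wp).
apply: (mulfI (x := w ^+ m - 1)); first by rewrite subr_eq0.
rewrite mulr0; under eq_bigr => j _ do rewrite mulnC exprM.
by rewrite -subrX1 -exprM mulnC exprM (prim_expr_order wp) expr1n subrr.
Qed.

Lemma conj_prim n w i : n.-primitive_root w -> (i <= n)%N ->
  conjc w ^+ i = w ^+ (n - i).
Proof.
move=> wp le_in; have cw := cn_prim wp.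
have w0 : w != 0 by rewrite -cn_gt0 cw.
have ww : w * conjc w = 1.
  apply: (@eq_trans _ _ (`|w| ^+ 2)); first by rewrite sqr_normc.
  by rewrite normc_def -cnE cw expr1n.
apply: (mulfI (x := w ^+ i)); first by rewrite expf_neq0.
by rewrite -exprMn ww expr1n -exprD subnKC// (prim_expr_order wp).
Qed.

Lemma conj_horner p z : conjc p.[z] = (map_poly (@conjc R) p).[conjc z].
Proof. by rewrite horner_map. Qed.

(* Discrete Fourier analysis at the [n]-th roots of unity, which is exact on
   polynomials of degree less than [n]; the conjugate of [p] only has
   nonpositive frequencies. *)
Lemma dft n w p (rho : R) k : n.-primitive_root w -> (size p <= n)%N -> (k < n)%N ->
  \sum_(j < n) p.[rho%:C%C * w ^+ j] * w ^+ (j * (n - k)) =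
  n%:R * (p`_k * rho%:C%C ^+ k).
Proof.
move=> wp sp kn.
under eq_bigr => j _.
  rewrite (horner_coef_wide _ sp) mulr_suml.
  under eq_bigr => i _ do
    rewrite exprMn -mulrA -mulrA -exprM -exprD -mulnDr mulrA.
  over.
rewrite exchange_big /=.
under eq_bigr => i _ do rewrite -mulr_sumr (sum_prim _ wp).
rewrite (bigD1 (Ordinal kn)) //= subnKC 1?ltnW// dvdnn mulrC big1 ?addr0//.
move=> i ik; case: ifP => [|_]; last by rewrite mulr0.
(* The frequency i + n - k lies strictly between 0 and 2n, so n is the only multiple of n that it
   can equal. *)
move=> /dvdnP[q]; have := ltn_ord i => lin h.
suff : nat_of_ord i = k by move=> e; move/eqP: ik; case; exact: val_inj.
case: q h => [|[|q]] h.
- by move: h lin; rewrite mul0n; lia.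
- by move: h lin; rewrite mul1n; lia.
- by move: h lin; rewrite !mulSn; lia.
Qed.

Lemma dft_conj n w p (rho : R) k : n.-primitive_root w -> (size p + k <= n)%N ->
  (0 < k)%N -> \sum_(j < n) conjc p.[rho%:C%C * w ^+ j] * w ^+ (j * (n - k)) = 0.
Proof.
move=> wp sp k0.
set q := map_poly (@conjc R) p.
have sq : (size q <= n)%N by rewrite size_map_poly (leq_trans _ sp)// leq_addr.
under eq_bigr => j _ do
  rewrite conj_horner (horner_coef_wide _ sq) mulr_suml.
rewrite exchange_big big1// => i _.
have [ip|ip] := ltnP i (size p); last first.
  by apply: big1 => j _; rewrite coef_map/= (nth_default _ ip) rmorph0 !mul0r.
under eq_bigr => j _ do
  rewrite [conjc (_ * _)]rmorphM/= exprMn [conjc (_ ^+ _)]rmorphXn/= exprAC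
    (conj_prim wp (ltnW (ltn_ord i))) -exprM -!mulrA -exprD
    [((n - i) * _)%N]mulnC -mulnDr mulrA.
rewrite -mulr_sumr (sum_prim _ wp); case: ifP => [|_]; last by rewrite mulr0.
move=> /dvdnP[m h]; exfalso; have lin := ltn_ord i.
case: m h => [|[|m]] h; move: h; rewrite ?mulSn ?mul0n ?addn0; lia.
Qed.

(** Adding the conjugate turns p into twice its real part and leaves the coefficients of positive
    index unchanged: the discrete way to recover a holomorphic function from its real part. *)
Lemma mean_coef n w p (rho : R) k : n.-primitive_root w -> (size p + k <= n)%N ->
  (0 < k)%N -> (k < n)%N ->
  2 * \sum_(j < n) (complex.Re p.[rho%:C%C * w ^+ j])%:C%C * w ^+ (j * (n - k)) =
  n%:R * (p`_k * rho%:C%C ^+ k).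
Proof.
move=> wp sp k0 kn.
rewrite mulr_sumr; under eq_bigr => j _ do rewrite mulrA -addcJ mulrDl.
rewrite big_split /= (dft_conj _ wp)// addr0 (dft _ wp)//.
by apply: leq_trans sp; rewrite leq_addr.
Qed.

Lemma mean_coef0 n w p (rho : R) : n.-primitive_root w -> (size p <= n)%N ->
  \sum_(j < n) complex.Re p.[rho%:C%C * w ^+ j] = n%:R * complex.Re p`_0.
Proof.
move=> wp sp; have n0 := prim_order_gt0 wp.
have := dft rho wp sp n0; rewrite expr0 mulr1 subn0 => h.
rewrite -Re_sum.
under eq_bigr => j _ do
  rewrite -[_.[_]]mulr1 -[X in _ * X](expr1n _ j) -(prim_expr_order wp) -exprM mulnC.
by rewrite h -(rmorph_nat (real_complex R)) ReZ.
Qed.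

Lemma circle_prim n w (rho : R) j : 0 <= rho -> n.-primitive_root w ->
  cn (rho%:C%C * w ^+ j) = rho.
Proof.
by move=> r0 wp; rewrite cnM cn_real cnX (cn_prim wp) expr1n mulr1 ger0_norm.
Qed.

Lemma coef_mean_le n w p (rho : R) k : 0 <= rho -> n.-primitive_root w ->
  (size p + k <= n)%N -> (0 < k)%N -> (k < n)%N ->
  n%:R * (cn p`_k * rho ^+ k) <= 2 * \sum_(j < n) `|complex.Re p.[rho%:C%C * w ^+ j]|.
Proof.
move=> r0 wp sp k0 kn.
have := congr1 cn (mean_coef rho wp sp k0 kn).
rewrite !cnM cnX cn_real !cn_nat ger0_norm// => <-.
rewrite ler_wpM2l//; apply: le_trans (cn_sum _ _ _) _.
by apply: ler_sum => j _; rewrite cnM cn_real cnX (cn_prim wp) expr1n mulr1.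
Qed.

(** Cauchy's estimate from the real part alone; the factor 2 is that of [mean_coef]. *)
Lemma coef_bound p (rho M : R) k : 0 <= rho ->
  (forall z, cn z = rho -> `|complex.Re p.[z]| <= M) -> (0 < k)%N ->
  cn p`_k * rho ^+ k <= 2 * M.
Proof.
move=> r0 h k0; pose n := (size p + k).+1.
have [w wp] := @prim_root_ex n (ltn0Sn _).
have nn : 0 < n%:R :> R by rewrite ltr0n.
rewrite -(ler_pM2l nn); apply: le_trans (@coef_mean_le n w p rho k r0 wp _ k0 _) _.
- by rewrite /n leqnSn.
- by rewrite /n ltnS leq_addl.
rewrite mulrCA ler_wpM2l//.
rewrite mulr_natl -[X in _ *+ X]card_ord -sumr_const.
by apply: ler_sum => j _; exact: h (circle_prim _ r0 wp).
Qed.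

(** Carathéodory's inequality: for a nonnegative real part the mean of the absolute values is the
    plain mean, which is the value at the centre. *)
Lemma coef_pos p (rho : R) k : 0 <= rho ->
  (forall z, cn z = rho -> 0 <= complex.Re p.[z]) -> (0 < k)%N ->
  cn p`_k * rho ^+ k <= 2 * complex.Re p`_0.
Proof.
move=> r0 h k0; pose n := (size p + k).+1.
have [w wp] := @prim_root_ex n (ltn0Sn _).
have nn : 0 < n%:R :> R by rewrite ltr0n.
rewrite -(ler_pM2l nn); apply: le_trans (@coef_mean_le n w p rho k r0 wp _ k0 _) _.
- by rewrite /n leqnSn.
- by rewrite /n ltnS leq_addl.
rewrite mulrCA ler_wpM2l// -(mean_coef0 rho wp) ?ler_sum//.
  by move=> j _; rewrite ger0_norm// h// (circle_prim _ r0 wp).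
by rewrite /n leqW// leq_addr.
Qed.

Lemma coef0_le p (rho M : R) : 0 <= rho ->
  (forall z, cn z = rho -> complex.Re p.[z] <= M) -> complex.Re p`_0 <= M.
Proof.
move=> r0 h; pose n := (size p).+1.
have [w wp] := @prim_root_ex n (ltn0Sn _).
have nn : 0 < n%:R :> R by rewrite ltr0n.
rewrite -(ler_pM2l nn) -(mean_coef0 rho wp) ?leqnSn//.
rewrite mulr_natl -[X in _ *+ X]card_ord -sumr_const.
by apply: ler_sum => j _; exact: h (circle_prim _ r0 wp).
Qed.

End complex_modulus.

(** * Fejér's theorem on the unit circle *)

Section fejer.
Context {R : realType}.
Implicit Types (z w : R[i]) (p q : {poly R[i]}).

(** On the unit circle its real part is the Fejér kernel |1 + z + ... + z^(m-1)|^2 / m. The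
    exponents |a - b| keep it a polynomial, since a negative power has there the same real part as
    the opposite positive one. *)
Definition fejer_poly (m : nat) : {poly R[i]} :=
  m%:R^-1 *: \sum_(a < m) \sum_(b < m) 'X^(maxn a b - minn a b).

Lemma mulc_conj1 z : cn z = 1 -> z * conjc z = 1.
Proof. by move=> z1; rewrite -sqr_normc normc_def -cnE z1 expr1n. Qed.

Lemma unit_pow_conj z a b : cn z = 1 -> complex.Re (z ^+ a * conjc z ^+ b) =
  complex.Re (z ^+ (maxn a b - minn a b)).
Proof.
move=> z1; have e c : z ^+ c * conjc z ^+ c = 1 by rewrite -exprMn mulc_conj1// expr1n.
have [ab|ba] := leqP a b.
  rewrite -{1}(subnK ab) exprD mulrCA e mulr1 -[conjc z ^+ _]/(conjc z ^+ _).
  by rewrite -rmorphXn Re_conj.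
by rewrite -{1}(subnK (ltnW ba)) exprD -mulrA e mulr1.
Qed.

Lemma fejer_sqr m z : cn z = 1 ->
  complex.Re (fejer_poly m).[z] = m%:R^-1 * cn (\sum_(k < m) z ^+ k) ^+ 2.
Proof.
move=> z1; rewrite hornerZ -(rmorph_nat (real_complex R)) -fmorphV ReZ; congr (_ * _).
set D := (\sum_(k < m) z ^+ k : R[i]).
have -> : cn D ^+ 2 = complex.Re (D * conjc D).
  by rewrite -sqr_normc normc_def -cnE -rmorphXn.
rewrite rmorph_sum /= mulr_suml horner_sum !Re_sum; apply: eq_bigr => a _.
rewrite mulr_sumr horner_sum !Re_sum; apply: eq_bigr => b _.
by rewrite hornerXn rmorphXn /= unit_pow_conj.
Qed.

Lemma fejer_far m z : (0 < m)%N -> cn z = 1 -> z != 1 ->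
  complex.Re (fejer_poly m).[z] <= 4 / (m%:R * cn (1 - z) ^+ 2).
Proof.
move=> m0 z1 nz1; rewrite fejer_sqr//.
have zz : 0 < cn (1 - z) by rewrite cn_gt0 subr_eq0 eq_sym.
have mm : 0 < m%:R :> R by rewrite ltr0n.
rewrite ler_pdivlMr ?mulr_gt0 ?exprn_gt0//.
rewrite mulrACA mulVf ?gt_eqF// mul1r -exprMn -cnM.
have -> : (\sum_(k < m) z ^+ k) * (1 - z) = 1 - z ^+ m.
  by rewrite -[RHS]opprB subrX1 mulrC -mulNr opprB.
have : cn (1 - z ^+ m) <= 2.
  by rewrite (le_trans (cnB _ _))// cn1 cnX z1 expr1n.
have := cn_ge0 (1 - z ^+ m); nra.
Qed.

(** All frequencies |a - b| are below m <= n, so averaging over the n-th roots of unity kills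
    everything off the diagonal: the discrete mean of the kernel is exactly one. *)
Lemma fejer_sum m n w z : (0 < m)%N -> (m <= n)%N -> n.-primitive_root w ->
  \sum_(j < n) (fejer_poly m).[z * conjc (w ^+ j)] = n%:R.
Proof.
move=> m0 mn wp.
have mm : m%:R != 0 :> R[i] by rewrite pnatr_eq0 -lt0n.
rewrite (eq_bigr (fun j : 'I_n => m%:R^-1 * \sum_(a < m) \sum_(b < m)
   (z * conjc (w ^+ j)) ^+ (maxn a b - minn a b))); last first.
  move=> j _; rewrite hornerZ horner_sum; congr (_ * _); apply: eq_bigr => a _.
  by rewrite horner_sum; apply: eq_bigr => b _; rewrite hornerXn.
rewrite -mulr_sumr exchange_big /= (eq_bigr (fun=> n%:R)).
  by rewrite sumr_const card_ord -[n%:R *+ m]mulr_natl mulKf.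
move=> a _; rewrite exchange_big /= (bigD1 a)//= maxnn minnn subnn.
rewrite (eq_bigr (fun=> 1)) ?sumr_const ?card_ord ?big1 ?addr0//.
move=> b ba; set d := (_ - _)%N.
have d0 : (0 < d)%N by rewrite /d; move: ba; rewrite -val_eqE /=; lia.
have dn : (d < n)%N by rewrite /d; have := ltn_ord a; have := ltn_ord b; lia.
under eq_bigr => j _ do rewrite exprMn rmorphXn /= exprAC
  (conj_prim wp (ltnW dn)) -exprM mulnC.
rewrite -mulr_sumr (sum_prim _ wp); case: ifP => [/dvdnP[k]|]; last by rewrite mulr0.
by case: k => [|k]; rewrite ?mulSn; lia.
Qed.

(** Discrete convolution with the Fejér kernel: p is a combination of rotated kernels weighted by m
    samples of g. *)
Lemma fejer_approx (g : R[i] -> R) (G : R) :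
  (forall z, cn z = 1 -> `|g z| <= G) ->
  (forall e : R, 0 < e -> exists2 d : R, 0 < d & forall z w, cn z = 1 -> cn w = 1 ->
     cn (z - w) < d -> `|g z - g w| <= e) ->
  forall e : R, 0 < e -> exists p, forall z, cn z = 1 -> `|complex.Re p.[z] - g z| <= e.
Proof.
move=> gG gc e e0.
have e20 : 0 < e / 2 by rewrite divr_gt0.
have [d d0 hd] := gc (e / 2) e20.
have G0 : 0 <= G by apply: le_trans (gG 1 cn1).
(* At distance at least d the kernel is at most 4 / (m d^2); this m makes its product with the
   oscillation 2 G at most e / 2. *)
pose m := (Num.truncn (16 * (G + 1) / (e * d ^+ 2))).+1.
have mP : 16 * (G + 1) / (e * d ^+ 2) < m%:R by rewrite /m truncnS_gt.
have m0 : (0 < m)%N by [].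
have mr : 0 < m%:R :> R by rewrite ltr0n.
have [w wp] := @prim_root_ex R m m0.
pose p := \sum_(j < m) (m%:R^-1 * g (w ^+ j))%:C%C *:
   (fejer_poly m \Po ((conjc (w ^+ j)) *: 'X)).
exists p => z z1.
have pz : complex.Re p.[z] = m%:R^-1 * \sum_(j < m) g (w ^+ j) *
    complex.Re (fejer_poly m).[z * conjc (w ^+ j)].
  rewrite /p horner_sum Re_sum mulr_sumr; apply: eq_bigr => j _.
  by rewrite hornerZ ReZ horner_comp [(_ *: 'X).[z]]hornerZ hornerX mulrA [_ * z]mulrC.
have one : m%:R^-1 * \sum_(j < m) complex.Re (fejer_poly m).[z * conjc (w ^+ j)] = 1.
  rewrite -Re_sum (fejer_sum _ m0 (leqnn _) wp) -(rmorph_nat (real_complex R)) /=.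
  by rewrite mulVf ?gt_eqF.
have -> : complex.Re p.[z] - g z = m%:R^-1 * \sum_(j < m) (g (w ^+ j) - g z) *
    complex.Re (fejer_poly m).[z * conjc (w ^+ j)].
  under eq_bigr => j _ do rewrite mulrBl.
  by rewrite sumrB mulrBr -pz -mulr_sumr [in RHS]mulrCA one mulr1.
rewrite normrM ger0_norm ?invr_ge0 ?ler0n// mulrC ler_pdivrMr//.
apply: le_trans (ler_norm_sum _ _ _) _.
(* A sample near z contributes at most e / 2 times the kernel, a far one at most e / 2; the sum of
   both bounds covers the two cases, and the kernel has mean one. *)
apply: (@le_trans _ _ (\sum_(j < m) (e / 2 * complex.Re (fejer_poly m).[z * conjc (w ^+ j)] + e / 2))).
  apply: ler_sum => j _; rewrite normrM.
  have wj : cn (w ^+ j) = 1 by rewrite cnX (cn_prim wp) expr1n.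
  have zw : cn (z * conjc (w ^+ j)) = 1 by rewrite cnM cn_conj z1 wj mulr1.
  have K0 : 0 <= complex.Re (fejer_poly m).[z * conjc (w ^+ j)].
    by rewrite fejer_sqr// mulr_ge0 ?exprn_ge0 ?cn_ge0// invr_ge0.
  rewrite (ger0_norm K0).
  have [near|far] := ltP (cn (w ^+ j - z)) d.
    by rewrite (le_trans (ler_wpM2r K0 (hd _ _ wj z1 near)))// lerDl ltW.
  have dd : cn (1 - z * conjc (w ^+ j)) = cn (w ^+ j - z).
    have -> : 1 - z * conjc (w ^+ j) = (w ^+ j - z) * conjc (w ^+ j).
      by rewrite mulrBl mulc_conj1.
    by rewrite cnM cn_conj wj mulr1.
  have nz : z * conjc (w ^+ j) != 1.
    by rewrite eq_sym -subr_eq0 -cn_gt0 dd (lt_le_trans d0).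
  have := fejer_far m0 zw nz; rewrite dd => hK.
  have g2 : `|g (w ^+ j) - g z| <= 2 * G.
    by apply: le_trans (ler_normB _ _) _; have := gG _ wj; have := gG _ z1; lra.
  have small : 4 / (m%:R * cn (w ^+ j - z) ^+ 2) * (2 * G) <= e / 2.
    have dd2 : d ^+ 2 <= cn (w ^+ j - z) ^+ 2 by rewrite lerXn2r ?nnegrE ?cn_ge0// ltW.
    have d20 : 0 < d ^+ 2 by rewrite exprn_gt0.
    have cp := lt_le_trans d0 far.
    rewrite mulrAC ler_pdivrMr ?mulr_gt0//.
    move: mP; rewrite ltr_pdivrMr ?mulr_gt0// => mP.
    have : m%:R * (e * d ^+ 2) <= m%:R * (e * cn (w ^+ j - z) ^+ 2).
      by rewrite !ler_wpM2l// ltW.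
    nra.
  have s1 : `|g (w ^+ j) - g z| * complex.Re (fejer_poly m).[z * conjc (w ^+ j)] <= e / 2.
    apply: le_trans small; rewrite mulrC; apply: ler_pM => //.
  by apply: le_trans s1 _; rewrite lerDr mulr_ge0// ltW.
rewrite big_split /= -mulr_sumr sumr_const card_ord.
have -> : \sum_(j < m) complex.Re (fejer_poly m).[z * conjc (w ^+ j)] = m%:R.
  by apply: (mulfI (x := m%:R^-1)); rewrite ?invr_eq0 ?gt_eqF// one mulVf ?gt_eqF.
by rewrite -[_ *+ m]mulr_natr; lra.
Qed.

End fejer.

(** * The Euclidean plane *)

(* [R * R] has no canonical pointed topological structure, which
   [compact_cover] requires. *)
Definition plane_ptop (R : realType) : ptopologicalType :=
  HB.pack (R * R)%type (Topological.on (R * R)%type) (Pointed.on (R * R)%type).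

Lemma plane_cover_compact (R : realType) (K : set (R * R)) : compact K -> cover_compact K.
Proof.
by move=> h; have := h; rewrite -[compact K]/(@compact (plane_ptop R) K) compact_cover.
Qed.

Section plane.
Context {R : realType}.
Implicit Types (X Y Z : R * R) (A K W : set (R * R)) (u w : R * R -> R).

Definition toC X : R[i] := (X.1 +i* X.2)%C.
Definition ofC (z : R[i]) : R * R := (complex.Re z, complex.Im z).

Lemma toCK : cancel toC ofC. Proof. by case. Qed.
Lemma ofCK : cancel ofC toC. Proof. by case. Qed.
Lemma toCD X Y : toC (X + Y) = toC X + toC Y. Proof. by []. Qed.
Lemma toCN X : toC (- X) = - toC X. Proof. by []. Qed.
Lemma toCB X Y : toC (X - Y) = toC X - toC Y. Proof. by []. Qed.

Lemma enormE X : enorm X = cn (toC X).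
Proof. by rewrite cnE /enorm /dot /= !expr2. Qed.

Lemma enorm_ge0 X : 0 <= enorm X. Proof. by rewrite enormE cn_ge0. Qed.
Lemma enorm0 : enorm (0 : R * R) = 0.
Proof. by rewrite enormE -[toC 0]/(0 : R[i]) cn0. Qed.
Lemma enormN X : enorm (- X) = enorm X. Proof. by rewrite !enormE toCN cnN. Qed.
Lemma enormD X Y : enorm (X + Y) <= enorm X + enorm Y.
Proof. by rewrite !enormE toCD cnD. Qed.
Lemma enormB X Y : enorm (X - Y) <= enorm X + enorm Y.
Proof. by rewrite -(enormN Y) enormD. Qed.
Lemma enormC X Y : enorm (X - Y) = enorm (Y - X).
Proof. by rewrite -enormN opprB. Qed.
Lemma enorm_tri Y X Z : enorm (X - Z) <= enorm (X - Y) + enorm (Y - Z).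
Proof. by rewrite (le_trans _ (enormD _ _))// addrA subrK. Qed.
Lemma enorm_sqr X : enorm X ^+ 2 = X.1 ^+ 2 + X.2 ^+ 2.
Proof. by rewrite /enorm sqr_sqrtr /dot -!expr2// addr_ge0 ?sqr_ge0. Qed.
Lemma enorm1 X : `|X.1| <= enorm X.
Proof. by rewrite enormE (cn_Re (toC X)). Qed.
Lemma enorm2 X : `|X.2| <= enorm X.
Proof. by rewrite enormE (cn_Im (toC X)). Qed.
Lemma enorm_le12 X : enorm X <= `|X.1| + `|X.2|.
Proof. by rewrite enormE (cn_ReIm (toC X)). Qed.
Lemma enorm_eq0 X : enorm X = 0 -> X = 0.
Proof. by rewrite enormE => /cn_eq0 h; rewrite -(toCK X) h. Qed.

Lemma enormZ (t : R) X : enorm (t *: X) = `|t| * enorm X.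
Proof.
rewrite !enormE -cn_real -cnM; congr cn.
by rewrite /toC /=; simpc.
Qed.

Lemma enorm_leN X : enorm X <= 2 * `|X|.
Proof.
rewrite (le_trans (enorm_le12 _))// prod_normE mulr2n mulrDl !mul1r.
by rewrite lerD// le_max lexx ?orbT.
Qed.

Lemma norm_le_enorm X : `|X| <= enorm X.
Proof. by rewrite prod_normE ge_max enorm1 enorm2. Qed.

Lemma nbhs_eball X A : nbhs X A <-> exists2 r : R, 0 < r & eball X r `<=` A.
Proof.
split.
  move=> /nbhs_ballP[r /= r0 h]; exists r => // Y; rewrite /eball /= => Yr; apply: h.
  rewrite -ball_normE /ball_ /=; apply: le_lt_trans Yr.
  by rewrite enormC norm_le_enorm.
move=> [r r0 h]; apply/nbhs_ballP; exists (r / 2); first by rewrite /= divr_gt0.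
move=> Y; rewrite -ball_normE /ball_ /= => Yr; apply: h; rewrite /eball /= enormC.
by apply: le_lt_trans (enorm_leN _) _; rewrite mulrC -ltr_pdivlMr.
Qed.

Lemma eball_sub X Y (r s : R) : enorm (X - Y) + r <= s -> eball X r `<=` eball Y s.
Proof.
move=> h Z; rewrite /eball /= => Zr; apply: lt_le_trans h.
by apply: le_lt_trans (enorm_tri X Z Y) _; rewrite addrC ltrD2l.
Qed.

Lemma eball_center X (r : R) : 0 < r -> eball X r X.
Proof. by rewrite /eball /= subrr enorm0. Qed.

Lemma open_eball X (r : R) : open (eball X r).
Proof.
rewrite openE => Y; rewrite /eball /interior /= => h; apply/nbhs_eball.
exists (r - enorm (Y - X)); first by rewrite subr_gt0.
by apply: eball_sub; rewrite addrC subrK.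
Qed.

Lemma openP A : open A <-> forall X, A X -> exists2 r : R, 0 < r & eball X r `<=` A.
Proof.
rewrite openE; split => h X AX; first by have /nbhs_eball := h X AX.
by apply/nbhs_eball; exact: h.
Qed.

Lemma closureP A X : closure A X <-> forall r : R, 0 < r -> exists2 Y, A Y & eball X r Y.
Proof.
split=> [cA r r0|h B /nbhs_eball[r r0 rB]].
  have [Y [AY XY]] := cA (eball X r) (proj2 (nbhs_eball _ _) (ex_intro2 _ _ r r0 (@subset_refl _ _))).
  by exists Y.
by have [Y AY XY] := h r r0; exists Y; split=> //; exact: rB.
Qed.

Lemma cont_atP u X : {for X, continuous u} <->
  forall e : R, 0 < e -> exists2 d : R, 0 < d & forall Y, eball X d Y -> `|u Y - u X| <= e.
Proof.
split=> [|h].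
  move=> /cvgrPdist_le h e e0; have /nbhs_eball[d d0 hd] := h e e0.
  by exists d => // Y Yd; rewrite distrC; exact: hd.
apply/cvgrPdist_le => e e0; have [d d0 hd] := h e e0.
by apply/nbhs_eball; exists d => // Y Yd /=; rewrite distrC; exact: hd.
Qed.

Lemma closed_ecball X (r : R) : closed (ecball X r).
Proof.
move=> Y /closureP h; rewrite /ecball /= leNgt; apply/negP => rY.
have [Z + ZY] : exists2 Z, ecball X r Z & eball Y (enorm (Y - X) - r) Z.
  by apply: h; rewrite subr_gt0.
move: ZY; rewrite /eball /ecball /= => ZY ZX.
have := enorm_tri Z Y X; rewrite (enormC Y Z); lra.
Qed.

Lemma compact_ecball X (r : R) : compact (ecball X r).
Proof.
apply: (@subclosed_compact _ _ (`[X.1 - r, X.1 + r]%classic `*` `[X.2 - r, X.2 + r]%classic)).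
- exact: closed_ecball.
- by apply: compact_setX; exact: segment_compact.
move=> Y; rewrite /ecball /= => h; split => /=; rewrite in_itv /= -ler_distl.
  by rewrite (le_trans (enorm1 (Y - X))).
by rewrite (le_trans (enorm2 (Y - X))).
Qed.

Lemma compact_gauge K (d : R * R -> R) : compact K -> (forall X, K X -> 0 < d X) ->
  exists2 l : seq (R * R), (forall X, X \in l -> K X) &
    forall Y, K Y -> exists2 X, X \in l & eball X (d X) Y.
Proof.
move=> /plane_cover_compact cK dp.
have [X|X KX|D DK Kc] := cK (R * R)%type K (fun X => eball X (d X)).
- by move=> _; exact: open_eball.
- by exists X => //; exact: eball_center (dp _ KX).
exists (finmap.enum_fset D) => [X XD|Y KY].
  by have := DK X XD; rewrite inE.
by have [X /= XD h] := Kc Y KY; exists X.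
Qed.

(** Upper semicontinuity is the right generality: the maximum principle applies this to a function
    that jumps at the boundary. *)
Lemma compact_usc_max K (f : R * R -> R) X0 : compact K -> K X0 ->
  (forall X, K X -> forall e : R, 0 < e ->
     exists2 d : R, 0 < d & forall Y, K Y -> eball X d Y -> f Y < f X + e) ->
  exists2 X, K X & forall Y, K Y -> f Y <= f X.
Proof.
move=> cK K0 usc; apply: contrapT => nomax.
(* Without a maximum each point has a neighbourhood on which f stays below one of its values f Y.
   The largest of finitely many such values would then be smaller than another of them. *)
have H X : exists Yd : (R * R) * R, K X -> [/\ K Yd.1, 0 < Yd.2 &
    forall Z, K Z -> eball X Yd.2 Z -> f Z < f Yd.1].
  have [KX|nKX] := pselect (K X); last by exists (X, 0).
  have [Y [KY fY]] : exists Y, K Y /\ f X < f Y.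
    apply: contrapT => h; apply: nomax; exists X => // Y KY.
    by rewrite leNgt; apply/negP => fY; apply: h; exists Y.
  have fe : 0 < f Y - f X by rewrite subr_gt0.
  have [d d0 hd] := usc X KX _ fe; exists (Y, d) => _; split=> // Z KZ Zd.
  by have := hd Z KZ Zd; rewrite addrC subrK.
have [g hg] := choice H.
have [l lK lc] := @compact_gauge K (fun X => (g X).2) cK (fun X KX => let: And3 _ b _ := hg X KX in b).
have [X Xl _] := lc X0 K0.
have [Y Yl hY] : exists2 Y, Y \in l & forall Z, Z \in l -> f (g Z).1 <= f (g Y).1.
  elim: l X Xl {lK lc} => // a l IH X _.
  have [->|[b bl]] : l = [::] \/ exists b, b \in l.
  - by case: (l) => [|b l']; [left|right; exists b; rewrite mem_head].
  - by exists a; rewrite ?mem_head// => Z; rewrite inE => /eqP ->.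
  have [Y Yl hY] := IH b bl.
  have [h|h] := leP (f (g a).1) (f (g Y).1).
    exists Y; first by rewrite inE Yl orbT.
    by move=> Z; rewrite inE => /orP[/eqP -> //|]; exact: hY.
  exists a; first by rewrite mem_head.
  move=> Z; rewrite inE => /orP[/eqP -> //|Zl].
  by rewrite (le_trans (hY Z Zl))// ltW.
have [KY _ _] := hg Y (lK Y Yl).
have [Z Zl Zb] := lc _ KY.
have [_ _ h3] := hg Z (lK Z Zl).
by have := h3 _ KY Zb; rewrite ltNge hY.
Qed.

End plane.

(** * Maximum principle *)

Section stencil.
Context {R : realType}.
Implicit Types (X Y Z : R * R) (A K W : set (R * R)) (u v w : R * R -> R).

Lemma half_pos (e : R) : 0 < e -> 0 < e / 2.
Proof. by move=> e0; rewrite divr_gt0. Qed.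

Definition lap4 u X (s : R) : R :=
  u (X + (s, 0)) + u (X - (s, 0)) + u (X + (0, s)) + u (X - (0, s)) - 4 * u X.

(* A weak form of [laplacian u X >= 0] that needs no differentiability, is
   stable under [maxr], and still implies the maximum principle. *)
Definition sub u X : Prop :=
  forall e : R, 0 < e -> exists2 d : R, 0 < d &
    forall s : R, 0 < s -> s < d -> - e * s ^+ 2 <= lap4 u X s.

Lemma enorm_e1 (s : R) : enorm (s, 0) = `|s|.
Proof. by rewrite enormE cnE /= expr0n/= addr0 sqrtr_sqr. Qed.
Lemma enorm_e2 (s : R) : enorm (0, s) = `|s|.
Proof. by rewrite enormE cnE /= expr0n/= add0r sqrtr_sqr. Qed.

Lemma stencil_eball X (s r : R) : 0 < s -> s < r ->
  [/\ eball X r (X + (s, 0)), eball X r (X - (s, 0)),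
      eball X r (X + (0, s)) & eball X r (X - (0, s))].
Proof.
by move=> s0 sr; split; rewrite /eball /= addrAC subrr add0r ?enormN
  ?enorm_e1 ?enorm_e2 gtr0_norm.
Qed.

Lemma sub_le u v X (r : R) : 0 < r -> sub u X -> u X = v X ->
  (forall Y, eball X r Y -> u Y <= v Y) -> sub v X.
Proof.
move=> r0 su uv h e e0; have [d d0 hd] := su e e0.
exists (Num.min d r); first by rewrite lt_min d0.
move=> s s0; rewrite lt_min => /andP[sd sr].
have [h1 h2 h3 h4] := stencil_eball X s0 sr.
apply: le_trans (hd s s0 sd) _.
by rewrite /lap4 uv lerD2r !lerD ?h.
Qed.

Lemma subD u v X : sub u X -> sub v X -> sub (fun Y => u Y + v Y) X.
Proof.
move=> su sv e e0; have e2 : 0 < e / 2 by rewrite divr_gt0.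
have [d d0 hd] := su _ e2; have [d' d'0 hd'] := sv _ e2.
exists (Num.min d d'); first by rewrite lt_min d0.
move=> s s0; rewrite lt_min => /andP[sd sd'].
have := hd s s0 sd; have := hd' s s0 sd'; rewrite /lap4; lra.
Qed.

Lemma sub_cst (a : R) X : sub (fun=> a) X.
Proof.
move=> e e0; exists 1 => // s s0 _; rewrite /lap4.
have -> : a + a + a + a - 4 * a = 0 by ring.
by rewrite mulNr oppr_le0 mulr_ge0 ?sqr_ge0 ?ltW.
Qed.

Lemma sub_exact u X : (forall s, lap4 u X s = 0) -> sub u X.
Proof.
move=> h e e0; exists 1 => // s s0 _.
by rewrite h mulNr oppr_le0 mulr_ge0 ?sqr_ge0 ?ltW.
Qed.

Lemma sub_max u v X : sub u X -> sub v X -> sub (fun Y => Num.max (u Y) (v Y)) X.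
Proof.
move=> su sv; have [uv|uv] := leP (u X) (v X).
  apply: (@sub_le v _ X 1) => //=; first by rewrite max_r.
  by move=> Y _; rewrite le_max lexx orbT.
apply: (@sub_le u _ X 1) => //=; first by rewrite max_l// ltW.
by move=> Y _; rewrite le_max lexx.
Qed.

Lemma lap4_shift u X (a : R * R) s : lap4 (fun Y => u (Y - a)) X s = lap4 u (X - a) s.
Proof. by rewrite /lap4 !(addrAC X _ (- a)). Qed.

Lemma sub_shift u X (a : R * R) : sub u (X - a) -> sub (fun Y => u (Y - a)) X.
Proof.
by move=> h e e0; have [d d0 hd] := h e e0; exists d => // s s0 sd; rewrite lap4_shift hd.
Qed.

Lemma sub_pos u X : (forall Y, 0 <= u Y) -> u X = 0 -> sub u X.
Proof.
move=> u0 uX; apply: (@sub_le (fun=> 0) _ X 1) => //; exact: sub_cst.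
Qed.

(* The boundary values are only controlled through upper limits, so [w] may be
   arbitrary outside [W]. *)
Lemma max_principle W w X0 (r : R) : open W -> W `<=` eball X0 r ->
  (forall X, W X -> {for X, continuous w}) -> (forall X, W X -> sub w X) ->
  (forall X, ~ W X -> forall e : R, 0 < e -> exists2 d : R, 0 < d &
     forall Y, W Y -> eball X d Y -> w Y <= e) ->
  forall X, W X -> w X <= 0.
Proof.
move=> oW Wr wc ws wb X1 WX1; rewrite leNgt; apply/negP => wX1.
have r0 : 0 < r by apply: le_lt_trans (Wr _ WX1); exact: enorm_ge0.
(* Adding h |X - X0|^2 raises the five-point Laplacian by 4 h s^2, which beats the tolerance h s^2
   taken in [sub]; h is small enough that the addition stays below half of w X1. *)
pose h := w X1 / (2 * r ^+ 2).
have h0 : 0 < h by rewrite divr_gt0// mulr_gt0 ?exprn_gt0.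
have hr : h * r ^+ 2 = w X1 / 2.
  by rewrite /h; field; rewrite gt_eqF.
pose q Y := (Y.1 - X0.1) ^+ 2 + (Y.2 - X0.2) ^+ 2.
have qE Y : q Y = enorm (Y - X0) ^+ 2 by rewrite enorm_sqr.
have qr Y : W Y -> q Y <= r ^+ 2.
  by move=> WY; rewrite qE lerXn2r ?nnegrE ?enorm_ge0 ?ltW//; exact: Wr.
have q0 Y : 0 <= q Y by rewrite qE sqr_ge0.
have qc Y : {for Y, continuous q}.
  rewrite /q; apply: cvgD; apply: cvgM; (apply: cvgB; last exact: cvg_cst).
  - exact: cvg_fst.
  - exact: cvg_fst.
  - exact: cvg_snd.
  - exact: cvg_snd.
pose v Y := w Y + h * q Y.
(* The floor h r^2 dominates the upper limits of v at the boundary of W, so f is upper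
   semicontinuous on the closed disc; its maximum exceeds the floor and therefore falls in W. *)
pose f Y := if `[< W Y >] then Num.max (v Y) (h * r ^+ 2) else h * r ^+ 2.
have fge Y : h * r ^+ 2 <= f Y by rewrite /f; case: ifP => //; rewrite le_max lexx orbT.
have K1 : ecball X0 r X1 by apply: ltW; exact: Wr.
have [X KX Xmax] : exists2 X, ecball X0 r X & forall Y, ecball X0 r Y -> f Y <= f X.
  apply: (@compact_usc_max R _ f X1) => //; first exact: compact_ecball.
  move=> X _ e e0.
  have [WX|nWX] := pselect (W X).
    have vc : {for X, continuous v}.
      by apply: cvgD; [exact: wc|apply: cvgM; [exact: cvg_cst|exact: qc]].
    have [d d0 hd] := (proj1 (cont_atP _ _)) vc (e / 2) (half_pos e0).
    exists d => // Y _ Yd; apply: (@le_lt_trans _ _ (f X + e / 2)); last by rewrite ltrD2l; lra.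
    rewrite {1}/f; case: ifP => [_|_]; last by have := fge X; lra.
    rewrite ge_max; apply/andP; split; last by have := fge X; lra.
    have := hd Y Yd; rewrite ler_distl => /andP[_ hh]; apply: le_trans hh _.
    by rewrite lerD2r /f asboolT// le_max lexx.
  have [d d0 hd] := wb X nWX (e / 2) (half_pos e0).
  exists d => // Y _ Yd; rewrite {2}/f asboolF//.
  rewrite /f; case: ifP => [/asboolP WY|_]; last by rewrite ltrDl.
  rewrite gt_max; apply/andP; split; last by rewrite ltrDl.
  have := hd Y WY Yd; have := ler_wpM2l (ltW h0) (qr Y WY); rewrite /v; lra.
have fX1 : h * r ^+ 2 < f X.
  apply: lt_le_trans (Xmax _ K1); rewrite /f asboolT// lt_max /v.
  by have hq := mulr_ge0 (ltW h0) (q0 X1); rewrite hr; apply/orP; left; lra.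
have WX : W X by apply: contrapT => nW; move: fX1; rewrite /f asboolF// ltxx.
have fXv : f X = v X.
  by move: fX1; rewrite /f asboolT// lt_max ltxx orbF => hv; rewrite max_l// ltW.
have [d d0 hd] := (proj1 (openP _) oW) X WX.
have [d' d'0 hd'] := ws X WX _ h0.
pose s := Num.min d d' / 2.
have m0 : 0 < Num.min d d' by rewrite lt_min d0.
have s0 : 0 < s by rewrite divr_gt0.
have sm : s < Num.min d d' by rewrite /s; lra.
move: (sm); rewrite lt_min => /andP[sd sd'].
have [h1 h2 h3 h4] := stencil_eball X s0 sd.
have vle Y : eball X d Y -> v Y <= v X.
  move=> Yd; have WY := hd Y Yd.
  rewrite -fXv; apply: le_trans (Xmax Y (ltW (Wr _ WY))).
  by rewrite /f asboolT// le_max lexx.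
have := vle _ h1; have := vle _ h2; have := vle _ h3; have := vle _ h4.
have := hd' s s0 sd'; have := mulr_gt0 h0 (exprn_gt0 2 s0).
rewrite /lap4 /v /q /= !addr0 !subr0; lra.
Qed.

End stencil.

(** * Harmonic functions as limits of harmonic polynomials *)

Section polynomial_tails.
Context {R : realType}.
Implicit Types (z w c : R[i]) (p q : {poly R[i]}) (rho M t : R).

Lemma geo_le2 t n : 0 <= t -> t <= 2^-1 -> \sum_(k < n) t ^+ k <= 2.
Proof.
move=> t0 t2; have h : (1 - t) * \sum_(k < n) t ^+ k = 1 - t ^+ n.
  by rewrite -[1 - t]opprB mulNr -subrX1 opprB.
have tn := exprn_ge0 n t0.
have S0 : 0 <= \sum_(k < n) t ^+ k by apply: sumr_ge0 => k _; exact: exprn_ge0.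
nra.
Qed.

(** By Cauchy's estimate the tail is dominated by a geometric series of ratio at most 1/2, whose sum
    gives the second factor 2. Only the real part is bounded on the circle, yet the whole remainder
    is controlled. *)
Lemma poly_tail p rho M K w : 0 < rho ->
  (forall z, cn z = rho -> `|complex.Re p.[z]| <= M) -> (0 < K)%N -> cn w <= rho / 2 ->
  cn (p.[w] - \sum_(k < K) p`_k * w ^+ k) <= 4 * M * (cn w / rho) ^+ K.
Proof.
move=> r0 h K0 wr.
have M0 : 0 <= M.
  by apply: le_trans (h rho%:C%C _); rewrite ?normr_ge0// cn_real gtr0_norm.
have -> : p.[w] - \sum_(k < K) p`_k * w ^+ k = (drop_poly K p).[w] * w ^+ K.
  rewrite -{1}(poly_take_drop K p) hornerD hornerM hornerXn addrAC.
  suff -> : (take_poly K p).[w] = \sum_(k < K) p`_k * w ^+ k by rewrite subrr add0r.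
  by rewrite horner_poly.
rewrite cnM cnX expr_div_n mulrCA -mulrA mulrC ler_wpM2l ?exprn_ge0 ?cn_ge0//.
rewrite horner_coef; apply: le_trans (cn_sum _ _ _) _.
have t0 : 0 <= cn w / rho by rewrite divr_ge0 ?cn_ge0// ltW.
have t2 : cn w / rho <= 2^-1 by rewrite ler_pdivrMr// mulrC.
have C0 : 0 <= 2 * (M / rho ^+ K).
  by rewrite mulr_ge0// divr_ge0// exprn_ge0// ltW.
apply: (@le_trans _ _ (\sum_(k < size (drop_poly K p)) 2 * (M / rho ^+ K) * (cn w / rho) ^+ k)).
  apply: ler_sum => k _; rewrite cnM cnX coef_drop_poly expr_div_n.
  have -> : 2 * (M / rho ^+ K) * (cn w ^+ k / rho ^+ k) =
      (2 * M) / rho ^+ (k + K) * cn w ^+ k.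
    by rewrite exprD; field; rewrite !expf_neq0// gt_eqF.
  rewrite ler_wpM2r ?exprn_ge0 ?cn_ge0// ler_pdivlMr ?exprn_gt0//.
  by rewrite coef_bound// ?(ltW r0)// addn_gt0 K0 orbT.
rewrite -mulr_sumr; have := geo_le2 (size (drop_poly K p)) t0 t2; nra.
Qed.

Lemma shift_horner p c w : (p \Po ('X + c%:P)).[w] = p.[w + c].
Proof. by rewrite horner_comp hornerD hornerX hornerC. Qed.

Lemma shift_coef1 p c : (p \Po ('X + c%:P))`_1 = p^`().[c].
Proof.
rewrite -[LHS]mulr1n -coef_deriv -horner_coef0 deriv_comp derivD derivX derivC addr0 mulr1.
by rewrite horner_comp hornerD hornerX hornerC add0r.
Qed.

Lemma shift_coef0 p c : (p \Po ('X + c%:P))`_0 = p.[c].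
Proof. by rewrite -horner_coef0 shift_horner add0r. Qed.

End polynomial_tails.

Section poly_approximable.
Context {R : realType}.
Implicit Types (X Y Z : R * R) (A B : set (R * R)) (u v : R * R -> R)
  (p q : {poly R[i]}) (r s e M : R).

Definition rep p X : R := complex.Re p.[toC X].

(* Uniform limits on [A] of real parts of complex polynomials: on discs these
   are exactly the harmonic functions, with all estimates inherited from
   polynomials. *)
Definition pa u A : Prop :=
  forall e, 0 < e -> exists p, forall X, A X -> `|u X - rep p X| <= e.

Lemma paS u A B : A `<=` B -> pa u B -> pa u A.
Proof. by move=> AB h e e0; have [p hp] := h e e0; exists p => X /AB; exact: hp. Qed.

Lemma pa_eq u v A : (forall X, A X -> u X = v X) -> pa u A -> pa v A.
Proof.
by move=> uv h e e0; have [p hp] := h e e0; exists p => X AX; rewrite -uv ?hp.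
Qed.

Lemma pa_rep p A : pa (rep p) A.
Proof. by move=> e e0; exists p => X _; rewrite subrr normr0 ltW. Qed.

Lemma pa_cst (a : R) A : pa (fun=> a) A.
Proof.
move=> e e0; exists (a%:C%C)%:P => X _.
by rewrite /rep hornerC /= subrr normr0 ltW.
Qed.

Lemma repD p q X : rep (p + q) X = rep p X + rep q X.
Proof. by rewrite /rep hornerD ReD. Qed.
Lemma repN p X : rep (- p) X = - rep p X.
Proof. by rewrite /rep hornerN ReN. Qed.
Lemma repZ (a : R) p X : rep (a%:C%C *: p) X = a * rep p X.
Proof. by rewrite /rep hornerZ ReZ. Qed.

Lemma paD u v A : pa u A -> pa v A -> pa (fun X => u X + v X) A.
Proof.
move=> hu hv e e0; have [p hp] := hu _ (half_pos e0); have [q hq] := hv _ (half_pos e0).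
exists (p + q) => X AX; rewrite repD opprD addrACA [leRHS]splitr.
by apply: le_trans (ler_normD _ _) _; rewrite lerD ?hp ?hq.
Qed.

Lemma paZ (a : R) u A : pa u A -> pa (fun X => a * u X) A.
Proof.
move=> hu e e0; have a1 : 0 < `|a| + 1 by rewrite ltr_wpDl.
have [p hp] := hu _ (divr_gt0 e0 a1).
exists (a%:C%C *: p) => X AX; rewrite repZ -mulrBr normrM.
apply: le_trans (ler_wpM2l (normr_ge0 _) (hp X AX)) _.
by rewrite mulrCA ger_pMr// ler_pdivrMr// mul1r lerDl.
Qed.

Lemma paN u A : pa u A -> pa (fun X => - u X) A.
Proof.
by move=> /(paZ (-1)) h; apply: pa_eq h => X _; rewrite mulN1r.
Qed.

Lemma paB u v A : pa u A -> pa v A -> pa (fun X => u X - v X) A.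
Proof. by move=> hu /paN hv; exact: paD hu hv. Qed.

Lemma four_sum (K : comPzRingType) (a0 a1 a2 a3 z j : K) : j ^+ 2 = -1 ->
  (a0 + a1 * z + a2 * z ^+ 2 + a3 * z ^+ 3) +
  (a0 + a1 * (- z) + a2 * (- z) ^+ 2 + a3 * (- z) ^+ 3) +
  (a0 + a1 * (j * z) + a2 * (j * z) ^+ 2 + a3 * (j * z) ^+ 3) +
  (a0 + a1 * (- (j * z)) + a2 * (- (j * z)) ^+ 2 + a3 * (- (j * z)) ^+ 3) = 4 * a0.
Proof.
move=> j2; transitivity (4 * a0 + 2 * a2 * z ^+ 2 * (1 + j ^+ 2)); first by ring.
by rewrite j2 subrr mulr0 addr0.
Qed.

Lemma four_bound (a b c d a' b' c' d' k : R) : `|a - a'| <= k -> `|b - b'| <= k ->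
  `|c - c'| <= k -> `|d - d'| <= k -> `|a + b + c + d - (a' + b' + c' + d')| <= 4 * k.
Proof. by rewrite !ler_norml; lra. Qed.

Lemma five_bound (a b c d f a' b' c' d' f' k : R) : `|a - a'| <= k -> `|b - b'| <= k ->
  `|c - c'| <= k -> `|d - d'| <= k -> `|f - f'| <= k ->
  `|(a + b + c + d - 4 * f) - (a' + b' + c' + d' - 4 * f')| <= 8 * k.
Proof. by rewrite !ler_norml; lra. Qed.

(** The stencil points are s times the fourth roots of unity, so the monomials of degree 1, 2 and 3
    cancel and only the tail of order four remains. *)
Lemma lap4_poly p X r M s : 0 < r ->
  (forall Y, ecball X r Y -> `|rep p Y| <= M) -> 0 < s -> s <= r / 2 ->
  `|lap4 (rep p) X s| <= 16 * M * (s / r) ^+ 4.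
Proof.
move=> r0 h s0 sr.
pose q := p \Po ('X + (toC X)%:P).
have qE (w : R[i]) : complex.Re q.[w] = rep p (X + ofC w).
  by rewrite /q shift_horner /rep toCD ofCK addrC.
have hq (z : R[i]) : cn z = r -> `|complex.Re q.[z]| <= M.
  move=> zr; rewrite qE; apply: h.
  by rewrite /ecball /= addrAC subrr add0r enormE ofCK zr.
have sc : cn s%:C%C = s by rewrite cn_real gtr0_norm.
pose T (w : R[i]) := \sum_(k < 4) q`_k * w ^+ k.
have hT (w : R[i]) : cn w = s -> `|complex.Re q.[w] - complex.Re (T w)| <= 4 * M * (s / r) ^+ 4.
  move=> ws; rewrite -ReB; apply: le_trans (cn_Re _) _.
  by rewrite -ws; apply: poly_tail => //; rewrite ws.
have s1 : cn s%:C%C = s by [].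
have s2 : cn (- s%:C%C) = s by rewrite cnN.
have s3 : cn ('i%C * s%:C%C) = s by rewrite cnM sc cnE /= expr0n expr1n add0r sqrtr1 mul1r.
have s4 : cn (- ('i%C * s%:C%C)) = s by rewrite cnN.
have TE (w : R[i]) : T w = q`_0 + q`_1 * w + q`_2 * w ^+ 2 + q`_3 * w ^+ 3.
  by rewrite /T !big_ord_recr big_ord0 /= add0r expr0 mulr1 expr1.
have T0 : complex.Re (T s%:C%C) + complex.Re (T (- s%:C%C)) + complex.Re (T ('i%C * s%:C%C))
    + complex.Re (T (- ('i%C * s%:C%C))) = 4 * complex.Re q`_0.
  rewrite -!ReD -[4]/(4%:R) -ReZ; congr complex.Re.
  by rewrite (rmorph_nat (real_complex R)) !TE (@four_sum R[i])// sqr_i.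
have e1 : rep p (X + (s, 0)) = complex.Re q.[s%:C%C] by rewrite qE.
have e2 : rep p (X - (s, 0)) = complex.Re q.[- s%:C%C] by rewrite qE.
have e3 : rep p (X + (0, s)) = complex.Re q.['i%C * s%:C%C].
  by rewrite qE; congr (rep p (_ + _)); rewrite /ofC /= !mul0r mulr0 mul1r subr0 add0r.
have e4 : rep p (X - (0, s)) = complex.Re q.[- ('i%C * s%:C%C)].
  by rewrite qE; congr (rep p (_ + _)); rewrite /ofC /= !mul0r mulr0 mul1r subr0 add0r.
have e0 : rep p X = complex.Re q`_0 by rewrite /q shift_coef0.
rewrite /lap4 e1 e2 e3 e4 e0 -T0.
have -> : 16 * M * (s / r) ^+ 4 = 4 * (4 * M * (s / r) ^+ 4) by ring.
exact: four_bound (hT _ s1) (hT _ s2) (hT _ s3) (hT _ s4).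
Qed.

Lemma eball_ecball X r : eball X r `<=` ecball X r.
Proof. by move=> Y /ltW. Qed.

Lemma ecball_eball X r s : r < s -> ecball X r `<=` eball X s.
Proof. by move=> rs Y h; exact: le_lt_trans h rs. Qed.

Lemma pa_lap4 u X r M s : 0 < r -> pa u (eball X r) ->
  (forall Y, eball X r Y -> `|u Y| <= M) -> 0 < s -> s <= r / 4 ->
  `|lap4 u X s| <= 16 * M * (2 * s / r) ^+ 4.
Proof.
move=> r0 pu uM s0 sr; apply/ler_addgt0Pr => e e0.
have e9 : 0 < e / 9 by rewrite divr_gt0.
have [p hp] := pu _ e9.
have r2 : 0 < r / 2 by exact: half_pos.
have sub1 : ecball X (r / 2) `<=` eball X r by apply: ecball_eball; lra.
have pM Y : ecball X (r / 2) Y -> `|rep p Y| <= M + e / 9.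
  move=> /sub1 h; have := hp _ h; have := uM _ h; rewrite !ler_norml; lra.
have s2 : s <= r / 2 / 2 by lra.
have := lap4_poly r2 pM s0 s2.
have -> : s / (r / 2) = 2 * s / r by field; rewrite gt_eqF.
set t := 2 * s / r => h.
have t0 : 0 <= t by rewrite /t divr_ge0 ?mulr_ge0 ?ltW.
have t2 : t <= 2^-1 by rewrite /t ler_pdivrMr//; lra.
have t4 : t ^+ 4 <= 16^-1.
  have : t ^+ 2 <= 4^-1 by nra.
  have := sqr_ge0 t; rewrite (exprM t 2 2); nra.
have [h1 h2 h3 h4] : [/\ eball X r (X + (s, 0)), eball X r (X - (s, 0)),
   eball X r (X + (0, s)) & eball X r (X - (0, s))] by apply: stencil_eball => //; lra.
have et : e / 9 * t ^+ 4 <= e / 9 * 16^-1 by rewrite ler_wpM2l// ltW.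
have h8 := five_bound (hp _ h1) (hp _ h2) (hp _ h3) (hp _ h4) (hp _ (eball_center X r0)).
rewrite -(subrK (lap4 (rep p) X s) (lap4 u X s)); apply: le_trans (ler_normD _ _) _.
apply: le_trans (lerD h8 h) _.
have -> : 16 * (M + e / 9) * t ^+ 4 = 16 * M * t ^+ 4 + 16 * (e / 9 * t ^+ 4) by ring.
by move: et; set E := e / 9 * t ^+ 4; set F := 16 * M * t ^+ 4 => et; lra.
Qed.

Lemma rep_bounded p X r : exists M, forall Y, eball X r Y -> `|rep p Y| <= M.
Proof.
exists (\sum_(k < size p) cn p`_k * (r + enorm X) ^+ k) => Y Yr.
rewrite /rep; apply: le_trans (cn_Re _) _; rewrite horner_coef.
apply: le_trans (cn_sum _ _ _) _; apply: ler_sum => k _.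
rewrite cnM cnX ler_wpM2l ?cn_ge0// -enormE lerXn2r ?nnegrE ?enorm_ge0//.
- by rewrite addr_ge0 ?enorm_ge0// ltW// (le_lt_trans _ Yr)// enorm_ge0.
- rewrite -{1}(subrK X Y) (le_trans (enormD _ _))// lerD2r; exact: ltW.
Qed.

Lemma pa_bounded u X r : pa u (eball X r) -> exists M, forall Y, eball X r Y -> `|u Y| <= M.
Proof.
move=> /(_ 1 ltr01)[p hp]; have [M hM] := rep_bounded p X r.
exists (1 + M) => Y Yr; rewrite -(subrK (rep p Y) (u Y)).
by apply: le_trans (ler_normD _ _) _; rewrite lerD ?hp ?hM.
Qed.

(** The stencil value is of order s^4, hence eventually below any multiple of s^2. *)
Lemma pa_sub u X r : 0 < r -> pa u (eball X r) -> sub u X.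
Proof.
move=> r0 pu; have [M hM] := pa_bounded pu.
have M0 : 0 <= M by apply: le_trans (hM X (eball_center X r0)).
move=> e e0; pose k := 16 * 16 * (M + 1) / r ^+ 4.
have k0 : 0 < k by rewrite divr_gt0 ?exprn_gt0// !mulr_gt0// ltr_wpDl.
pose d := Num.min (r / 4) (Num.min 1 (e / k)).
have r4 : 0 < r / 4 by rewrite divr_gt0.
exists d; first by rewrite !lt_min ltr01 r4 (divr_gt0 e0 k0).
move=> s s0; rewrite !lt_min => /and3P[sr s1 sk].
have := pa_lap4 r0 pu hM s0 (ltW sr); rewrite ler_norml => /andP[h _].
apply: le_trans h; rewrite mulNr lerN2.
apply: (@le_trans _ _ (k * s ^+ 4)).
  rewrite expr_div_n exprMn /k (_ : 2 ^+ 4 = 16 :> R); last by ring.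
  have -> : 16 * M * (16 * s ^+ 4 / r ^+ 4) = (16 * 16 * s ^+ 4 / r ^+ 4) * M by field; rewrite gt_eqF.
  have -> : 16 * 16 * (M + 1) / r ^+ 4 * s ^+ 4 = (16 * 16 * s ^+ 4 / r ^+ 4) * (M + 1) by field; rewrite gt_eqF.
  rewrite ler_wpM2l ?lerDl//; apply: divr_ge0; first by rewrite !mulr_ge0 ?exprn_ge0// ltW.
  by rewrite exprn_ge0// ltW.
rewrite (_ : s ^+ 4 = s ^+ 2 * s ^+ 2); last by ring.
rewrite mulrA ler_wpM2r ?sqr_ge0//.
have : k * s <= e by rewrite -ler_pdivlMl// mulrC ltW.
have : s ^+ 2 <= s by rewrite expr2 ger_pMl// ltW.
nra.
Qed.

Lemma pa_lip0 u X Y r M : 0 < r -> pa u (eball X r) ->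
  (forall Z, eball X r Z -> `|u Z| <= M) -> enorm (Y - X) <= r / 4 ->
  `|u Y - u X| <= 8 * M / r * enorm (Y - X).
Proof.
move=> r0 pu uM Yr; apply/ler_addgt0Pr => e e0.
have e9 : 0 < e / 4 by rewrite divr_gt0.
have [p hp] := pu _ e9.
have r2 : 0 < r / 2 by exact: half_pos.
have sub1 : ecball X (r / 2) `<=` eball X r by apply: ecball_eball; lra.
pose q := p \Po ('X + (toC X)%:P).
have hq (z : R[i]) : cn z = r / 2 -> `|complex.Re q.[z]| <= M + e / 4.
  move=> zr; rewrite /q shift_horner.
  have zb : eball X r (X + ofC z).
    by apply: sub1; rewrite /ecball /= addrAC subrr add0r enormE ofCK zr.
  have -> : complex.Re p.[z + toC X] = rep p (X + ofC z) by rewrite /rep toCD ofCK addrC.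
  by have := uM _ zb; have := hp _ zb; rewrite !ler_norml; lra.
have w2 : cn (toC (Y - X)) <= r / 2 / 2 by rewrite -enormE; lra.
have := poly_tail r2 hq (ltn0Sn 0) w2.
rewrite big_ord1 expr0 mulr1 /q shift_horner shift_coef0.
rewrite -toCD subrK expr1 => /(le_trans (cn_Re _)); rewrite ReB -!/(rep _ _) -enormE.
have -> : enorm (Y - X) / (r / 2) = 2 * enorm (Y - X) / r by field; rewrite gt_eqF.
set t := 2 * _ / r.
have -> : 8 * M / r * enorm (Y - X) = 4 * M * t by rewrite /t; field; rewrite gt_eqF.
have t0 : 0 <= t by rewrite divr_ge0 ?mulr_ge0 ?enorm_ge0// ltW.
have t2 : t <= 2^-1 by rewrite /t ler_pdivrMr//; lra.
have hX := hp _ (eball_center X r0).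
have hY : eball X r Y by rewrite /eball /=; lra.
move: (hp _ hY) hX; rewrite !ler_norml; nra.
Qed.

Lemma pa_cont u X r : 0 < r -> pa u (eball X r) -> {for X, continuous u}.
Proof.
move=> r0 pu; have [M hM] := pa_bounded pu.
have M0 : 0 <= M by apply: le_trans (hM X (eball_center X r0)).
apply/cont_atP => e e0; pose k := 8 * (M + 1) / r.
have k0 : 0 < k by rewrite divr_gt0// mulr_gt0// ltr_wpDl.
have r4 : 0 < r / 4 by rewrite divr_gt0.
exists (Num.min (r / 4) (e / k)); first by rewrite lt_min r4 (divr_gt0 e0 k0).
move=> Y; rewrite /eball /= lt_min => /andP[Y1 Y2].
apply: le_trans (pa_lip0 r0 pu hM (ltW Y1)) _.
apply: (@le_trans _ _ (k * enorm (Y - X))).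
  by rewrite ler_wpM2r ?enorm_ge0// /k ler_pM2r ?invr_gt0// ler_pM2l// lerDl.
by rewrite mulrC -ler_pdivlMr// ltW.
Qed.

End poly_approximable.

(** * Derivatives of approximable functions and the Dirichlet problem on discs *)

Section derivatives_and_dirichlet.
Context {R : realType}.
Implicit Types (X Y Z : R * R) (A B : set (R * R)) (u v w g : R * R -> R)
  (p q : {poly R[i]}) (r s e M : R).

(** Helly's theorem on the line. It builds limits (derivatives, solutions of the Dirichlet problem,
    conjugates, boundary values) from all approximations with their errors at once, without choosing
    a sequence. *)
Lemma nested_point (I : Type) (i0 : I) (x y : I -> R) :
  (forall i j, x i - y i <= x j + y j) -> exists z, forall i, `|z - x i| <= y i.
Proof.
move=> h; pose S := [set x i - y i | i in [set: I]].
have S0 : S !=set0 by exists (x i0 - y i0); exists i0.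
have ub j : ubound S (x j + y j) by move=> _ [i _ <-]; exact: h.
exists (sup S) => i; rewrite ler_distl; apply/andP; split.
  by apply: sup_ubound; [exists (x i0 + y i0)|exists i].
by apply: sup_le_ub.
Qed.

Lemma derive_quad u X (v : R * R) (b C d : R) : 0 < d ->
  (forall h : R, `|h| < d -> `|u (X + h *: v) - u X - h * b| <= C * h ^+ 2) ->
  derivable u X v /\ 'D_v u X = b.
Proof.
move=> d0 H.
have C0 : 0 <= C.
  have d2 : `|d / 2| < d by rewrite gtr0_norm ?half_pos//; lra.
  have := le_trans (normr_ge0 _) (H _ d2).
  by rewrite pmulr_lge0// exprn_gt0// half_pos.
have cv : h^-1 *: ((u \o shift X) (h *: v) - u X) @[h --> 0^'] --> b.
  apply/cvgrPdist_le => e e0; near=> h.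
  have h0 : h != 0 by near: h; exact: nbhs_dnbhs_neq.
  have hd : `|h| < d by near: h; apply: dnbhs0_lt.
  have he : `|h| < e / (C + 1) by near: h; apply: dnbhs0_lt; rewrite divr_gt0// ltr_wpDl.
  rewrite /= [h *: v + X]addrC.
  have -> : b - h^-1 *: (u (X + h *: v) - u X) = - (h^-1 * (u (X + h *: v) - u X - h * b)).
    by rewrite -[_ *: _]/(_ * _); field.
  rewrite normrN normrM normfV ler_pdivrMl ?normr_gt0//.
  apply: le_trans (H h hd) _.
  rewrite -real_normK ?num_real// expr2 mulrA [leRHS]mulrC ler_wpM2r//.
  move: he; rewrite ltr_pdivlMr ?ltr_wpDl// => he.
  have := normr_ge0 h; nra.
split; first by apply/cvg_ex; exists b.
by rewrite /derive; apply/cvg_lim.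
Unshelve. all: by end_near. Qed.

(** Two approximations with errors e and e' differ by at most e + e', so by Cauchy's estimate their
    derivatives at X differ by at most 4 (e + e') / r. Real and imaginary parts are then found
    separately by [nested_point], which doubles 4 to 8. *)
Lemma pa_lin_ex u X r : 0 < r -> pa u (eball X r) ->
  exists a : R[i], forall p e, 0 <= e -> (forall Y, eball X r Y -> `|u Y - rep p Y| <= e) ->
    cn (a - p^`().[toC X]) <= 8 * e / r.
Proof.
move=> r0 pu.
pose I := {pe : {poly R[i]} * R | 0 <= pe.2 /\ forall Y, eball X r Y -> `|u Y - rep pe.1 Y| <= pe.2}.
have [p1 hp1] := pu _ ltr01.
have i0 : I by exists (p1, 1).
pose d (i : I) := ((sval i).1)^`().[toC X]; pose y (i : I) := 4 * (sval i).2 / r.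
have hij (i j : I) : cn (d i - d j) <= y i + y j.
  rewrite /d /y; case: i => [[p e] /= [e0 pe]]; case: j => [[p' e'] /= [e'0 pe']].
  rewrite -hornerN -hornerD -derivN -derivD -shift_coef1.
  have r2 : 0 <= r / 2 by rewrite divr_ge0 ?ltW.
  have h : forall z : R[i], cn z = r / 2 ->
      `|complex.Re ((p - p') \Po ('X + (toC X)%:P)).[z]| <= e + e'.
    move=> z zr; rewrite shift_horner.
    have zb : eball X r (X + ofC z).
      by rewrite /eball /= addrAC subrr add0r enormE ofCK zr; lra.
    have -> : complex.Re (p - p').[z + toC X] = rep p (X + ofC z) - rep p' (X + ofC z).
      by rewrite -repN -repD /rep toCD ofCK [z + _]addrC.
    by have := pe _ zb; have := pe' _ zb; rewrite !ler_norml; lra.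
  have := coef_bound r2 h (ltn0Sn 0); rewrite expr1 mulrA ler_pdivrMr// => hh.
  rewrite -mulrDl ler_pdivlMr//; lra.
have [|a1 h1] := @nested_point I i0 (fun i => complex.Re (d i)) y _.
  move=> i j; have := le_trans (cn_Re _) (hij i j); rewrite ReB ler_norml; lra.
have [|a2 h2] := @nested_point I i0 (fun i => complex.Im (d i)) y _.
  move=> i j; have := le_trans (cn_Im _) (hij i j).
  have -> : complex.Im (d i - d j) = complex.Im (d i) - complex.Im (d j) by case: (d i) (d j) => [? ?] [].
  rewrite ler_norml; lra.
exists (a1 +i* a2)%C => p e e0 pe.
pose i1 : I := exist _ (p, e) (conj e0 pe).
apply: le_trans (cn_ReIm _) _.
have := h1 i1; have := h2 i1; rewrite /d /y /=.
case: (p^`().[toC X]) => x y' /= ha hb.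
have -> : 8 * e / r = 4 * e / r + 4 * e / r by field; rewrite gt_eqF.
exact: lerD.
Qed.

(* [u_x - i u_y], i.e. the derivative of the holomorphic function with real
   part [u]. *)
Definition der u X : R[i] := ('D_(@e1 R) u X -i* 'D_(@e2 R) u X)%C.

(** The second clause makes [der u] the limit of the derivatives of the approximating polynomials;
    the third is a second-order Taylor bound whose constant depends only on r and on a bound of
    u. *)
Lemma pa_der_all u X r : 0 < r -> pa u (eball X r) ->
  [/\ derivable u X e1 /\ derivable u X e2,
      (forall p e, 0 <= e -> (forall Y, eball X r Y -> `|u Y - rep p Y| <= e) ->
        cn (der u X - p^`().[toC X]) <= 8 * e / r) &
      (forall M, (forall Y, eball X r Y -> `|u Y| <= M) -> forall Y, enorm (Y - X) <= r / 4 ->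
        `|u Y - u X - complex.Re (der u X * toC (Y - X))| <= 16 * M * (enorm (Y - X) / r) ^+ 2)].
Proof.
move=> r0 pu; have [a ha] := pa_lin_ex r0 pu.
have T M : (forall Y, eball X r Y -> `|u Y| <= M) -> forall Y, enorm (Y - X) <= r / 4 ->
    `|u Y - u X - complex.Re (a * toC (Y - X))| <= 16 * M * (enorm (Y - X) / r) ^+ 2.
  move=> uM Y Yr; apply/ler_addgt0Pr => e e0.
  have e9 : 0 < e / 9 by rewrite divr_gt0.
  have [p hp] := pu _ e9.
  have r2 : 0 < r / 2 by exact: half_pos.
  have sub1 : ecball X (r / 2) `<=` eball X r by apply: ecball_eball; lra.
  pose q := p \Po ('X + (toC X)%:P).
  have hq (z : R[i]) : cn z = r / 2 -> `|complex.Re q.[z]| <= M + e / 9.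
    move=> zr; rewrite /q shift_horner.
    have zb : eball X r (X + ofC z).
      by apply: sub1; rewrite /ecball /= addrAC subrr add0r enormE ofCK zr.
    have -> : complex.Re p.[z + toC X] = rep p (X + ofC z) by rewrite /rep toCD ofCK addrC.
    by have := uM _ zb; have := hp _ zb; rewrite !ler_norml; lra.
  have w2 : cn (toC (Y - X)) <= r / 2 / 2 by rewrite -enormE; lra.
  have := poly_tail r2 hq (ltn0Sn 1) w2.
  rewrite big_ord_recr big_ord1 expr0 mulr1 expr1 /q shift_horner shift_coef0 shift_coef1.
  rewrite -toCD subrK => /(le_trans (cn_Re _)); rewrite ReB ReD -!/(rep _ _) -enormE.
  have -> : enorm (Y - X) / (r / 2) = 2 * (enorm (Y - X) / r) by field; rewrite gt_eqF.
  set t := enorm _ / r; rewrite exprMn => h1.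
  have t0 : 0 <= t by rewrite divr_ge0 ?enorm_ge0// ltW.
  have t2 : t <= 4^-1 by rewrite /t ler_pdivrMr//; lra.
  have h2 := ha p (e / 9) (ltW e9) hp.
  have h3 : `|complex.Re ((a - p^`().[toC X]) * toC (Y - X))| <= 8 * (e / 9) * t.
    apply: le_trans (cn_Re _) _; rewrite cnM -enormE /t.
    have -> : 8 * (e / 9) * (enorm (Y - X) / r) = 8 * (e / 9) / r * enorm (Y - X) by ring.
    by apply: ler_wpM2r => //; exact: enorm_ge0.
  have hX := hp _ (eball_center X r0).
  have hY : eball X r Y by rewrite /eball /=; lra.
  have h4 := hp _ hY.
  move: h3; rewrite mulrBl ReB => h3.
  have ee : 4 * (M + e / 9) * (2 ^+ 2 * t ^+ 2) = 16 * M * t ^+ 2 + 16 * (e / 9) * t ^+ 2 by ring.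
  have et : 16 * (e / 9) * t ^+ 2 <= e / 9.
    have : t ^+ 2 <= 16^-1 by nra.
    by move=> ht; have := ler_wpM2l (ltW e9) ht; lra.
  have et2 : 8 * (e / 9) * t <= 2 * (e / 9) by have := ler_wpM2l (ltW e9) t2; lra.
  move: h1; rewrite ee => h1.
  move: h1 h3 h4 hX et et2; rewrite !ler_norml.
  set x1 := complex.Re (a * _); set x2 := complex.Re (_ * _).
  set x3 := 16 * M * t ^+ 2; set x4 := 16 * (e / 9) * _; set x5 := 8 * _ * t.
  by move=> /andP[? ?] /andP[? ?] /andP[? ?] /andP[? ?] ? ?; apply/andP; split; lra.
have [M hM] := pa_bounded pu.
have r4 : 0 < r / 4 by rewrite divr_gt0.
have D1 : derivable u X e1 /\ 'D_e1 u X = complex.Re a.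
  apply: (@derive_quad u X e1 (complex.Re a) (16 * M / r ^+ 2) _ r4) => h hr.
  have e1n : enorm (X + h *: e1 - X) = `|h|.
    by rewrite addrAC subrr add0r enormZ /e1 enorm_e1 normr1 mulr1.
  have := T M hM (X + h *: e1); rewrite e1n => /(_ (ltW hr)).
  have -> : complex.Re (a * toC (X + h *: e1 - X)) = h * complex.Re a.
    rewrite addrAC subrr add0r; case: (a) => x y /=.
    by rewrite scaler0 mulr0 subr0 -[h%:A]/(h * 1) mulr1 mulrC.
  have -> // : 16 * M * (`|h| / r) ^+ 2 = 16 * M / r ^+ 2 * h ^+ 2.
  by rewrite expr_div_n real_normK ?num_real//; field; rewrite gt_eqF.
have D2 : derivable u X e2 /\ 'D_e2 u X = - complex.Im a.
  apply: (@derive_quad u X e2 (- complex.Im a) (16 * M / r ^+ 2) _ r4) => h hr.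
  have e1n : enorm (X + h *: e2 - X) = `|h|.
    by rewrite addrAC subrr add0r enormZ /e2 enorm_e2 normr1 mulr1.
  have := T M hM (X + h *: e2); rewrite e1n => /(_ (ltW hr)).
  have -> : complex.Re (a * toC (X + h *: e2 - X)) = h * - complex.Im a.
    rewrite addrAC subrr add0r; case: (a) => x y /=.
    by rewrite scaler0 mulr0 sub0r -[h%:A]/(h * 1) mulr1 mulrN mulrC.
  have -> // : 16 * M * (`|h| / r) ^+ 2 = 16 * M / r ^+ 2 * h ^+ 2.
  by rewrite expr_div_n real_normK ?num_real//; field; rewrite gt_eqF.
have da : der u X = a by rewrite /der (proj2 D1) (proj2 D2) opprK; case: (a).
split; rewrite ?da//.
by split; [case: D1|case: D2].
Qed.

Lemma rep_max p X r M : 0 < r -> (forall Y, esphere X r Y -> rep p Y <= M) ->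
  forall Y, ecball X r Y -> rep p Y <= M.
Proof.
move=> r0 h Y; rewrite /ecball /= le_eqVlt => /orP[/eqP|] Yr; first exact: h.
rewrite -subr_le0.
apply: (@max_principle R (eball X r) (fun Z => rep p Z - M) X r) => //.
- exact: open_eball.
- move=> Z _; apply: cvgB; last exact: cvg_cst.
  by apply: (@pa_cont R _ Z 1) => //; exact: pa_rep.
- move=> Z _; apply: (@pa_sub R _ Z 1) => //.
  by apply: paB; [exact: pa_rep|exact: pa_cst].
move=> Z nZ e e0.
have [Zr|Zr] := eqVneq (enorm (Z - X)) r; last first.
  have rZ : 0 < enorm (Z - X) - r.
    by rewrite subr_gt0 lt_neqAle eq_sym Zr leNgt; apply/negP.
  exists (enorm (Z - X) - r) => // V; rewrite /eball /= => Vr VZ; exfalso.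
  have := enorm_tri V Z X; rewrite (enormC Z V); lra.
have /cont_atP /(_ e e0)[d d0 hd] : {for Z, continuous (rep p)}.
  by apply: (@pa_cont R _ Z 1) => //; exact: pa_rep.
exists d => // V _ /hd; have := h Z Zr; rewrite ler_norml; lra.
Qed.

Lemma pa_max u X r M : 0 < r -> pa u (ecball X r) ->
  (forall Y, esphere X r Y -> u Y <= M) -> forall Y, ecball X r Y -> u Y <= M.
Proof.
move=> r0 pu h Y Yr; apply/ler_addgt0Pr => e e0.
have [p hp] := pu _ (half_pos e0).
have hs Z : esphere X r Z -> rep p Z <= M + e / 2.
  move=> Zr; have Zc : ecball X r Z by rewrite /ecball /= Zr.
  by have := h Z Zr; have := hp Z Zc; rewrite ler_norml; lra.
by have := rep_max r0 hs Yr; have := hp Y Yr; rewrite ler_norml; lra.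
Qed.

Lemma pa_max_norm u X r M : 0 < r -> pa u (ecball X r) ->
  (forall Y, esphere X r Y -> `|u Y| <= M) -> forall Y, ecball X r Y -> `|u Y| <= M.
Proof.
move=> r0 pu h Y Yr; rewrite ler_norml; apply/andP; split.
  rewrite lerNl; apply: (pa_max r0 (paN pu)) => // Z Zr.
  by have := h Z Zr; rewrite ler_norml; lra.
apply: (pa_max r0 pu) => // Z Zr.
by have := h Z Zr; rewrite ler_norml; lra.
Qed.

Lemma esphere_compact X r : compact (esphere X r).
Proof.
apply: (@subclosed_compact _ _ (ecball X r)); last by move=> Y; rewrite /ecball /= => ->.
  move=> Y cY; rewrite /esphere /=.
  apply/eqP; rewrite -subr_eq0 -normr_eq0; apply/eqP/le_anti; rewrite normr_ge0 andbT.
  apply/ler_addgt0Pr => e e0; rewrite add0r.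
  have [Z ZX ZY] := proj1 (closureP _ _) cY e e0.
  move: ZX ZY; rewrite /esphere /eball /= => <- /ltW ZY; apply: le_trans ZY.
  rewrite ler_norml; have := enorm_tri Z Y X; have := enorm_tri Y Z X.
  rewrite (enormC Y Z); lra.
exact: compact_ecball.
Qed.

Lemma compact_unif (K : set (R * R)) g : compact K ->
  (forall Y, K Y -> forall e, 0 < e -> exists2 d : R, 0 < d &
     forall Z, K Z -> eball Y d Z -> `|g Z - g Y| <= e) ->
  forall e, 0 < e -> exists2 d : R, 0 < d &
    forall Y Z, K Y -> K Z -> enorm (Y - Z) < d -> `|g Y - g Z| <= e.
Proof.
move=> cK gc e e0.
have H Y : exists d : R, K Y -> 0 < d /\ forall Z, K Z -> eball Y d Z -> `|g Z - g Y| <= e / 2.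
  have [KY|nKY] := pselect (K Y); last by exists 1.
  by have [d d0 hd] := gc Y KY _ (half_pos e0); exists d.
have [f hf] := choice H.
have fp X : K X -> 0 < f X / 2 by move=> /hf[f0 _]; exact: half_pos.
have [l lK lc] := compact_gauge cK fp.
have [d d0 hd] : exists2 d : R, 0 < d & forall X, X \in l -> d <= f X / 2.
  elim: l lK {lc} => [|a l IH] lK; first by exists 1.
  have [X Xl|d d0 hd] := IH; first by apply: lK; rewrite inE Xl orbT.
  exists (Num.min d (f a / 2)); first by rewrite lt_min d0 fp//; apply: lK; rewrite mem_head.
  move=> X; rewrite inE ge_min => /orP[/eqP ->|/hd ->//]; first by rewrite lexx orbT.
exists d => // Y Z KY KZ YZ.
have [X Xl XY] := lc Y KY.
have [f0 hX] := hf X (lK X Xl).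
have XY1 : eball X (f X) Y by move: XY; rewrite /eball /=; lra.
have XZ1 : eball X (f X) Z.
  move: XY (hd X Xl); rewrite /eball /= => XY dX.
  by have := enorm_tri Y Z X; rewrite (enormC Z Y); lra.
by have := hX Y KY XY1; have := hX Z KZ XZ1; rewrite !ler_norml; lra.
Qed.

(** Fejér's theorem approximates the data on the circle by real parts of polynomials, the maximum
    principle carries closeness on the circle into the disc, and [nested_point] supplies the value
    at each point. *)
Lemma dirichlet_disc X r g : 0 < r ->
  (forall Y, esphere X r Y -> forall e, 0 < e -> exists2 d : R, 0 < d &
     forall Z, esphere X r Z -> eball Y d Z -> `|g Z - g Y| <= e) ->
  exists V, pa V (ecball X r) /\ forall Y, esphere X r Y -> V Y = g Y.
Proof.
move=> r0 gc.
have gu := compact_unif (@esphere_compact X r) gc.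
have rC : r%:C%C != 0 by rewrite -cn_gt0 cn_real gtr0_norm.
pose P (z : R[i]) : R * R := X + ofC (r%:C%C * z).
have PX (z : R[i]) : enorm (P z - X) = r * cn z.
  by rewrite /P addrAC subrr add0r enormE ofCK cnM cn_real gtr0_norm.
have PP (z w : R[i]) : enorm (P z - P w) = r * cn (z - w).
  rewrite /P opprD addrACA subrr add0r enormE toCB !ofCK -mulrBr cnM cn_real gtr0_norm//.
have sph (z : R[i]) : cn z = 1 -> esphere X r (P z) by move=> z1; rewrite /esphere /= PX z1 mulr1.
have [d1 d10 hd1] := gu _ ltr01.
have [G hG] : exists G : R, forall Y, esphere X r Y -> `|g Y| <= G.
  have [l lK lc] := @compact_gauge R _ (fun=> d1) (@esphere_compact X r) (fun _ _ => d10).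
  exists (\sum_(Z <- l) (`|g Z| + 1)) => Y KY.
  have [Z Zl YZ] := lc Y KY.
  rewrite (big_rem Z)//= -[leLHS]addr0; apply: lerD.
    by have := hd1 Y Z KY (lK Z Zl) YZ; rewrite -{2}(subrK (g Z) (g Y)) => h;
      apply: le_trans (ler_normD _ _) _; rewrite addrC lerD2l.
  by apply: sumr_ge0 => ? _; rewrite addr_ge0.
have app e : 0 < e -> exists p, forall Y, esphere X r Y -> `|rep p Y - g Y| <= e.
  move=> e0; have [||p hp] := @fejer_approx R (g \o P) G _ _ e e0.
  - by move=> z z1; exact: hG (sph z z1).
  - move=> e' e'0; have [d d0 hd] := gu e' e'0; exists (d / r); first by rewrite divr_gt0.
    move=> z w z1 w1 zw; apply: hd; [exact: sph|exact: sph|].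
    by rewrite PP mulrC -ltr_pdivlMr.
  exists (p \Po ((r%:C%C)^-1 *: ('X - (toC X)%:P))) => Y KY.
  pose z := (r%:C%C)^-1 * toC (Y - X).
  have zE : P z = Y by rewrite /P /z mulVKf// toCK addrC subrK.
  have z1 : cn z = 1.
    apply: (mulfI (x := r)); first by rewrite gt_eqF.
    by rewrite -PX zE mulr1.
  have := hp z z1; rewrite /= zE /rep horner_comp hornerZ hornerD hornerN hornerX hornerC.
  by rewrite -toCB.
pose I := {pe : {poly R[i]} * R | 0 <= pe.2 /\ forall Y, esphere X r Y -> `|rep pe.1 Y - g Y| <= pe.2}.
have [p1 hp1] := app _ ltr01.
have i0 : I by exists (p1, 1).
have H Y : exists v : R, ecball X r Y -> forall i : I, `|v - rep (sval i).1 Y| <= (sval i).2.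
  have [KY|nKY] := pselect (ecball X r Y); last by exists 0.
  have [|v hv] := @nested_point I i0 (fun i => rep (sval i).1 Y) (fun i => (sval i).2).
    move=> [[p e] /= [e0 pe]] [[p' e'] /= [e'0 pe']].
    have h Z : esphere X r Z -> rep (p - p') Z <= e + e'.
      move=> KZ; rewrite repD repN; have := pe Z KZ; have := pe' Z KZ.
      by rewrite !ler_norml; lra.
    by have := rep_max r0 h KY; rewrite repD repN; lra.
  by exists v.
have [V hV] := choice H.
exists V; split.
  move=> e e0; have [p hp] := app e e0; exists p => Y KY.
  exact: (hV Y KY (exist _ (p, e) (conj (ltW e0) hp))).
move=> Y KY; apply/eqP; rewrite -subr_eq0 -normr_eq0; apply/eqP/le_anti; rewrite normr_ge0 andbT.
apply/ler_addgt0Pr => e e0; rewrite add0r.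
have [p hp] := app _ (half_pos e0).
have KcY : ecball X r Y by rewrite /ecball /= KY.
have := hV Y KcY (exist _ (p, e / 2) (conj (ltW (half_pos e0)) hp)) => /=.
by have := hp Y KY; rewrite !ler_norml; lra.
Qed.

End derivatives_and_dirichlet.

(** * From vanishing Laplacian to the five-point stencil *)

Section harmonic_calculus.
Context {R : realType}.
Implicit Types (X Y Z : R * R) (A B : set (R * R)) (u v w g : R * R -> R)
  (p q : {poly R[i]}) (r s e M : R).

Lemma line_derive u X (v : R * R) s : derivable u (X + s *: v) v ->
  is_derive s (1 : R) (fun t : R => u (X + t *: v)) ('D_v u (X + s *: v)).
Proof.
have E : (fun h : R => h^-1 *: (((fun t : R => u (X + t *: v)) \o shift s) (h *: (1 : R)) - u (X + s *: v))) =
    (fun h : R => h^-1 *: ((u \o shift (X + s *: v)) (h *: v) - u (X + s *: v))).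
  apply/funext => h /=; congr (_ *: (u _ - _)).
  by rewrite -[h%:A]/(h * 1) mulr1 scalerDl addrCA.
by move=> du; apply: DeriveDef; rewrite /derivable /derive E.
Qed.

Lemma is_derive_within (f df : R -> R) (a b : R) :
  (forall t : R, a <= t <= b -> is_derive t (1 : R) f (df t)) -> {within `[a, b], continuous f}.
Proof.
move=> h; apply: continuous_in_subspaceT => t; rewrite inE /= in_itv /= => tab.
have := h t tab => -[dt _]; apply/differentiable_continuous.
exact/derivable1_diffP.
Qed.

Lemma line_MVT u X (v : R * R) (df : R -> R) :
  (forall t : R, 0 <= t <= 1 -> derivable u (X + t *: v) v /\ 'D_v u (X + t *: v) = df t) ->
  exists2 t : R, 0 < t < 1 & u (X + v) - u X = df t.
Proof.
move=> h.
have D (t : R) : 0 <= t <= 1 -> is_derive t (1 : R) (fun t : R => u (X + t *: v)) (df t).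
  by move=> /h[d <-]; exact: line_derive.
have [|t] := @MVT R (fun t : R => u (X + t *: v)) df 0 1 ltr01 _ (is_derive_within D).
  by move=> t; rewrite in_itv /= => /andP[t0 t1]; apply: D; rewrite !ltW.
rewrite in_itv /= scale1r scale0r addr0 subr0 mulr1 => t01 E.
by exists t.
Qed.

Lemma pa_dir u X r (v : R * R) : 0 < r -> pa u (eball X r) ->
  derivable u X v /\ 'D_v u X = complex.Re (der u X * toC v).
Proof.
move=> r0 pu; have [_ _ T] := pa_der_all r0 pu.
have [M hM] := pa_bounded pu.
have v1 : 0 < enorm v + 1 by rewrite ltr_wpDl ?enorm_ge0.
have d0 : 0 < r / 4 / (enorm v + 1) by rewrite !divr_gt0.
apply: (@derive_quad R u X v _ (16 * M * (enorm v / r) ^+ 2) _ d0) => h hd.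
have hv : enorm (h *: v) <= r / 4.
  rewrite enormZ; move: hd; rewrite ltr_pdivlMr// => /ltW; apply: le_trans.
  by rewrite ler_wpM2l// lerDl.
have := T M hM (X + h *: v); rewrite addrAC subrr add0r => /(_ hv).
have -> : complex.Re (der u X * toC (h *: v)) = h * complex.Re (der u X * toC v).
  rewrite -ReZ; congr complex.Re; rewrite mulrCA; congr (_ * _).
  by rewrite /toC /=; simpc.
rewrite enormZ.
have -> // : 16 * M * (`|h| * enorm v / r) ^+ 2 = 16 * M * (enorm v / r) ^+ 2 * h ^+ 2.
by rewrite !exprMn real_normK ?num_real//; ring.
Qed.

(** The mean value theorem is applied to the symmetric difference with s^2 c subtracted; its
    derivative is controlled by the first-order expansion of ['D_v u] at X. *)
Lemma second_diff u X (v : R * R) r : 0 < r ->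
  (forall s : R, `|s| < r -> derivable u (X + s *: v) v) -> derivable ('D_v u) X v ->
  forall e : R, 0 < e -> exists2 d : R, 0 < d & forall s : R, 0 < s -> s < d ->
    `|u (X + s *: v) + u (X - s *: v) - 2 * u X - s ^+ 2 * 'D_v ('D_v u) X| <= e * s ^+ 2.
Proof.
move=> r0 du ddu e e0; set c : R := 'D_v ('D_v u) X.
have [d d0 hd] : exists2 d : R, 0 < d & forall s : R, `|s| < d ->
    `|'D_v u (X + s *: v) - 'D_v u X - s * c| <= e / 2 * `|s|.
  have : h^-1 *: (('D_v u \o shift X) (h *: v) - 'D_v u X) @[h --> 0^'] --> c by exact: ddu.
  move=> /cvgrPdist_le /(_ _ (half_pos e0)) /nbhs_ballP[d /= d0 hd].
  exists d => // s sd; have [->|s0] := eqVneq s 0.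
    by rewrite scale0r addr0 subrr mul0r subrr normr0 mulr0.
  have := hd s; rewrite /ball /= sub0r normrN => /(_ sd s0).
  rewrite [s *: v + X]addrC -[_ *: _]/(_ * _) => h.
  have -> : 'D_v u (X + s *: v) - 'D_v u X - s * c =
    - (s * (c - s^-1 * ('D_v u (X + s *: v) - 'D_v u X))) by field.
  by rewrite normrN normrM mulrC ler_wpM2r.
exists (Num.min r d); first by rewrite lt_min r0.
move=> s s0; rewrite lt_min => /andP[sr sd].
pose f (t : R) := u (X + t *: v) + u (X + t *: (- v)) - t ^+ 2 * c.
pose df (t : R) := 'D_v u (X + t *: v) - 'D_v u (X + (- t) *: v) - 2 * t * c.
have D (t : R) : 0 <= t <= s -> is_derive t (1 : R) f (df t).
  move=> /andP[t0 ts].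
  have tr : `|t| < r by rewrite ger0_norm//; exact: le_lt_trans sr.
  have tr' : `|- t| < r by rewrite normrN.
  have D1 := line_derive (du _ tr).
  have D2 : is_derive t (1 : R) (fun t : R => u (X + t *: (- v))) (- 'D_v u (X + (- t) *: v)).
    have D3 := line_derive (du _ tr').
    have D4 : is_derive t (1 : R) (fun t : R => - t) (-1) by exact: is_deriveN.
    have D5 := @is_derive1_comp R (fun t : R => u (X + t *: v)) (fun t : R => - t) t _ _ D3 D4.
    have -> : (fun t0 : R => u (X + t0 *: - v)) = (fun t : R => u (X + t *: v)) \o (fun t : R => - t).
      by apply/funext => z /=; rewrite scalerN scaleNr.
    by move: D5; rewrite mulrN1.
  have D3 : is_derive t (1 : R) (fun t : R => t ^+ 2 * c) (2 * t * c).
    have -> : (fun t : R => t ^+ 2 * c) = (id : R -> R) * (id : R -> R) * cst c.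
      by apply/funext => z; rewrite expr2.
    apply: is_derive_eq; rewrite /GRing.scale /= /cst /=; ring.
  by apply: is_deriveB.
have cf : {within `[0, s], continuous f} by exact: is_derive_within D.
have [|t] := @MVT R f df 0 s s0 _ cf.
  by move=> t; rewrite in_itv /= => /andP[t0 t1]; apply: D; rewrite !ltW.
rewrite in_itv /= => /andP[t0 ts] E.
have td : `|t| < d by rewrite gtr0_norm//; exact: lt_trans sd.
have td' : `|- t| < d by rewrite normrN.
have -> : u (X + s *: v) + u (X - s *: v) - 2 * u X - s ^+ 2 * c = f s - f 0.
  by rewrite /f !scale0r addr0 scalerN expr0n mul0r; ring.
rewrite E subr0 normrM (gtr0_norm s0) expr2 mulrA ler_wpM2r ?(ltW s0)//.
have := hd _ td; have := hd _ td'; rewrite normrN (gtr0_norm t0) /df => h1 h2.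
have -> : 'D_v u (X + t *: v) - 'D_v u (X + - t *: v) - 2 * t * c =
  ('D_v u (X + t *: v) - 'D_v u X - t * c) - ('D_v u (X + - t *: v) - 'D_v u X - - t * c) by ring.
apply: le_trans (ler_normB _ _) _; apply: le_trans (lerD h2 h1) _.
by rewrite -mulrDl -splitr ler_wpM2l ?ltW.
Qed.

Lemma harmonic_on_sub u A X : open A -> harmonic_on u A -> A X ->
  [/\ {for X, continuous u}, sub u X & sub (fun Y => - u Y) X].
Proof.
move=> oA [c2 lap0] AX; have [uc dX] := c2 X AX.
have [r r0 rA] := (proj1 (openP _) oA) X AX.
have E (v : R * R) : v = e1 \/ v = e2 -> enorm v = 1 -> forall e : R, 0 < e -> exists2 d : R, 0 < d & forall s : R, 0 < s -> s < d ->
    `|u (X + s *: v) + u (X - s *: v) - 2 * u X - s ^+ 2 * 'D_v ('D_v u) X| <= e * s ^+ 2.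
  move=> hv v1; apply: second_diff r0 _ _.
    move=> s sr; have AXs : A (X + s *: v).
      by apply: rA; rewrite /eball /= addrAC subrr add0r enormZ v1 mulr1.
    by have [_ /(_ v hv)[]] := c2 _ AXs.
  by have [_ _ /(_ v hv)[]] := dX v hv.
have E1 := E e1 (or_introl erefl) _.
have E2 := E e2 (or_intror erefl) _.
have n1 : enorm (e1 : R * R) = 1 by rewrite /e1 enorm_e1 normr1.
have n2 : enorm (e2 : R * R) = 1 by rewrite /e2 enorm_e2 normr1.
have B (e : R) : 0 < e -> exists2 d : R, 0 < d & forall s : R, 0 < s -> s < d -> `|lap4 u X s| <= e * s ^+ 2.
  move=> e0; have [d d0 hd] := E1 n1 _ (half_pos e0); have [d' d'0 hd'] := E2 n2 _ (half_pos e0).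
  exists (Num.min d d'); first by rewrite lt_min d0.
  move=> s s0; rewrite lt_min => /andP[sd sd'].
  have := hd s s0 sd; have := hd' s s0 sd'.
  have -> : s *: e1 = (s, 0) :> R * R.
    by rewrite /e1 -[LHS]/(s * 1, s * 0) mulr1 mulr0.
  have -> : s *: e2 = (0, s) :> R * R.
    by rewrite /e2 -[LHS]/(s * 0, s * 1) mulr1 mulr0.
  have := lap0 X AX; rewrite /laplacian.
  set c1 := 'D_e1 _ _; set c2' := 'D_e2 _ _ => hc.
  have -> : c2' = - c1 by move: hc; lra.
  rewrite /lap4 mulrN.
  set k := s ^+ 2 * c1; set q := e * s ^+ 2.
  have -> : e / 2 * s ^+ 2 = q / 2 by rewrite /q; field.
  by rewrite !ler_norml; lra.
split=> // e e0; have [d d0 hd] := B e e0; exists d => // s s0 sd;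
  have := hd s s0 sd; rewrite ler_norml mulNr => /andP[h1 h2] //.
have -> : lap4 (fun Y => - u Y) X s = - lap4 u X s by rewrite /lap4; ring.
by rewrite lerN2.
Qed.

End harmonic_calculus.

(** * Local harmonicity, Harnack's inequality, two-constants estimate *)

Section harmonic_functions_theory.
Context {R : realType}.
Implicit Types (X Y Z : R * R) (A B : set (R * R)) (u v w g V : R * R -> R)
  (p q : {poly R[i]}) (r s e M : R).

Lemma pa_contw V A X e : pa V A -> A X -> 0 < e ->
  exists2 d : R, 0 < d & forall Y, A Y -> eball X d Y -> `|V Y - V X| <= e.
Proof.
move=> pV AX e0; have e3 : 0 < e / 3 by rewrite divr_gt0.
have [p hp] := pV _ e3.
have /cont_atP/(_ _ e3)[d d0 hd] : {for X, continuous (rep p)}.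
  by apply: (@pa_cont R _ X 1) => //; exact: pa_rep.
exists d => // Y AY Yd; have := hd Y Yd; have := hp X AX; have := hp Y AY.
by rewrite !ler_norml; lra.
Qed.

Lemma sub_le_pa u V X r : 0 < r -> pa V (ecball X r) ->
  (forall Y, ecball X r Y -> {for Y, continuous u}) ->
  (forall Y, eball X r Y -> sub u Y) ->
  (forall Y, esphere X r Y -> u Y <= V Y) -> forall Y, ecball X r Y -> u Y <= V Y.
Proof.
move=> r0 pV uc us uV Y; rewrite /ecball /= le_eqVlt => /orP[/eqP|] Yr; first exact: uV.
have sb Z : eball X r Z -> exists2 s : R, 0 < s & eball Z s `<=` ecball X r.
  move=> Zr; exists (r - enorm (Z - X)); first by rewrite subr_gt0.
  by apply: subset_trans (@eball_ecball R X r); apply: eball_sub; rewrite addrC subrK.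
rewrite -subr_le0.
apply: (@max_principle R (eball X r) (fun Z => u Z - V Z) X r) => //.
- exact: open_eball.
- move=> Z Zr; apply: cvgB; first by apply: uc; exact: ltW.
  by have [s s0 sZ] := sb Z Zr; apply: (@pa_cont R _ Z s) => //; apply: paS pV.
- move=> Z Zr; apply: subD; first exact: us.
  by have [s s0 sZ] := sb Z Zr; apply: (@pa_sub R _ Z s) => //; apply/paN; apply: paS pV.
move=> Z nZ e e0.
have [Zr|Zr] := eqVneq (enorm (Z - X)) r; last first.
  have rZ : 0 < enorm (Z - X) - r.
    by rewrite subr_gt0 lt_neqAle eq_sym Zr leNgt; apply/negP.
  exists (enorm (Z - X) - r) => // W; rewrite /eball /= => Wr WZ; exfalso.
  have := enorm_tri W Z X; rewrite (enormC Z W); lra.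
have Zc : ecball X r Z by rewrite /ecball /= Zr.
have [d d0 hd] := proj1 (cont_atP _ _) (uc Z Zc) _ (half_pos e0).
have [d' d'0 hd'] := pa_contw pV Zc (half_pos e0).
exists (Num.min d d'); first by rewrite lt_min d0.
move=> W Wr; rewrite /eball /= lt_min => /andP[W1 W2].
have := hd W W1; have := hd' W (ltW Wr) W2; have := uV Z Zr.
by rewrite !ler_norml; lra.
Qed.

(** Comparison with the solution of the Dirichlet problem from above and from below: the stencil
    condition on u and on -u already yields approximability by polynomials. *)
Lemma harm4_pa u X r : 0 < r -> (forall Y, ecball X r Y -> {for Y, continuous u}) ->
  (forall Y, eball X r Y -> sub u Y /\ sub (fun Z => - u Z) Y) -> pa u (ecball X r).
Proof.
move=> r0 uc us.
have [|V [pV Vg]] := @dirichlet_disc R X r u r0.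
  move=> Y Ys e e0; have Yc : ecball X r Y by rewrite /ecball /= Ys.
  have [d d0 hd] := proj1 (cont_atP _ _) (uc Y Yc) _ e0.
  by exists d => // Z _ /hd.
apply: (pa_eq _ pV) => Y Yr; apply/eqP; rewrite eq_le; apply/andP; split; last first.
  apply: (sub_le_pa r0 pV uc) => // [Z Zr|Z Zr]; first by have [] := us Z Zr.
  by rewrite Vg.
rewrite -lerN2; apply: (@sub_le_pa (fun Z => - u Z) (fun Z => - V Z) X r r0 (paN pV)) => // Z Zr.
- by apply: cvgN; exact: uc.
- by have [] := us Z Zr.
- by rewrite Vg.
Qed.

Definition harm u A : Prop := forall X, A X -> exists2 r, 0 < r & pa u (eball X r).

Lemma harmS u A B : A `<=` B -> harm u B -> harm u A.
Proof. by move=> AB h X /AB; exact: h. Qed.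

Lemma harm_cont u A X : harm u A -> A X -> {for X, continuous u}.
Proof. by move=> h /h[r r0 pu]; exact: pa_cont pu. Qed.

Lemma harm_sub u A X : harm u A -> A X -> sub u X /\ sub (fun Y => - u Y) X.
Proof. by move=> h /h[r r0 pu]; split; [exact: pa_sub pu|exact: pa_sub (paN pu)]. Qed.

(** A Runge statement for discs: local approximability becomes approximability on any closed disc in
    A. It passes through the stencil condition, which is local, and back by [harm4_pa]. *)
Lemma harm_ecball u A X r : harm u A -> 0 < r -> ecball X r `<=` A -> pa u (ecball X r).
Proof.
move=> h r0 rA; apply: harm4_pa => // Y Yr; first by apply: harm_cont h _; exact: rA.
by apply: harm_sub h _; apply: rA; exact: ltW.
Qed.

Lemma harm_eball u A X r : harm u A -> 0 < r -> ecball X r `<=` A -> pa u (eball X r).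
Proof. by move=> h r0 rA; apply: paS (@eball_ecball R X r) _; exact: harm_ecball h r0 rA. Qed.

Lemma harmB u v A : harm u A -> harm v A -> harm (fun X => u X - v X) A.
Proof.
move=> hu hv X AX; have [r r0 pu] := hu X AX; have [s s0 pv] := hv X AX.
exists (Num.min r s); first by rewrite lt_min r0.
apply: paB; [apply: paS pu|apply: paS pv] => Y;
  by rewrite /eball /= lt_min => /andP[].
Qed.

Lemma harm_cst (a : R) A : harm (fun=> a) A.
Proof. by move=> X _; exists 1 => //; exact: pa_cst. Qed.

Lemma harmonic_on_harm u A : open A -> harmonic_on u A -> harm u A.
Proof.
move=> oA hu X AX; have [r r0 rA] := proj1 (openP A) oA X AX.
have r2 := half_pos r0; exists (r / 2) => //.
apply: paS (@eball_ecball R _ _) _.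
have h Y : ecball X (r / 2) Y -> A Y.
  by move=> Yr; apply: rA; apply: ecball_eball Yr; lra.
apply: harm4_pa => // Y Yr; first by have [] := harmonic_on_sub oA hu (h Y Yr).
by have [] := harmonic_on_sub oA hu (h Y (ltW Yr)).
Qed.

Lemma rep_shiftE p X (z : R[i]) :
  complex.Re (p \Po ('X + (toC X)%:P)).[z] = rep p (X + ofC z).
Proof. by rewrite shift_horner /rep toCD ofCK [z + _]addrC. Qed.

Lemma ofC_eball X r (z : R[i]) : (eball X r (X + ofC z) <-> cn z < r).
Proof. by rewrite /eball /= addrAC subrr add0r enormE ofCK. Qed.

(** By [coef_pos] the nonconstant part of the series is dominated by a geometric series, which
    amounts to at most half of the constant term within r / 16. *)
Lemma harnack u X Y r : 0 < r -> pa u (eball X r) -> (forall Z, eball X r Z -> 0 <= u Z) ->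
  enorm (Y - X) <= r / 16 -> u X / 2 <= u Y /\ u Y <= 2 * u X.
Proof.
move=> r0 pu u0 Yr.
suff H e : 0 < e -> u X / 2 - 4 * e <= u Y /\ u Y <= 2 * u X + 4 * e.
  split; apply/ler_addgt0Pr => e e0; have e4 : 0 < e / 4 by rewrite divr_gt0.
    by have [] := H _ e4; lra.
  by have [] := H _ e4; lra.
move=> e0; have [p hp] := pu _ e0.
(* Adding the error e makes the real part of the approximating polynomial itself nonnegative. *)
pose q := (p + (e%:C%C)%:P) \Po ('X + (toC X)%:P).
have qE z : complex.Re q.[z] = rep p (X + ofC z) + e.
  by rewrite /q rep_shiftE repD; congr (_ + _); rewrite /rep hornerC.
have r2 : 0 < r / 2 by exact: half_pos.
have hq (z : R[i]) : cn z = r / 2 -> 0 <= complex.Re q.[z].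
  move=> zr; have zb : eball X r (X + ofC z) by apply/ofC_eball; rewrite zr; lra.
  rewrite qE; have := u0 _ zb; have := hp _ zb; rewrite !ler_norml; lra.
set c0 := complex.Re q`_0.
have c0E : c0 = rep p X + e.
  by rewrite /c0 -horner_coef0 qE; congr (rep p _ + _); rewrite -[ofC 0]/(0, 0) addr0.
have q1 k : (0 < k)%N -> cn q`_k * (r / 2) ^+ k <= 2 * c0.
  by move=> k0; exact: coef_pos (ltW r2) hq k0.
have c00 : 0 <= c0.
  have := q1 1%N isT; have := mulr_ge0 (cn_ge0 q`_1) (ltW r2); rewrite expr1; lra.
pose w := toC (Y - X).
have wr : cn w / (r / 2) <= 8^-1.
  by rewrite ler_pdivrMr// -enormE; lra.
have w0 : 0 <= cn w / (r / 2) by rewrite divr_ge0 ?cn_ge0// ltW.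
have D : cn (q.[w] - q`_0) <= c0 / 2.
  have -> : q.[w] - q`_0 = (drop_poly 1 q).[w] * w.
    rewrite -{1}(poly_take_drop 1 q) hornerD hornerM expr1 hornerX addrAC.
    suff -> : (take_poly 1 q).[w] = q`_0 by rewrite subrr add0r.
    by rewrite horner_poly big_ord1 expr0 mulr1.
  rewrite horner_coef mulr_suml; apply: le_trans (cn_sum _ _ _) _.
  apply: (@le_trans _ _ (\sum_(k < size (drop_poly 1 q)) (2 * c0 * (cn w / (r / 2))) * (cn w / (r / 2)) ^+ k)).
    apply: ler_sum => k _; rewrite -mulrA -exprSr cnM cnX coef_drop_poly addn1.
    rewrite -mulrA -exprS expr_div_n mulrA [leRHS]mulrAC ler_wpM2r ?exprn_ge0 ?cn_ge0//.
    by rewrite ler_pdivlMr ?exprn_gt0// q1.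
  rewrite -mulr_sumr.
  have := @geo_le2 R _ (size (drop_poly 1 q)) w0 (le_trans wr _).
  have h8 : 8^-1 <= 2^-1 :> R by lra.
  move=> /(_ h8); set S := \sum_(_ < _) _ => S2.
  have c8 : 2 * c0 * (cn w / (r / 2)) <= c0 / 4.
    by have := ler_wpM2l c00 wr; lra.
  have S0 : 0 <= S by apply: sumr_ge0 => k _; exact: exprn_ge0.
  nra.
have Yb : eball X r Y by rewrite /eball /=; lra.
have := le_trans (cn_Re _) D; rewrite ReB qE /w toCK -/c0 [X + (Y - X)]addrC subrK c0E.
have := hp _ Yb; have := hp _ (eball_center X r0); have := u0 _ (eball_center X r0).
by rewrite !ler_norml; lra.
Qed.

(* Two-constants estimate: a harmonic function on a disc which is tiny on a
   concentric subdisc is small on a fixed fraction of the disc. *)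
Lemma smallness (k t : R) : 0 < k -> k <= 1 -> 0 < t -> exists2 h : R, 0 < h &
  forall u X r M, 0 < r -> 0 <= M -> pa u (eball X r) ->
    (forall Y, eball X r Y -> `|u Y| <= M) ->
    (forall Y, eball X (k * r) Y -> `|u Y| <= h * M) ->
    forall Y, ecball X (r / 4) Y -> `|u Y| <= t * M.
Proof.
move=> k0 k1 t0.
(* K cuts the series: the terms from degree K on are at most about t / 2 of M on the quarter disc,
   and the lower coefficients are read off the small disc at the price of a factor k^-K, which S
   collects. *)
pose K := (Num.truncn (8 / t)).+1.
have Kt : 8 / t < K%:R by rewrite /K truncnS_gt.
have KP : (0 < K)%N by [].
have tK : 4 * 2^-1 ^+ K <= t / 2.
  have h : K%:R <= 2 ^+ K :> R by rewrite -natrX ler_nat ltnW// ltn_expl.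
  have h' := lt_le_trans Kt h.
  rewrite exprVn ler_pdivrMr ?exprn_gt0//.
  by move: h'; rewrite ltr_pdivrMr// => h'; lra.
have k1' : 1 <= k^-1 by rewrite invr_ge1 ?unitfE ?gt_eqF.
pose S : R := K%:R * k^-1 ^+ K.
have S0 : 0 < S by rewrite mulr_gt0 ?exprn_gt0 ?invr_gt0 ?ltr0n.
exists (t / (4 * S)); first by rewrite divr_gt0// mulr_gt0.
move=> u X r M r0 M0 pu uM uh Y Yr; apply/ler_addgt0Pr => e e0.
set h := t / (4 * S) in uh *.
pose e' := e / (5 + 2 * S).
have S5 : 0 < 5 + 2 * S by rewrite addr_gt0// mulr_gt0.
have e'0 : 0 < e' by rewrite divr_gt0.
have [p hp] := pu _ e'0.
pose q := p \Po ('X + (toC X)%:P).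
have r2 : 0 < r / 2 by exact: half_pos.
have kr2 : 0 < k * r / 2 by rewrite half_pos// mulr_gt0.
have krr : k * r <= r by rewrite ger_pMl.
have hq (z : R[i]) : cn z = r / 2 -> `|complex.Re q.[z]| <= M + e'.
  move=> zr; have zb : eball X r (X + ofC z) by apply/ofC_eball; rewrite zr; lra.
  by rewrite /q rep_shiftE; have := uM _ zb; have := hp _ zb; rewrite !ler_norml; lra.
have hq' (z : R[i]) : cn z = k * r / 2 -> `|complex.Re q.[z]| <= h * M + e'.
  move=> zr; have zb : eball X (k * r) (X + ofC z) by apply/ofC_eball; rewrite zr; lra.
  have zb' : eball X r (X + ofC z) by apply/ofC_eball; rewrite zr; lra.
  by rewrite /q rep_shiftE; have := uh _ zb; have := hp _ zb'; rewrite !ler_norml; lra.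
pose w := toC (Y - X).
have wr : cn w <= r / 2 / 2 by rewrite /w -enormE; move: Yr; rewrite /ecball /=; lra.
have h0 : 0 <= h by rewrite ltW// divr_gt0// mulr_gt0.
have hM0 : 0 <= h * M + e' by rewrite addr_ge0 ?(mulr_ge0 h0 M0)// ltW.
have A1 := poly_tail r2 hq KP wr.
have wd0 : 0 <= cn w / (r / 2) by rewrite divr_ge0 ?cn_ge0 ?(ltW r2).
have wd2 : cn w / (r / 2) <= 2^-1 by rewrite ler_pdivrMr// mulrC.
have A3 : 4 * (M + e') * (cn w / (r / 2)) ^+ K <= t / 2 * (M + e').
  have : (cn w / (r / 2)) ^+ K <= 2^-1 ^+ K.
    by rewrite lerXn2r ?nnegrE ?invr_ge0.
  move=> a3; have M1 : 0 <= M + e' by rewrite addr_ge0// ltW.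
  have := ler_wpM2l M1 a3; have := ler_wpM2l M1 tK.
  move: (M + e') (2^-1 ^+ K) ((cn w / (r / 2)) ^+ K) => a b c; clear; lra.
have A4 : `|complex.Re (\sum_(j < K) q`_j * w ^+ j)| <= 2 * (h * M + e') * S.
  rewrite Re_sum; apply: le_trans (ler_norm_sum _ _ _) _.
  apply: (@le_trans _ _ (\sum_(j < K) 2 * (h * M + e') * k^-1 ^+ K)); last first.
    by rewrite sumr_const card_ord /S -[_ *+ K]mulr_natl mulrCA.
  apply: ler_sum => j _.
  have [j0|j0] := posnP j.
    rewrite j0 expr0 mulr1.
    have h1 : complex.Re q`_0 <= h * M + e'.
      apply: coef0_le (ltW kr2) _ => z /hq'; exact: le_trans (ler_norm _).
    have h2 : complex.Re (- q)`_0 <= h * M + e'.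
      apply: coef0_le (ltW kr2) _ => z /hq' h'; rewrite hornerN ReN.
      by apply: le_trans h'; rewrite -normrN ler_norm.
    move: h2; rewrite coefN ReN => h2.
    have : 1 <= k^-1 ^+ K by rewrite exprn_ege1.
    by move=> hk; have := ler_wpM2l hM0 hk; rewrite ler_norml; lra.
  apply: le_trans (cn_Re _) _; rewrite cnM cnX.
  have cq := coef_bound (ltW kr2) hq' j0.
  have wk : cn w ^+ j <= (k * r / 2) ^+ j * k^-1 ^+ K.
    apply: (@le_trans _ _ ((r / 2) ^+ j)).
      by rewrite lerXn2r ?nnegrE ?cn_ge0 ?(ltW r2)//; lra.
    have -> : (k * r / 2) ^+ j * k^-1 ^+ K = (k ^+ j * k^-1 ^+ K) * (r / 2) ^+ j.
      by rewrite -(mulrA k) exprMn mulrAC.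
    rewrite -[leLHS]mul1r ler_wpM2r ?exprn_ge0 ?(ltW r2)//.
    rewrite exprVn ler_pdivlMr ?exprn_gt0// mul1r.
    by rewrite ler_wiXn2l ?(ltW k0)// ltnW.
  apply: le_trans (ler_wpM2l (cn_ge0 _) wk) _.
  by rewrite mulrA ler_wpM2r ?exprn_ge0 ?invr_ge0 ?(ltW k0).
have Yb : eball X r Y by move: Yr; rewrite /eball /ecball /=; lra.
have B1 := hp _ Yb.
have B2 := le_trans (cn_Re _) (le_trans A1 A3).
move: B2; rewrite ReB /q rep_shiftE /w toCK [X + (Y - X)]addrC subrK => B2.
have hS : 2 * h * S = t / 2 by rewrite /h; field; rewrite gt_eqF.
have eS : (5 + 2 * S) * e' = e by rewrite /e' mulrC divfK// gt_eqF.
move: A4 B1 B2; rewrite /q; set T := complex.Re (\sum_(_ < _) _).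
have -> : 2 * (h * M + e') * S = t / 2 * M + 2 * S * e' by rewrite -hS; ring.
(* For t above 8 the term t / 2 * e' is not absorbed by e, but then the bound M itself suffices. *)
have [t5|t5] := leP t 8.
  have : t / 2 * e' <= 4 * e' by rewrite ler_wpM2r ?(ltW e'0)//; lra.
  move: eS; rewrite mulrDl; set x := 2 * S * e'; set y := t / 2 * e'; rewrite mulrDr -/y.
  by rewrite !ler_norml; lra.
have := uM _ Yb => hb _ _ _; apply: le_trans hb _.
rewrite -[leLHS]addr0 lerD ?(ltW e0)// -[leLHS]mul1r ler_wpM2r//; lra.
Qed.

End harmonic_functions_theory.

(** * Decay at a boundary point above a cone *)

Section perron.
Context {R : realType}.
Implicit Types (X Y Z : R * R) (A B : set (R * R)) (u v w g V s : R * R -> R)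
  (p q : {poly R[i]}) (r e M : R).

Lemma pa_der_re (a : R[i]) u X r : 0 < r -> pa u (eball X r) ->
  pa (fun Y => complex.Re (a * der u Y)) (eball X (r / 2)).
Proof.
move=> r0 pu e e0; have r2 := half_pos r0.
have a1 : 0 < cn a + 1 by rewrite ltr_wpDl ?cn_ge0.
pose e' := e * r / (16 * (cn a + 1)).
have e'0 : 0 < e' by rewrite divr_gt0 ?mulr_gt0.
have [p hp] := pu _ e'0.
exists (a%:P * p^`()) => Y Yr.
have sb : eball Y (r / 2) `<=` eball X r.
  by apply: eball_sub; move: Yr; rewrite /eball /=; lra.
have [_ h _] := pa_der_all r2 (paS sb pu).
have := h p e' (ltW e'0) (fun Z Zr => hp Z (sb Z Zr)) => {}h.
rewrite /rep hornerM hornerC -ReB -mulrBr.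
apply: le_trans (cn_Re _) _; rewrite cnM.
apply: le_trans (ler_wpM2l (cn_ge0 _) h) _.
have -> : cn a * (8 * e' / (r / 2)) = e * (cn a / (cn a + 1)).
  by rewrite /e'; field; rewrite !gt_eqF.
by rewrite ger_pMr// ler_pdivrMr// mul1r lerDl.
Qed.

Lemma pa_lin (a b c : R) A : pa (fun Y => a * Y.1 + b * Y.2 + c) A.
Proof.
move=> e e0; exists ((a -i* b)%C *: 'X + (c%:C%C)%:P) => Y _.
have -> : rep ((a -i* b)%C *: 'X + (c%:C%C)%:P) Y = a * Y.1 + b * Y.2 + c.
  by rewrite /rep hornerD hornerZ hornerX hornerC ReD /= mulNr opprK.
by rewrite subrr normr0 ltW.
Qed.

Lemma max_principle2 (W : set (R * R)) w X0 r : open W -> W `<=` eball X0 r ->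
  (forall X, closure W X -> {for X, continuous w}) -> (forall X, W X -> sub w X) ->
  (forall X, closure W X -> ~ W X -> w X <= 0) -> forall X, W X -> w X <= 0.
Proof.
move=> oW Wr wc ws wb; apply: (@max_principle R W w X0 r) => //.
  by move=> X WX; apply: wc; exact: subset_closure.
move=> X nW e e0; have [cX|ncX] := pselect (closure W X).
  have [d d0 hd] := proj1 (cont_atP _ _) (wc X cX) e e0.
  exists d => // Y _ /hd; have := wb X cX nW; rewrite ler_norml; lra.
have [d [d0 hd]] : exists d : R, 0 < d /\ forall Y, W Y -> ~ eball X d Y.
  apply: contrapT => h; apply: ncX; apply/closureP => d d0; apply: contrapT => h'.
  by apply: h; exists d; split => // Y WY Yd; apply: h'; exists Y.
by exists d => // Y WY /(hd Y WY).
Qed.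

(* A quadratic barrier: in the half disc above the line [y = q.2 - eps rho]
   the harmonic function [x^2 - y^2 + 3 rho y] dominates [rho^2] on the arc. *)
Lemma decay w (q0 : R * R) (rho eps M : R) : 0 < rho -> 0 <= eps -> eps <= 16^-1 -> 0 <= M ->
  (forall Y, ecball q0 rho Y -> {for Y, continuous w}) ->
  (forall Y, eball q0 rho Y -> sub w Y) ->
  (forall Y, ecball q0 rho Y -> Y.2 - q0.2 <= - (eps * `|Y.1 - q0.1|) -> w Y <= 0) ->
  (forall Y, ecball q0 rho Y -> w Y <= M) ->
  forall Y, ecball q0 (rho / 16) Y -> w Y <= M / 2.
Proof.
move=> r0 e0 e16 M0 wc ws wz wM Y Yr.
pose yy Z := Z.2 - q0.2 + eps * rho.
pose W : set (R * R) := [set Z | eball q0 rho Z /\ 0 < yy Z].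
pose c := (1 - eps ^+ 2)^-1.
have e2 : eps ^+ 2 <= 256^-1 by nra.
have c1 : c * (1 - eps ^+ 2) = 1 by rewrite /c mulVf// gt_eqF//; lra.
have c0 : 0 < c by rewrite /c invr_gt0; lra.
have c2 : c <= 256 / 255.
  have h : 255 / 256 <= 1 - eps ^+ 2 by lra.
  by have := ler_wpM2l (ltW c0) h; rewrite c1; lra.
pose Q Z := ((Z.1 - q0.1) * (Z.1 - q0.1) - yy Z * yy Z + 3 * rho * yy Z) / rho ^+ 2.
pose f Z := w Z - c * M * Q Z.
have yc Z : {for Z, continuous yy}.
  by apply: cvgD; [apply: cvgB; [exact: cvg_snd|exact: cvg_cst]|exact: cvg_cst].
have xc Z : {for Z, continuous (fun Z : R * R => Z.1 - q0.1)}.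
  by apply: cvgB; [exact: cvg_fst|exact: cvg_cst].
have Qc Z : {for Z, continuous Q}.
  apply: cvgM; last exact: cvg_cst.
  apply: cvgD; first by apply: cvgB; apply: cvgM; first [exact: xc|exact: yc].
  by apply: cvgM; [exact: cvg_cst|exact: yc].
have r2 : 0 < rho ^+ 2 by rewrite exprn_gt0.
have yle Z : ecball q0 rho Z -> yy Z <= (1 + eps) * rho.
  rewrite /ecball /= => Zr; have := le_trans (ler_norm _) (enorm2 (Z - q0)); rewrite /yy /=; lra.
have oW : open W.
  apply/openP => Z [Zr Zy].
  have [d d0 hd] := proj1 (cont_atP _ _) (yc Z) _ (half_pos Zy).
  exists (Num.min d (rho - enorm (Z - q0))); first by rewrite lt_min d0 subr_gt0.
  move=> T; rewrite /eball /= lt_min => /andP[T1 T2]; split.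
    by apply: (@eball_sub R Z q0 (rho - enorm (Z - q0)) rho) => //; lra.
  by have := hd T T1; rewrite ler_norml; lra.
have clW Z : closure W Z -> ecball q0 rho Z /\ 0 <= yy Z.
  move=> cZ; split.
    apply: (@closed_ecball R q0 rho); apply: closureS cZ => T [Tr _]; exact: ltW.
  rewrite leNgt; apply/negP => yZ.
  have [d d0 hd] := proj1 (cont_atP _ _) (yc Z) (- yy Z / 2) (half_pos (eq_ind_r is_true yZ (oppr_gt0 _))).
  have [T [Tr Ty] Td] := proj1 (closureP _ _) cZ d d0.
  by have := hd T Td; rewrite ler_norml; lra.
have main Z : W Z -> f Z <= 0.
  apply: (@max_principle2 W f q0 rho) => //.
  - by move=> T [].
  - move=> T /clW[Tr _]; apply: cvgB; first exact: wc.
    by apply: cvgM; [exact: cvg_cst|exact: Qc].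
  - move=> T [Tr _]; rewrite /f.
    apply: subD; first exact: ws.
    apply: sub_exact => t; rewrite /lap4 /Q /yy /=; field; rewrite gt_eqF//.
  - move=> T /clW[Tr Ty] nW.
    have QE : Q T * rho ^+ 2 = (T.1 - q0.1) ^+ 2 - yy T ^+ 2 + 3 * rho * yy T.
      by rewrite /Q; field; rewrite gt_eqF.
    have cM : 0 <= c * M by rewrite mulr_ge0// ltW.
    have [y0|y0] := eqVneq (yy T) 0.
      have wT : w T <= 0.
        apply: wz => //; have := le_trans (enorm1 (T - q0)) Tr; move: y0; rewrite /yy /= => y0 h.
        have := ler_wpM2l e0 h; lra.
      have Q0 : 0 <= Q T.
        by rewrite -(pmulr_lge0 _ r2) QE y0 expr0n/= subr0 mulr0 addr0 sqr_ge0.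
      have := mulr_ge0 cM Q0; rewrite /f; lra.
    have ypos : 0 < yy T by rewrite lt_neqAle eq_sym y0.
    have Tr' : enorm (T - q0) = rho.
      apply/eqP; rewrite eq_le [X in X && _]Tr /= leNgt; apply/negP => h.
      by apply: nW.
    have := enorm_sqr (T - q0); rewrite Tr' /= => E.
    have Q1 : (1 - eps ^+ 2) <= Q T.
      rewrite -(ler_pM2r r2) QE.
      have -> : (T.1 - q0.1) ^+ 2 = rho ^+ 2 - (yy T - eps * rho) ^+ 2.
        by rewrite E /yy; ring.
      have := yle T Tr => yl.
      have : 0 <= yy T * ((1 + eps) * rho - yy T) by rewrite mulr_ge0// subr_ge0.
      have : 0 <= yy T * rho * (1 - 2 * eps) by rewrite !mulr_ge0 ?(ltW r0)//; lra.
      nra.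
    have := ler_wpM2l cM Q1; have -> : c * M * (1 - eps ^+ 2) = M by rewrite mulrAC c1 mul1r.
    by have := wM T Tr; rewrite /f; lra.
have Yr' : eball q0 rho Y by apply: ecball_eball Yr; lra.
have [yY|yY] := ltP 0 (yy Y); last first.
  have : w Y <= 0.
    apply: wz; first exact: ltW.
    have := le_trans (enorm1 (Y - q0)) (ltW Yr'); move: yY; rewrite /yy /= => yY h.
    by have := ler_wpM2l e0 h; lra.
  by lra.
have := main Y (conj Yr' yY); rewrite /f.
have QY : Q Y <= 49 / 128.
  rewrite /Q ler_pdivrMr//.
  have h1 := le_trans (enorm1 (Y - q0)) Yr; have h2 := le_trans (ler_norm _) (le_trans (enorm2 (Y - q0)) Yr).
  have y1 : yy Y <= rho / 8 by move: h2; rewrite /yy /=; have := ler_wpM2r (ltW r0) e16; lra.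
  have x2 : (Y.1 - q0.1) * (Y.1 - q0.1) <= rho / 16 * (rho / 16).
    by move: h1; rewrite ler_norml /=; nra.
  nra.
have : c * Q Y <= 2^-1.
  have [Q0|Q0] := leP 0 (Q Y); nra.
move=> h; have := ler_wpM2l M0 h; lra.
Qed.

(** Hölder decay of exponent 1/4: a factor 1/2 in size for a factor 16 in radius. The hypotheses of
    [decay] persist on smaller concentric discs. *)
Lemma decay_iter w (q0 : R * R) (rho eps M : R) k : 0 < rho -> 0 <= eps -> eps <= 16^-1 -> 0 <= M ->
  (forall Y, ecball q0 rho Y -> {for Y, continuous w}) ->
  (forall Y, eball q0 rho Y -> sub w Y) ->
  (forall Y, ecball q0 rho Y -> Y.2 - q0.2 <= - (eps * `|Y.1 - q0.1|) -> w Y <= 0) ->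
  (forall Y, ecball q0 rho Y -> w Y <= M) ->
  forall Y, ecball q0 (rho * 16^-1 ^+ k) Y -> w Y <= M * 2^-1 ^+ k.
Proof.
move=> r0 e0 e16 M0 wc ws wz wM; elim: k => [|k IH] Y.
  by rewrite expr0 mulr1 expr0 mulr1; exact: wM.
rewrite !exprSr !mulrA.
have k0 : 0 < rho * 16^-1 ^+ k by rewrite mulr_gt0// exprn_gt0// invr_gt0.
have kr : rho * 16^-1 ^+ k <= rho.
  rewrite (ger_pMr _ r0); apply: exprn_ile1; first by rewrite invr_ge0 ler0n.
  by rewrite invf_le1 ?ltr0n// ler1n.
have sb : ecball q0 (rho * 16^-1 ^+ k) `<=` ecball q0 rho.
  by move=> Z Zr; exact: le_trans kr.
apply: (@decay w q0 _ eps (M * 2^-1 ^+ k)) => //.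
- by rewrite mulr_ge0// exprn_ge0// invr_ge0.
- by move=> Z /sb; exact: wc.
- by move=> Z Zr; apply: ws; exact: lt_le_trans kr.
- by move=> Z /sb; exact: wz.
Qed.

End perron.

(** * The flattening map of a domain above a Lipschitz graph *)

Section perron_solution.
Context {R : realType}.
Implicit Types (X Y Z : R * R) (A B : set (R * R)) (u v w g V s : R * R -> R)
  (p q : {poly R[i]}) (r e M : R).

(* [G] lies above a Lipschitz graph squeezed in a strip; its Perron function is
   the height function of the flattening map. *)
Definition cone_domain (G : set (R * R)) (eps c : R) : Prop :=
  [/\ open G, 0 <= eps <= 16^-1, 0 < c,
      (forall X (v : R * R), G X -> eps * `|v.1| <= v.2 -> G (X + v)) &
      (forall X, c < X.2 -> G X) /\ (forall X, G X -> - c < X.2)].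

Context (G : set (R * R)) (eps c : R).
Context (Gd : cone_domain G eps c).

(** Subsolutions live on the whole plane and vanish off G, so no boundary values have to be
    discussed. The bound by the positive part of y + c fixes the growth at infinity, where G is
    unbounded, and depends on the height alone. *)
Definition perron_class s : Prop :=
  [/\ continuous s, forall X, sub s X,
      forall X, 0 <= s X <= Num.max 0 (X.2 + c) & forall X, ~ G X -> s X = 0].

Lemma max_lin_sub (a : R) X : sub (fun Y : R * R => Num.max 0 (Y.2 + a)) X.
Proof.
apply: (@sub_max R (fun=> 0) (fun Y => Y.2 + a)); first exact: sub_cst.
by apply: sub_exact => t; rewrite /lap4 /=; ring.
Qed.

Lemma max_lin_cont (a : R) : continuous (fun Y : R * R => Num.max 0 (Y.2 + a)).
Proof.
move=> X; apply: (@continuous_max _ _ (fun=> 0) (fun Y : R * R => Y.2 + a)).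
  exact: cst_continuous.
by apply: cvgD; [exact: cvg_snd|exact: cvg_cst].
Qed.

Lemma perron_class0 : perron_class (fun Y => Num.max 0 (Y.2 - c)).
Proof.
have [_ _ c0 _ [up lo]] := Gd; split.
- exact: max_lin_cont.
- exact: max_lin_sub.
- by move=> X; rewrite le_max lexx /= ge_max le_max lexx /= le_max; apply/orP; right; lra.
- by move=> X nG; rewrite max_l// leNgt; apply/negP => h; apply: nG; apply: up; lra.
Qed.

Lemma perron_class_max s u : perron_class s -> perron_class u ->
  perron_class (fun Y => Num.max (s Y) (u Y)).
Proof.
move=> [s1 s2 s3 s4] [u1 u2 u3 u4]; split.
- by move=> X; apply: continuous_max; [exact: s1|exact: u1].
- by move=> X; exact: sub_max.
- move=> X; have /andP[a b] := s3 X; have /andP[a' b'] := u3 X.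
  by rewrite le_max a /= ge_max b b'.
- by move=> X nG; rewrite s4// u4// maxxx.
Qed.

(** Poisson modification: s is replaced in the disc by the harmonic function with its values on the
    circle. The bound y + c is itself harmonic, so it survives by the maximum principle. *)
Lemma perron_modif s X r : perron_class s -> 0 < r -> ecball X r `<=` G ->
  exists s', [/\ perron_class s', forall Y, s Y <= s' Y & pa s' (ecball X r)].
Proof.
move=> [s1 s2 s3 s4] r0 rG; have [oG _ c0 _ [up lo]] := Gd.
have [|V [pV Vs]] := @dirichlet_disc R X r s r0.
  move=> Y _ e e0; have [d d0 hd] := proj1 (cont_atP _ _) (s1 Y) e e0.
  by exists d => // Z _ /hd.
have sV Y : ecball X r Y -> s Y <= V Y.
  by apply: (@sub_le_pa R s V X r r0 pV) => [Z _|Z _|Z Zs]; [exact: s1|exact: s2|rewrite Vs].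
have Vle Y : ecball X r Y -> V Y <= Y.2 + c.
  move=> Yr; rewrite -subr_le0.
  have pl : pa (fun Y => V Y - (0 * Y.1 + 1 * Y.2 + c)) (ecball X r).
    exact: paB pV (pa_lin _ _ _ _).
  have := @pa_max R _ X r 0 r0 pl _ Y Yr; rewrite mul0r add0r mul1r; apply.
  move=> Z Zs; have Zc : ecball X r Z by rewrite /ecball /= Zs.
  have /andP[_] := s3 Z; rewrite Vs// mul0r add0r mul1r max_r ?subr_le0//.
  by have := lo Z (rG Z Zc); lra.
pose s' Y := if enorm (Y - X) <= r then V Y else s Y.
have ss' Y : s Y <= s' Y by rewrite /s'; case: ifP => // h; exact: sV.
have s'V Y : ecball X r Y -> s' Y = V Y by rewrite /s' /ecball /= => ->.
have s'o Y : r <= enorm (Y - X) -> s' Y = s Y.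
  rewrite /s' => h; case: ifP => // h'; apply: Vs.
  by apply/eqP; rewrite eq_le h h'.
exists s'; split => //; last by apply: pa_eq pV => Y /s'V.
split.
- move=> Y; apply/cont_atP => e e0.
  have [d d0 hd] := proj1 (cont_atP _ _) (s1 Y) e e0.
  have [Yr|Yr] := leP (enorm (Y - X)) r.
    have [d' d'0 hd'] := pa_contw pV Yr e0.
    have [Yr'|Yr'] := ltP (enorm (Y - X)) r.
      exists (Num.min d' (r - enorm (Y - X))); first by rewrite lt_min d'0 subr_gt0.
      move=> Z; rewrite /eball /= lt_min => /andP[Z1 Z2].
      have Zr : ecball X r Z.
        apply: eball_ecball; apply: (@eball_sub R Y X (r - enorm (Y - X)) r) => //; lra.
      by rewrite !s'V//; exact: hd'.
    exists (Num.min d d'); first by rewrite lt_min d0.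
    move=> Z; rewrite /eball /= lt_min => /andP[Z1 Z2].
    have [Zr|Zr] := leP (enorm (Z - X)) r; first by rewrite !s'V//; exact: hd'.
    by rewrite (s'o Y)// (s'o Z) ?(ltW Zr)//; exact: hd.
  exists (Num.min d (enorm (Y - X) - r)); first by rewrite lt_min d0 subr_gt0.
  move=> Z; rewrite /eball /= lt_min => /andP[Z1 Z2].
  rewrite (s'o Y) ?(ltW Yr)// (s'o Z); first exact: hd.
  by have := enorm_tri Z Y X; rewrite (enormC Y Z); lra.
- move=> Y; have [Yr|Yr] := ltP (enorm (Y - X)) r; last first.
    by apply: (@sub_le R s _ Y 1) => //; rewrite s'o.
  have rr : 0 < r - enorm (Y - X) by rewrite subr_gt0.
  have sb : eball Y (r - enorm (Y - X)) `<=` ecball X r.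
    by apply: subset_trans (@eball_ecball R X r); apply: eball_sub; lra.
  apply: (@sub_le R V _ Y (r - enorm (Y - X))) => //.
  + by apply: (pa_sub rr); exact: paS pV.
  + by rewrite s'V//; exact: ltW.
  + by move=> Z /sb/s'V ->.
- move=> Y; have [Yr|Yr] := leP (enorm (Y - X)) r; last by rewrite s'o ?(ltW Yr).
  rewrite s'V//; have /andP[h _] := s3 Y; rewrite (le_trans h (sV Y Yr)) /=.
  by rewrite le_max Vle// orbT.
- move=> Y nG; rewrite s'o ?s4//; rewrite leNgt; apply/negP => h.
  by apply: nG; apply: rG; exact: ltW.
Qed.

Definition perron X : R := sup [set s X | s in perron_class].

Lemma perron_has_sup X : has_sup [set s X | s in perron_class].
Proof.
split; first by exists (Num.max 0 (X.2 - c)); exists (fun Y => Num.max 0 (Y.2 - c)) => //; exact: perron_class0.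
exists (Num.max 0 (X.2 + c)) => _ [s [_ _ h _] <-].
by have /andP[] := h X.
Qed.

Lemma perron_ub s X : perron_class s -> s X <= perron X.
Proof.
move=> hs; apply: sup_ubound; last by exists s.
by have [] := perron_has_sup X.
Qed.

Lemma perron_approx X e : 0 < e -> exists2 s, perron_class s & perron X - e <= s X.
Proof.
move=> e0; have [_ [s hs <-] h] := sup_adherent e0 (perron_has_sup X).
by exists s => //; exact: ltW.
Qed.

Lemma perron_le X : perron X <= Num.max 0 (X.2 + c).
Proof.
apply: sup_le_ub; first by have [] := perron_has_sup X.
by move=> _ [s [_ _ h _] <-]; have /andP[] := h X.
Qed.

Lemma perron_ge X : Num.max 0 (X.2 - c) <= perron X.
Proof. exact: (perron_ub X perron_class0). Qed.

Lemma perron_ge0 X : 0 <= perron X.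
Proof. by apply: le_trans (perron_ge X); rewrite le_max lexx. Qed.

Lemma perron_out X : ~ G X -> perron X = 0.
Proof.
move=> nG; apply/eqP; rewrite eq_le perron_ge0 andbT.
apply: sup_le_ub; first by have [] := perron_has_sup X.
by move=> _ [s [_ _ _ h] <-]; rewrite h.
Qed.

(** A translation by a vector of the cone maps the class into itself, because G is stable under it
    and the upper bound grows with the height. *)
Lemma perron_cone X (v : R * R) : eps * `|v.1| <= v.2 -> perron X <= perron (X + v).
Proof.
have [oG /andP[e0 _] c0 Gc [up lo]] := Gd.
move=> hv; have v2 : 0 <= v.2 by apply: le_trans hv; rewrite mulr_ge0.
apply: sup_le_ub; first by have [] := perron_has_sup X.
move=> _ [s [s1 s2 s3 s4] <-].
rewrite -{1}(addrK v X); apply: (@perron_ub (fun Y => s (Y - v)) (X + v)); split.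
- move=> Y; apply: (@continuous_comp _ _ _ (fun Y => Y - v) s); last exact: s1.
  by apply: cvgB; [exact: cvg_id|exact: cvg_cst].
- by move=> Y; apply: sub_shift; exact: s2.
- move=> Y; have /andP[-> h] /= := s3 (Y - v); apply: le_trans h _.
  by rewrite ge_max !le_max lexx /= lerD2r gerBl v2 orbT.
- by move=> Y nG; apply: s4 => h; apply: nG; rewrite -(subrK v Y); exact: Gc.
Qed.

(** Members that are harmonic in the disc are equi-Lipschitz on a smaller one. A member close to the
    supremum on a finite net is therefore close to it everywhere there, and its approximating
    polynomial serves for the supremum. *)
Lemma perron_harm : harm perron G.
Proof.
have [oG _ c0 _ [up lo]] := Gd.
move=> X GX; have [r' r'0 r'G] := proj1 (openP _) oG X GX.
pose r := r' / 2; have r0 : 0 < r by exact: half_pos.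
have rG : ecball X r `<=` G.
  by apply: subset_trans r'G; apply: ecball_eball; rewrite /r; lra.
exists (r / 4); first by rewrite divr_gt0.
pose K : R := `|X.2| + r + c.
have K0 : 0 < K by have := normr_ge0 X.2; rewrite /K; lra.
have Lip s Y Z : perron_class s -> pa s (ecball X r) -> eball X (r / 4) Y ->
    enorm (Z - Y) <= r / 8 -> `|s Z - s Y| <= 16 * K / r * enorm (Z - Y).
  move=> [s1 s2 s3 s4] ps Yr ZY.
  have sb : eball Y (r / 2) `<=` ecball X r.
    apply: subset_trans (@eball_ecball R X r); apply: eball_sub.
    by move: Yr; rewrite /eball /=; lra.
  have sK W : eball Y (r / 2) W -> `|s W| <= K.
    move=> /sb Wr; have /andP[a b] := s3 W; rewrite ger0_norm//.
    apply: le_trans b _; rewrite ge_max (ltW K0) /= /K.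
    have := le_trans (enorm2 (W - X)) Wr; rewrite /= ler_norml.
    have := ler_norm X.2; lra.
  have := pa_lip0 (half_pos r0) (paS sb ps) sK _ => /(_ Z).
  have -> : r / 2 / 4 = r / 8 by field.
  have -> : 8 * K / (r / 2) = 16 * K / r by field; rewrite gt_eqF.
  exact.
move=> e e0; have e8 : 0 < e / 8 by rewrite divr_gt0.
pose d := Num.min (r / 8) (e / 8 / (16 * K / r)).
have d0 : 0 < d by rewrite lt_min !divr_gt0// !mulr_gt0// invr_gt0.
have dK : 16 * K / r * d <= e / 8.
  rewrite mulrC -ler_pdivlMr ?ge_min ?lexx ?orbT//.
  by rewrite !divr_gt0// mulr_gt0.
have [l lK lc] := @compact_gauge R _ (fun=> d) (@compact_ecball R X (r / 4)) (fun _ _ => d0).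
have [s [cs ps hs]] : exists s, [/\ perron_class s, pa s (ecball X r) &
    forall Y, Y \in l -> perron Y - e / 8 <= s Y].
  elim: (l) => [|a l' [s [cs ps hs]]].
    have [s [cs _ ps]] := perron_modif perron_class0 r0 rG.
    by exists s; split.
  have [sa ca ha] := perron_approx a e8.
  have [s' [cs' le' ps']] := perron_modif (perron_class_max cs ca) r0 rG.
  exists s'; split => // Y; rewrite inE => /orP[/eqP ->|Yl].
    by apply: le_trans ha (le_trans _ (le' a)); rewrite le_max lexx orbT.
  by apply: le_trans (hs Y Yl) (le_trans _ (le' Y)); rewrite le_max lexx.
have [p hp] := ps _ (half_pos e0).
exists p => Y Yr.
have Yr' : ecball X r Y by apply: eball_ecball; apply: lt_le_trans Yr _; lra.
have [Z Zl ZY] := lc Y (ltW Yr).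
have ZYr : enorm (Z - Y) <= r / 8.
  by rewrite enormC (le_trans (ltW ZY))// ge_min lexx.
have ZYd : 16 * K / r * enorm (Z - Y) <= e / 8.
  have Kr : 0 <= 16 * K / r by apply: divr_ge0; [rewrite mulr_ge0// ltW|exact: ltW].
  by apply: le_trans dK; rewrite ler_wpM2l// enormC; exact: ltW.
have [s2 c2 h2] := perron_approx Y e8.
have [s' [cs' le' ps']] := perron_modif (perron_class_max cs c2) r0 rG.
have h3 : perron Y - e / 8 <= s' Y.
  by apply: le_trans h2 (le_trans _ (le' Y)); rewrite le_max lexx orbT.
have L1 := le_trans (Lip s' Y Z cs' ps' Yr ZYr) ZYd.
have L2 := le_trans (Lip s Y Z cs ps Yr ZYr) ZYd.
have h4 := perron_ub Z cs'; have h5 := hs Z Zl; have h6 := perron_ub Y cs.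
move: (hp Y Yr') L1 L2; rewrite !ler_norml; lra.
Qed.

(** At a point X off G the whole cone below X is off G, so the decay estimate holds for all members
    with the same constants, hence for their supremum. *)
Lemma perron_cont : continuous perron.
Proof.
have [oG /andP[e0 e16] c0 Gc [up lo]] := Gd.
move=> X; have [GX|nGX] := pselect (G X); first exact: harm_cont perron_harm GX.
apply/cont_atP => e e_0.
pose M : R := `|X.2| + 1 + c.
have M0 : 0 <= M by have := normr_ge0 X.2; rewrite /M; lra.
have [k hk] : exists k, M * 2^-1 ^+ k <= e.
  exists (Num.truncn (M / e)).+1; rewrite exprVn ler_pdivrMr ?exprn_gt0//.
  rewrite mulrC -ler_pdivrMr//; apply: ltW; apply: lt_le_trans (truncnS_gt _) _.
  by rewrite -natrX ler_nat ltnW// ltn_expl.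
exists (1 * 16^-1 ^+ k); first by rewrite mul1r exprn_gt0// invr_gt0.
move=> Y Yd; rewrite (perron_out nGX) subr0 ger0_norm ?perron_ge0//.
apply: le_trans hk.
apply: sup_le_ub; first by have [] := perron_has_sup Y.
move=> _ [s [s1 s2 s3 s4] <-].
apply: (@decay_iter R s X 1 eps M k) => //.
- by move=> Z _; exact: s1.
- move=> Z _ ZX; rewrite s4// => GZ; apply: nGX.
  have -> : X = Z + (X - Z) by rewrite addrC subrK.
  by apply: Gc => //=; rewrite distrC; lra.
- move=> Z Zr; have /andP[_] := s3 Z; move=> h; apply: le_trans h _.
  rewrite ge_max M0 /= /M; have := le_trans (enorm2 (Z - X)) Zr; rewrite /= ler_norml.
  have := ler_norm X.2; lra.
- exact: ltW.
Qed.

End perron_solution.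

(** * Holomorphic functions as limits of polynomials, local conjugates *)

Section holomorphic.
Context {R : realType}.
Implicit Types (X Y Z : R * R) (A B : set (R * R)) (u v w g V s : R * R -> R)
  (f : R * R -> R[i]) (p q : {poly R[i]}) (r e M : R).

Definition ca f A : Prop :=
  forall e, 0 < e -> exists p, forall X, A X -> cn (f X - p.[toC X]) <= e.

Lemma caS f A B : A `<=` B -> ca f B -> ca f A.
Proof. by move=> AB h e e0; have [p hp] := h e e0; exists p => X /AB; exact: hp. Qed.

Lemma ca_eq f (g : R * R -> R[i]) A : (forall X, A X -> f X = g X) -> ca f A -> ca g A.
Proof.
by move=> fg h e e0; have [p hp] := h e e0; exists p => X AX; rewrite -fg ?hp.
Qed.

Lemma caM (a b : R[i]) f A : ca f A -> ca (fun X => a * f X + b) A.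
Proof.
move=> hf e e0; have a1 : 0 < cn a + 1 by rewrite ltr_wpDl ?cn_ge0.
have [p hp] := hf _ (divr_gt0 e0 a1).
exists (a *: p + b%:P) => X AX.
rewrite hornerD hornerZ hornerC opprD addrACA subrr addr0 -mulrBr cnM.
apply: le_trans (ler_wpM2l (cn_ge0 _) (hp X AX)) _.
by rewrite mulrCA ger_pMr// ler_pdivrMr// mul1r lerDl.
Qed.

Lemma ca_re (a : R[i]) f A : ca f A -> pa (fun X => complex.Re (a * f X)) A.
Proof.
move=> /(caM a 0) hf e e0; have [p hp] := hf e e0; exists p => X AX.
by rewrite /rep -ReB; apply: le_trans (cn_Re _) _; have := hp X AX; rewrite addr0.
Qed.

Lemma der_bound u X r M : 0 < r -> pa u (eball X r) ->
  (forall Y, eball X r Y -> `|u Y| <= M) -> cn (der u X) <= 8 * M / r.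
Proof.
move=> r0 pu uM; have [_ h _] := pa_der_all r0 pu.
have M0 : 0 <= M by apply: le_trans (uM X (eball_center X r0)).
have := h 0 M M0; rewrite derivC horner0 subr0; apply => Y Yr.
by rewrite /rep horner0 subr0; exact: uM.
Qed.

Lemma der_rep p X : der (rep p) X = p^`().[toC X].
Proof.
apply/eqP; rewrite -subr_eq0; apply/eqP/cn_eq0/le_anti; rewrite cn_ge0 andbT.
have [_ h _] := pa_der_all ltr01 (pa_rep p (eball X 1)).
have := h p 0 (lexx _); rewrite mulr0 mul0r; apply => Y _.
by rewrite subrr normr0.
Qed.

Lemma der_ca u X r : 0 < r -> pa u (eball X r) -> ca (der u) (eball X (r / 2)).
Proof.
move=> r0 pu e e0; have r2 := half_pos r0.
have e'0 : 0 < e * r / 16 by rewrite divr_gt0 ?mulr_gt0.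
have [p hp] := pu _ e'0.
exists p^`() => Y Yr.
have sb : eball Y (r / 2) `<=` eball X r.
  by apply: eball_sub; move: Yr; rewrite /eball /=; lra.
have [_ h _] := pa_der_all r2 (paS sb pu).
have := h p _ (ltW e'0) (fun Z Zr => hp Z (sb Z Zr)) => {}h; apply: le_trans h _.
by have -> : 8 * (e * r / 16) / (r / 2) = e by field; rewrite gt_eqF.
Qed.

Lemma der_eq u X r (a : R[i]) : 0 < r -> pa u (eball X r) ->
  (forall e, 0 < e -> exists p e', [/\ 0 <= e' /\ 8 * e' / r <= e,
     forall Y, eball X r Y -> `|u Y - rep p Y| <= e' & cn (a - p^`().[toC X]) <= e]) ->
  der u X = a.
Proof.
move=> r0 pu h; apply/eqP; rewrite -subr_eq0; apply/eqP/cn_eq0/le_anti; rewrite cn_ge0 andbT.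
apply/ler_addgt0Pr => e e0; rewrite add0r.
have [p [e' [[e'0 ee] hp ha]]] := h _ (half_pos e0).
have [_ hd _] := pa_der_all r0 pu.
have -> : der u X - a = (der u X - p^`().[toC X]) - (a - p^`().[toC X]) by rewrite opprB addrA subrK.
apply: le_trans (cnB _ _) _; have := hd p e' e'0 hp; lra.
Qed.

Lemma ca_der (a : R[i]) f X r : 0 < r -> ca f (eball X r) ->
  der (fun Y => complex.Re (a * f Y)) X = a * der (fun Y => complex.Re (f Y)) X.
Proof.
move=> r0 cf.
have pf : pa (fun Y => complex.Re (f Y)) (eball X r).
  by apply: pa_eq (ca_re 1 cf) => Y _; rewrite mul1r.
apply: (der_eq r0 (ca_re a cf)) => e e0.
have a1 : 0 < cn a + 1 by rewrite ltr_wpDl ?cn_ge0.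
pose e1 := e * r / (8 * (cn a + 1)).
have e10 : 0 < e1 by rewrite divr_gt0 ?mulr_gt0.
have [p hp] := cf _ e10.
have E : (cn a + 1) * e1 * 8 / r = e by rewrite /e1; field; rewrite !gt_eqF.
exists (a *: p), ((cn a + 1) * e1); split.
- by split; [rewrite mulr_ge0 ?ltW|rewrite [8 * _]mulrC E].
- move=> Y Yr; rewrite /rep hornerZ -ReB -mulrBr.
  apply: le_trans (cn_Re _) _; rewrite cnM; apply: ler_pM; rewrite ?cn_ge0//.
    by rewrite lerDl.
  exact: hp.
rewrite derivZ hornerZ -mulrBr cnM.
have [_ hd _] := pa_der_all r0 pf.
have h := hd p e1 (ltW e10) _.
apply: le_trans (ler_wpM2l (cn_ge0 a) (h _)) _.
  move=> Y Yr; rewrite /rep -ReB; exact: le_trans (cn_Re _) (hp Y Yr).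
rewrite -[leRHS]E; have -> : (cn a + 1) * e1 * 8 / r = (cn a + 1) * (8 * e1 / r) by ring.
apply: ler_wpM2r; last by rewrite lerDl.
by apply: divr_ge0; [apply: mulr_ge0 => //; exact: ltW|exact: ltW].
Qed.

(** Imaginary parts of the approximations, normalised to vanish at the centre, are Cauchy on the
    smaller disc: a real part bounded by e + e' on the larger disc bounds the derivative, which is
    integrated from the centre. The constant C records the loss of radius. *)
Lemma conj_disc u X r r' : 0 < r' -> r' < r -> pa u (eball X r) ->
  exists k : R * R -> R, ca (fun Y => u Y +i* k Y)%C (eball X r').
Proof.
move=> r'0 rr pu; have r0 := lt_trans r'0 rr.
have d0 : 0 < r - r' by rewrite subr_gt0.
pose C := 8 * r' / (r - r').
have C0 : 0 <= C by rewrite divr_ge0 ?mulr_ge0// ltW.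
pose I := {pe : {poly R[i]} * R | [/\ 0 <= pe.2, complex.Im pe.1.[toC X] = 0 &
  forall Y, eball X r Y -> `|u Y - rep pe.1 Y| <= pe.2]}.
have app e : 0 < e -> exists p, complex.Im p.[toC X] = 0 /\
    forall Y, eball X r Y -> `|u Y - rep p Y| <= e.
  move=> e0; have [p hp] := pu _ e0.
  exists (p - ((0 +i* complex.Im p.[toC X])%C)%:P); split.
    by rewrite hornerD hornerN hornerC; case: (p.[toC X]) => a b /=; rewrite subrr.
  by move=> Y Yr; rewrite repD repN {2}/rep hornerC /= subr0; exact: hp.
have [p1 [hp1 hp1']] := app 1 ltr01.
have i0 : I by exists (p1, 1).
have key p e p' e' : complex.Im p.[toC X] = 0 -> complex.Im p'.[toC X] = 0 -> 0 <= e -> 0 <= e' ->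
    (forall Y, eball X r Y -> `|u Y - rep p Y| <= e) ->
    (forall Y, eball X r Y -> `|u Y - rep p' Y| <= e') ->
    forall Y, eball X r' Y -> `|complex.Im p.[toC Y] - complex.Im p'.[toC Y]| <= C * (e + e').
  move=> ip ip' e0 e'0 hp hp' Y Yr.
  pose q := p - p'.
  have qM Z : eball X r Z -> `|rep q Z| <= e + e'.
    by move=> Zr; rewrite repD repN; have := hp Z Zr; have := hp' Z Zr; rewrite !ler_norml; lra.
  have imE Z : complex.Im p.[toC Z] - complex.Im p'.[toC Z] = rep ((- 'i%C) *: q) Z.
    rewrite /rep hornerZ /q hornerD hornerN.
    by case: (p.[toC Z]) => a b; case: (p'.[toC Z]) => a' b' /=; rewrite oppr0 mul0r sub0r mulN1r opprK.
  pose df (t : R) : R := complex.Re (der (rep ((- 'i%C) *: q)) (X + t *: (Y - X)) * toC (Y - X)).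
  have [t|t t01 E] := @line_MVT R (rep ((- 'i%C) *: q)) X (Y - X) df.
    by move=> _; apply: (pa_dir _ ltr01); exact: pa_rep.
  rewrite imE -[Y in rep _ Y](subrK X) [Y - X + X]addrC.
  have iX : rep ((- 'i%C) *: q) X = 0 by rewrite -imE ip ip' subrr.
  rewrite -[rep _ _]subr0 -[X in _ - X]iX E /df.
  apply: le_trans (cn_Re _) _; rewrite cnM der_rep derivZ hornerZ cnM cnN.
  have -> : cn 'i%C = 1 :> R by rewrite cnE /= expr0n/= expr1n add0r sqrtr1.
  rewrite mul1r -der_rep -enormE.
  set Z := X + t *: (Y - X).
  move: t01 => /andP[t0 t1].
  have Zr : eball X r' Z.
    rewrite /eball /= /Z addrAC subrr add0r enormZ gtr0_norm//.
    by apply: le_lt_trans Yr; rewrite ler_piMl ?enorm_ge0// ltW.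
  have sb : eball Z (r - r') `<=` eball X r.
    by apply: eball_sub; move: Zr; rewrite /eball /=; lra.
  have h := @der_bound (rep q) Z (r - r') (e + e') d0 (pa_rep _ _) (fun W Wr => qM W (sb W Wr)).
  rewrite /C; have -> : 8 * r' / (r - r') * (e + e') = 8 * (e + e') / (r - r') * r' by ring.
  by apply: ler_pM; rewrite ?cn_ge0 ?enorm_ge0//; exact: ltW.
have HY Y : exists k : R, eball X r' Y -> forall i : I, `|k - complex.Im (sval i).1.[toC Y]| <= C * (sval i).2.
  have [Yr|nYr] := pselect (eball X r' Y); last by exists 0.
  have [|k hk] := @nested_point R I i0 (fun i => complex.Im (sval i).1.[toC Y]) (fun i => C * (sval i).2).
    move=> [[p e] /= [e0 ip hp]] [[p' e'] /= [e'0 ip' hp']].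
    have := key p e p' e' ip ip' e0 e'0 hp hp' Y Yr; rewrite mulrDr ler_norml; lra.
  by exists k.
have [k hk] := choice HY.
exists k => e e0.
have C1 : 0 < 1 + C by rewrite ltr_pwDl.
have [p [ip hp]] := app _ (divr_gt0 e0 C1).
exists p => Y Yr.
have Yb : eball X r Y by exact: lt_trans rr.
have h1 := hp Y Yb.
have e'0 : 0 <= e / (1 + C) by rewrite divr_ge0// ltW.
have h2 := hk Y Yr (exist _ (p, e / (1 + C)) (And3 e'0 ip hp)).
apply: le_trans (cn_ReIm _) _.
have -> : e = e / (1 + C) + C * (e / (1 + C)) by field; rewrite gt_eqF.
by move: h1 h2; rewrite /rep /=; case: (p.[toC Y]) => a b /= h1 h2; exact: lerD.
Qed.

Lemma primitive_ex (f : R -> R) (a b : R) : a < b ->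
  (forall t : R, a <= t <= b -> {for t, continuous f}) ->
  exists Q : R -> R, forall t : R, a < t < b -> is_derive t (1 : R) Q (f t).
Proof.
move=> ab cf; exists (fun x => \int[@lebesgue_measure R]_(t in `[a, x]) f t)%R => t /andP[ta tb].
have intf : (@lebesgue_measure R).-integrable `[a, b] (EFin \o f).
  apply: continuous_compact_integrable; first exact: segment_compact.
  by apply: continuous_in_subspaceT => x; rewrite inE /= in_itv /=; exact: cf.
have [|d1 d2] := continuous_FTC1_closed tb intf ta; first by apply: cf; rewrite !ltW.
by apply: (DeriveDef d1); rewrite -derive1E; exact: d2.
Qed.

Lemma same_deriv (Q Q' df : R -> R) (a b x y : R) :
  (forall t : R, a < t < b -> is_derive t (1 : R) Q (df t)) ->
  (forall t : R, a < t < b -> is_derive t (1 : R) Q' (df t)) ->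
  a < x < b -> a < y < b -> Q x - Q' x = Q y - Q' y.
Proof.
move=> hQ hQ'; wlog xy : x y / x <= y => [hw xab yab|].
  by have [/hw ->//|/ltW/hw ->] := leP x y.
move=> /andP[ax xb] /andP[ay yb].
pose h t := Q t - Q' t.
have D (t : R) : x <= t <= y -> is_derive t (1 : R) h (df t - df t).
  move=> /andP[xt ty]; have tab : a < t < b by rewrite (lt_le_trans ax)//= (le_lt_trans ty).
  by apply: is_deriveB; [exact: hQ|exact: hQ'].
have [|z _] := @MVT_segment R h (fun t => df t - df t) x y xy _ (is_derive_within D).
  by move=> t; rewrite in_itv /= => /andP[t1 t2]; apply: D; rewrite !ltW.
by rewrite subrr mul0r => /eqP; rewrite subr_eq0 eq_sym => /eqP.
Qed.

End holomorphic.

(** * Gradient of the height function and its conjugate *)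

Section conjugate.
Context {R : realType}.
Implicit Types (X Y Z : R * R) (A B : set (R * R)) (u g V s : R * R -> R)
  (p q : {poly R[i]}) (r e M : R).

Lemma scaleE (t : R) X : t *: X = (t * X.1, t * X.2). Proof. by []. Qed.

Lemma cont_vert u X : {for X, continuous u} -> {for X.2, continuous (fun t : R => u (X.1, t))}.
Proof.
move=> /cont_atP h; apply/cvgrPdist_le => e e0; have [d d0 hd] := h e e0.
near=> t; rewrite distrC -surjective_pairing; apply: hd; rewrite /eball /=.
apply: le_lt_trans (enorm_le12 _) _; rewrite /= subrr normr0 add0r.
by near: t; exists d => //= t; rewrite distrC.
Unshelve. all: by end_near. Qed.

Lemma conj_der u (k : R * R -> R) X r : 0 < r -> ca (fun Y => u Y +i* k Y)%C (eball X r) ->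
  [/\ pa (fun Y => - k Y) (eball X r), pa u (eball X r) & der (fun Y => - k Y) X = 'i%C * der u X].
Proof.
move=> r0 cf; have E1 Y : complex.Re ('i%C * (u Y +i* k Y)%C) = - k Y.
  by rewrite /= mul0r mul1r sub0r.
have -> : (fun Y => - k Y) = (fun Y => complex.Re ('i%C * (u Y +i* k Y)%C)).
  by apply/funext => Y; rewrite E1.
split; first exact: ca_re.
  by apply: pa_eq (ca_re 1 cf) => Y _; rewrite mul1r.
by rewrite (ca_der _ r0 cf).
Qed.

Lemma toC_e1 : toC (e1 : R * R) = 1. Proof. by []. Qed.
Lemma toC_e2 : toC (e2 : R * R) = 'i%C. Proof. by []. Qed.
Lemma Re_mulE (a : R[i]) (v : R * R) :
  complex.Re (a * toC v) = complex.Re a * v.1 - complex.Im a * v.2.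
Proof. by case: a. Qed.

Lemma mvt_bound (F dF : R -> R) (K x y : R) :
  (forall t : R, Num.min x y <= t <= Num.max x y -> is_derive t (1 : R) F (dF t) /\ `|dF t| <= K) ->
  `|F x - F y| <= K * `|x - y|.
Proof.
wlog xy : x y / x <= y => [hw h|].
  have [/hw|/ltW/hw] := leP x y; first exact.
  by rewrite distrC [`|x - y|]distrC minC maxC; exact.
rewrite min_l// max_r// => h.
have D (t : R) : x <= t <= y -> is_derive t (1 : R) F (dF t) by move=> /h[].
have [|z zxy E] := @MVT_segment R F dF x y xy _ (is_derive_within D).
  by move=> t; rewrite in_itv /= => /andP[t1 t2]; apply: D; rewrite !ltW.
rewrite distrC [`|x - y|]distrC E normrM ler_wpM2r//.
by move: zxy; rewrite in_itv /= => /h[].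
Qed.

Context (G : set (R * R)) (eps c : R).
Context (Gd : cone_domain G eps c) (c1 : c < 1).
Local Notation H := (perron G c).

Lemma cone_up X Y : G X -> Y.1 = X.1 -> X.2 <= Y.2 -> G Y.
Proof.
have [_ /andP[e0 _] _ Gc _] := Gd => GX h1 h2.
have -> : Y = X + (Y - X) by rewrite addrC subrK.
by apply: Gc => //=; rewrite h1 subrr normr0 mulr0 subr_ge0.
Qed.

Lemma cone_ball_up X Y r : eball X r `<=` G -> Y.1 = X.1 -> X.2 <= Y.2 -> eball Y r `<=` G.
Proof.
move=> rG h1 h2 Z Zr; have GZ : G (Z + (X - Y)).
  apply: rG; rewrite /eball /= -addrA [X - Y - X]addrAC subrr add0r.
  exact: Zr.
apply: (cone_up GZ); rewrite /=; first by rewrite h1 subrr addr0.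
by rewrite gerDl subr_le0.
Qed.

Lemma perron_ball X : G X -> exists r, [/\ 0 < r, r <= 1, eball X r `<=` G & pa H (eball X r)].
Proof.
have [oG _ _ _ _] := Gd => GX.
have [r r0 rG] := proj1 (openP _) oG X GX.
pose r1 := Num.min (r / 2) 1.
have r10 : 0 < r1 by rewrite lt_min half_pos//= ltr01.
have sb : ecball X r1 `<=` G.
  apply: subset_trans rG; apply: ecball_eball.
  by rewrite gt_min; apply/orP; left; lra.
exists r1; split => //; first by rewrite ge_min lexx orbT.
  by apply: subset_trans sb; exact: eball_ecball.
exact: harm_eball (perron_harm Gd) r10 sb.
Qed.

Lemma cone_der_ge0 X (v : R * R) : G X -> eps * `|v.1| <= v.2 ->
  0 <= complex.Re (der H X * toC v).
Proof.
have [_ /andP[e0 _] _ Gc _] := Gd => GX hv.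
have [r [r0 r1 rG pH]] := perron_ball GX.
have [dv <-] := pa_dir v r0 pH.
rewrite /derive; apply: limr_ge; first exact: dv.
near=> h; rewrite /= [h *: v + X]addrC.
have h0 : h != 0 by near: h; exact: nbhs_dnbhs_neq.
have [hp|hn] := ltP 0 h.
  rewrite -[_ *: _]/(_ * _) mulr_ge0 ?invr_ge0 ?(ltW hp)// subr_ge0.
  by apply: (perron_cone Gd); rewrite /= normrM (gtr0_norm hp) mulrCA ler_wpM2l// ltW.
have hn' : h < 0 by rewrite lt_neqAle h0.
rewrite -[_ *: _]/(_ * _) mulr_le0 ?invr_le0// subr_le0.
have -> : H X = H ((X + h *: v) + (- h) *: v) by rewrite scaleNr addrK.
by apply: (perron_cone Gd); rewrite /= normrM (gtr0_norm (_ : 0 < - h)) ?oppr_gt0// mulrCA ler_wpM2l// oppr_ge0.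
Unshelve. all: by end_near. Qed.

Definition Hx X : R := complex.Re (der H X).
Definition Hy X : R := - complex.Im (der H X).

(** The derivatives along the two edges (1, eps) and (-1, eps) of the cone are nonnegative. *)
Lemma Hx_le X : G X -> `|Hx X| <= eps * Hy X.
Proof.
have [_ /andP[e0 _] _ _ _] := Gd => GX.
have v1 : eps * `|1 : R| <= eps by rewrite normr1 mulr1.
have v2 : eps * `|- 1 : R| <= eps by rewrite normrN normr1 mulr1.
have := @cone_der_ge0 X (1, eps) GX v1; have := @cone_der_ge0 X (-1, eps) GX v2.
by rewrite !Re_mulE /Hx /Hy; case: (der H X) => a b /=; rewrite ler_norml; lra.
Qed.

Lemma Hy_ge0 X : G X -> 0 <= Hy X.
Proof.
move=> GX; have v0 : eps * `|0 : R| <= 1 by rewrite normr0 mulr0.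
by have := @cone_der_ge0 X (0, 1) GX v0; rewrite Re_mulE mulr0 mulr1 sub0r.
Qed.

Lemma Hy_pa X r : 0 < r -> pa H (eball X r) -> pa Hy (eball X (r / 2)).
Proof.
move=> r0 pH; apply: pa_eq (pa_der_re 'i%C r0 pH) => Y _.
by rewrite /Hy; case: (der H Y) => a b /=; rewrite mul0r mul1r sub0r.
Qed.

Lemma Hx_pa X r : 0 < r -> pa H (eball X r) -> pa Hx (eball X (r / 2)).
Proof.
move=> r0 pH; apply: pa_eq (pa_der_re 1 r0 pH) => Y _.
by rewrite mul1r.
Qed.

(** H_y is nonnegative and harmonic, so by Harnack a zero climbs the vertical line above X in steps
    of r / 64, discs above X keeping their radius inside G. Then H would be constant on a long
    vertical segment, which the bounds in terms of y - c and y + c forbid. *)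
Lemma Hy_gt0 X : G X -> 0 < Hy X.
Proof.
have [oG _ c0 Gc [up lo]] := Gd.
move=> GX; rewrite lt_neqAle Hy_ge0// andbT eq_sym; apply/negP => /eqP Hy0.
have [r' [r'0 _ r'G _]] := perron_ball GX.
pose r := r' / 2; have r0 : 0 < r by exact: half_pos.
have step Y : Y.1 = X.1 -> X.2 <= Y.2 -> Hy Y = 0 ->
    forall Z, Z.1 = X.1 -> Y.2 <= Z.2 -> Z.2 <= Y.2 + r / 64 -> Hy Z = 0.
  move=> Y1 Y2 HY Z Z1 Z2 Z3.
  have sb : ecball Y r `<=` G.
    by apply: subset_trans (cone_ball_up r'G Y1 Y2); apply: ecball_eball; rewrite /r; lra.
  have pH := harm_eball (perron_harm Gd) r0 sb.
  have hn W : eball Y (r / 2) W -> 0 <= Hy W.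
    by move=> Wr; apply: Hy_ge0; apply: sb; move: Wr; rewrite /eball /ecball /=; lra.
  have hd : enorm (Z - Y) <= r / 2 / 16.
    apply: le_trans (enorm_le12 _) _; rewrite /= Y1 Z1 subrr normr0 add0r.
    by rewrite ger0_norm ?subr_ge0//; lra.
  have [Z0 ZY] := harnack (half_pos r0) (Hy_pa r0 pH) hn hd.
  by move: Z0 ZY; rewrite HY mul0r mulr0 => a b; apply/le_anti; rewrite a b.
have all0 n Z : Z.1 = X.1 -> X.2 <= Z.2 -> Z.2 <= X.2 + n%:R * (r / 64) -> Hy Z = 0.
  elim: n Z => [|n IH] Z Z1 Z2 Z3.
    have -> // : Z = X.
    by apply/pair_eqP; rewrite /pair_eq /= Z1 eqxx /= eq_le Z2 andbT; move: Z3; rewrite mul0r addr0.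
  have [h|h] := leP Z.2 (X.2 + n%:R * (r / 64)); first exact: IH.
  pose Y := (X.1, X.2 + n%:R * (r / 64)).
  have Yge : X.2 <= Y.2 by rewrite /= lerDl mulr_ge0// ltW// divr_gt0.
  apply: (step Y) => //; [by apply: IH|exact: ltW|].
  by move: Z3; rewrite -natr1 mulrDl mul1r /= addrA.
(* At this height the lower bound y - c already exceeds the upper bound of H at X. *)
pose T : R := `|X.2| + 2 * (c + 1); have T0 : 0 <= `|X.2| by [].
have XT : X.2 < T by have := ler_norm X.2; rewrite /T; lra.
have [|t /andP[t0 t1] E] := @line_MVT R H X (0, T - X.2) (fun=> 0).
  move=> t /andP[t0 t1].
  rewrite [t *: (0, _)]scaleE mulr0; set Z : R * R := X + _.
  have Z1 : Z.1 = X.1 by rewrite /Z /= addr0.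
  have Z2 : X.2 <= Z.2 by rewrite /Z /= lerDl mulr_ge0// subr_ge0 ltW.
  have GZ : G Z by exact: (cone_up GX).
  have [s [s0 _ sG pH]] := perron_ball GZ.
  have [d1 ->] := pa_dir (0, T - X.2) s0 pH; split => //.
  rewrite Re_mulE mulr0 sub0r -mulNr.
  have -> : - complex.Im (der H Z) = 0; last by rewrite mul0r.
  pose n := (Num.truncn ((T - X.2) / (r / 64))).+1.
  apply: (all0 n) => //; rewrite /Z /= lerD2l; apply: (@le_trans _ _ (T - X.2)).
    by rewrite ler_piMl// subr_ge0 ltW.
  rewrite -ler_pdivrMr; first exact/ltW/truncnS_gt.
  by rewrite divr_gt0.
have h1 := perron_ge Gd (X + (0, T - X.2)); have h2 := perron_le Gd X.
move: h1; have -> : H (X + (0, T - X.2)) = H X by apply/eqP; rewrite -subr_eq0 E.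
rewrite /= [X.2 + _]addrC subrK ge_max => /andP[_ h1].
have : Num.max 0 (X.2 + c) <= `|X.2| + c.
  by rewrite ge_max lerD2r ler_norm andbT addr_ge0// ltW.
by move: h1; rewrite /T; lra.
Qed.

Lemma Hx_line_cont X : G X -> {for X.2, continuous (fun t : R => Hx (X.1, t))}.
Proof.
move=> GX; have [r [r0 _ _ pH]] := perron_ball GX.
apply: cont_vert; exact: pa_cont (half_pos r0) (Hx_pa r0 pH).
Qed.

(** Q is a primitive of H_x down the vertical line over x, normalised to vanish at height 3, well
    above the strip; a is any height from which the line stays in G. The normalisation makes values
    independent of a. *)
Definition column (x a : R) (Q : R -> R) : Prop :=
  [/\ a < 3, forall t : R, a < t -> G (x, t),
      forall t : R, a < t < 4 -> is_derive t (1 : R) Q (Hx (x, t)) & Q 3 = 0].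

Lemma column_ex X : G X -> X.2 < 4 -> exists a Q, a < X.2 /\ column X.1 a Q.
Proof.
have [_ _ c0 _ [up _]] := Gd.
move=> GX X4; have [r [r0 _ rG _]] := perron_ball GX.
pose a : R := Num.min (X.2 - r / 2) 2.
have aX : a < X.2 by rewrite gt_min; apply/orP; left; have := half_pos r0; lra.
have Ga : G (X.1, a).
  have [h|h] := leP (X.2 - r / 2) 2.
    rewrite /a min_l//; apply: rG; rewrite /eball /=.
    apply: le_lt_trans (enorm_le12 _) _; rewrite /= subrr normr0 add0r.
    by rewrite ler0_norm; have := half_pos r0; lra.
  by rewrite /a min_r ?(ltW h)//; apply: up; apply: (lt_trans c1); rewrite /= ltr1n.
have Gt t : a <= t -> G (X.1, t) by move=> h; exact: (cone_up Ga).
have a3 : a < 3 by rewrite gt_min; apply/orP; right; lra.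
have [Q hQ] := @primitive_ex R (fun t => Hx (X.1, t)) a 4 (lt_trans aX X4)
  (fun t h => Hx_line_cont (Gt t (andP h).1)).
exists a, (fun t => Q t - Q 3); split => //; split => // [t|t h|]; last by rewrite subrr.
  by move=> /ltW; exact: Gt.
by rewrite -[Hx _]subr0; apply: is_deriveB; exact: hQ.
Qed.

Lemma column_uniq (x a a' : R) Q Q' t : column x a Q -> column x a' Q' ->
  a < t -> a' < t -> t < 4 -> Q t = Q' t.
Proof.
move=> [a3 aG dQ Q3] [a'3 a'G dQ' Q'3] at_ a't t4.
have m1 : Num.max a a' < t by rewrite gt_max at_.
have m3 : Num.max a a' < 3 by rewrite gt_max a3.
have r34 : 3 < 4 :> R by lra.
have d1 (s : R) : Num.max a a' < s < 4 -> is_derive s (1 : R) Q (Hx (x, s)).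
  by rewrite gt_max => /andP[/andP[h _] h']; apply: dQ; rewrite h.
have d2 (s : R) : Num.max a a' < s < 4 -> is_derive s (1 : R) Q' (Hx (x, s)).
  by rewrite gt_max => /andP[/andP[_ h] h']; apply: dQ'; rewrite h.
have tI : Num.max a a' < t < 4 by rewrite m1.
have I3 : Num.max a a' < (3 : R) < 4 by rewrite m3 r34.
have := same_deriv d1 d2 tI I3.
by rewrite Q3 Q'3 subrr => /eqP; rewrite subr_eq0 => /eqP.
Qed.

Lemma perron_bounded X Y r : r <= 1 -> X.2 <= 4 -> eball X r Y -> `|H Y| <= 6.
Proof.
move=> r1 X4 Yr; rewrite ger0_norm ?(perron_ge0 Gd)//.
apply: le_trans (perron_le Gd Y) _; rewrite ge_max; apply/andP; split; first by rewrite ler0n.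
have := le_trans (ler_norm _) (enorm2 (Y - X)); move: Yr c1; rewrite /eball /=; lra.
Qed.

(* Derivative in [x] of the primitive: since [H] is harmonic,
   [(H_x)_x = - (H_y)_y], so the derivative is [H_y(x,3) - H_y(x,y)]. *)
Lemma column_shift X : G X -> X.2 < 4 -> exists C d : R, 0 < d /\
  forall h : R, `|h| < d -> forall a Q a' Q', column X.1 a Q -> column (X.1 + h) a' Q' ->
    a < X.2 -> a' < X.2 ->
    `|Q' X.2 - Q X.2 + h * (Hy X - Hy (X.1, 3))| <= C * h ^+ 2.
Proof.
have [_ _ c0 _ [up lo]] := Gd.
move=> GX X4; pose y0 : R := Num.min X.2 3.
have GY : G (X.1, y0).
  rewrite /y0; have [h|h] := leP X.2 3; first by rewrite -surjective_pairing.
  by apply: up; apply: (lt_trans c1); rewrite /= ltr1n.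
have [r' [r'0 r'1 r'G _]] := perron_ball GY.
have [r [r0 r1 rr]] : exists r : R, [/\ 0 < r, r <= 1 & r < r'].
  by exists (r' / 2); split; [exact: half_pos|lra|lra].
have r2 := half_pos r0.
have y3 : y0 <= 3 by rewrite ge_min lexx orbT.
have yX : y0 <= X.2 by rewrite ge_min lexx.
pose M1 : R := 8 * 6 / (r / 2); pose C : R := 16 * M1 / (r / 2) ^+ 2.
have T (t h : R) : y0 <= t -> t <= 4 -> `|h| < r / 8 ->
   `|Hx (X.1 + h, t) - Hx (X.1, t) - h * complex.Re (der Hx (X.1, t))| <= C * h ^+ 2 /\
   is_derive t (1 : R) (fun t : R => Hy (X.1, t)) (- complex.Re (der Hx (X.1, t))).
  move=> yt t4 hr; have bG : ecball (X.1, t) r `<=` G.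
    apply: subset_trans (@cone_ball_up _ (X.1, t) _ r'G erefl yt).
    exact: ecball_eball.
  have pH := harm_eball (perron_harm Gd) r0 bG.
  have b6 Z : eball (X.1, t) r Z -> `|H Z| <= 6 by exact: perron_bounded.
  have pHx := Hx_pa r0 pH.
  have M1P Z : eball (X.1, t) (r / 2) Z -> `|Hx Z| <= M1.
    move=> Zr; apply: le_trans (cn_Re _) _.
    have sb : eball Z (r / 2) `<=` eball (X.1, t) r.
      by apply: eball_sub; move: Zr; rewrite /eball /=; lra.
    by apply: (der_bound r2 (paS sb pH)) => W /sb; exact: b6.
  have [_ _ TT] := pa_der_all r2 pHx; split.
    have := TT M1 M1P (X.1 + h, t).
    have -> : (X.1 + h, t) - (X.1, t) = (h, 0) :> R * R.
      by rewrite -[LHS]/(X.1 + h - X.1, t - t) subrr addrAC subrr add0r.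
    rewrite enorm_e1 Re_mulE mulr0 subr0 [_ * h]mulrC.
    have -> : 16 * M1 * (`|h| / (r / 2)) ^+ 2 = C * h ^+ 2.
      by rewrite exprMn real_normK ?num_real// /C; field; rewrite gt_eqF.
    by apply; lra.
  have ca' := der_ca r0 pH.
  have E : der Hy (X.1, t) = 'i%C * der Hx (X.1, t).
    rewrite -[RHS](ca_der _ r2 ca'); congr (der _ _); apply/funext => Z.
    by rewrite /Hy; case: (der H Z) => x y /=; rewrite mul0r mul1r sub0r.
  have [d1 d2] := pa_dir e2 r2 (Hy_pa r0 pH).
  have := @line_derive R Hy (X.1, 0) e2 t.
  have -> : (X.1, 0) + t *: e2 = (X.1, t) :> R * R by rewrite scaleE mulr0 mulr1 -[LHS]/(X.1 + 0, 0 + t) addr0 add0r.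
  rewrite d2 E toC_e2 => /(_ d1) D.
  have -> : (fun t : R => Hy (X.1, t)) = (fun t : R => Hy ((X.1, 0) + t *: e2)).
    by apply/funext => s; rewrite scaleE mulr0 mulr1 -[X in _ = Hy X]/(X.1 + 0, 0 + s) addr0 add0r.
  by move: D; rewrite mulrAC -expr2 sqr_i mulN1r ReN.
exists (4 * C), (r / 8); split; first by rewrite divr_gt0.
move=> h hr a Q a' Q' [a3 aG dQ Q3] [a'3 a'G dQ' Q'3] aX a'X.
pose F (t : R) := Q' t - Q t + h * Hy (X.1, t).
pose dF (t : R) := Hx (X.1 + h, t) - Hx (X.1, t) + h * - complex.Re (der Hx (X.1, t)).
have D (t : R) : y0 <= t -> t < 4 -> is_derive t (1 : R) F (dF t) /\ `|dF t| <= C * h ^+ 2.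
  move=> yt t4; have [T1 T2] := T t h yt (ltW t4) hr; split.
    have ay : a < t by apply: lt_le_trans yt; rewrite lt_min aX.
    have a'y : a' < t by apply: lt_le_trans yt; rewrite lt_min a'X.
    by apply: is_deriveD; apply: is_deriveB; [apply: dQ'|apply: dQ]; rewrite ?ay ?a'y.
  by rewrite /dF mulrN.
have C0 : 0 <= C * h ^+ 2.
  by have [_ /(le_trans (normr_ge0 _))] := D y0 (lexx _) (le_lt_trans y3 (ltr_nat R 3 4)).
have -> : Q' X.2 - Q X.2 + h * (Hy X - Hy (X.1, 3)) = F X.2 - F 3.
  by rewrite /F Q3 Q'3 -surjective_pairing; ring.
have lX := lo X GX.
apply: le_trans (@mvt_bound F dF (C * h ^+ 2) X.2 3 _) _.
  move=> t; rewrite /y0 in D *; move=> /andP[t1 t2]; apply: D => //.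
  by apply: le_lt_trans t2 _; rewrite gt_max X4 ltr_nat.
have -> : 4 * C * h ^+ 2 = C * h ^+ 2 * 4 by ring.
apply: ler_wpM2l => //; rewrite ler_norml.
by move: X4 lX c1; clear => ? ? ?; lra.
Qed.

Lemma K_ex : exists K : R * R -> R, [/\ K (0, 3) = 0,
  (forall X, G X -> `|X.1| < 4 -> X.2 < 4 ->
    exists r, [/\ 0 < r, eball X r `<=` G & ca (fun Y => K Y +i* H Y)%C (eball X r)]) &
  forall X, G X -> `|X.1| < 4 -> X.2 < 4 -> der K X = 'i%C * der H X].
Proof.
have [oG _ c0 _ [up lo]] := Gd.
(* This disc stays above height 1 > c, and the concentric one of radius 30 contains the points (x,
   3) with |x| < 4. *)
have cG : ecball (0, 32) 31 `<=` G.
  move=> Y Yr; apply: up; apply: (lt_le_trans c1).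
  have := le_trans (enorm2 (Y - (0, 32))) Yr; rewrite ler_norml /=; lra.
have c30 : 0 < 30 :> R by rewrite ltr0n.
have c31 : 30 < 31 :> R by rewrite ltr_nat.
have [k0 hk0] := conj_disc c30 c31 (harm_eball (perron_harm Gd) (ltr0n R 31) cG).
have HP X : exists q : R, G X -> X.2 < 4 -> exists a Q, [/\ a < X.2, column X.1 a Q & q = Q X.2].
  have [GX|nGX] := pselect (G X); last by exists 0.
  have [X4|X4] := ltP X.2 4; last by exists 0 => _.
  by have [a [Q [h1 h2]]] := column_ex GX X4; exists (Q X.2) => _ _; exists a, Q.
have [P hP] := choice HP.
have PE (x a t : R) Q : column x a Q -> a < t -> t < 4 -> P (x, t) = Q t.
  move=> cQ at_ t4; have [_ aG _ _] := cQ.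
  have [a' [Q' [a't cQ' ->]]] := hP (x, t) (aG t at_) t4.
  exact: (column_uniq cQ' cQ).
pose K X := (- k0 (X.1, 3) - P X) + k0 (0, 3).
have K_x X : G X -> `|X.1| < 4 -> X.2 < 4 -> derivable K X e1 /\ 'D_e1 K X = Hy X.
  move=> GX X1 X4.
  have [C [d [d0 hC]]] := column_shift GX X4.
  have Y0 : eball (0, 32) 30 (X.1, 3).
    have : X.1 ^+ 2 < 4 ^+ 2 by rewrite -real_normK ?num_real// ltr_pXn2r ?nnegrE.
    move=> h; rewrite /eball /= -(@ltr_pXn2r R 2)// ?nnegrE ?enorm_ge0//.
    by rewrite enorm_sqr /= subr0; lra.
  have [s s0 sB] := proj1 (openP _) (@open_eball R (0, 32) 30) _ Y0.
  have [pk _ dk] := conj_der s0 (caS sB hk0).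
  have [M hM] := pa_bounded pk; have [_ _ T] := pa_der_all s0 pk.
  have [r [r0 r1 rG _]] := perron_ball GX.
  pose d' := Num.min d (Num.min (s / 4) r).
  have d'0 : 0 < d' by rewrite !lt_min d0 r0 divr_gt0.
  apply: (@derive_quad R K X e1 (Hy X) (C + 16 * M / s ^+ 2) d' d'0) => h.
  rewrite !lt_min => /and3P[hd hs hr].
  have [a [Q [aX cQ]]] := column_ex GX X4.
  have Xh : X + h *: e1 = (X.1 + h, X.2) :> R * R.
    by rewrite scaleE mulr1 mulr0 -[LHS]/(X.1 + h, X.2 + 0) addr0.
  have GXh : G (X.1 + h, X.2).
    rewrite -Xh; apply: rG; rewrite /eball /= addrAC subrr add0r enormZ.
    by rewrite /e1 enorm_e1 normr1 mulr1.
  have [a' [Q' [a'X cQ']]] := column_ex GXh X4.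
  have h1 := hC h hd a Q a' Q' cQ cQ' aX a'X.
  have E1 : P X = Q X.2 by rewrite [X in P X]surjective_pairing; exact: PE cQ aX X4.
  have E2 : P (X.1 + h, X.2) = Q' X.2 by exact: PE cQ' a'X X4.
  have := T M hM (X.1 + h, 3).
  have -> : (X.1 + h, 3) - (X.1, 3) = (h, 0) :> R * R.
    by rewrite -[LHS]/(X.1 + h - X.1, 3 - 3) subrr addrAC subrr add0r.
  rewrite enorm_e1 => /(_ (ltW hs)); rewrite dk Re_mulE mulr0 subr0.
  have -> : complex.Re ('i%C * der H (X.1, 3)) = Hy (X.1, 3).
    by rewrite /Hy; case: (der H _) => x y /=; rewrite mul0r mul1r sub0r.
  have -> : 16 * M * (`|h| / s) ^+ 2 = 16 * M / s ^+ 2 * h ^+ 2.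
    by rewrite exprMn real_normK ?num_real//; field; rewrite gt_eqF.
  move=> h2; rewrite Xh /K E1 E2 /=.
  have -> : - k0 (X.1 + h, 3) - Q' X.2 + k0 (0, 3) - (- k0 (X.1, 3) - Q X.2 + k0 (0, 3)) - h * Hy X =
    (- k0 (X.1 + h, 3) - - k0 (X.1, 3) - Hy (X.1, 3) * h) -
    (Q' X.2 - Q X.2 + h * (Hy X - Hy (X.1, 3))) by ring.
  apply: le_trans (ler_normB _ _) _; rewrite mulrDl addrC; exact: lerD.
(* Near X the function K differs by a constant from the conjugate -k1 given by [conj_disc]: their
   x-derivatives agree along the horizontal line through X, then their y-derivatives along every
   vertical line. *)
have main X : G X -> `|X.1| < 4 -> X.2 < 4 ->
    exists r, [/\ 0 < r, eball X r `<=` G & ca (fun Y => K Y +i* H Y)%C (eball X r)].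
  move=> GX X1 X4; have [r [r0 r1 rG pH]] := perron_ball GX.
  have r2 := half_pos r0; have r2r : r / 2 < r by lra.
  have [k1 hk1] := conj_disc r2 r2r pH.
  have dk1 W : eball X (r / 2) W -> [/\ exists2 s, 0 < s & pa (fun Y => - k1 Y) (eball W s) &
      der (fun Y => - k1 Y) W = 'i%C * der H W].
    move=> WX; have [s s0 sB] := proj1 (openP _) (@open_eball R X (r / 2)) _ WX.
    by have [p1 _ p2] := conj_der s0 (caS sB hk1); split => //; exists s.
  pose s : R := Num.min (r / 4) (Num.min (4 - `|X.1|) (4 - X.2)).
  have s0 : 0 < s by rewrite !lt_min !subr_gt0 X1 X4 divr_gt0.
  have sr : s <= r / 4 by rewrite ge_min lexx.
  have s1 : s <= 4 - `|X.1| by rewrite !ge_min lexx orbT.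
  have s4 : s <= 4 - X.2 by rewrite !ge_min lexx !orbT.
  have sq Y : `|Y.1 - X.1| < s -> `|Y.2 - X.2| <= s -> eball X (r / 2) Y.
    by move=> h1 h2; apply: le_lt_trans (enorm_le12 _) _; rewrite /=; lra.
  have sG Y : `|Y.1 - X.1| < s -> `|Y.2 - X.2| <= s -> G Y.
    by move=> h1 h2; apply: rG; have := sq Y h1 h2; rewrite /eball /=; lra.
  have horiz (x : R) : `|x - X.1| < s -> K (x, X.2) - - k1 (x, X.2) = K X - - k1 X.
    move=> xs.
    have line (t : R) : X + t *: e1 = (X.1 + t, X.2) :> R * R.
      by rewrite scaleE mulr1 mulr0 -[LHS]/(X.1 + t, X.2 + 0) addr0.
    have mem (t : R) : - s < t < s -> `|(X + t *: e1).1 - X.1| < s /\ `|(X + t *: e1).2 - X.2| <= s.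
      by move=> ts; rewrite line /= subrr normr0 (ltW s0) addrAC subrr add0r ltr_norml.
    have D1 (t : R) : - s < t < s -> is_derive t (1 : R) (fun t : R => K (X + t *: e1)) (Hy (X + t *: e1)).
      move=> ts; have [m1 m2] := mem t ts.
      have k1' : `|(X + t *: e1).1| < 4.
        rewrite line /=; apply: le_lt_trans (ler_normD _ _) _.
        by move: ts; rewrite -ltr_norml; lra.
      have k2' : (X + t *: e1).2 < 4 by rewrite line.
      have [d1 <-] := K_x _ (sG _ m1 m2) k1' k2'.
      exact: line_derive.
    have D2 (t : R) : - s < t < s -> is_derive t (1 : R) (fun t : R => - k1 (X + t *: e1)) (Hy (X + t *: e1)).
      move=> ts; have [m1 m2] := mem t ts.
      have [[s' s'0 pk] dk] := dk1 _ (sq _ m1 m2).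
      have [d1] := pa_dir e1 s'0 pk; rewrite dk toC_e1 mulr1 => d2.
      have <- : complex.Re ('i%C * der H (X + t *: e1)) = Hy (X + t *: e1).
        by rewrite /Hy; case: (der H _) => a b /=; rewrite mul0r mul1r sub0r.
      by rewrite -d2; exact: (line_derive d1).
    have i0 : - s < 0 < s by rewrite oppr_lt0 s0.
    have ix : - s < x - X.1 < s by rewrite -ltr_norml.
    have := same_deriv D1 D2 ix i0.
    have -> : X + (x - X.1) *: e1 = (x, X.2) :> R * R by rewrite line addrC subrK.
    by rewrite line addr0 -surjective_pairing.
  have vert Y : `|Y.1 - X.1| < s -> `|Y.2 - X.2| < s -> K Y - - k1 Y = K (Y.1, X.2) - - k1 (Y.1, X.2).
    move=> Y1 Y2.
    have Gb : G (Y.1, X.2 - s) by apply: sG => //=; rewrite addrAC subrr add0r normrN gtr0_norm.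
    have b4 : X.2 - s < 4 by lra.
    have [a [Q [ab cQ]]] := @column_ex (Y.1, X.2 - s) Gb b4.
    have [_ _ dQ _] := cQ.
    have line (t : R) : (Y.1, 0) + t *: e2 = (Y.1, t) :> R * R.
      by rewrite scaleE mulr1 mulr0 -[LHS]/(Y.1 + 0, 0 + t) addr0 add0r.
    have D1 (t : R) : X.2 - s < t < X.2 + s -> is_derive t (1 : R) (fun t => - Q t) (- Hx (Y.1, t)).
      move=> /andP[t1 t2]; apply: is_deriveN; apply: dQ; rewrite (lt_trans ab t1) /=.
      by apply: lt_le_trans t2 _; lra.
    have D2 (t : R) : X.2 - s < t < X.2 + s ->
        is_derive t (1 : R) (fun t : R => - k1 ((Y.1, 0) + t *: e2)) (- Hx (Y.1, t)).
      move=> ts; have m2 : `|(Y.1, t).2 - X.2| <= s by rewrite ltW// ltr_distl.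
      have [[s' s'0 pk] dk] := dk1 _ (sq (Y.1, t) Y1 m2).
      have [d1] := pa_dir e2 s'0 pk; rewrite dk toC_e2 mulrAC -expr2 sqr_i mulN1r ReN => d2.
      have := @line_derive R (fun Y => - k1 Y) (Y.1, 0) e2 t; rewrite line => /(_ d1).
      by rewrite d2.
    have iX : X.2 - s < X.2 < X.2 + s by rewrite ltrDl s0 andbT; lra.
    have iY : X.2 - s < Y.2 < X.2 + s by rewrite -ltr_distl.
    have := same_deriv D1 D2 iY iX; rewrite !line -surjective_pairing.
    have aX : a < X.2 by apply: lt_trans ab _; have := s0; rewrite /=; lra.
    have aY : a < Y.2 by apply: lt_trans ab _; case/andP: iY.
    have Y4 : Y.2 < 4 by case/andP: iY => _ h; apply: lt_le_trans h _; lra.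
    have E1 : P Y = Q Y.2 by rewrite [X in P X]surjective_pairing; exact: PE cQ aY Y4.
    have E2 : P (Y.1, X.2) = Q X.2 by exact: PE cQ aX X4.
    rewrite /K E1 E2 /=; lra.
  exists s; split => //.
    move=> Y Ys; apply: sG; first exact: le_lt_trans (enorm1 (Y - X)) Ys.
    by apply: ltW; exact: le_lt_trans (enorm2 (Y - X)) Ys.
  have sb : eball X s `<=` eball X (r / 2) by move=> Y; rewrite /eball /=; lra.
  apply: ca_eq (caM 'i%C ((K X - - k1 X)%:C)%C (caS sb hk1)) => Y Ys.
  have Y1 := le_lt_trans (enorm1 (Y - X)) Ys; have Y2 := le_lt_trans (enorm2 (Y - X)) Ys.
  have := vert Y Y1 Y2; rewrite (horiz _ Y1) => h.
  have -> : K Y = - k1 Y + (K X - - k1 X) by rewrite -h; ring.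
  by apply/eqP; rewrite eq_complex /= !mul0r !mul1r sub0r addr0 add0r !eqxx.
exists K; split => //.
  have G3 : G (0, 3) by apply: up; apply: (lt_trans c1); rewrite /= ltr1n.
  have [a [Q [a3 cQ]]] := @column_ex (0, 3) G3 (ltr_nat R 3 4 : 3 < 4).
  have [_ _ _ Q3] := cQ.
  by rewrite /K (PE _ _ _ _ cQ) ?ltr_nat// Q3 subr0 addNr.
move=> X GX X1 X4; have [r [r0 rG cr]] := main X GX X1 X4.
have := ca_der (- 'i%C) r0 cr => /=.
have -> : (fun Y => complex.Re (- 'i%C * (K Y +i* H Y)%C)) = H.
  by apply/funext => Y /=; rewrite oppr0 mul0r mulN1r sub0r opprK.
by move=> ->; rewrite mulNr mulrN mulrA -expr2 sqr_i mulN1r opprK.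
Qed.

End conjugate.

(** * Boundary values and injectivity of the flattening map *)

Section uniformizer.
Context {R : realType}.
Implicit Types (X Y Z v : R * R) (A B : set (R * R)) (t s e r : R).
Context (G : set (R * R)) (eps c : R).
Context (Gd : cone_domain G eps c) (eps64 : eps <= 64^-1) (c256 : c <= 256^-1).
Local Notation H := (perron G c).
Local Notation Dx := (Hx G c).
Local Notation Dy := (Hy G c).

Lemma cone_cl X v : closure G X -> eps * `|v.1| < v.2 -> G (X + v).
Proof.
have [_ /andP[e0 e16] _ Gc _] := Gd => /closureP cX hv.
pose s := v.2 - eps * `|v.1|; have s0 : 0 < s by rewrite subr_gt0.
have [Y GY YX] := cX _ (half_pos s0).
have -> : X + v = Y + (v + (X - Y)) by rewrite addrCA [Y + _]addrC subrK addrC.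
apply: Gc => //.
have h1 := le_lt_trans (enorm1 (Y - X)) YX; have h2 := le_lt_trans (enorm2 (Y - X)) YX.
have h3 : `|(v + (X - Y)).1| <= `|v.1| + s / 2.
  apply: le_trans (ler_normD _ _) _; rewrite lerD2l.
  by move: h1; rewrite /= distrC => /ltW.
apply: le_trans (ler_wpM2l e0 h3) _.
move: h2; rewrite /= ltr_norml => /andP[_ h2].
have : eps * (s / 2) <= s / 2 by rewrite ler_piMl ?(ltW (half_pos s0))//; lra.
by rewrite mulrDr {2 3}/s; rewrite /s in h2 *; lra.
Qed.

Lemma cl_up X t : closure G X -> 0 < t -> G (X + (0, t)).
Proof. by move=> cX t0; apply: cone_cl => //=; rewrite normr0 mulr0. Qed.

Lemma cl_low X : closure G X -> - c <= X.2.
Proof.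
have [_ _ _ _ [_ lo]] := Gd => cX; apply/ler_addgt0Pr => e e0.
by have := lo _ (cl_up cX e0) => /= /ltW.
Qed.

Context (K : R * R -> R) (K03 : K (0, 3) = 0).
Context (Kca : forall X, G X -> `|X.1| < 4 -> X.2 < 4 ->
    exists r, [/\ 0 < r, eball X r `<=` G & ca (fun Y => K Y +i* H Y)%C (eball X r)]).
Context (Kder : forall X, G X -> `|X.1| < 4 -> X.2 < 4 -> der K X = 'i%C * der H X).

Lemma K_dir X v : G X -> `|X.1| < 4 -> X.2 < 4 ->
  (derivable K X v /\ 'D_v K X = Dy X * v.1 - Dx X * v.2) /\
  (derivable H X v /\ 'D_v H X = Dx X * v.1 + Dy X * v.2).
Proof.
move=> GX X1 X2; have [r [r0 _ cr]] := Kca GX X1 X2.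
have pK : pa K (eball X r) by apply: pa_eq (ca_re 1 cr) => Y _; rewrite mul1r.
have [r' [r'0 _ _ pH]] := perron_ball Gd GX.
have [k1 k2] := pa_dir v r0 pK; have [h1 h2] := pa_dir v r'0 pH.
split; split => //; rewrite ?k2 ?h2 ?Kder// Re_mulE /Hx /Hy; case: (der H X) => a b /=; ring.
Qed.

Lemma KH_mvt (a b : R) X v (s t : R) : s < t ->
  (forall x : R, s <= x <= t -> [/\ G (X + x *: v), `|(X + x *: v).1| < 4 & (X + x *: v).2 < 4]) ->
  exists2 Y, G Y & a * K (X + t *: v) + b * H (X + t *: v) - (a * K (X + s *: v) + b * H (X + s *: v)) =
    (a * (Dy Y * v.1 - Dx Y * v.2) + b * (Dx Y * v.1 + Dy Y * v.2)) * (t - s).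
Proof.
move=> st h.
pose F (x : R) := a * K (X + x *: v) + b * H (X + x *: v).
pose dF (x : R) := let Y := X + x *: v in a * (Dy Y * v.1 - Dx Y * v.2) + b * (Dx Y * v.1 + Dy Y * v.2).
have D (x : R) : s <= x <= t -> is_derive x (1 : R) F (dF x).
  move=> /h[h1 h2 h3]; have [[d1 E1] [d2 E2]] := @K_dir _ v h1 h2 h3.
  have := line_derive d1; have := line_derive d2; rewrite E1 E2 => i2 i1.
  by apply: is_deriveD.
have [|x] := @MVT R F dF s t st _ (is_derive_within D).
  by move=> x; rewrite in_itv /= => /andP[x1 x2]; apply: D; rewrite !ltW.
rewrite in_itv /= => /andP[sx xt] E; exists (X + x *: v) => //.
by have [] := h x; rewrite ?(ltW sx) ?(ltW xt).
Qed.

Lemma upE X t : X + t *: e2 = (X.1, X.2 + t).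
Proof. by rewrite scaleE mulr0 mulr1 -[LHS]/(X.1 + 0, X.2 + t) addr0. Qed.

Lemma H_mono X t : 0 <= t -> H X <= H (X + t *: e2).
Proof.
by move=> t0; apply: (perron_cone Gd); rewrite scaleE /= mulr0 normr0 mulr0 mulr1.
Qed.

Lemma cl_upe X t : closure G X -> 0 < t -> G (X + t *: e2).
Proof.
by move=> cX t0; apply: cone_cl => //; rewrite scaleE /= mulr0 normr0 mulr0 mulr1.
Qed.

Lemma K_vert X s t : (forall x : R, s <= x -> G (X + x *: e2)) -> s <= t -> `|X.1| < 4 -> X.2 + t < 4 ->
  `|K (X + s *: e2) - K (X + t *: e2)| <= eps * (H (X + t *: e2) - H (X + s *: e2)).
Proof.
move=> h; rewrite le_eqVlt => /orP[/eqP <-|st] X1 X2; first by rewrite !subrr normr0 mulr0.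
have m (x : R) : s <= x <= t -> [/\ G (X + x *: e2), `|(X + x *: e2).1| < 4 & (X + x *: e2).2 < 4].
  by move=> /andP[h1 h2]; split; [exact: h|rewrite upE|rewrite upE /=; apply: le_lt_trans X2; rewrite lerD2l].
have [Y GY /=] := KH_mvt (-1) eps st m; have [Z GZ /=] := KH_mvt 1 eps st m.
have p : 0 <= t - s by rewrite subr_ge0 ltW.
have := Hx_le Gd GY; have := Hx_le Gd GZ; rewrite !ler_norml => /andP[z1 z2] /andP[y1 y2].
have i1 : 0 <= 1 * (Dy Z * 0 - Dx Z * 1) + eps * (Dx Z * 0 + Dy Z * 1) by lra.
have i2 : 0 <= -1 * (Dy Y * 0 - Dx Y * 1) + eps * (Dx Y * 0 + Dy Y * 1) by lra.
move: (mulr_ge0 i1 p) (mulr_ge0 i2 p) => j1 j2 E1 E2; rewrite -E1 in j1; rewrite -E2 in j2.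
by move: j1 j2; clear => j1 j2; apply/andP; split; lra.
Qed.

(** As |K_y| = |H_x| <= eps H_y, the oscillation of K along a vertical segment is at most eps times
    the increase of H, which is continuous down to the boundary. The resulting intervals around the
    values of K are nested. *)
Lemma Kbar_ex : exists Kb : R * R -> R, (forall X, G X -> Kb X = K X) /\
  forall X t, closure G X -> `|X.1| < 4 -> 0 < t -> X.2 + t < 4 ->
    `|Kb X - K (X + t *: e2)| <= eps * (H (X + t *: e2) - H X).
Proof.
have [_ /andP[e0 _] _ _ _] := Gd.
have HP X : exists k : R, closure G X -> `|X.1| < 4 -> (G X -> k = K X) /\
  forall t, 0 < t -> X.2 + t < 4 -> `|k - K (X + t *: e2)| <= eps * (H (X + t *: e2) - H X).
  have [GX|nGX] := pselect (G X).
    exists (K X) => _ X1; split=> // t t0 Xt.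
    have := @K_vert X 0 t _ (ltW t0) X1 Xt; rewrite scale0r addr0; apply=> x x0.
    by apply: (cone_up Gd GX); rewrite upE //= lerDl.
  have [[cX X1]|nX] := pselect (closure G X /\ `|X.1| < 4); last by exists 0 => cX X1; case: nX.
  have [X4|X4] := leP 4 X.2.
    by exists 0 => _ _; split=> // t t0 Xt; lra.
  pose I := {t : R | 0 < t < 4 - X.2}.
  have i0 : 0 < (4 - X.2) / 2 < 4 - X.2 by lra.
  have i1 : I by exists ((4 - X.2) / 2).
  have [|k hk] := @nested_point R I i1 (fun i => K (X + sval i *: e2)) (fun i => eps * (H (X + sval i *: e2) - H X)).
    have main s t : 0 < s -> s <= t -> t < 4 - X.2 ->
       `|K (X + s *: e2) - K (X + t *: e2)| <= eps * (H (X + t *: e2) - H X) + eps * (H (X + s *: e2) - H X).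
      move=> s0 st t4; apply: le_trans (@K_vert X s t _ st X1 _) _; [by move=> x sx; apply: cl_upe => //; exact: lt_le_trans sx|lra|].
      rewrite -mulrDr ler_wpM2l//; have := H_mono X (ltW s0); lra.
    move=> [s /= /andP[s0 s4]] [t /= /andP[t0 t4]].
    have [st|/ltW ts] := leP s t.
      by have := main s t s0 st t4; rewrite ler_norml; lra.
    by have := main t s t0 ts s4; rewrite ler_norml; lra.
  exists k => _ _; split => // t t0 Xt.
  have it : 0 < t < 4 - X.2 by lra.
  exact: (hk (exist (fun t : R => is_true (0 < t < 4 - X.2)) t it)).
have [k0 hk0] := choice HP.
exists (fun X => if pselect (G X) then K X else k0 X); split => [X GX|X t cX X1 t0 Xt]; first by case: pselect.
have [h1 h2] := hk0 X cX X1.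
by case: pselect => GX; [rewrite -h1//; exact: h2|exact: h2].
Qed.

Context (Kb : R * R -> R) (KbE : forall X, G X -> Kb X = K X).
Context (Kb_vert : forall X t, closure G X -> `|X.1| < 4 -> 0 < t -> X.2 + t < 4 ->
    `|Kb X - K (X + t *: e2)| <= eps * (H (X + t *: e2) - H X)).

Lemma K_cont X : G X -> `|X.1| < 4 -> X.2 < 4 -> {for X, continuous K}.
Proof.
move=> GX X1 X2; have [r [r0 _ cr]] := Kca GX X1 X2.
by apply: (pa_cont r0); apply: pa_eq (ca_re 1 cr) => Y _; rewrite mul1r.
Qed.

Lemma Kb_cont X e : closure G X -> `|X.1| < 4 -> X.2 < 4 -> 0 < e ->
  exists2 d : R, 0 < d & forall Y, closure G Y -> eball X d Y -> `|Kb Y - Kb X| <= e.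
Proof.
have [_ /andP[eps0 _] _ _ _] := Gd.
move=> cX X1 X4 e0; have [GX|nGX] := pselect (G X).
  have [d d0 hd] := proj1 (cont_atP _ _) (K_cont GX X1 X4) e e0.
  have [oG _ _ _ _] := Gd; have [r r0 rG] := proj1 (openP _) oG X GX.
  exists (Num.min d r); first by rewrite lt_min d0.
  move=> Y _; rewrite /eball /= lt_min => /andP[Yd Yr].
  by rewrite !KbE//; [exact: hd|exact: rG].
have HX : H X = 0 by exact: (perron_out Gd nGX).
have e4 : 0 < e / 4 by rewrite divr_gt0.
have [d1 d10 hd1] := proj1 (cont_atP _ _) (perron_cont Gd (x := X)) _ e4.
pose t : R := Num.min (d1 / 2) ((4 - X.2) / 2).
have t0 : 0 < t by rewrite lt_min half_pos//= divr_gt0// subr_gt0.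
have td : t <= d1 / 2 by rewrite ge_min lexx.
have t4 : t <= (4 - X.2) / 2 by rewrite ge_min lexx orbT.
have Ht : H (X + t *: e2) <= e / 4.
  have := hd1 (X + t *: e2); rewrite HX subr0 => /(_ _)/(le_trans (ler_norm _)); apply.
  rewrite /eball /= addrAC subrr add0r enormZ /e2 enorm_e2 normr1 mulr1 gtr0_norm//; lra.
have GT : G (X + t *: e2).
  exact: cl_upe.
have XT4 : (X + t *: e2).2 < 4 by rewrite upE /=; lra.
have XT1 : `|(X + t *: e2).1| < 4 by rewrite upE.
have [d2 d20 hd2] := proj1 (cont_atP _ _) (K_cont GT XT1 XT4) _ e4.
have [d3 d30 hd3] := proj1 (cont_atP _ _) (perron_cont Gd (x := X + t *: e2)) _ e4.
pose d := Num.min (Num.min d2 d3) (Num.min (4 - `|X.1|) ((4 - X.2) / 4)).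
have d0 : 0 < d by rewrite !lt_min d20 d30 subr_gt0 X1 divr_gt0// subr_gt0.
exists d => // Y cY; rewrite /eball /= !lt_min => /andP[/andP[Y2 Y3] /andP[Y4 Y5]].
have Y1 : `|Y.1| < 4.
  have -> : Y.1 = X.1 + (Y - X).1 by rewrite /= addrC subrK.
  by apply: le_lt_trans (ler_normD _ _) _; have := enorm1 (Y - X); lra.
have YX : Y.2 - X.2 < (4 - X.2) / 4.
  by apply: le_lt_trans Y5; apply: le_trans (enorm2 (Y - X)); exact: ler_norm.
have Yt : Y.2 + t < 4 by lra.
have E : Y + t *: e2 - (X + t *: e2) = Y - X by rewrite opprD addrACA subrr addr0.
have k1 : `|K (Y + t *: e2) - K (X + t *: e2)| <= e / 4 by apply: hd2; rewrite /eball /= E.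
have k2 : `|H (Y + t *: e2) - H (X + t *: e2)| <= e / 4 by apply: hd3; rewrite /eball /= E.
have k3 := Kb_vert cY Y1 t0 Yt.
have Xt : X.2 + t < 4 by lra.
have k4 := Kb_vert cX X1 t0 Xt.
have k5 : eps * (H (Y + t *: e2) - H Y) <= 64^-1 * (e / 2).
  apply: ler_pM => //; first by rewrite subr_ge0 H_mono// ltW.
  by move: k2; rewrite ler_norml; have := perron_ge0 Gd Y; lra.
have k6 : eps * (H (X + t *: e2) - H X) <= 64^-1 * (e / 2).
  apply: ler_pM => //; first by rewrite subr_ge0 H_mono// ltW.
  by rewrite HX; lra.
move: k1 k3 k4 k5 k6; rewrite !ler_norml.
move: (Kb Y) (Kb X) (K (Y + _)) (K (X + _)) (eps * (H (Y + _) - _)) (eps * (H (X + _) - _)).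
by move=> a1 a2 a3 a4 a5 a6; lra.
Qed.

Lemma convex_lt4 (a b x : R) : `|a| < 4 -> `|a + b| < 4 -> 0 < x <= 1 -> `|a + x * b| < 4.
Proof.
move=> h1 h2 /andP[x0 x1]; have -> : a + x * b = (1 - x) * a + x * (a + b) by ring.
apply: le_lt_trans (ler_normD _ _) _; rewrite !normrM (gtr0_norm x0) ger0_norm ?subr_ge0//.
have q0 : 0 <= 1 - x by lra.
have := ler_wpM2l q0 (ltW h1); have : x * `|a + b| < x * 4 by rewrite ltr_pM2l.
lra.
Qed.

(** K_x = H_y dominates |K_y|, so K is strictly monotone along segments of slope 1/4; being steeper
    than eps, they enter G even from a boundary point. Two such segments form a tent joining two
    boundary points through G. *)
Lemma Kb_tent X (s a : R) : s = 1 \/ s = -1 -> closure G X -> 0 < a -> `|X.1| < 4 -> `|X.1 + s * a| < 4 -> X.2 + a / 4 < 4 ->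
  s * Kb X < s * K (X + (s * a, a / 4)).
Proof.
have [_ /andP[eps0 _] _ _ _] := Gd.
move=> hs cX a0 X1 Xa X4; have s1 : `|s| = 1 by case: hs => ->; rewrite ?normrN normr1.
set v := (s * a, a / 4).
have m (x : R) : 0 < x <= 1 -> [/\ G (X + x *: v), `|(X + x *: v).1| < 4 & (X + x *: v).2 < 4].
  move=> /andP[x0 x1]; have xa : x * a <= a by rewrite ler_piMl// ltW.
  have xa0 : 0 < x * a by rewrite mulr_gt0.
  split.
  - apply: cone_cl => //; rewrite scaleE /= mulrCA normrM s1 mul1r gtr0_norm//.
    have : eps * (x * a) <= 64^-1 * (x * a) by rewrite ler_wpM2r ?(ltW xa0).
    by rewrite [x * (a / 4)]mulrA; lra.
  - by apply: (@convex_lt4 _ (s * a)) => //; rewrite x0.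
  - by rewrite scaleE /= mulrA; lra.
have inc (x y : R) : 0 < x -> x < y -> y <= 1 -> s * K (X + x *: v) < s * K (X + y *: v).
  move=> x0 xy y1; have [|Y GY] := @KH_mvt s 0 X v x y xy.
    by move=> z /andP[z1 z2]; apply: m; rewrite (lt_le_trans x0)//= (le_trans z2).
  rewrite !mul0r !addr0 -subr_gt0 => ->; rewrite mulr_gt0 ?subr_gt0//.
  have Yp := Hy_gt0 Gd GY; have := Hx_le Gd GY.
  have -> : s * (Dy Y * v.1 - Dx Y * v.2) = (s * s) * a * Dy Y - (s * Dx Y) * (a / 4) by rewrite /v /=; ring.
  have -> : s * s = 1 by rewrite -expr2 -real_normK ?num_real// s1 expr1n.
  have -> : `|Dx Y| = `|s * Dx Y| by rewrite normrM s1 mul1r.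
  move=> h.
  have h2 : s * Dx Y <= Dy Y.
    apply: le_trans (ler_norm _) (le_trans h _); rewrite ler_piMl ?ltW//.
    by apply: le_lt_trans eps64 _; rewrite invf_lt1 ?ltr1n.
  have a4 : 0 <= a / 4 by lra.
  have := ler_wpM2r a4 h2; have := mulr_gt0 a0 Yp; lra.
have h1 : s * K (X + (1 / 2) *: v) < s * K (X + (1 : R) *: v) by apply: inc => //; lra.
rewrite scale1r in h1; apply: le_lt_trans h1.
apply/ler_addgt0Pr => e e0; have X4' : X.2 < 4 by lra.
have [d d0 hd] := Kb_cont cX X1 X4' e0.
have v0 : 0 < enorm v + 1 by rewrite ltr_wpDl ?enorm_ge0.
pose x : R := Num.min (1 / 4) (d / 2 / (enorm v + 1)).
have x0 : 0 < x by rewrite lt_min !divr_gt0.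
have x1 : x <= 1 / 4 by rewrite ge_min lexx.
have x2 : x * (enorm v + 1) <= d / 2 by rewrite -ler_pdivlMr// ge_min lexx orbT.
have mx : 0 < x <= 1 by lra.
have [Gx _ _] := m x mx.
have := hd (X + x *: v) (subset_closure Gx); rewrite KbE// => /(_ _) h.
have {}h : `|K (X + x *: v) - Kb X| <= e.
  apply: h; rewrite /eball /= addrAC subrr add0r enormZ gtr0_norm//.
  by move: x2; rewrite mulrDr mulr1; lra.
have h3 : s * K (X + x *: v) < s * K (X + (1 / 2) *: v) by apply: inc => //; lra.
have : `|s * (K (X + x *: v) - Kb X)| <= e by rewrite normrM s1 mul1r.
by rewrite ler_norml mulrBr; lra.
Qed.

Lemma H_up X v : closure G X -> `|v.1| / 8 < v.2 -> `|X.1| < 4 -> `|(X + v).1| < 4 -> (X + v).2 < 4 -> H X < H (X + v).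
Proof.
have [_ /andP[eps0 _] _ _ _] := Gd.
move=> cX hv X1 Xv1 Xv2; have v2 : 0 < v.2 by apply: le_lt_trans hv; rewrite divr_ge0.
have ev : eps * `|v.1| < v.2.
  apply: le_lt_trans hv; rewrite mulrC ler_wpM2l//; apply: (le_trans eps64).
  by rewrite lef_pV2 ?posrE// ler_nat.
have h : H X <= H (X + (1 / 2) *: v).
  by apply: (perron_cone Gd); rewrite scaleE /= normrM gtr0_norm// mulrCA ler_wpM2l// ltW.
apply: (le_lt_trans h).
have half1 : 1 / 2 < (1 : R) by lra.
have [|Y GY] := @KH_mvt 0 1 X v (1/2) 1 half1.
  move=> x /andP[x1 x2]; have x0 : 0 < x by lra.
  split.
  - by apply: cone_cl => //; rewrite scaleE /= normrM gtr0_norm// mulrCA ltr_pM2l.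
  - by apply: (@convex_lt4 _ v.1) => //; rewrite x0.
  - apply: le_lt_trans Xv2; rewrite /= lerD2l ler_piMl// ltW//.
rewrite !mul0r !add0r !mul1r scale1r -subr_gt0 => ->; apply: mulr_gt0; last by lra.
have Yp := Hy_gt0 Gd GY; have Yx := Hx_le Gd GY.
have h1 : `|Dx Y * v.1| <= Dy Y * (eps * `|v.1|).
  by rewrite normrM [_ * (eps * _)]mulrCA mulrA ler_wpM2r.
have : Dy Y * (eps * `|v.1|) < Dy Y * v.2 by rewrite ltr_pM2l.
by move: h1; rewrite ler_norml; lra.
Qed.

Definition kbox : set (R * R) := [set X | closure G X /\ (`|X.1| <= 5 / 2 /\ X.2 <= 5 / 2)].
Definition Fb X : R * R := (Kb X, H X).

(** Two distinct points are joined either by a steep segment, along which H increases, or by a tent,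
    along which K is strictly monotone. *)
Lemma Fb_inj X Y : kbox X -> kbox Y -> Fb X = Fb Y -> X = Y.
Proof.
move=> [cX [X1 X2]] [cY [Y1 Y2]] [EK EH].
have cb : c <= 1 by move: c256; lra.
have lX := cl_low cX; have lY := cl_low cY.
have small (Z : R * R) : `|Z.1| <= 5 / 2 -> `|Z.1| < 4 by lra.
have [h|h] := ltP (`|(Y - X).1| / 8) (Y - X).2.
  have := H_up cX h (small _ X1); rewrite addrC subrK EH ltxx => /(_ (small _ Y1)) f.
  by suff : false by []; apply: f; lra.
have [h'|h'] := ltP (`|(X - Y).1| / 8) (X - Y).2.
  have := H_up cY h' (small _ Y1); rewrite addrC subrK EH ltxx => /(_ (small _ X1)) f.
  by suff : false by []; apply: f; lra.
have tent (U W : R * R) : closure G U -> closure G W -> `|U.1| <= 5/2 -> `|W.1| <= 5 / 2 -> U.2 <= 5 / 2 -> W.2 <= 5 / 2 ->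
    U.1 < W.1 -> `|W.2 - U.2| <= (W.1 - U.1) / 8 -> Kb U < Kb W.
  move=> cU cW U1 W1 U2 W2 UW; rewrite ler_norml => /andP[b1 b2].
  (* Horizontal lengths of the two sides of the tent: a + b is the horizontal distance of U and W,
     and (a - b) / 4 their difference of height. *)
  pose a := (W.1 - U.1 + 4 * (W.2 - U.2)) / 2; pose b := (W.1 - U.1 - 4 * (W.2 - U.2)) / 2.
  move: U1 W1; rewrite !ler_norml => /andP[U1 U1'] /andP[W1 W1'].
  have a0 : 0 < a by rewrite /a; lra.
  have b0 : 0 < b by rewrite /b; lra.
  have Ua : (U.1 + 1 * a, U.2 + a / 4) = (W.1 + -1 * b, W.2 + b / 4).
    by congr (_, _); rewrite /a /b; field.
  have t1 : 1 * Kb U < 1 * K (U + (1 * a, a / 4)).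
    by apply: Kb_tent => //; [left|rewrite ltr_norml; lra|rewrite ltr_norml /a; lra|rewrite /a; lra].
  have t2 : -1 * Kb W < -1 * K (W + (-1 * b, b / 4)).
    by apply: Kb_tent => //; [right|rewrite ltr_norml; lra|rewrite ltr_norml /b; lra|rewrite /b; lra].
  by move: t1 t2; rewrite -[U + _]/(U.1 + 1 * a, U.2 + a / 4) Ua -[W + _]/(W.1 + -1 * b, W.2 + b / 4); lra.
move: h h'; rewrite /= [`|X.1 - Y.1|]distrC => h h'.
have b : `|Y.2 - X.2| <= `|Y.1 - X.1| / 8 by rewrite ler_norml; lra.
have [XY|YX|XY] := ltgtP X.1 Y.1.
- have := tent X Y cX cY X1 Y1 X2 Y2 XY; rewrite EK ltxx => f; suff : false by [].
  by apply: f; move: b; rewrite (gtr0_norm (x := Y.1 - X.1)) ?subr_gt0.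
- have := tent Y X cY cX Y1 X1 Y2 X2 YX; rewrite EK ltxx => f; suff : false by [].
  by apply: f; move: b; rewrite distrC (ltr0_norm (x := Y.1 - X.1)) ?subr_lt0// opprB.
- move: b; rewrite XY subrr normr0 mul0r normr_le0 subr_eq0 => /eqP e.
  by rewrite (surjective_pairing X) (surjective_pairing Y) XY e.
Qed.

Lemma H_near X : closure G X -> `|H X - X.2| <= c.
Proof.
have [_ _ c0 _ _] := Gd.
move=> cX; have := perron_le Gd X; have := perron_ge Gd X; have l := cl_low cX.
rewrite ge_max => /andP[_ h1]; rewrite max_r; last lra.
by move=> h2; rewrite ler_norml; lra.
Qed.

(** Going up to height 3 costs eps times an increase of H of at most 4, hence 1/16. Along height 3,
    H is within c of y on unit discs, so H_y is within 8 c <= 1/32 of one. *)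
Lemma Kb_near X : kbox X -> `|Kb X - X.1| <= 1 / 16 + `|X.1| / 32.
Proof.
have [_ /andP[e0 _] c0 _ [up lo]] := Gd.
move=> [cX [X1 X2]].
have G3 (x : R) : G (x, 3) by apply: up => /=; move: c256; lra.
have X4 : `|X.1| < 4 by lra.
have t0 : 0 < 3 - X.2 by lra.
have Xt : X.2 + (3 - X.2) < 4 by lra.
have := Kb_vert cX X4 t0 Xt; rewrite upE (addrC X.2) subrK => h1.
have h2 : eps * (H (X.1, 3) - H X) <= 1 / 16.
  have := H_near (subset_closure (G3 X.1)); rewrite ler_norml /= => /andP[_ h2].
  have : H (X.1, 3) - H X <= 4 by have := perron_ge0 Gd X; move: c256; lra.
  have : 0 <= H (X.1, 3) - H X.
    rewrite subr_ge0; have := @perron_cone _ _ _ _ Gd X (0, 3 - X.2).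
    by rewrite -[X + _]/(X.1 + 0, X.2 + (3 - X.2)) addr0 (addrC X.2) subrK /= normr0 mulr0; apply; lra.
  by move=> p q; have := ler_pM e0 p eps64 q; lra.
have D (x : R) : `|x| < 4 -> `|Dy (x, 3) - 1| <= 1 / 32.
  move=> x4; have sG : ecball (x, 3) 1 `<=` G.
    move=> Y /(le_trans (enorm2 (Y - (x, 3)))); rewrite ler_norml /= => h; apply: up; move: c256; lra.
  have pH := harm_eball (perron_harm Gd) ltr01 sG.
  have [_ /(_ ((0 -i* 1)%C *: 'X) c (ltW c0)) h _] := pa_der_all ltr01 pH.
  have /h : forall Y, eball (x, 3) 1 Y -> `|H Y - rep ((0 -i* 1)%C *: 'X) Y| <= c.
    move=> Y Y1; have GY := sG _ (ltW Y1); have := H_near (subset_closure GY).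
    by rewrite /rep hornerZ hornerX /= mul0r sub0r mulNr mul1r opprK.
  rewrite derivZ derivX hornerZ hornerC mulr1 => /(le_trans (cn_Im _)).
  rewrite /Hy; case: (der H _) => a b /=; rewrite opprK divr1 -normrN opprD => h'.
  by apply: (le_trans h'); move: c256; lra.
have E (x : R) : (0, 3) + x *: e1 = (x, 3) :> R * R.
  by rewrite scaleE mulr0 mulr1 -[LHS]/(0 + x, 3 + 0) addr0 add0r.
pose F (x : R) := K ((0, 3) + x *: e1) - x.
have h3 : `|F X.1 - F 0| <= 1 / 32 * `|X.1 - 0|.
  apply: (@mvt_bound R F (fun x => Dy (x, 3) - 1)).
  move=> t tX; have t4 : `|t| < 4.
    move: X4 tX; rewrite !ltr_norml => /andP[a1 a2] /andP[]; rewrite ge_min le_max => /orP b1 /orP b2.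
    by apply/andP; split; [case: b1; lra|case: b2; lra].
  split; last exact: D.
  have t3 : (t, 3).2 < 4 :> R by rewrite /= ltr_nat.
  have [[d1 E1] _] := @K_dir (t, 3) e1 (G3 t) t4 t3.
  have := @line_derive R K (0, 3) e1 t; rewrite E => /(_ d1); rewrite E1 mulr1 mulr0 subr0 => d2.
  exact: is_deriveB.
rewrite /F !E K03 !subr0 in h3.
have h4 : 1 / 32 * `|X.1| <= `|X.1| / 32 by lra.
move: h1 h2 h3 h4; move: (1 / 32 * _) (eps * _) (`|X.1| / 32).
by move: (K (X.1, 3)) (Kb X); move=> k kb a b d; rewrite !ler_norml; lra.
Qed.

End uniformizer.

Section uniformizer_package.
Context {R : realType}.
Implicit Types (X Y : R * R) (e r t : R).

Lemma der_congr (u v : R * R -> R) X r : 0 < r -> pa u (eball X r) ->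
  (forall Y, eball X r Y -> u Y = v Y) -> der u X = der v X.
Proof.
move=> r0 pu uv; have pv := pa_eq uv pu.
have [_ hu _] := pa_der_all r0 pu; have [_ hv _] := pa_der_all r0 pv.
apply/eqP; rewrite -subr_eq0; apply/negPn/negP => /eqP n0.
have {}n0 : 0 < cn (der u X - der v X).
  by rewrite lt_neqAle cn_ge0 andbT; apply/eqP => /esym/cn_eq0.
pose e : R := r * cn (der u X - der v X) / 32.
have e0 : 0 < e by rewrite divr_gt0// mulr_gt0.
have [p hp] := pu e e0.
have h1 := hu p e (ltW e0) hp.
have h2 : cn (der v X - p^`().[toC X]) <= 8 * e / r.
  by apply: hv (ltW e0) _ => Y Yr; rewrite -uv//; exact: hp.
have : cn (der u X - der v X) <= 8 * e / r + 8 * e / r.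
  have -> : der u X - der v X = (der u X - p^`().[toC X]) - (der v X - p^`().[toC X]).
    by rewrite opprB addrA subrK.
  by apply: le_trans (cnB _ _) _; exact: lerD.
have -> : 8 * e / r = cn (der u X - der v X) / 4 by rewrite /e; field; rewrite gt_eqF.
lra.
Qed.

(* [Fb Kb G c] is the conformal map [k + i H] of the part of [G] near the
   origin onto a half disc, continued to the closure of [G]. *)
Record uniformizer (G : set (R * R)) (c : R) (k : R * R -> R) : Prop := Uniformizer {
  unif_cont : forall X e, kbox G X -> 0 < e ->
    exists2 d : R, 0 < d & forall Y, closure G Y -> eball X d Y -> `|k Y - k X| <= e;
  unif_inj : forall X Y, kbox G X -> kbox G Y -> Fb G c k X = Fb G c k Y -> X = Y;
  unif_near : forall X, kbox G X -> `|k X - X.1| <= 1 / 16 + `|X.1| / 32;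
  unif_ca : forall X, G X -> `|X.1| < 4 -> X.2 < 4 ->
    exists r, [/\ 0 < r, eball X r `<=` G & ca (fun Y => k Y +i* perron G c Y)%C (eball X r)];
  unif_der : forall X, G X -> `|X.1| < 4 -> X.2 < 4 -> der k X = 'i%C * der (perron G c) X }.

Lemma uniformizer_ex (G : set (R * R)) (eps c : R) :
  cone_domain G eps c -> eps <= 64^-1 -> c <= 256^-1 -> exists k, uniformizer G c k.
Proof.
move=> Gd eps64 c256; have c1 : c < 1 by lra.
have [K [K03 Kca Kder]] := K_ex Gd c1.
have [Kb [KbE Kbv]] := Kbar_ex Gd Kca Kder.
exists Kb; split.
- move=> X e [cX [X1 X2]] e0.
  have X4 : `|X.1| < 4 by lra.
  have X4' : X.2 < 4 by lra.
  exact: (Kb_cont Gd eps64 Kca KbE Kbv cX X4 X4' e0).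
- exact: (Fb_inj Gd eps64 c256 Kca Kder KbE Kbv).
- exact: (Kb_near Gd eps64 c256 K03 Kca Kder Kbv).
- move=> X GX X1 X2; have [r [r0 rG cr]] := Kca X GX X1 X2.
  by exists r; split=> //; apply: ca_eq cr => Y /rG GY; rewrite KbE.
- move=> X GX X1 X2; rewrite -Kder//.
  have [r [r0 rG cr]] := Kca X GX X1 X2.
  have pK : pa K (eball X r) by apply: pa_eq (ca_re 1 cr) => Y _; rewrite mul1r.
  by apply/esym; apply: (der_congr r0 pK) => Y /rG GY; rewrite KbE.
Qed.

End uniformizer_package.

(** * Odd reflection *)

Section transport.
Context {R : realType}.
Implicit Types (X Y Z : R * R) (A Q : set (R * R)) (e r M : R).

Definition contw (f : R * R -> R) A := forall X, A X -> forall e, 0 < e ->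
  exists2 d : R, 0 < d & forall Y, A Y -> eball X d Y -> `|f Y - f X| <= e.

Lemma contw_within f A : contw f A -> {within A, continuous f}.
Proof.
move=> h; apply/subspace_continuousP => X AX; apply/cvgrPdist_le => e e0.
have [d d0 hd] := h X AX e e0.
rewrite near_withinE; apply/nbhs_eball; exists d => // Y Yd AY.
by rewrite distrC; exact: hd.
Qed.

Lemma contw_pair (k h : R * R -> R) A : contw k A -> contw h A -> {within A, continuous (fun X => (k X, h X))}.
Proof.
move=> /contw_within/subspace_continuousP hk /contw_within/subspace_continuousP hh.
apply/subspace_continuousP => X AX; exact: (cvg_pair (hk X AX) (hh X AX)).
Qed.

Lemma contwS f A Q : Q `<=` A -> contw f A -> contw f Q.
Proof.
move=> QA h X /QA AX e e0; have [d d0 hd] := h X AX e e0.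
by exists d => // Y /QA; exact: hd.
Qed.

Definition axis : set (R * R) := [set z | z.2 = 0].

Lemma closed_axis : closed axis.
Proof.
move=> X /closureP h; apply/eqP; apply/negPn/negP => n0.
have [|Y Y0 YX] := h `|X.2|; first by rewrite normr_gt0.
have := le_lt_trans (enorm2 (Y - X)) YX.
by rewrite /= Y0 sub0r normrN ltxx.
Qed.

(** An injective continuous map of a compact set is closed, so w carried to the image is continuous,
    and Tietze's theorem extends it with the same bound. The real axis is adjoined with value 0 so
    that an odd extension will be continuous. *)
Lemma transport_ext Q (k h w : R * R -> R) M : compact Q -> contw k Q -> contw h Q -> contw w Q ->
  (forall X Y, Q X -> Q Y -> (k X, h X) = (k Y, h Y) -> X = Y) ->
  (forall X, Q X -> h X = 0 -> w X = 0) -> 0 < M -> (forall X, Q X -> `|w X| <= M) ->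
  exists g : R * R -> R, [/\ continuous g, forall X, Q X -> g (k X, h X) = w X,
    forall z, axis z -> g z = 0 & forall z, `|g z| <= M].
Proof.
move=> cQ ck ch cw inj hw M0 wM; pose F X := (k X, h X).
have cF : {within Q, continuous F} by exact: contw_pair.
have hd : hausdorff_space (R * R)%type by exact: norm_hausdorff.
pose gd z := if pselect (exists2 X, Q X & F X = z) is left p then w (s2val (cid2 p)) else 0.
have gdF X : Q X -> gd (F X) = w X.
  move=> QX; rewrite /gd; case: pselect => [p|]; last by case; exists X.
  by congr w; case: (cid2 p) => Y QY FY /=; exact: inj.
pose A := F @` Q `|` axis.
have clF C : closed C -> closed (F @` (Q `&` w @^-1` C)) .
  move=> cC; have /continuous_closedP/(_ C cC)/closed_subspaceP[V cV VE] := contw_within cw.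
  rewrite [Q `&` _]setIC -VE setIC; apply: (compact_closed hd).
  apply: continuous_compact; first by apply: continuous_subspaceW cF => X [].
  exact: compact_closedI.
have clA : closed A.
  apply: closedU; last exact: closed_axis.
  by have := clF setT closedT; rewrite preimage_setT setIT.
have cg : {within A, continuous gd}.
  apply/continuous_closedP => C cC; apply/closed_subspaceP.
  exists (F @` (Q `&` w @^-1` C) `|` (if pselect (C 0) then axis else set0)).
    by apply: closedU; [exact: clF|case: (pselect (C 0)) => ? /=; [exact: closed_axis|exact: closed0]].
  apply/seteqP; split => z [].
    move=> h1 Az; split=> //; change (C (gd z)).
    case: h1 => [[X [QX wX] <-]|]; first by rewrite gdF.
    case: (pselect (C 0)) => //= C0 z0; rewrite /gd; case: pselect => // p.
    by case: (cid2 p) => X QX /= FX; rewrite hw//; move: z0; rewrite -FX.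
  move=> Cz Az; split=> //; change (C (gd z)) in Cz.
  have [p|np] := pselect (exists2 X, Q X & F X = z).
    by left; case: p => X QX FX; exists X => //; split=> //; change (C (w X)); rewrite -gdF// FX.
  right; case: Az => [[X QX FX]|az]; first by case: np; exists X.
  by move: Cz; rewrite /gd; case: pselect => // ? C0; case: (pselect (C 0)).
have [z Az|g [gE gc gM]] := @continuous_bounded_extension _ R (@pseudometric_normal R (R * R)%type) A clA gd M M0 cg.
  rewrite /gd; case: pselect => [p|_]; last by rewrite normr0 ltW.
  by case: (cid2 p) => X QX _ /=; exact: wM.
exists g; split=> // [X QX|z az].
  by rewrite -gE ?gdF// inE; left; exists X.
rewrite -gE ?inE; last by right.
by rewrite /gd; case: pselect => // p; case: (cid2 p) => X QX /= FX; rewrite hw//; move: az; rewrite -FX.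
Qed.

Definition mirror X : R * R := (X.1, - X.2).

(** The function is g at the upper projection of z minus g at the upper projection of its mirror
    image; one of the two points always lies on the axis, where g vanishes. *)
Lemma odd_ext (g : R * R -> R) M : continuous g -> (forall z, axis z -> g z = 0) -> (forall z, `|g z| <= M) ->
  exists g' : R * R -> R, [/\ continuous g', forall z, g' (mirror z) = - g' z,
    forall z, 0 <= z.2 -> g' z = g z & forall z, `|g' z| <= M].
Proof.
move=> cg g0 gM.
have E1 (z : R * R) : 0 <= z.2 -> (z.1, Num.max z.2 0) = z /\ axis (z.1, Num.max (- z.2) 0).
  by move=> z0; rewrite max_l// -surjective_pairing /axis /= max_r// oppr_le0.
have E2 (z : R * R) : z.2 <= 0 -> axis (z.1, Num.max z.2 0).
  by move=> z0; rewrite /axis /= max_r.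
exists (fun z => g (z.1, Num.max z.2 0) - g (z.1, Num.max (- z.2) 0)); split.
- move=> z; apply/cont_atP => e e0.
  have [d d0 hd] := proj1 (cont_atP g _) (cg (z.1, Num.max z.2 0)) _ (half_pos e0).
  have [d' d'0 hd'] := proj1 (cont_atP g _) (cg (z.1, Num.max (- z.2) 0)) _ (half_pos e0).
  exists (Num.min d d' / 2); first by rewrite half_pos// lt_min d0.
  move=> y; rewrite /eball /= => yz; have m1 : Num.min d d' <= d by rewrite ge_min lexx.
  have m2 : Num.min d d' <= d' by rewrite ge_min lexx orbT.
  have mx (a b : R) : `|Num.max a 0 - Num.max b 0| <= `|a - b|.
    rewrite ler_norml; have := ler_norm (a - b); have := ler_norm (b - a); rewrite [`|b - a|]distrC.
    by case: (leP a 0); case: (leP b 0) => *; apply/andP; split; lra.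
  have n1 := enorm1 (y - z); have n2 := enorm2 (y - z); rewrite /= in n1 n2.
  have m3 := mx y.2 z.2.
  have b1 : eball (z.1, Num.max z.2 0) d (y.1, Num.max y.2 0).
    by rewrite /eball /=; apply: le_lt_trans (enorm_le12 _) _ => /=; lra.
  have b2 : eball (z.1, Num.max (- z.2) 0) d' (y.1, Num.max (- y.2) 0).
    rewrite /eball /=; apply: le_lt_trans (enorm_le12 _) _ => /=.
    by have := mx (- y.2) (- z.2); rewrite -opprD normrN; lra.
  have h1 := hd _ b1; have h2 := hd' _ b2.
  have -> : forall a b c f : R, a - b - (c - f) = (a - c) - (b - f) by move=> *; ring.
  by apply: le_trans (ler_normB _ _) _; lra.
- by move=> z; rewrite /mirror /= opprK opprB.
- by move=> z /E1[-> a0]; rewrite (g0 _ a0) subr0.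
- move=> z; case/orP: (le_total 0 z.2) => z0.
    by have [-> a0] := E1 z z0; rewrite (g0 _ a0) subr0.
  by rewrite (g0 _ (E2 z z0)) sub0r normrN.
Qed.

Lemma pa_mirror (V : R * R -> R) r : pa V (ecball 0 r) -> pa (V \o mirror) (ecball 0 r).
Proof.
move=> pV e e0; have [p hp] := pV e e0; exists (map_poly conjc p) => X Xr.
have -> : rep (map_poly conjc p) X = rep p (mirror X).
  rewrite /rep; have -> : toC X = conjc (toC (mirror X)) by rewrite /toC /mirror /= opprK.
  by rewrite horner_map; case: p.[_].
apply: hp; move: Xr; rewrite /ecball /= !subr0; congr (_ <= _).
by apply/eqP; rewrite -(@eqrXn2 _ 2) ?enorm_ge0// !enorm_sqr /mirror /= sqrrN.
Qed.

(** V plus its reflection is harmonic with zero values on the circle, so V is odd and vanishes on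
    the axis. *)
Lemma odd_disc (g : R * R -> R) r M : 0 < r -> continuous g -> (forall z, g (mirror z) = - g z) ->
  (forall z, `|g z| <= M) ->
  exists V, [/\ pa V (ecball 0 r), forall z, esphere 0 r z -> V z = g z,
    forall z, ecball 0 r z -> `|V z| <= M & forall z, ecball 0 r z -> axis z -> V z = 0].
Proof.
move=> r0 cg og gM; have [|V [pV Vg]] := @dirichlet_disc R 0 r g r0.
  move=> Y _ e e0; have [d d0 hd] := proj1 (cont_atP g Y) (cg Y) e e0.
  by exists d => // Z _; exact: hd.
exists V; split=> // [z zr|z zr az].
  by apply: (pa_max_norm r0 pV) => // Y Ys; rewrite Vg.
have mE Y : enorm (mirror Y) = enorm Y.
  by apply/eqP; rewrite -(@eqrXn2 _ 2) ?enorm_ge0// !enorm_sqr /mirror /= sqrrN.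
have := @pa_max_norm R _ 0 r 0 r0 (paD pV (pa_mirror pV)) _ z zr; rewrite normr_le0 => h.
have /eqP : V z + V (mirror z) == 0.
  apply: h => Y Ys; rewrite /= !Vg ?og ?subrr ?normr0//.
  by move: Ys; rewrite /esphere /= !subr0 mE.
have -> : mirror z = z by rewrite /mirror az oppr0 -az -surjective_pairing.
by move=> h'; lra.
Qed.

End transport.

(** * Composition with holomorphic maps and the chain rule *)

Section composition.
Context {R : realType}.
Implicit Types (X Y Z : R * R) (A : set (R * R)) (e r M : R) (f : R * R -> R[i]) (V k h w : R * R -> R).

Lemma poly_lip (p : {poly R[i]}) M : exists C : R, 0 <= C /\
  forall a b : R[i], cn a <= M -> cn b <= M -> cn p.[a] <= C /\ cn (p.[a] - p.[b]) <= C * cn (a - b).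
Proof.
elim/poly_ind: p => [|p c [C [C0 hC]]].
  by exists 0; split=> // a b _ _; rewrite !horner0 subr0 cn0 mul0r.
have [M0|M0] := ltP M 0.
  exists 0; split=> // a b aM; have := le_trans (cn_ge0 a) aM; lra.
exists (C * M + cn c + C); split; first by rewrite !addr_ge0 ?mulr_ge0 ?cn_ge0.
move=> a b aM bM; have [h1 h2] := hC a b aM bM.
rewrite !hornerMXaddC; split.
  apply: le_trans (cnD _ _) _; rewrite cnM.
  have := ler_pM (cn_ge0 _) (cn_ge0 _) h1 aM; lra.
have -> : p.[a] * a + c - (p.[b] * b + c) = p.[a] * (a - b) + (p.[a] - p.[b]) * b by ring.
apply: le_trans (cnD _ _) _; rewrite !cnM.
have := ler_pM (cn_ge0 _) (cn_ge0 _) h1 (lexx (cn (a - b))).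
have := ler_pM (cn_ge0 _) (cn_ge0 _) h2 bM.
have := mulr_ge0 (cn_ge0 c) (cn_ge0 (a - b)); lra.
Qed.

Lemma ca_poly f A M p : ca f A -> (forall X, A X -> cn (f X) <= M) -> ca (fun X => p.[f X]) A.
Proof.
move=> cf fM e e0; have [C [C0 hC]] := poly_lip p (M + 1).
have C1 : 0 < C + 1 by rewrite ltr_wpDl.
have m0 : 0 < Num.min 1 (e / (C + 1)) by rewrite lt_min ltr01 divr_gt0.
have [q hq] := cf _ m0; exists (p \Po q) => X AX.
rewrite horner_comp; have := hq X AX; rewrite le_min => /andP[h1 h2].
have qM : cn q.[toC X] <= M + 1.
  have -> : q.[toC X] = f X - (f X - q.[toC X]) by rewrite subKr.
  by apply: le_trans (cnB _ _) _; apply: lerD => //; exact: fM.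
have [_ h] := hC (f X) (q.[toC X]) (le_trans (fM X AX) (ler_wpDr ler01 (lexx M))) qM.
apply: (le_trans h); rewrite ler_pdivlMr// in h2.
have := mulr_ge0 C0 (cn_ge0 (f X - q.[toC X])); have := cn_ge0 (f X - q.[toC X]).
by move: h2; rewrite mulrDr mulr1; lra.
Qed.

Lemma ca_cont f X r : 0 < r -> ca f (eball X r) -> forall e, 0 < e ->
  exists2 d : R, 0 < d & d <= r /\ forall Y, eball X d Y -> cn (f Y - f X) <= e.
Proof.
move=> r0 cf e e0; have e3 : 0 < e / 3 by rewrite divr_gt0.
have [p hp] := cf _ e3.
have [C [C0 hC]] := poly_lip p (cn (toC X) + r).
have C1 : 0 < C + 1 by rewrite ltr_wpDl.
exists (Num.min r (e / 3 / (C + 1))); first by rewrite lt_min r0 !divr_gt0.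
split=> [|Y]; first by rewrite ge_min lexx.
rewrite /eball /= lt_min => /andP[Yr Yd].
have Yn : cn (toC Y - toC X) = enorm (Y - X) by rewrite -toCB enormE.
have YM : cn (toC Y) <= cn (toC X) + r.
  have -> : toC Y = toC X + (toC Y - toC X) by rewrite addrC subrK.
  by apply: le_trans (cnD _ _) _; rewrite lerD2l Yn ltW.
have XM : cn (toC X) <= cn (toC X) + r by rewrite lerDl ltW.
have [_ h] := hC _ _ YM XM.
have h1 := hp Y Yr; have h2 := hp X (eball_center X r0).
have -> : f Y - f X = (f Y - p.[toC Y]) + (p.[toC Y] - p.[toC X]) - (f X - p.[toC X]) by ring.
apply: le_trans (cnB _ _) _; apply: le_trans (lerD (cnD _ _) (lexx _)) _.
have h3 : C * cn (toC Y - toC X) <= e / 3.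
  move: Yd; rewrite Yn ltr_pdivlMr// mulrDr mulr1 => Yd.
  by have := enorm_ge0 (Y - X); lra.
lra.
Qed.

Lemma pa_comp V k h X r s Z0 : 0 < r -> ca (fun Y => k Y +i* h Y)%C (eball X r) ->
  pa V (eball Z0 s) -> eball Z0 s (k X, h X) ->
  exists2 r' : R, 0 < r' & pa (fun Y => V (k Y, h Y)) (eball X r').
Proof.
move=> r0 cf pV Xs.
have d0 : 0 < s - enorm ((k X, h X) - Z0) by rewrite subr_gt0.
have [d d1 [dr hd]] := ca_cont r0 cf (half_pos d0); exists d => // e e0.
have E Y : toC (k Y, h Y) = (k Y +i* h Y)%C by [].
have N Y : enorm ((k Y, h Y) - (k X, h X)) = cn ((k Y +i* h Y)%C - (k X +i* h X)%C).
  by rewrite enormE toCB !E.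
have sb Y : eball X d Y -> eball Z0 s (k Y, h Y).
  move=> Yd; have h1 := hd Y Yd; rewrite -N in h1.
  rewrite /eball /=; apply: le_lt_trans (enorm_tri (k X, h X) _ _) _.
  by move: d0; lra.
have [p hp] := pV _ (half_pos e0).
have cs : ca (fun Y => (k Y +i* h Y)%C) (eball X d).
  by apply: caS cf => Y; rewrite /eball /= => /lt_le_trans; apply.
have cM Y : eball X d Y -> cn (k Y +i* h Y)%C <= cn (k X +i* h X)%C + (s - enorm ((k X, h X) - Z0)) / 2.
  move=> Yd; have -> : (k Y +i* h Y)%C = (k X +i* h X)%C + ((k Y +i* h Y)%C - (k X +i* h X)%C).
    by rewrite addrC subrK.
  by apply: le_trans (cnD _ _) _; rewrite lerD2l; exact: hd.
have [q hq] := ca_poly p cs cM (half_pos e0).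
exists q => Y Yd; have h1 := hp _ (sb Y Yd); have h2 := hq Y Yd.
have h3 : `|rep p (k Y, h Y) - rep q Y| <= e / 2.
  by rewrite /rep E -ReB; apply: le_trans (cn_Re _) _.
by move: h1 h3; rewrite !ler_norml; move: (V _) (rep p _) (rep q _) => a b c; lra.
Qed.

Lemma der_comp V k h X r s Z0 : 0 < r -> ca (fun Y => k Y +i* h Y)%C (eball X r) ->
  pa V (eball Z0 s) -> eball Z0 s (k X, h X) ->
  der (fun Y => V (k Y, h Y)) X = der V (k X, h X) * der k X.
Proof.
move=> r0 cf pV Xs; have [r' r'0 pW] := pa_comp r0 cf pV Xs.
have pk : pa k (eball X r) by apply: pa_eq (ca_re 1 cf) => Y _; rewrite mul1r.
have ph : pa h (eball X r).
  by apply: pa_eq (ca_re (- 'i%C) cf) => Y _ /=; rewrite oppr0 mul0r mulN1r sub0r opprK.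
have dh : der h X = - 'i%C * der k X.
  have <- := ca_der (- 'i%C) r0 cf; congr (der _ X); apply/funext => Y.
  by rewrite /= oppr0 mul0r mulN1r sub0r opprK.
set s' := s - enorm ((k X, h X) - Z0); have s'0 : 0 < s' by rewrite subr_gt0.
have pV' : pa V (eball (k X, h X) s').
  by apply: paS pV; apply: eball_sub; rewrite addrC subrK.
have [_ _ TV] := pa_der_all s'0 pV'; have [MV hMV] := pa_bounded pV'.
have [_ _ Tk] := pa_der_all r0 pk; have [Mk hMk] := pa_bounded pk.
have [_ _ Th] := pa_der_all r0 ph; have [Mh hMh] := pa_bounded ph.
have [d1 d10 [d1r hd1]] := ca_cont r0 cf (divr_gt0 s'0 (ltr0n R 4)).
have MV0 : 0 <= MV := le_trans (normr_ge0 _) (hMV _ (eball_center _ s'0)).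
have Mk0 : 0 <= Mk := le_trans (normr_ge0 _) (hMk _ (eball_center _ r0)).
have Mh0 : 0 <= Mh := le_trans (normr_ge0 _) (hMh _ (eball_center _ r0)).
set a := der V (k X, h X); set b := der k X.
have E : toC (k X, h X) = (k X +i* h X)%C by [].
pose C1 : R := 16 * (Mk + Mh) / r ^+ 2.
have C10 : 0 <= C1 by rewrite divr_ge0 ?sqr_ge0// mulr_ge0// addr_ge0.
pose C2 : R := 16 * MV / s' ^+ 2.
have C20 : 0 <= C2 by rewrite divr_ge0 ?sqr_ge0// mulr_ge0.
pose d := Num.min 1 (Num.min (r / 4) (d1 / 2)).
have d0 : 0 < d by rewrite !lt_min ltr01 divr_gt0// half_pos.
have main (v : R * R) : enorm v = 1 -> 'D_v (fun Y => V (k Y, h Y)) X = complex.Re (a * b * toC v).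
  move=> v1; apply: (proj2 (@derive_quad R (fun Y => V (k Y, h Y)) X v _ (cn a * C1 + C2 * (cn b + C1) ^+ 2) d d0 _)) => t td.
  move: (td); rewrite /d !lt_min => /and3P[t1 tr t2].
  set Y := X + t *: v; have YX : Y - X = t *: v by rewrite /Y addrAC subrr add0r.
  have Yn : enorm (Y - X) = `|t| by rewrite YX enormZ v1 mulr1.
  have h1 := Tk Mk hMk Y; have h2 := Th Mh hMh Y.
  rewrite Yn in h1 h2; have {}h1 := h1 (ltW tr); have {}h2 := h2 (ltW tr).
  set D := toC ((k Y, h Y) - (k X, h X)).
  have tv : toC (t *: v) = t%:C%C * toC v by rewrite /toC scaleE; apply/eqP; rewrite eq_complex /= !mul0r subr0 addr0 !eqxx.
  have Dn : enorm ((k Y, h Y) - (k X, h X)) = cn D by rewrite enormE.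
  have h3 : cn (D - b * toC (t *: v)) <= C1 * t ^+ 2.
    apply: le_trans (cn_ReIm _) _.
    have -> : C1 * t ^+ 2 = 16 * Mk * (`|t| / r) ^+ 2 + 16 * Mh * (`|t| / r) ^+ 2.
      by rewrite exprMn real_normK ?num_real// /C1; field; rewrite gt_eqF.
    apply: lerD.
      by move: h1; rewrite YX ReB.
    move: h2; rewrite dh YX -/b; congr (`|_| <= _).
    rewrite /D toCB -[toC (k Y, h Y)]/(k Y +i* h Y)%C -[toC (k X, h X)]/(k X +i* h X)%C.
    by case: (b) (toC _) => x y [x' y'] /=; ring.
  have h4 : cn D <= s' / 4.
    rewrite /D toCB; apply: hd1; rewrite /eball /= Yn; apply: lt_trans t2 _; lra.
  have := TV MV hMV (k Y, h Y); rewrite Dn => /(_ h4) h5.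
  have h6 : cn D <= (cn b + C1) * `|t|.
    have -> : D = b * toC (t *: v) + (D - b * toC (t *: v)) by rewrite addrC subrK.
    apply: le_trans (cnD _ _) _; rewrite cnM -enormE -YX Yn mulrDl lerD2l.
    rewrite YX; apply: (le_trans h3); rewrite ler_wpM2l// -real_normK ?num_real// expr2 ler_piMl//; exact: ltW.
  have h7 : 16 * MV * (cn D / s') ^+ 2 <= C2 * (cn b + C1) ^+ 2 * t ^+ 2.
    have -> : 16 * MV * (cn D / s') ^+ 2 = C2 * (cn D ^+ 2) by rewrite exprMn /C2; field; rewrite gt_eqF.
    rewrite -mulrA ler_wpM2l// -[t ^+ 2]real_normK ?num_real// -exprMn.
    by rewrite ler_pXn2r// nnegrE ?cn_ge0// (le_trans (cn_ge0 D)).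
  have -> : V (k Y, h Y) - V (k X, h X) - t * complex.Re (a * b * toC v) =
     (V (k Y, h Y) - V (k X, h X) - complex.Re (a * D)) + complex.Re (a * (D - b * toC (t *: v))).
    rewrite tv; have -> : t * complex.Re (a * b * toC v) = complex.Re (a * (b * (t%:C%C * toC v))).
      by case: (a) (b) (toC v) => x y [x' y'] [x'' y''] /=; ring.
    by rewrite mulrBr ReB; ring.
  apply: le_trans (ler_normD _ _) _.
  have h8 : `|complex.Re (a * (D - b * toC (t *: v)))| <= cn a * C1 * t ^+ 2.
    by apply: le_trans (cn_Re _) _; rewrite cnM -mulrA ler_wpM2l ?cn_ge0.
  by rewrite mulrDl addrC; apply: lerD => //; exact: le_trans h7.
have m1 := main e1; have m2 := main e2.
rewrite /der m1; last by rewrite /e1 enorm_e1 normr1.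
rewrite m2; last by rewrite /e2 enorm_e2 normr1.
by rewrite toC_e1 toC_e2; case: (a * b) => x y /=; congr (_ +i* _)%C; ring.
Qed.

End composition.

(** * Representation on the flattened disc *)

Section representation.
Context {R : realType}.
Implicit Types (X Y Z : R * R) (A : set (R * R)) (e r M : R).
Context (G : set (R * R)) (eps c : R) (Gd : cone_domain G eps c) (eps64 : eps <= 64^-1) (c256 : c <= 256^-1).
Context (k : R * R -> R) (uk : uniformizer G c k).
Local Notation H := (perron G c).
Local Notation F := (Fb G c k).

Lemma kbox_ball X : kbox G X -> enorm X < 4.
Proof.
move=> [cX [X1 X2]]; have l := cl_low Gd cX.
have h1 : X.1 ^+ 2 <= (5 / 2) ^+ 2 by rewrite -real_normK ?num_real// ler_pXn2r// nnegrE; lra.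
have h2 : X.2 ^+ 2 <= (5 / 2) ^+ 2.
  by rewrite -[X.2 ^+ 2]real_normK ?num_real// ler_pXn2r// ?nnegrE ?ler_norml; move: c256; lra.
rewrite -(@ltr_pXn2r R 2)// ?nnegrE ?enorm_ge0// enorm_sqr; lra.
Qed.

Lemma compact_kbox : compact (kbox G).
Proof.
apply: (@subclosed_compact _ _ (ecball 0 4)); [|exact: compact_ecball|].
  move=> X /closureP cX; have cGX : closure G X.
    apply/closureP => r r0; have [Y [/closureP cY _] YX] := cX _ (half_pos r0).
    have [Z GZ ZY] := cY _ (half_pos r0); exists Z => //.
    by move: ZY YX; rewrite /eball /= => ZY YX; have := enorm_tri Y Z X; lra.
  split=> //; split; rewrite leNgt; apply/negP => h.
    have p : 0 < `|X.1| - 5 / 2 by rewrite subr_gt0.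
    have [Y [_ [Y1 _]] YX] := cX _ p; have := le_lt_trans (enorm1 (Y - X)) YX; rewrite /= => n.
    have : `|X.1| <= `|Y.1| + `|Y.1 - X.1|.
      have -> : X.1 = Y.1 - (Y.1 - X.1) by rewrite subKr.
      by apply: le_trans (ler_normB _ _) _; rewrite subKr.
    lra.
  have p : 0 < X.2 - 5 / 2 by rewrite subr_gt0.
  have [Y [_ [_ Y2]] YX] := cX _ p; have := le_lt_trans (enorm2 (Y - X)) YX; rewrite /= ltr_norml; lra.
by move=> X /kbox_ball; rewrite /ecball /= subr0 => /ltW.
Qed.

Lemma perron_gt0 X : G X -> 0 < H X.
Proof.
move=> GX; have [r [r0 r1 rG _]] := perron_ball Gd GX.
pose t := r / 2; have t0 : 0 < t by exact: half_pos.
pose Y := X + (- t) *: e2.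
have E (x : R) : Y + x *: (t *: e2) = X + ((x - 1) * t) *: e2.
  by rewrite /Y -addrA scalerA -scalerDl; congr (_ + _ *: _); ring.
have [|x x01] := @line_MVT R H Y (t *: e2) (fun x => t * Hy G c (X + ((x - 1) * t) *: e2)).
  move=> x x01; rewrite E; have xt : `|(x - 1) * t| < r.
    rewrite normrM (gtr0_norm t0); apply: (@le_lt_trans _ _ (1 * t)); last by rewrite /t; lra.
    by rewrite ler_wpM2r ?(ltW t0)// ler_norml; lra.
  have GZ : G (X + ((x - 1) * t) *: e2).
    by apply: rG; rewrite /eball /= addrAC subrr add0r enormZ /e2 enorm_e2 normr1 mulr1.
  have [s [s0 _ _ pH]] := perron_ball Gd GZ; have [d1 ->] := pa_dir (t *: e2) s0 pH.
  by split=> //; rewrite Re_mulE (scaleE t e2) /Hy; case: (der H (X + _)) => a b /=; ring.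
have -> : Y + t *: e2 = X by rewrite /Y -addrA -scalerDl addNr scale0r addr0.
move=> h; have := perron_ge0 Gd Y; suff : 0 < H X - H Y by lra.
rewrite h mulr_gt0// (Hy_gt0 Gd)//.
apply: rG; rewrite /eball /= addrAC subrr add0r enormZ /e2 enorm_e2 normr1 mulr1.
case/andP: x01 => x0 x1; rewrite normrM (gtr0_norm t0); apply: (@le_lt_trans _ _ (1 * t)); last by rewrite /t; lra.
by rewrite ler_wpM2r ?(ltW t0)// ler_norml; lra.
Qed.

Lemma Fk_cont X e : kbox G X -> 0 < e ->
  exists2 d : R, 0 < d & forall Y, closure G Y -> eball X d Y -> enorm (F Y - F X) <= e.
Proof.
move=> kX e0; have [d d0 hd] := unif_cont uk kX (half_pos e0).
have [d' d'0 hd'] := proj1 (cont_atP H X) (perron_cont Gd (x := X)) _ (half_pos e0).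
exists (Num.min d d'); first by rewrite lt_min d0.
move=> Y cY; rewrite /eball /= lt_min => /andP[h1 h2].
apply: le_trans (enorm_le12 _) _ => /=.
by have := hd Y cY h1; have := hd' Y h2; lra.
Qed.

(** The artificial sides of [kbox] are mapped outside the disc of radius 2. Hence the domain on
    which the representation is proved ends only at the true boundary and at the preimage of the
    circle. *)
Lemma F_edge X : kbox G X -> enorm (F X) <= 2 -> `|X.1| < 5 / 2 /\ X.2 < 5 / 2.
Proof.
move=> kX FX; have [cX [X1 X2]] := kX.
have n := unif_near uk kX.
have a1 := le_trans (enorm1 (F X)) FX; have a2 := le_trans (enorm2 (F X)) FX; rewrite /= in a1 a2.
have b := H_near Gd cX; split.
  rewrite lt_neqAle X1 andbT; apply/negP => /eqP E.
  have : `|X.1| <= `|k X - X.1| + `|k X|.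
    by rewrite addrC; have := ler_normB (k X) (k X - X.1); rewrite subKr.
  rewrite E in n *; lra.
rewrite ltNge; apply/negP => h.
by move: a2 b; rewrite !ler_norml; move: c256; lra.
Qed.

(** V solves the Dirichlet problem with the odd extension of the values of w carried to the circle
    of radius 2. Then w and V composed with F agree wherever the preimage of the disc ends, and
    inside it by the maximum principle. *)
Lemma half_disc_rep (w : R * R -> R) M : 0 < M ->
  (forall X, eball 0 4 X -> {for X, continuous w}) ->
  (forall X, eball 0 4 X -> ~ G X -> w X = 0) -> harm w (G `&` eball 0 4) ->
  (forall X, eball 0 4 X -> `|w X| <= M) ->
  exists V, [/\ pa V (ecball 0 2), forall z, ecball 0 2 z -> `|V z| <= M,
    forall z, ecball 0 2 z -> axis z -> V z = 0 &
    forall X, kbox G X -> enorm (F X) < 2 -> w X = V (F X)].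
Proof.
move=> M0 wc w0 wh wM; have [oG _ _ _ _] := Gd.
have b4 X : kbox G X -> eball 0 4 X by move=> /kbox_ball; rewrite /eball /= subr0.
have HG X : H X = 0 -> ~ G X by move=> H0 /perron_gt0; rewrite H0 ltxx.
have kcl : kbox G `<=` closure G by move=> X [].
have cN : contw (fun X => enorm (F X)) (kbox G).
  move=> X kX e e0; have [d d0 hd] := Fk_cont kX e0; exists d => // Y /kcl cY Yd.
  apply: le_trans (hd Y cY Yd); rewrite ler_norml; apply/andP; split.
    by have := enorm_tri (F Y) (F X) 0; rewrite !subr0 enormC; lra.
  by have := enorm_tri (F X) (F Y) 0; rewrite !subr0; lra.
pose Q := kbox G `&` [set X | enorm (F X) = 2].
have Qk : Q `<=` kbox G by move=> X [].
have cQ : compact Q.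
  have /continuous_closedP/(_ [set 2])/(_ _)/closed_subspaceP := contw_within cN.
  case; first exact: closed_eq.
  move=> V cV VE; have -> : Q = kbox G `&` V.
    by rewrite setIC VE setIC; apply/seteqP; split.
  exact: compact_closedI compact_kbox cV.
have ck : contw k (kbox G).
  move=> X kX e e0; have [d d0 hd] := unif_cont uk kX e0.
  by exists d => // Y /kcl cY; exact: hd.
have cH : contw H (kbox G).
  move=> X kX e e0; have [d d0 hd] := proj1 (cont_atP H X) (perron_cont Gd (x := X)) e e0.
  by exists d => // Y _; exact: hd.
have cw : contw w (kbox G).
  move=> X kX e e0; have [d d0 hd] := proj1 (cont_atP w X) (wc X (b4 X kX)) e e0.
  by exists d => // Y _; exact: hd.
have inj X Y : Q X -> Q Y -> (k X, H X) = (k Y, H Y) -> X = Y.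
  by move=> [kX _] [kY _]; exact: (unif_inj uk kX kY).
have hw X : Q X -> H X = 0 -> w X = 0 by move=> [/b4 X4 _] /HG; exact: w0.
have wQ X : Q X -> `|w X| <= M by move=> [/b4 X4 _]; exact: wM.
have [g [gc gE ga gM]] := transport_ext cQ (contwS Qk ck) (contwS Qk cH) (contwS Qk cw) inj hw M0 wQ.
have [g' [gc' go gp gM']] := odd_ext gc ga gM.
have [V [pV Vs VM Va]] := @odd_disc R g' 2 M (ltr0n R 2) gc' go gM'.
exists V; split=> // X0 kX0 FX0.
pose W := [set X | [/\ G X, `|X.1| < 5 / 2 /\ X.2 < 5 / 2 & enorm (F X) < 2]].
have Wk : W `<=` kbox G by move=> X [GX [X1 X2] _]; split; [exact: subset_closure|split; exact: ltW].
have cl2 X : closure W X -> kbox G X /\ enorm (F X) <= 2.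
  move=> cX; have kX : kbox G X.
    have /closure_id -> : closed (kbox G) by apply: compact_closed; [exact: norm_hausdorff|exact: compact_kbox].
    exact: closureS cX.
  split=> //; apply/ler_addgt0Pr => e e0; have [d d0 hd] := cN X kX e e0.
  have [Y WY YX] := proj1 (closureP W X) cX d d0.
  have := hd Y (Wk _ WY) YX; case: WY => _ _ FY; rewrite ler_norml; lra.
have F2 X : enorm (F X) <= 2 -> ecball 0 2 (F X) by rewrite /ecball /= subr0.
have bd X : kbox G X -> enorm (F X) <= 2 -> ~ W X -> w X = V (F X).
  move=> kX FX nW; have [GX|nG] := pselect (G X); last first.
    rewrite w0//; last exact: b4.
    by rewrite Va//; [exact: F2|rewrite /axis /= (perron_out Gd nG)].
  have [X1 X2] := F_edge kX FX.
  have FX2 : enorm (F X) = 2.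
    by apply/eqP; rewrite eq_le FX /= leNgt; apply/negP => h; apply: nW.
  rewrite Vs; last by rewrite /esphere /= subr0.
  by rewrite gp ?(perron_ge0 Gd)// gE.
have oW : open W.
  apply/openP => X [GX [X1 X2] FX]; have [r [r0 r1 rG _]] := perron_ball Gd GX.
  have kX : kbox G X by apply: Wk.
  have d0 : 0 < (2 - enorm (F X)) / 2 by apply: half_pos; rewrite subr_gt0.
  have [d d1 hd] := cN X kX _ d0.
  exists (Num.min (Num.min r d) (Num.min (5 / 2 - `|X.1|) (5 / 2 - X.2))); first by rewrite !lt_min r0 d1 !subr_gt0 X1.
  move=> Y; rewrite /eball /= !lt_min => /andP[/andP[Yr Yd] /andP[Y1 Y2]].
  have GY := rG _ Yr.
  have m1 := enorm1 (Y - X); have m2 := enorm2 (Y - X); rewrite /= in m1 m2.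
  have Y1' : `|Y.1| < 5 / 2.
    have -> : Y.1 = X.1 + (Y.1 - X.1) by rewrite addrC subrK.
    by apply: le_lt_trans (ler_normD _ _) _; lra.
  have Y2' : Y.2 < 5 / 2 by have := ler_norm (Y.2 - X.2); lra.
  have kY : kbox G Y by split; [exact: subset_closure|split; exact: ltW].
  by split=> //; have := hd Y kY Yd; move: d0; rewrite ler_norml; lra.
have hVF : harm (fun X => V (F X)) W.
  move=> X [GX [X1 X2] FX].
  have X1' : `|X.1| < 4 by lra.
  have X2' : X.2 < 4 by lra.
  have [r [r0 rG cr]] := unif_ca uk GX X1' X2'.
  have [|r' r'0 pr] := @pa_comp R V k H X r 2 0 r0 cr (paS (@eball_ecball R 0 2) pV).
    by rewrite /eball /= subr0.
  by exists r'.
have hw' : harm w W.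
  by apply: harmS wh => X WX; split; [case: WX|apply: b4; exact: Wk].
have hz := harmB hw' hVF; have hz' := harmB hVF hw'.
have lim (s : R) X : s = 1 \/ s = -1 -> ~ W X -> forall e, 0 < e -> exists2 d : R, 0 < d &
    forall Y, W Y -> eball X d Y -> s * (w Y - V (F Y)) <= e.
  move=> hs nW e e0; have [cX|ncX] := pselect (closure W X); last first.
    move: ncX => /closureP/existsNP[d /not_implyP[d0 hd]]; exists d => // Y WY YX.
    by case: hd; exists Y.
  have [kX FX] := cl2 X cX; have E := bd X kX FX nW.
  have e2 := half_pos e0.
  have [d1 d10 hd1] := cw X kX _ e2.
  have [d2 d20 hd2] := pa_contw pV (F2 X FX) e2.
  have [d3 d30 hd3] := Fk_cont kX (half_pos d20).
  exists (Num.min d1 d3); first by rewrite lt_min d10.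
  move=> Y WY; rewrite /eball /= lt_min => /andP[Y1 Y3].
  have kY := Wk _ WY; have h1 := hd1 Y kY Y1.
  have FY2 : ecball 0 2 (F Y) by apply: F2; case: WY => _ _ /ltW.
  have h2 := hd2 (F Y) FY2; have {}h2 : `|V (F Y) - V (F X)| <= e / 2.
    by apply: h2; rewrite /eball /=; have := hd3 Y (kcl _ kY) Y3; lra.
  have s1 : `|s| = 1 by case: hs => ->; rewrite ?normrN normr1.
  apply: le_trans (ler_norm _) _; rewrite normrM s1 mul1r.
  have -> : w Y - V (F Y) = (w Y - w X) - (V (F Y) - V (F X)) by rewrite E; ring.
  by apply: le_trans (ler_normB _ _) _; lra.
have Wb : W `<=` eball 0 4 by move=> X /Wk/b4.
have [WX0|nW] := pselect (W X0); last by apply: bd => //; exact: ltW.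
apply/eqP; rewrite eq_le; apply/andP; split; rewrite -subr_le0.
  apply: (@max_principle R W (fun X => w X - V (F X)) 0 4 oW Wb) => // X.
  - exact: harm_cont hz.
  - by move=> WX; have [] := harm_sub hz WX.
  - move=> nW e e0; have [|d d0 hd] := lim 1 X _ nW e e0; first by left.
    by exists d => // Y WY YX; have := hd Y WY YX; rewrite mul1r.
apply: (@max_principle R W (fun X => V (F X) - w X) 0 4 oW Wb) => // X.
- exact: harm_cont hz'.
- by move=> WX; have [] := harm_sub hz' WX.
- move=> nW e e0; have [|d d0 hd] := lim (-1) X _ nW e e0; first by right.
  by exists d => // Y WY YX; have := hd Y WY YX; rewrite mulN1r opprB.
Qed.

End representation.

(** * Counting zeros *)

Section zeros.
Context {R : realType}.
Implicit Types (X Y Z : R * R) (e r M B d : R) (p q h L : {poly R[i]}) (zs : seq R[i]).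

(** Newton interpolation. The constant depends on the nodes, which is harmless: d will be an
    approximation error tending to zero while the nodes stay fixed. *)
Lemma interp zs : uniq zs -> (forall z, z \in zs -> cn z <= 1) -> exists C : R, 0 <= C /\
  forall p d, 0 <= d -> (forall z, z \in zs -> cn p.[z] <= d) ->
  exists L, (forall z, z \in zs -> L.[z] = p.[z]) /\ forall x, cn x <= 1 -> cn L.[x] <= C * d.
Proof.
elim: zs => [|z zs IH] /=.
  by move=> _ _; exists 0; split=> // p d d0 _; exists 0; split=> // x _; rewrite horner0 cn0 mul0r.
move=> /andP[zn uz] z1; have [|C [C0 hC]] := IH uz.
  by move=> y yz; apply: z1; rewrite inE yz orbT.
pose P := \prod_(a <- zs) ('X - a%:P).
have P2 x : cn x <= 1 -> cn P.[x] <= 2 ^+ size zs.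
  move=> x1; rewrite /P; elim: zs {IH zn uz P hC} z1 => [|a s IHs] z1.
    by rewrite big_nil hornerC cn1.
  rewrite big_cons hornerM hornerXsubC cnM exprS; apply: ler_pM; rewrite ?cn_ge0//.
    apply: le_trans (cnB _ _) _; have := z1 a; rewrite !inE eqxx orbT => /(_ isT); lra.
  apply: IHs => y; rewrite !inE => /orP[/eqP ->|ys]; apply: z1; rewrite !inE ?eqxx// ys !orbT//.
have Pz : P.[z] != 0 by rewrite /P -/(root _ z) root_prod_XsubC.
have cPz : 0 < cn P.[z] by rewrite cn_gt0.
exists (C + (1 + C) / cn P.[z] * 2 ^+ size zs); split.
  by rewrite addr_ge0// mulr_ge0 ?exprn_ge0// divr_ge0 ?cn_ge0// addr_ge0.
move=> p d d0 hp; have [|L [hL LC]] := hC p d d0.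
  by move=> y yz; apply: hp; rewrite inE yz orbT.
exists (L + ((p.[z] - L.[z]) / P.[z]) *: P); split.
  move=> y; rewrite inE => /orP[/eqP ->|yz]; rewrite hornerD hornerZ.
    by rewrite divfK// addrC subrK.
  have /eqP -> : P.[y] == 0 by rewrite /P -/(root _ y) root_prod_XsubC.
  by rewrite mulr0 addr0 hL.
move=> x x1; rewrite hornerD hornerZ; apply: le_trans (cnD _ _) _; rewrite !cnM cnV.
rewrite [leRHS]mulrDl; apply: lerD; first exact: LC.
have h1 : cn (p.[z] - L.[z]) <= (1 + C) * d.
  apply: le_trans (cnB _ _) _; rewrite mulrDl mul1r; apply: lerD; first by apply: hp; rewrite inE eqxx.
  by apply: LC; apply: z1; rewrite inE eqxx.
have -> : (1 + C) / cn P.[z] * 2 ^+ size zs * d = ((1 + C) * d / cn P.[z]) * 2 ^+ size zs by ring.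
apply: ler_pM; rewrite ?cn_ge0 ?P2//; first by rewrite divr_ge0 ?cn_ge0.
by rewrite ler_pM2r ?invr_gt0.
Qed.

Lemma poly_max h r M : 0 < r -> (forall x, cn x = r -> cn h.[x] <= M) ->
  forall x, cn x <= r -> cn h.[x] <= M.
Proof.
move=> r0 hM x xr; have [->|n0] := eqVneq h.[x] 0.
  rewrite cn0; have := hM (r%:C)%C; rewrite cn_real gtr0_norm// => /(_ erefl); exact: le_trans (cn_ge0 _).
pose a := conjc h.[x] / ((cn h.[x])%:C)%C.
have a1 : cn a = 1.
  by rewrite /a cnM cnV cn_conj cn_real ger0_norm ?cn_ge0// divff// gt_eqF// cn_gt0.
have c2 : complex.Re (a * h.[x]) = cn h.[x].
  have -> : a * h.[x] = ((cn h.[x])%:C)%C.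
    rewrite /a mulrAC; have -> : conjc h.[x] * h.[x] = ((cn h.[x] ^+ 2)%:C)%C.
      rewrite cnE sqr_sqrtr ?addr_ge0 ?sqr_ge0//; case: (h.[x]) => u v.
      by apply/eqP; rewrite eq_complex /=; apply/andP; split; apply/eqP; ring.
    rewrite expr2 rmorphM /= mulfK//; apply/eqP => /(congr1 cn); rewrite cn0 cn_real ger0_norm ?cn_ge0//.
    by move/cn_eq0/eqP; exact/negP.
  by [].
have := @rep_max R (a *: h) 0 r M r0 _ (ofC x); rewrite /rep ofCK hornerZ c2; apply.
  move=> Y; rewrite /esphere /= subr0 enormE => Yr; rewrite hornerZ.
  apply: le_trans (ler_norm _) _; apply: le_trans (cn_Re _) _.
  by rewrite cnM a1 mul1r; exact: hM.
by rewrite /ecball /= subr0 enormE ofCK.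
Qed.

(* After subtracting the interpolation polynomial at the zeros, approximating
   polynomials are divisible by the product of the [X - z]. *)
Lemma zero_count (f : R * R -> R[i]) B (zs : seq (R * R)) : uniq zs ->
  (forall z, z \in zs -> enorm z <= 1 / 5) -> (forall z, z \in zs -> f z = 0) ->
  ca f (eball 0 1) -> (forall X, eball 0 1 X -> cn (f X) <= B) ->
  forall X, enorm X <= 1 / 5 -> cn (f X) <= (4 / 7) ^+ size zs * B.
Proof.
move=> uz z5 fz cf fB X X5; have [|z z1|C [C0 hC]] := @interp [seq toC z | z <- zs].
- by rewrite map_inj_uniq//; exact: (can_inj (@toCK R)).
- case/mapP: z1 => y yz ->; rewrite -enormE; have := z5 y yz; lra.
have inb (Y : R * R) : enorm Y < 1 -> eball 0 1 Y by rewrite /eball /= subr0.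
have B0 : 0 <= B := le_trans (cn_ge0 _) (fB 0 (eball_center 0 ltr01)).
have K0 : 0 < (1 + C) * 2 by rewrite mulr_gt0// ltr_pwDl.
apply/ler_addgt0Pr => e e0; have d0 := divr_gt0 e0 K0; set d := e / _ in d0.
have [p hp] := cf d d0.
have [|L [hL LC]] := hC p d (ltW d0).
  move=> _ /mapP[z zz ->]; have := hp z; rewrite fz// sub0r cnN; apply.
  by apply: inb; have := z5 z zz; lra.
set m := size zs.
have [q qE] : exists q, p - L = q * \prod_(a <- [seq toC z | z <- zs]) ('X - a%:P).
  apply: uniq_roots_prod_XsubC.
    by apply/allP => a az; rewrite /root hornerD hornerN hL// subrr.
  rewrite uniq_rootsE map_inj_uniq//; exact: (can_inj (@toCK R)).
rewrite big_map in qE.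
(* Each factor is at least 9/10 - 1/5 on the circle of radius 9/10 and at most 1/5 + 1/5 on the disc
   of radius 1/5; the quotient 4/7 is the gain per zero. *)
have lo x : cn x = 9 / 10 -> (7 / 10) ^+ m <= cn (\prod_(a <- zs) ('X - (toC a)%:P)).[x].
  move=> x9; rewrite /m; elim: zs z5 {uz fz hC hL m qE} => [|a s IH] z5.
    by rewrite big_nil expr0 hornerC cn1.
  have c7 : 0 <= 7 / 10 :> R by lra.
  rewrite [size _]/= big_cons hornerM hornerXsubC cnM exprS; apply: ler_pM => //.
  - have := z5 a; rewrite inE eqxx enormE => /(_ isT).
    have := cnD (x - toC a) (toC a); rewrite subrK x9; lra.
  - by apply: IH => z zz; apply: z5; rewrite inE zz orbT.
have hi x : cn x <= 1 / 5 -> cn (\prod_(a <- zs) ('X - (toC a)%:P)).[x] <= (2 / 5) ^+ m.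
  move=> x5; rewrite /m; elim: zs z5 {uz fz hC hL m qE lo} => [|a s IH] z5.
    by rewrite big_nil expr0 hornerC cn1.
  rewrite big_cons hornerM hornerXsubC cnM exprS; apply: ler_pM; rewrite ?cn_ge0//.
  - apply: le_trans (cnB _ _) _; have := z5 a; rewrite inE eqxx enormE => /(_ isT); lra.
  - by apply: IH => z zz; apply: z5; rewrite inE zz orbT.
have p7 : 0 < (7 / 10) ^+ m :> R by rewrite exprn_gt0//; lra.
have qb x : cn x = 9 / 10 -> cn q.[x] <= (B + (1 + C) * d) / (7 / 10) ^+ m.
  move=> x9; rewrite ler_pdivlMr//; apply: le_trans (ler_wpM2l (cn_ge0 _) (lo x x9)) _.
  rewrite -cnM -hornerM -qE hornerD hornerN.
  have x1 : cn x <= 1 by rewrite x9; lra.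
  apply: le_trans (cnB _ _) _; have := LC x x1.
  have xb : eball 0 1 (ofC x) by apply: inb; rewrite enormE ofCK x9; lra.
  have := hp _ xb; have := fB _ xb; rewrite ofCK.
  have : cn p.[x] <= cn (f (ofC x)) + cn (f (ofC x) - p.[x]).
    by have := cnB (f (ofC x)) (f (ofC x) - p.[x]); rewrite subKr.
  by rewrite mulrDl mul1r; lra.
have c9 : 0 < 9 / 10 :> R by lra.
have X9 : cn (toC X) <= 9 / 10 by rewrite -enormE; lra.
have h1 := poly_max c9 qb X9.
have X5' : cn (toC X) <= 1 / 5 by rewrite -enormE.
have h2 : cn (p - L).[toC X] <= (4 / 7) ^+ m * (B + (1 + C) * d).
  rewrite qE hornerM cnM; apply: le_trans (ler_pM (cn_ge0 _) (cn_ge0 _) h1 (hi _ X5')) _.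
  have -> : 4 / 7 = (2 / 5) / (7 / 10) :> R by field.
  rewrite [X in _ <= X * _]expr_div_n; move: (_ ^+ m) (_ ^+ m) (B + _) => a b c.
  by have -> : c / b * a = a / b * c by ring.
have X1 : cn (toC X) <= 1 by rewrite -enormE; lra.
have h3 := LC _ X1.
have h4 : cn (f X - p.[toC X]) <= d by apply: hp; apply: inb; lra.
have -> : f X = (f X - p.[toC X]) + (p - L).[toC X] + L.[toC X].
  by rewrite hornerD hornerN; ring.
apply: le_trans (cnD _ _) _; apply: le_trans (lerD (cnD _ _) (lexx _)) _.
have h5 : (4 / 7) ^+ m <= 1 :> R by rewrite exprn_ile1//; lra.
have dE : d * ((1 + C) * 2) = e by rewrite /d divfK// gt_eqF.
have : (4 / 7) ^+ m * ((1 + C) * d) <= (1 + C) * d.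
  by rewrite ler_piMl// mulr_ge0 ?(ltW d0)// addr_ge0.
by rewrite mulrDr in h2; lra.
Qed.

End zeros.

(** * Counting critical points up to the boundary *)

Section boundary_count.
Context {R : realType}.
Implicit Types (X Y Z : R * R) (A : set (R * R)) (e r M t d mu : R).
Context (G : set (R * R)) (eps c : R) (Gd : cone_domain G eps c) (eps64 : eps <= 64^-1) (c256 : c <= 256^-1).
Local Notation H := (perron G c).

Lemma perron_mvt X t : G X -> 0 < t ->
  exists2 s : R, 0 <= s <= t & H (X + t *: e2) - H X = t * Hy G c (X + s *: e2).
Proof.
move=> GX t0; have E (x : R) : X + x *: (t *: e2) = X + (x * t) *: e2 by rewrite scalerA.
have [|x x01 h] := @line_MVT R H X (t *: e2) (fun x => t * Hy G c (X + (x * t) *: e2)).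
  move=> x x01; rewrite E; have GZ : G (X + (x * t) *: e2).
    by apply: (cone_up Gd GX); rewrite upE//= lerDl mulr_ge0 ?(ltW t0)//; case/andP: x01.
  have [s [s0 _ _ pH]] := perron_ball Gd GZ; have [d1 ->] := pa_dir (t *: e2) s0 pH.
  by split=> //; rewrite Re_mulE (scaleE t e2) /Hy; case: (der H (X + _)) => a b /=; ring.
exists (x * t) => //; case/andP: x01 => x0 x1.
by rewrite mulr_ge0 ?(ltW t0) ?(ltW x0)//= ler_piMl ?(ltW t0) ?(ltW x1).
Qed.

(** Linear growth is asked along some heights tending to 0 only, which is what an iteration over
    scales produces. *)
Definition hopf X : Prop := exists2 a : R, 0 < a &
  forall d, 0 < d -> exists2 t : R, 0 < t < d & a * t <= H (X + t *: e2).

(** The mean value theorem between heights t' and t, with t' so small that H is still at most a t /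
    2 there; it moves the Hopf bound to interior points, where derivatives exist. *)
Lemma hopf_der X : closure G X -> ~ G X -> hopf X -> exists2 a : R, 0 < a &
  forall d, 0 < d -> exists2 Y, G Y /\ eball X d Y & a <= Hy G c Y.
Proof.
move=> cX nX [a a0 ha]; exists (a / 2); first exact: half_pos.
move=> d d0; have [t /andP[t0 td] ht] := ha d d0.
have HX : H X = 0 := perron_out Gd nX.
have at2 : 0 < a * t / 2 by rewrite half_pos// mulr_gt0.
have [d' d'0 hd'] := proj1 (cont_atP H X) (perron_cont Gd (x := X)) _ at2.
pose t' := Num.min (t / 2) (d' / 2).
have t'0 : 0 < t' by rewrite lt_min !half_pos.
have t't : t' <= t / 2 by rewrite ge_min lexx.
have t'd : t' <= d' / 2 by rewrite ge_min lexx orbT.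
have N (s : R) : 0 <= s -> enorm (X + s *: e2 - X) = s.
  by move=> s0; rewrite addrAC subrr add0r enormZ /e2 enorm_e2 normr1 mulr1 ger0_norm.
have Ht' : H (X + t' *: e2) <= a * t / 2.
  have := hd' (X + t' *: e2); rewrite HX subr0 => h; apply: le_trans (ler_norm _) (h _).
  by rewrite /eball /= N ?ltW//; lra.
have tt : 0 < t - t' by lra.
have [s /andP[s0 st]] := perron_mvt (cl_upe Gd cX t'0) tt.
rewrite -!addrA -!scalerDl [t' + (t - t')]addrC subrK => E.
exists (X + (t' + s) *: e2).
  by split; [apply: (cl_upe Gd cX); lra|rewrite /eball /= N; lra].
rewrite leNgt; apply/negP => h.
have : (t - t') * Hy G c (X + (t' + s) *: e2) < (t - t') * (a / 2) by rewrite ltr_pM2l.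
have : 0 < t' * a by rewrite mulr_gt0.
lra.
Qed.

Definition crit_at (w : R * R -> R) A X : Prop := forall e, 0 < e -> exists2 d : R, 0 < d &
  forall Y, A Y -> eball X d Y -> cn (der w Y) <= e.

(* In the flattening coordinates [w] extends to an odd, hence harmonic,
   function across the real axis, and its critical points become zeros of a
   holomorphic function; on the boundary this uses that the flattening map has
   a nonvanishing derivative there. *)
Lemma boundary_count (w : R * R -> R) M mu (s : seq (R * R)) : 0 < M ->
  (forall X, eball 0 4 X -> {for X, continuous w}) ->
  (forall X, eball 0 4 X -> ~ G X -> w X = 0) -> harm w (G `&` eball 0 4) ->
  (forall X, eball 0 4 X -> `|w X| <= M) ->
  (exists Y, [/\ G Y, enorm Y <= 1 / 16 & mu <= `|w Y|]) ->
  uniq s -> (forall X, X \in s -> [/\ closure G X, enorm X <= 1 / 16, crit_at w G X & ~ G X -> hopf X]) ->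
  mu <= (4 / 7) ^+ size s * (8 * M).
Proof.
move=> M0 wc w0 wh wM [Y0 [GY0 Y0n wY0]] us hs.
have [oG _ c0 _ _] := Gd.
have [k uk] := uniformizer_ex Gd eps64 c256.
have [V [pV VM V0 VE]] := half_disc_rep Gd c256 uk M0 wc w0 wh wM.
have kb X : closure G X -> enorm X < 1 / 8 -> kbox G X.
  by move=> cX Xn; split=> //; have := enorm1 X; have := enorm2 X; rewrite ler_norml; split; lra.
pose F := Fb G c k.
have Fn X : closure G X -> enorm X < 1 / 8 -> enorm (F X) <= 1 / 16 + `|X.1| / 32 + `|X.1| + c + `|X.2|.
  move=> cX Xn; have kX : kbox G X by exact: kb.
  have n1 := unif_near uk kX; have n2 := H_near Gd cX.
  apply: le_trans (enorm_le12 _) _ => /=.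
  have a1 : `|k X| <= `|k X - X.1| + `|X.1|.
    by have := ler_normD (k X - X.1) X.1; rewrite subrK.
  have a2 : `|H X| <= `|H X - X.2| + `|X.2|.
    by have := ler_normD (H X - X.2) X.2; rewrite subrK.
  lra.
have F5 X : closure G X -> enorm X <= 1 / 16 -> enorm (F X) <= 1 / 5.
  move=> cX Xn; have Xn' : enorm X < 1 / 8 by lra.
  by have := Fn X cX Xn'; have := enorm1 X; have := enorm2 X; move: c256; lra.
have F2 X : closure G X -> enorm X < 1 / 8 -> enorm (F X) < 1 / 2.
  by move=> cX Xn; have := Fn X cX Xn; have := enorm1 X; have := enorm2 X; move: c256; lra.
have pV' : pa V (eball 0 2) by exact: paS (@eball_ecball R 0 2) pV.
pose f := der V.
have cf : ca f (eball 0 1).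
  by have := der_ca (ltr0n R 2) pV'; rewrite divff.
have fB X : eball 0 1 X -> cn (f X) <= 8 * M.
  move=> X1; rewrite -[8 * M]divr1; apply: der_bound ltr01 _ _.
    by apply: paS pV'; apply: eball_sub; move: X1; rewrite /eball /=; lra.
  move=> Y YX; apply: VM; rewrite /ecball /=; apply: le_trans (enorm_tri X _ _) _.
  by move: X1 YX; rewrite /eball /=; lra.
have dW X : G X -> enorm X < 1 / 8 -> der w X = f (F X) * der k X.
  move=> GX Xn; have m1 := enorm1 X; have m2 := ler_norm X.2; have m2' := enorm2 X.
  have X1 : `|X.1| < 4 by lra.
  have X2 : X.2 < 4 by lra.
  have [r [r0 rG cr]] := unif_ca uk GX X1 X2.
  have kX : kbox G X by apply: kb; [exact: subset_closure|lra].
  have FX := F2 X (subset_closure GX) Xn.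
  have FX2 : eball 0 2 (Fb G c k X) by rewrite /eball /= subr0; move: FX; rewrite /F; lra.
  rewrite -(der_comp r0 cr pV' FX2).
  have [d d0 hd] := Fk_cont Gd uk kX (ltr01 : 0 < (1 : R)).
  have [|r' r'0 pw] := wh X.
    by split=> //; rewrite /eball /= subr0; lra.
  pose r2 := Num.min (Num.min r r') (Num.min d (1 / 8 - enorm X)).
  have r20 : 0 < r2 by rewrite !lt_min r0 r'0 d0 subr_gt0.
  apply: (der_congr r20).
    by apply: paS pw => Y; rewrite /eball /= !lt_min => /andP[/andP[]].
  move=> Y; rewrite /eball /= !lt_min => /andP[/andP[Yr Yr'] /andP[Yd Y16]].
  have GY := rG Y Yr; apply: VE.
    apply: kb; first exact: subset_closure.
    by have := enorm_tri X Y 0; rewrite !subr0; lra.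
  have := hd Y (subset_closure GY) Yd; have := enorm_tri (Fb G c k X) (Fb G c k Y) 0.
  by rewrite !subr0; move: FX; rewrite /F; lra.
have dk X : G X -> enorm X < 1 / 8 -> cn (der k X) = cn (der H X).
  move=> GX Xn; have m1 := enorm1 X; have m2 := ler_norm X.2; have m2' := enorm2 X.
  rewrite (unif_der uk GX); [|lra|lra].
  have E : cn ('i%C : R[i]) = 1 by rewrite cnE /= expr0n /= add0r expr1n sqrtr1.
  by rewrite cnM E mul1r.
have dHy X : Hy G c X <= cn (der H X).
  by apply: le_trans (cn_Im _); rewrite /Hy -normrN; exact: ler_norm.
have z0 z : z \in [seq F X | X <- s] -> f z = 0.
  move=> /mapP[X Xs ->]; have [cX Xn kX hX] := hs X Xs; have Xn8 : enorm X < 1 / 8 by lra.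
  have [GX|nX] := pselect (G X).
    have : der w X = 0.
      apply: cn_eq0; apply/eqP; rewrite eq_le cn_ge0 andbT; apply/ler_addgt0Pr => e e0.
      have [d d0 hd] := kX e e0; rewrite add0r; apply: hd => //; exact: eball_center.
    rewrite dW// => /eqP; rewrite mulf_eq0 => /orP[/eqP //|/eqP dk0].
    have := dk X GX Xn8; rewrite dk0 cn0 => dH0.
    by have := lt_le_trans (Hy_gt0 Gd GX) (dHy X); rewrite -dH0 ltxx.
  (* If f did not vanish at F X, the modulus of [der w], which is |f(F)| times that of [der H],
     would stay at least (al / 2) a at points of G arbitrarily close to X, although X is
     critical. *)
  have [a a0 ha] := hopf_der cX nX (hX nX).
  apply: cn_eq0; apply/eqP; rewrite eq_le cn_ge0 andbT leNgt; apply/negP => fX.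
  set al := cn (f (F X)) in fX.
  have kbX : kbox G X by apply: kb => //; lra.
  have FX := F5 X cX Xn.
  have F1 : eball (F X) (1 - enorm (F X)) `<=` eball 0 1.
    by apply: eball_sub; rewrite subr0 addrC subrK.
  have F10 : 0 < 1 - enorm (F X) by lra.
  have [d1 d10 [d1r hd1]] := ca_cont F10 (caS F1 cf) (half_pos fX).
  have [d2 d20 hd2] := Fk_cont Gd uk kbX (half_pos d10).
  have b0 : 0 < al / 2 * a / 2 by rewrite half_pos// mulr_gt0// half_pos.
  have [d3 d30 hd3] := kX _ b0.
  pose d := Num.min (Num.min d2 d3) (1 / 16).
  have d0 : 0 < d by rewrite !lt_min d20 d30; lra.
  have [Y [GY]] := ha d d0; rewrite /eball /= !lt_min => /andP[/andP[Y2 Y3] Y16] aY.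
  have Yn : enorm Y < 1 / 8 by have := enorm_tri X Y 0; rewrite !subr0; lra.
  have := hd3 Y GY Y3; rewrite dW// cnM dk// leNgt => /negP; apply.
  have h1 : cn (f (F Y) - f (F X)) <= al / 2.
    by apply: hd1; rewrite /eball /=; have := hd2 Y (subset_closure GY) Y2; rewrite /F; lra.
  have h2 : al / 2 <= cn (f (F Y)).
    have := cnB (f (F Y)) (f (F Y) - f (F X)); rewrite subKr -/al; lra.
  have h3 := le_trans aY (dHy Y).
  have al0 : 0 <= al / 2 by rewrite ltW// half_pos.
  by have := ler_pM al0 (ltW a0) h2 h3; lra.
have us' : uniq [seq F X | X <- s].
  rewrite map_inj_in_uniq// => X Y Xs Ys; apply: (unif_inj uk); apply: kb.
  - by have [] := hs X Xs.
  - by have [_ h _ _] := hs X Xs; lra.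
  - by have [] := hs Y Ys.
  - by have [_ h _ _] := hs Y Ys; lra.
have z5 z : z \in [seq F X | X <- s] -> enorm z <= 1 / 5.
  by move=> /mapP[X Xs ->]; have [cX Xn _ _] := hs X Xs; exact: F5.
have cnt := zero_count us' z5 z0 cf fB; rewrite size_map in cnt.
apply: (le_trans wY0).
have cY0 := subset_closure GY0.
have FY0 := F5 Y0 cY0 Y0n.
rewrite (VE Y0); [|by apply: kb => //; lra|by move: FY0; rewrite /F; lra].
have HY := perron_ge0 Gd Y0.
have E (x : R) : (k Y0, 0) + x *: (0, H Y0) = (k Y0, x * H Y0) :> R * R.
  by rewrite scaleE mulr0 -[LHS]/(k Y0 + 0, 0 + x * H Y0) addr0 add0r.
have nb (x : R) : 0 <= x <= 1 -> enorm (k Y0, x * H Y0) <= 1 / 5.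
  move=> /andP[x0 x1]; apply: le_trans FY0.
  rewrite -(@ler_pXn2r R 2)// ?nnegrE ?enorm_ge0// !enorm_sqr lerD2l /=.
  by rewrite ler_pXn2r// ?nnegrE ?mulr_ge0// ler_piMl.
(* V vanishes at the foot (k Y0, 0), so its value at F Y0 is bounded by the derivative on the
   vertical segment between them, where the zero count makes it small. *)
have [|x x01] := @line_MVT R V (k Y0, 0) (0, H Y0) (fun x => complex.Re (f (k Y0, x * H Y0) * toC (0, H Y0))).
  move=> x x01; rewrite E.
  have b1 : eball (k Y0, x * H Y0) 1 `<=` eball 0 2.
    by apply: eball_sub; rewrite subr0; have := nb x x01; lra.
  exact: (pa_dir (0, H Y0) ltr01 (paS b1 pV')).
have x01' : 0 <= x <= 1 by lra.
have -> : (k Y0, 0) + (0, H Y0) = F Y0 :> R * R by rewrite -[LHS]/(k Y0 + 0, 0 + H Y0) addr0 add0r.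
rewrite (V0 (k Y0, 0)) ?subr0//; last first.
  by rewrite /ecball /= subr0; have := nb 0; rewrite mul0r lexx ler01 => /(_ isT); lra.
move=> ->; apply: le_trans (cn_Re _) _; rewrite cnM.
have h1 := cnt _ (nb x x01').
have h2 : cn (toC (0, H Y0)) <= 1.
  have h : `|H Y0| <= 1 / 5 := le_trans (enorm2 (F Y0)) FY0.
  by have <- := @enormE R (0, H Y0); rewrite enorm_e2; lra.
by have := ler_pM (cn_ge0 _) (cn_ge0 _) h1 h2; rewrite mulr1.
Qed.

End boundary_count.

(** * Hopf lemma at Dini points *)

Section hopf_iteration.
Context {R : realType}.
Implicit Types (X Y Z : R * R) (e r M t d m b sg : R).
Context (W : set (R * R)) (h : R * R -> R).
Context (oW : open W) (hc : continuous h) (h0 : forall Y, 0 <= h Y) (hh : harm h W).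

Lemma quad_pa (a b c f : R) A : pa (fun Y : R * R => a * (Y.1 ^+ 2 - Y.2 ^+ 2) + b * Y.1 + c * Y.2 + f) A.
Proof.
move=> e e0; exists ((a%:C)%C *: 'X ^+ 2 + (b -i* c)%C *: 'X + ((f%:C)%C)%:P) => Y _.
have -> : rep ((a%:C)%C *: 'X ^+ 2 + (b -i* c)%C *: 'X + ((f%:C)%C)%:P) Y =
    a * (Y.1 ^+ 2 - Y.2 ^+ 2) + b * Y.1 + c * Y.2 + f.
  by rewrite /rep !hornerE /= expr2 /=; ring.
by rewrite subrr normr0 ltW.
Qed.

(* Barrier: with [z = y + b r] the harmonic function
   [2 (x^2 - z^2 + 2 r z) / r] is nonnegative on [W] and at least [r] on the
   part of the circle of radius [r] in [W]. *)
Lemma hopf_step r b m sg : 0 < r -> 0 <= b -> b <= 1 / 64 -> 0 < m -> 0 <= sg -> sg <= 1 / 16 ->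
  (forall Y, enorm Y <= r -> W Y -> - b * r <= Y.2) ->
  (forall Y, enorm Y <= r -> ~ W Y -> Y.2 <= b * r) ->
  (forall Y, enorm Y <= r -> m * (Y.2 - sg * r) <= h Y) ->
  forall Y, enorm Y <= r / 32 -> m * (1 - 4 * sg) * (Y.2 - (64 * b + sg / 8) * (r / 32)) <= h Y.
Proof.
move=> r0 b0 b2 m0 s0 s16 lo hi hm.
pose B Y := 2 * (Y.1 ^+ 2 - (Y.2 + b * r) ^+ 2 + 2 * r * (Y.2 + b * r)) / r.
pose q Y := m * (Y.2 - b * r - sg * B Y).
have hq : harm q setT.
  move=> X _; exists 1 => //; apply: pa_eq (@quad_pa (- 2 * m * sg / r) 0 (m + 4 * m * sg * b - 4 * m * sg)
    (- m * b * r + 2 * m * sg * b ^+ 2 * r - 4 * m * sg * b * r) _) => Y _.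
  by rewrite /q /B; field; rewrite gt_eqF.
pose Wr := W `&` eball 0 r.
have cl X : closure Wr X -> enorm X <= r /\ - b * r <= X.2.
  move=> /closureP cX; split; apply/ler_addgt0Pr => e e0; have [Y [WY Yr] YX] := cX e e0.
    by move: Yr YX; rewrite /eball /= subr0; have := enorm_tri Y X 0; rewrite !subr0 (enormC X); lra.
  move: Yr; rewrite /eball /= subr0 => /ltW Yr; have := lo Y Yr WY.
  by have := le_lt_trans (enorm2 (Y - X)) YX; rewrite /= ltr_norml; lra.
have yp X : closure Wr X -> [/\ 0 <= X.2 + b * r, X.2 + b * r <= 2 * r & X.1 ^+ 2 + X.2 ^+ 2 <= r ^+ 2].
  move=> /cl[h1 h2]; have y2 := enorm2 X; have br : b * r <= r by rewrite ler_piMl ?ltW//; lra.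
  split; [lra| |by rewrite -enorm_sqr ler_pXn2r// nnegrE ?enorm_ge0// ltW].
  by have := ler_norm X.2; lra.
have key Y : enorm Y < r -> W Y -> q Y <= h Y.
  have bd X : closure Wr X -> ~ Wr X -> q X - h X <= 0.
    move=> cX nX; have [h1 h2] := cl X cX; have [z0 z2 xy] := yp X cX.
    have [WX|nWX] := pselect (W X).
      have Xr : enorm X = r.
        by apply/eqP; rewrite eq_le h1 leNgt; apply/negP => f; apply: nX; split=> //; rewrite /eball /= subr0.
      have Br : r <= B X.
        rewrite /B ler_pdivlMr//.
        have : X.1 ^+ 2 + X.2 ^+ 2 = r ^+ 2 by rewrite -enorm_sqr Xr.
        have zr : X.2 + b * r <= (1 + b) * r by have := ler_norm X.2; have := enorm2 X; rewrite mulrDl mul1r; lra.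
        move=> x2; have -> : X.1 ^+ 2 = r ^+ 2 - ((X.2 + b * r) - b * r) ^+ 2 by rewrite addrK -x2 addrK.
        move: z0 zr; move: (X.2 + b * r) => z z0 zr.
        have : 0 <= z * ((1 + b) * r - z) by rewrite mulr_ge0// subr_ge0.
        have : b ^+ 2 * r ^+ 2 <= 1 / 64 * r ^+ 2 by rewrite ler_wpM2r ?sqr_ge0//; nra.
        have := sqr_ge0 r; nra.
      rewrite subr_le0; apply: le_trans (hm X h1); rewrite /q ler_pM2l//.
      have := ler_wpM2l s0 Br; have : 0 <= b * r by rewrite mulr_ge0// ltW.
      lra.
    have := h0 X; suff : q X <= 0 by lra.
    rewrite /q; apply: mulr_ge0_le0; first exact: ltW.
    have := hi X h1 nWX.
    suff : 0 <= sg * B X by lra.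
    rewrite mulr_ge0// /B divr_ge0 ?(ltW r0)// mulr_ge0//.
    have := sqr_ge0 X.1; have : 0 <= (X.2 + b * r) * (2 * r - (X.2 + b * r)) by rewrite mulr_ge0// subr_ge0.
    by move: (X.2 + b * r) => z; nra.
  move=> Yr WY; rewrite -subr_le0.
  have oWr : open Wr by apply: openI => //; exact: open_eball.
  have Wrb : Wr `<=` eball 0 r by move=> X [].
  have hz := harmB (harmS (@subsetT _ W) hq) hh.
  apply: (@max_principle2 R Wr (fun X => q X - h X) 0 r oWr Wrb) => //.
  - by move=> X _; apply: cvgB; [exact: (harm_cont hq I)|exact: hc].
  - by move=> X [WX _]; have [] := harm_sub hz WX.
  - by split=> //; rewrite /eball /= subr0.
move=> Y Yr.
have Yr' : enorm Y <= r by lra.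
have Yr'' : enorm Y < r by lra.
have m1 : 0 <= m * (1 - 4 * sg) by rewrite mulr_ge0 ?ltW//; lra.
have y2 := enorm2 Y; have y1 := enorm1 Y.
have [WY|nWY] := pselect (W Y); last first.
  apply: le_trans (h0 Y); rewrite mulr_ge0_le0// subr_le0.
  apply: le_trans (hi Y Yr' nWY) _.
  have : 0 <= sg * r by rewrite mulr_ge0// ltW.
  have : 0 <= b * r by rewrite mulr_ge0// ltW.
  by lra.
apply: le_trans (key Y Yr'' WY); rewrite /q -mulrA ler_pM2l//.
have zp : 0 <= Y.2 + b * r by have := lo Y Yr' WY; lra.
have x2 : Y.1 ^+ 2 <= r ^+ 2 / 1024.
  have -> : r ^+ 2 / 1024 = (r / 32) ^+ 2 by field.
  by rewrite -[Y.1 ^+ 2]real_normK ?num_real// ler_pXn2r ?nnegrE//; lra.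
have HB : B Y <= r / 512 + 4 * (Y.2 + b * r).
  rewrite /B ler_pdivrMr// mulrDl; have := sqr_ge0 (Y.2 + b * r).
  by move: x2; move: (Y.1 ^+ 2) (Y.2 + b * r) => a z; nra.
have := ler_wpM2l s0 HB.
have sb : 0 <= sg * b by rewrite mulr_ge0.
have sr : 0 <= sg * r by rewrite mulr_ge0// ltW.
have br : 0 <= b * r by rewrite mulr_ge0// ltW.
have t1 : sg * (b * r) <= b * r / 16.
  by have := ler_wpM2r br s16; lra.
have t2 : sg * (sg * r) <= sg * r / 16.
  by have := ler_wpM2r sr s16; lra.
by move: t1 t2 sr br; move: (sg * B Y) => SB *; lra.
Qed.

(** A bound h >= m (y - sg r) on the disc of radius r passes to radius r / 32 with sg replaced by 64
    b + sg / 8 and m by m (1 - 4 sg); summability of b keeps m away from 0. The direction v is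
    tilted because the frame is that of the boundary point, while growth is wanted along the
    vertical of the chart. *)
Lemma hopf_iter (r0 : R) (b : nat -> R) : 0 < r0 -> (forall k, 0 <= b k) ->
  (forall n, \sum_(k < n) b k <= 1 / 2048) ->
  (forall k Y, enorm Y <= r0 / 32 ^+ k -> W Y -> - b k * (r0 / 32 ^+ k) <= Y.2) ->
  (forall k Y, enorm Y <= r0 / 32 ^+ k -> ~ W Y -> Y.2 <= b k * (r0 / 32 ^+ k)) ->
  (forall Y, W Y -> 0 < h Y) ->
  forall v, enorm v <= 1 -> 1 / 2 <= v.2 ->
  exists2 a : R, 0 < a & forall d, 0 < d -> exists2 t : R, 0 < t < d & a * t <= h (t *: v).
Proof.
move=> r00 b0 sb lo hi hp v v1 v2.
have b2 k : b k <= 1 / 2048.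
  by apply: le_trans (sb k.+1); rewrite big_ord_recr /= lerDr sumr_ge0.
have b64 k : b k <= 1 / 64 by apply: le_trans (b2 k) _; lra.
have rk k : 0 < r0 / 32 ^+ k by rewrite divr_gt0// exprn_gt0.
have [m0 m00 hm0] : exists2 m : R, 0 < m & forall Y, enorm Y <= r0 -> m * (Y.2 - 1 / 32 * r0) <= h Y.
  pose K := ecball 0 r0 `&` [set Y : R * R | 1 / 32 * r0 <= Y.2].
  have cK : compact K.
    apply: (@subclosed_compact _ _ (ecball 0 r0)); [|exact: compact_ecball|by move=> Y []].
    apply: closedI; first exact: closed_ecball.
    move=> X /closureP cX; apply/ler_addgt0Pr => e e0; have [Y Yr YX] := cX e e0.
    have := le_lt_trans (enorm2 (Y - X)) YX; move: Yr => /=; rewrite ltr_norml; lra.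
  have KW Y : K Y -> W Y.
    move=> [Yr Y2]; apply: contrapT => nW; have := hi 0%N Y; rewrite expr0 divr1.
    move: Yr; rewrite /ecball /= subr0 => Yr /(_ Yr nW); move: Y2; rewrite /= => Y2.
    have : b 0%N * r0 <= 1 / 2048 * r0 by rewrite ler_wpM2r ?(ltW r00).
    by move: r00; lra.
  have KX : K (0, r0).
    by split; rewrite /ecball /= ?subr0 ?enorm_e2 ?gtr0_norm//; lra.
  have [|X KXm hX] := @compact_usc_max R K (fun Y => - h Y) (0, r0) cK KX.
    move=> X _ e e0; have [d d0 hd] := proj1 (cont_atP h X) (hc (x := X)) _ (half_pos e0).
    by exists d => // Y _ /hd; rewrite ler_norml; lra.
  have hX0 := hp X (KW X KXm).
  exists (h X / r0); first by rewrite divr_gt0.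
  move=> Y Yr; have [Y2|Y2] := leP (1 / 32 * r0) Y.2; last first.
    apply: le_trans (h0 Y); apply: mulr_ge0_le0; last by rewrite subr_le0 ltW.
    by rewrite divr_ge0// ltW.
  have KY : K Y by split=> //; rewrite /ecball /= subr0.
  have hY : h X <= h Y by have := hX Y KY; rewrite lerN2.
  apply: le_trans hY.
  rewrite mulrAC ler_pdivrMr// ler_pM2l//.
  by have := ler_norm Y.2; have := enorm2 Y; lra.
(* The weight 32/7 = 4 (1 + 1/8 + 1/64 + ...) is the total loss that one unit of sg causes over all
   later scales, so the third clause is an invariant. *)
have main n : exists sg m : R, [/\ 0 <= sg /\ sg <= 1 / 16, m <= m0,
    m0 * (1 - 32 / 7 * (1 / 32 + 64 * \sum_(k < n) b k) + 32 / 7 * sg) <= m &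
    forall Y, enorm Y <= r0 / 32 ^+ n -> m * (Y.2 - sg * (r0 / 32 ^+ n)) <= h Y].
  elim: n => [|n [sg [m [[s0 s16] mle mm hm]]]].
    exists (1 / 32), m0; split; [by split; lra|exact: lexx| |by rewrite expr0 divr1].
    by rewrite big_ord0 ler_piMr ?(ltW m00)//; lra.
  have mp : 0 < m.
    apply: lt_le_trans mm; rewrite mulr_gt0//; have := sb n; lra.
  exists (64 * b n + sg / 8), (m * (1 - 4 * sg)); split.
  - by split; [have := b0 n; lra|have := b2 n; lra].
  - by apply: le_trans mle; rewrite ler_piMr ?(ltW mp)//; lra.
  - rewrite big_ord_recr /=; set S := \sum_(i < n) b i in mm *.
    have := ler_wpM2r s0 mle; lra.
  - have := hopf_step (rk n) (b0 n) (b64 n) mp s0 s16 (lo n) (hi n) hm.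
    by have -> : r0 / 32 ^+ n / 32 = r0 / 32 ^+ n.+1 by rewrite exprS; field; rewrite expf_neq0.
(* With 64 times the sum of b at most 1/32, the invariant leaves m >= 5/7 m0. At the point (r / 2) v
   the height is at least r / 4 and sg r at most r / 16, which leaves 3/8 of r / 2. *)
exists (m0 * (5 / 7) * (3 / 8)); first by rewrite !mulr_gt0//; lra.
move=> d d0; pose n := Num.bound (r0 / d).
have nd : r0 / 32 ^+ n < d.
  rewrite ltr_pdivrMr ?exprn_gt0// mulrC -ltr_pdivrMr//.
  apply: (@lt_le_trans _ _ n%:R).
    by apply: archi_boundP; rewrite divr_ge0 ?(ltW r00) ?(ltW d0).
  by rewrite -natrX ler_nat ltnW// ltn_expl.
have [sg [m [[s0 s16] _ mm hm]]] := main n.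
have rn := rk n; set r := r0 / 32 ^+ n in rn nd hm.
exists (r / 2); first by apply/andP; split; lra.
have nv : enorm ((r / 2) *: v) <= r.
  by rewrite enormZ gtr0_norm ?half_pos//; have := ler_wpM2l (ltW (half_pos rn)) v1; lra.
apply: le_trans (hm _ nv); rewrite scaleE /=.
have mp : m0 * (5 / 7) <= m.
  by apply: le_trans mm; rewrite ler_pM2l//; have := sb n; lra.
have h1 : r / 2 * (1 / 2) <= r / 2 * v.2 by rewrite ler_pM2l// half_pos.
have h2 : sg * r <= 1 / 16 * r by rewrite ler_pM2r.
have h3 : 3 / 8 * (r / 2) <= r / 2 * v.2 - sg * r by lra.
by rewrite -mulrA; apply: ler_pM => //; rewrite ?mulr_ge0 ?(ltW m00)//; lra.
Qed.

End hopf_iteration.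

(** * Hausdorff measure and energy estimates *)

Section plane_measure.
Context {R : realType}.
Implicit Types (X Y Z : R * R) (A W : set (R * R)) (t r e : R).
Local Notation mu := (@lebesgue_measure R).

(** Measurability refers to the product structure, so an open set is exhibited as a countable union
    of open squares with rational centres, encoded by natural numbers. *)
Lemma open_measurable_plane A : open A -> measurable A.
Proof.
move=> oA; pose Q := (rat * rat * nat)%type.
have [code [dec cd]] : exists (code : Q -> nat) (dec : nat -> option Q), forall q, dec (code q) = Some q.
  by exists pickle, unpickle; exact: pickleK.
pose rect (q : Q) : set (R * R) := [set` `]ratr q.1.1 - q.2.+1%:R^-1, ratr q.1.1 + q.2.+1%:R^-1[ ] `*`
   [set` `]ratr q.1.2 - q.2.+1%:R^-1, ratr q.1.2 + q.2.+1%:R^-1[ ].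
pose S (n : nat) : set (R * R) := if dec n is Some q then
  (if pselect (rect q `<=` A) then rect q else set0) else set0.
have -> : A = \bigcup_n S n.
  apply/seteqP; split=> X; last first.
    by move=> [n _]; rewrite /S; case: (dec n) => // q; case: (pselect _) => //= h; exact: h.
  move=> AX; have [r r0 rA] := proj1 (openP A) oA X AX.
  pose n := Num.truncn (4 / r); pose d : R := n.+1%:R^-1.
  have d0 : 0 < d by rewrite invr_gt0.
  have dr : d < r / 4.
    rewrite /d -[r / 4]invrK ltf_pV2 ?posrE ?invr_gt0 ?divr_gt0// invf_div; exact: truncnS_gt.
  have [q1 hq1] : exists q : rat, X.1 - d < ratr q < X.1 + d.
    by have [|q] := @rat_in_itvoo R (X.1 - d) (X.1 + d); [lra|rewrite in_itv /=; exists q].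
  have [q2 hq2] : exists q : rat, X.2 - d < ratr q < X.2 + d.
    by have [|q] := @rat_in_itvoo R (X.2 - d) (X.2 + d); [lra|rewrite in_itv /=; exists q].
  exists (code (q1, q2, n)); first by [].
  rewrite /S cd.
  have h : rect (q1, q2, n) `<=` A.
    move=> Y [] /=; rewrite !in_itv /= -/d => Y1 Y2; apply: rA; rewrite /eball /=.
    apply: le_lt_trans (enorm_le12 _) _ => /=.
    have : `|Y.1 - X.1| < 2 * d by rewrite ltr_norml; lra.
    have : `|Y.2 - X.2| < 2 * d by rewrite ltr_norml; lra.
    lra.
  case: (pselect _) => //= _; split; rewrite /= in_itv /= -/d; lra.
apply: bigcupT_measurable => n; rewrite /S; case: (dec n) => // q.
by case: (pselect _) => //= _; apply: measurableX; exact: measurable_itv.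
Qed.

Definition ext0 W (g : R * R -> R) X : R := if pselect (W X) then g X else 0.

Lemma ext0_measurable W (g : R * R -> R) : open W -> (forall X, W X -> {for X, continuous g}) ->
  (forall X, W X -> 0 <= g X) -> measurable_fun setT (ext0 W g).
Proof.
move=> oW gc g0 mT; apply: (measurability _ (measurable_realfun.RGenOInfty.measurableE R)) => //.
move=> /= _ [_ [t ->] <-]; rewrite setTI.
have [t0|t0] := leP 0 t.
  apply: open_measurable_plane; apply/openP => X; rewrite /preimage /= in_itv /= andbT /ext0.
  case: (pselect (W X)) => [WX /= tX|? /= h]; last by have := le_lt_trans t0 h; rewrite ltxx.
  have [r r0 rW] := proj1 (openP W) oW X WX.
  have p : 0 < (g X - t) / 2 by apply: half_pos; rewrite subr_gt0.
  have [d d0 hd] := proj1 (cont_atP g X) (gc X WX) _ p.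
  exists (Num.min r d); first by rewrite lt_min r0.
  move=> Y; rewrite /eball /= lt_min => /andP[Yr Yd]; rewrite in_itv /= andbT.
  case: (pselect (W Y)) => [WY /=|[]]; last exact: rW.
  by have := hd Y Yd; rewrite ler_norml; lra.
rewrite (_ : _ @^-1` _ = setT)//; apply/seteqP; split=> // X _.
rewrite /preimage /= in_itv /= andbT /ext0; case: (pselect (W X)) => //= WX.
exact: lt_le_trans (g0 X WX).
Qed.

End plane_measure.

(** * Hausdorff measure of Lipschitz images *)

Section hausdorff_upper.
Context {R : realType}.
Implicit Types (X Y Z : R * R) (A : set (R * R)) (t r e d : R).
Local Notation mu := (@lebesgue_measure R).

Lemma nneseries_le (f : nat -> \bar R) (c : \bar R) : (forall k, (0 <= f k)%E) ->
  (forall n, (\sum_(0 <= k < n) f k <= c)%E) -> (\sum_(k <oo) f k <= c)%E.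
Proof.
move=> f0 h; apply: lime_le; first exact: is_cvg_nneseries.
by near=> n; exact: h.
Unshelve. all: by end_near. Qed.

Definition csquare X r : set (R * R) := [set` `[X.1 - r, X.1 + r] ] `*` [set` `[X.2 - r, X.2 + r] ].

Lemma csquare_diam X r : 0 <= r -> (diameter (csquare X r) <= (4 * r)%:E)%E.
Proof.
move=> r0; apply: ge_ereal_sup => y [->|]; first by rewrite lee_fin mulr_ge0.
move=> [[Y Z] [[/= Y1 Y2] [/= Z1 Z2]] <-]; rewrite lee_fin /=.
move: Y1 Y2 Z1 Z2; rewrite !in_itv /= => Y1 Y2 Z1 Z2.
apply: le_trans (enorm_le12 _) _ => /=.
have : `|Y.1 - Z.1| <= 2 * r by rewrite ler_norml; lra.
have : `|Y.2 - Z.2| <= 2 * r by rewrite ler_norml; lra.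
lra.
Qed.

(** The image of a piece of length h lies in a square of half side 3 h, of diameter at most 12 h.
    Squares are used because covers must consist of measurable sets; h is so small that their
    diameter is at most d. *)
Lemma hausdorff1_delta_itv (gam : R -> R * R) (B : set R) d a b : 0 < d -> a <= b ->
  (forall x y, B x -> B y -> enorm (gam x - gam y) <= 3 * `|x - y|) ->
  (hausdorff1_delta d (gam @` (B `&` [set` `]a, b] ])) <= (12 * (b - a))%:E)%E.
Proof.
move=> d0 ab gL; pose n := (Num.truncn (12 * (b - a) / d)).+1.
pose h := (b - a) / n%:R; have n0 : 0 < n%:R :> R by rewrite ltr0n.
have h0 : 0 <= h by rewrite divr_ge0 ?subr_ge0// ltW.
have hd : 12 * h <= d.
  rewrite /h mulrA ler_pdivrMr// [d * _]mulrC -ler_pdivrMr//; apply: ltW; exact: truncnS_gt.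
pose P k := B `&` [set x | a + k%:R * h < x <= a + k.+1%:R * h].
pose F (k : nat) : set (R * R) := if (k < n)%N then
  (if pselect (exists x, P k x) is left p then csquare (gam (projT1 (cid p))) (3 * h) else set0) else set0.
have mF k : measurable (F k).
  rewrite /F; case: ifP => // _; case: pselect => // p; apply: measurableX; exact: measurable_itv.
have gF k : (gauge1 d (F k) <= (if (k < n)%N then 12 * h else 0)%:E)%E.
  rewrite /F; case: ifP => kn; last by rewrite gauge1_set0.
  case: pselect => p; last by rewrite gauge1_set0// lee_fin mulr_ge0.
  have h3 : 0 <= 3 * h by rewrite mulr_ge0.
  have D := csquare_diam (gam (projT1 (cid p))) h3.
  have {}D : (diameter (csquare (gam (projT1 (cid p))) (3 * h)) <= (12 * h)%:E)%E.
    by apply: le_trans D _; rewrite lee_fin; lra.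
  rewrite /gauge1; case: ifPn => // /asboolPn; case; apply: le_trans D _.
  by rewrite lee_fin.
have cov : gam @` (B `&` [set` `]a, b] ]) `<=` \bigcup_k F k.
  move=> y [x [Bx]] /=; rewrite in_itv /= => /andP[ax xb] <- {y}.
  have hp : 0 < h by rewrite /h divr_gt0// subr_gt0; exact: lt_le_trans xb.
  have [k [kn xk]] : exists k, (k < n)%N /\ a + k%:R * h < x <= a + k.+1%:R * h.
    have : exists k, (k <= n)%N /\ x <= a + k%:R * h.
      by exists n; split=> //; rewrite /h mulrC divfK ?gt_eqF// addrC subrK.
    move=> ex; have ex' : exists k, x <= a + k%:R * h by case: ex => k [_ hk]; exists k.
    case: (ex_minnP ex') => [[|k]]; first by rewrite mul0r addr0 leNgt ax.
    move=> xk mk; exists k; split.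
      by case: ex => j [jn xj]; apply: leq_trans jn; exact: mk.
    rewrite xk andbT ltNge; apply/negP => /mk; by rewrite ltnn.
  exists k => //; rewrite /F kn; case: pselect => [p|]; last by case; exists x.
  case: (cid p) => y [By /= yk] /=.
  have xy : `|x - y| <= h by rewrite ler_norml; move: xk yk; rewrite -natr1 mulrDl mul1r; lra.
  have := gL x y Bx By; have := enorm1 (gam x - gam y); have := enorm2 (gam x - gam y).
  rewrite /= => h1 h2 h3; split; rewrite /= in_itv /= -ler_distl; lra.
apply: le_trans (ereal_inf_lbound _) _; first by exists F => //; split.
apply: nneseries_le => [k|m]; first exact: gauge1_ge0.
apply: (@le_trans _ _ (\sum_(0 <= k < m) (if (k < n)%N then 12 * h else 0)%:E)%E).
  by apply: lee_sum => k _.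
rewrite sumEFin lee_fin; have h12 : 0 <= 12 * h by rewrite mulr_ge0.
have E : \sum_(0 <= k < m) (if (k < n)%N then 12 * h else 0) = (minn m n)%:R * (12 * h).
  elim: m => [|m IH]; first by rewrite big_nil min0n mul0r.
  rewrite big_nat_recr //= IH; case: ltnP => mn.
    by rewrite !(minn_idPl _) ?(ltnW mn)// -natr1; ring.
  by rewrite !(minn_idPr _) ?addr0// ltnW.
rewrite E; apply: (@le_trans _ _ (n%:R * (12 * h))); first by rewrite ler_wpM2r// ler_nat geq_minr.
by rewrite /h mulrCA [n%:R * _]mulrC divfK ?gt_eqF.
Qed.

(** Lebesgue measure is unfolded as an infimum over covers by half-open intervals, each of which is
    handled by [hausdorff1_delta_itv]. *)
Lemma hausdorff1_graph (gam : R -> R * R) (B Z : set R) :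
  (forall x y, B x -> B y -> enorm (gam x - gam y) <= 3 * `|x - y|) ->
  (hausdorff1 (gam @` (B `&` Z)) <= 12%:E * mu Z)%E.
Proof.
move=> gL; apply: ge_ereal_sup => _ [d /= d0 <-].
rewrite -lee_pdivrMl//; apply: le_ereal_inf_tmp => _ [F [mF ZF] <-].
rewrite lee_pdivrMl//.
have c0 k : (0 <= wlength idfun (F k))%E by exact: wlength_ge0.
rewrite -nneseriesZl//.
apply: (@le_trans _ _ (\sum_(k <oo) hausdorff1_delta d (gam @` (B `&` F k)))%E).
  apply: le_trans (mu_ext_sigma_subadditive (gauge1_ge0 d) _).
  apply: le_mu_ext => _ [x [Bx /ZF[k _ Fx]] <-]; exists k => //; by exists x.
apply: lee_nneseries => k; first by move=> *; exact/mu_ext_ge0/gauge1_ge0.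
move=> _; have /ocitvP[->|[[a b] /= ab ->]] : ocitv (F k) := mF k.
  rewrite setI0 image_set0 /hausdorff1_delta mu_ext0 ?gauge1_set0//; last exact: gauge1_ge0.
rewrite wlength_itv_bnd ?(ltW ab)//= -EFinM.
exact: hausdorff1_delta_itv d0 (ltW ab) gL.
Qed.

End hausdorff_upper.

(** * Layer-cake comparison of integrals *)

Section layer_cake.
Import HBNNSimple.
Context {R : realType}.
Implicit Types (t r e eta v : R) (J : nat).
Local Notation mu := (@lebesgue_measure R).

Definition steps eta J v : R := \sum_(j < J) (if j.+1%:R * eta <= v then eta else 0).

Lemma steps_lb eta J v : 0 < eta -> Num.min (v - eta) (J%:R * eta) <= steps eta J v.
Proof.
move=> e0; elim: J => [|J IH]; first by rewrite /steps big_ord0 mul0r ge_min lexx orbT.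
rewrite /steps big_ord_recr /= -/(steps eta J v).
have E : J.+1%:R * eta = J%:R * eta + eta by rewrite -natr1 mulrDl mul1r.
rewrite E; case: ifPn => h.
  rewrite ge_min; apply/orP; right; rewrite lerD2r; apply: le_trans IH.
  by rewrite le_min lexx andbT; lra.
rewrite -ltNge in h; rewrite addr0; apply: le_trans IH; rewrite le_min !ge_min lexx /=; apply/orP; left; lra.
Qed.

Lemma steps_ub eta J v : 0 < eta -> 0 <= v -> steps eta J v <= v.
Proof.
move=> e0 v0; have h K : steps eta K v <= K%:R * eta.
  elim: K => [|K IH]; first by rewrite /steps big_ord0 mul0r.
  rewrite /steps big_ord_recr /= -/(steps eta K v) -natr1 mulrDl mul1r lerD//.
  by case: ifP => // _; exact: ltW.
elim: J => [|J IH]; first by rewrite /steps big_ord0.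
rewrite /steps big_ord_recr /= -/(steps eta J v); case: ifPn => [|_]; last by rewrite addr0.
by apply: le_trans; rewrite -natr1 mulrDl mul1r lerD2r.
Qed.

Lemma int_steps d (T : measurableType d) (m : {measure set T -> \bar R}) (S : nat -> set T) eta J :
  0 < eta -> (forall j, measurable (S j)) ->
  measurable_fun setT (fun x => \sum_(j < J) eta * \1_(S j) x) /\
  (\int[m]_x (\sum_(j < J) eta * \1_(S j) x)%:E = \sum_(j < J) eta%:E * m (S j))%E.
Proof.
move=> e0 mS.
have mI j : measurable_fun setT (fun x => eta * \1_(S j) x : R).
  by apply: measurable_funM; [exact: measurable_cst|exact: measurable_indic].
split; first by apply: measurable_sum => j.
under eq_integral do rewrite -sumEFin.
rewrite ge0_integral_sum//=; last 2 first.
- by move=> j; apply/measurable_EFinP.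
- by move=> j x _; rewrite lee_fin mulr_ge0// ltW.
apply: eq_bigr => j _; under eq_integral do rewrite EFinM.
rewrite ge0_integralZl_EFin ?(ltW e0)//; last by apply/measurable_EFinP; exact: measurable_indic.
by rewrite integral_indic ?setIT.
Qed.

Lemma steps_indic (T : Type) (g : T -> R) eta J x :
  \sum_(j < J) eta * \1_[set y | j.+1%:R * eta <= g y] x = steps eta J (g x).
Proof.
apply: eq_bigr => j _; rewrite indicE; case: ifPn => h.
  by rewrite mem_set// mulr1.
by rewrite memNset ?mulr0//= ; exact/negP.
Qed.

Lemma steps_integral eta J (F : measurableTypeR R -> \bar R) : 0 < eta -> measurable_fun setT F ->
  (forall y, 0 <= F y)%E ->
  (\sum_(j < J) eta%:E * mu [set y | (j.+1%:R * eta)%:E <= F y] <= \int[mu]_y F y)%E.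
Proof.
move=> e0 mF F0.
pose S (j : nat) : set (measurableTypeR R) := [set y | ((j.+1%:R * eta)%:E <= F y)%E].
have mS j : measurable (S j).
  rewrite -[X in measurable X]setTI.
  exact: emeasurable_fun_c_infty.
have [m1 <-] := int_steps (mu : {measure set (measurableTypeR R) -> \bar R}) J e0 mS.
apply: ge0_le_integral => //.
- by move=> y _; rewrite lee_fin sumr_ge0// => j _; rewrite mulr_ge0// ltW.
- exact/measurable_EFinP.
move=> y _; have := F0 y; case FE : (F y) => [v| |] //; last by move=> _; rewrite leey.
rewrite !lee_fin => v0; apply: le_trans (steps_ub J e0 v0); rewrite /steps.
apply: ler_sum => j _; rewrite indicE; case: ifPn => h; first by rewrite ler_piMr ?(ltW e0)//; case: (_ \in _).
have nS : ~ S j y by rewrite /S /= FE lee_fin; exact/negP.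
by rewrite (memNset nS) mulr0.
Qed.

Lemma ereal_le_eps (x a b : \bar R) : (0 <= a)%E -> (a < +oo)%E ->
  (forall eta, 0 < eta -> (x <= eta%:E * a + b)%E) -> (x <= b)%E.
Proof.
case: a => // a; rewrite lee_fin => a0 _ h.
case: b h => [b| |] h; last by have := h 1 ltr01; rewrite addeNy leeNy_eq => /eqP ->.
  apply/lee_addgt0Pr => e e0; have p : 0 < e / (a + 1) by rewrite divr_gt0// ltr_wpDl.
  apply: le_trans (h _ p) _; rewrite -EFinM -EFinD addeC lee_fin lerD2r.
  by rewrite mulrAC ler_pdivrMr ?ltr_wpDl// ler_pM2l// lerDl.
by rewrite leey.
Qed.

Lemma sintegral_steps d (T : measurableType d) (m : {measure set T -> \bar R}) (h : {nnsfun T >-> R}) eta :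
  0 < eta -> exists J, (sintegral m h <= eta%:E * m [set X | (0 < h X)%R] +
    \sum_(j < J) eta%:E * m [set X | (j.+1%:R * eta <= h X)%R])%E.
Proof.
move=> e0.
have [M hM] : exists M : R, forall X, h X <= M.
  have [M [_ hM]] := simple_bounded h; exists (M + 1) => X.
  by apply: le_trans (ler_norm _) (hM _ _ X I); rewrite ltrDl.
pose J := (Num.truncn (M / eta)).+1.
exists J.
have hJ X : h X <= J%:R * eta.
  by apply: le_trans (hM X) _; rewrite -ler_pdivrMr//; apply: ltW; exact: truncnS_gt.
pose S (j : nat) : set T := [set X | j.+1%:R * eta <= h X].
have mS j : measurable (S j).
  have -> : S j = h @^-1` [set` `[j.+1%:R * eta, +oo[ ].
    by apply/seteqP; split => X; rewrite /preimage /= in_itv /= andbT.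
  by apply: measurable_funPTI; exact: measurable_itv.
pose S0 (j : nat) : set T := [set X | 0 < h X].
have mS0 j : measurable (S0 j).
  have -> : S0 j = h @^-1` [set` `]0, +oo[ ].
    by apply/seteqP; split => X; rewrite /preimage /= in_itv /= andbT.
  by apply: measurable_funPTI; exact: measurable_itv.
have [m1 I1] := int_steps m J e0 mS.
have [m0 I0] := int_steps m 1 e0 mS0.
have sE : (sintegral m h <= \int[m]_X (\sum_(j < 1) eta * \1_(S0 j) X +
    \sum_(j < J) eta * \1_(S j) X)%:E)%E.
  have -> : sintegral m h = (\int[m]_X (h X)%:E)%E.
    by rewrite integral_nnsfun// ; congr (sintegral _ _); apply/funext => X; rewrite patchT ?inE.
  apply: ge0_le_integral => //.
  - by move=> X _; rewrite lee_fin; exact: fun_ge0.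
  - by apply/measurable_EFinP; exact: measurable_funPT.
  - by apply/measurable_EFinP; exact: measurable_funD.
  move=> X _; rewrite lee_fin steps_indic big_ord_recl big_ord0 addr0 indicE.
  have [h0|h0] := ltP 0 (h X).
    rewrite mem_set// mulr1; have := steps_lb J (h X) e0; have := hJ X => h1.
    by rewrite min_l; lra.
  apply: (le_trans h0); rewrite addr_ge0//; first by rewrite mulr_ge0 ?(ltW e0)//; case: (_ \in _).
  by rewrite sumr_ge0// => j _; case: ifP => // _; exact: ltW.
apply: (le_trans sE).
under eq_integral do rewrite EFinD.
rewrite ge0_integralD//; last 4 first.
- by move=> X _; rewrite lee_fin sumr_ge0// => j _; rewrite mulr_ge0// ltW.
- exact/measurable_EFinP.
- by move=> X _; rewrite lee_fin sumr_ge0// => j _; rewrite mulr_ge0// ltW.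
- exact/measurable_EFinP.
by rewrite I0 I1 big_ord_recl big_ord0 adde0.
Qed.

(** The integral is a supremum over simple functions below f, and each of them is replaced by a
    staircase of mesh eta. The error is eta times the measure of A, whence the finiteness
    assumption; the layers are compared through the superlevel sets of F1 and F2. *)
Lemma H1_layer (A : set (R * R)) (f : R * R -> R) (F1 F2 : measurableTypeR R -> \bar R) (k : R) :
  0 <= k -> (forall X, A X -> 0 <= f X) -> (hausdorff1 A < +oo)%E ->
  measurable_fun setT F1 -> (forall y, 0 <= F1 y)%E -> measurable_fun setT F2 -> (forall y, 0 <= F2 y)%E ->
  (forall t, 0 < t -> (hausdorff1 (A `&` [set X | (t <= f X)%R]) <=
     k%:E * mu [set y | t%:E <= F1 y] + k%:E * mu [set y | t%:E <= F2 y])%E) ->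
  (\int[H1]_(X in (A : set (caratheodory_type hausdorff1_outer))) (f X)%:E <=
    k%:E * (\int[mu]_y F1 y) + k%:E * (\int[mu]_y F2 y))%E.
Proof.
move=> k0 f0 Afin mF1 F10 mF2 F20 hyp.
rewrite ge0_integralE; last by move=> X AX; rewrite lee_fin f0.
apply: ge_ereal_sup => _ [h /= hf <-].
have hA X : (0 < h X)%R -> A X /\ (h X <= f X)%R.
  move=> hX; have := hf X; rewrite /patch; case: ifPn => [|_]; first by rewrite inE lee_fin.
  by rewrite lee_fin leNgt hX.
apply: (ereal_le_eps _ Afin); first exact: hausdorff1_ge0.
move=> eta e0.
have [J sE] := sintegral_steps (@H1 R) h e0.
apply: (le_trans sE); apply: leeD.
  by rewrite lee_pmul2l ?lte_fin//; apply: le_hausdorff1 => X /hA[].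
have bd (j : nat) : (H1 [set X | (j.+1%:R * eta <= h X)%R] <= k%:E * mu [set y | (j.+1%:R * eta)%:E <= F1 y] +
    k%:E * mu [set y | (j.+1%:R * eta)%:E <= F2 y])%E.
  have t0 : 0 < j.+1%:R * eta by rewrite mulr_gt0.
  apply: le_trans (hyp _ t0); apply: le_hausdorff1 => X /= Sj.
  by have [AX fX] := hA X (lt_le_trans t0 Sj); split=> //=; exact: le_trans fX.
apply: (@le_trans _ _ (k%:E * (\sum_(j < J) eta%:E * mu [set y | ((j.+1%:R * eta)%:E <= F1 y)%E]) +
    k%:E * (\sum_(j < J) eta%:E * mu [set y | ((j.+1%:R * eta)%:E <= F2 y)%E]))%E).
  rewrite !ge0_sume_distrr; last 2 first.
  - by move=> j _; rewrite mule_ge0 ?lee_fin ?(ltW e0).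
  - by move=> j _; rewrite mule_ge0 ?lee_fin ?(ltW e0).
  rewrite -big_split /=; apply: lee_sum => j _.
  rewrite !(muleCA k%:E) -ge0_muleDr; last 2 first.
  - by rewrite mule_ge0 ?lee_fin.
  - by rewrite mule_ge0 ?lee_fin.
  by rewrite lee_pmul2l ?lte_fin//; exact: bd.
by apply: leeD; rewrite lee_wpmul2l ?lee_fin//; exact: steps_integral.
Qed.

End layer_cake.

(** * Energy estimates on a segment *)

Section line.
Context {R : realType}.
Implicit Types (a b e t p q s : R).
Local Notation mu := (@lebesgue_measure R).

Lemma last_zero (G : R -> R) a b : a <= b -> (forall t, a <= t <= b -> {for t, continuous G}) ->
  (exists2 z, a <= z <= b & G z = 0) -> G b != 0 ->
  exists s, [/\ a <= s, s < b, G s = 0 & forall t, s < t <= b -> G t != 0].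
Proof.
move=> ab cG [z zab Gz] Gb; pose S := [set t | a <= t <= b /\ G t = 0].
have S0 : S !=set0 by exists z.
have Sb : has_ubound S by exists b => t [/andP[]].
have sb : sup S <= b by apply: sup_le_ub => // t [/andP[]].
have as_ : a <= sup S.
  by case/andP: (zab) => az _; apply: (le_trans az); apply: sup_ubound.
have Gs : G (sup S) = 0.
  apply/eqP; apply/negPn/negP => n0.
  have Gp : 0 < `|G (sup S)| by rewrite normr_gt0.
  have Sab : a <= sup S <= b by rewrite as_.
  have [d /= d0 hd] := proj1 (cvgrPdist_lt _ _) (cG (sup S) Sab) `|G (sup S)| Gp.
  have [t [tab Gt] ht] := sup_adherent d0 (conj S0 Sb).
  have := hd t; rewrite Gt subr0 ltxx => h; suff : false by []; apply: h.
  rewrite /= ger0_norm; first lra.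
  by rewrite subr_ge0; apply: sup_ubound.
exists (sup S); split=> //.
  by rewrite lt_neqAle sb andbT; apply/eqP => E; move: Gb; rewrite -E Gs eqxx.
move=> t /andP[st tb]; apply/eqP => Gt; have := st; rewrite ltNge => /negP; apply.
by apply: sup_ubound => //; split=> //; rewrite tb andbT ltW// (le_lt_trans as_ st).
Qed.

(** The Cauchy-Schwarz inequality, from (G' - l)^2 >= 0 with l the mean slope; F is a primitive of
    the minorant 2 l G' - l^2 of the squared derivative. *)
Lemma segment_energy (G G' phi : R -> R) a b : a < b ->
  (forall t, a <= t <= b -> is_derive t (1 : R) G (G' t) /\ {for t, continuous G'}) ->
  measurable_fun (setT : set (measurableTypeR R)) phi -> (forall t, 0 <= phi t) ->
  (forall t, a <= t <= b -> G' t ^+ 2 <= phi t) ->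
  ((((G b - G a) ^+ 2) / (b - a))%:E <= \int[mu]_t (phi t)%:E)%E.
Proof.
move=> ab hD mphi phi0 hphi.
pose l := (G b - G a) / (b - a); have ba : 0 < b - a by rewrite subr_gt0.
pose F t := 2 * l * G t - l ^+ 2 * t; pose F' t := 2 * l * G' t - l ^+ 2.
have DF t : a <= t <= b -> is_derive t (1 : R) F (F' t).
  move=> tab; have [d _] := hD t tab; rewrite /F' -[X in _ - X]mulr1.
  by apply: is_deriveB.
have cF' t : a <= t <= b -> {for t, continuous F'}.
  move=> tab; have [_ c] := hD t tab; apply: cvgB; last exact: cvg_cst.
  by apply: cvgM => //; exact: cvg_cst.
have cw (f : R -> R) : (forall t, a <= t <= b -> {for t, continuous f}) -> {within `[a, b], continuous f}.
  by move=> h; apply: continuous_in_subspaceT => t; rewrite inE /= in_itv /=; exact: h.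
have cF t : a <= t <= b -> {for t, continuous F}.
  by move=> /DF [d _]; apply: differentiable_continuous; apply/derivable1_diffP.
have I1 : (\int[mu]_(t in `[a, b]) (F' t)%:E = (F b)%:E - (F a)%:E)%E.
  apply: continuous_FTC2 => //; first exact: cw.
    split.
    - by move=> t; rewrite in_itv /= => /andP[h1 h2]; have [] := DF t; rewrite ?(ltW h1) ?(ltW h2).
    - by apply: cvg_at_right_filter; apply: cF; rewrite lexx ltW.
    - by apply: cvg_at_left_filter; apply: cF; rewrite lexx ltW.
  move=> t; rewrite in_itv /= => /andP[h1 h2]; rewrite derive1E.
  have tab : a <= t <= b by rewrite (ltW h1) (ltW h2).
  by have [_ ->] := DF t tab.
have -> : (G b - G a) ^+ 2 / (b - a) = F b - F a.
  by rewrite /F /l; field; rewrite gt_eqF.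
rewrite EFinB -I1.
have cG2 : {within `[a, b], continuous (fun t => G' t ^+ 2)}.
  by apply: cw => t tab; have [_ c] := hD t tab; apply: cvgM.
have seg := @segment_compact R a b.
apply: (@le_trans _ _ (\int[mu]_(t in `[a, b]) (G' t ^+ 2)%:E)%E).
  apply: le_integral => //.
  - exact: (continuous_compact_integrable seg (cw _ cF')).
  - exact: (continuous_compact_integrable seg cG2).
  - move=> t _; rewrite lee_fin /F'; have := sqr_ge0 (G' t - l); rewrite sqrrB; lra.
apply: (@le_trans _ _ (\int[mu]_(t in `[a, b]) (phi t)%:E)%E).
  apply: ge0_le_integral => //.
  - by move=> t _; rewrite lee_fin sqr_ge0.
  - apply/measurable_EFinP; apply: subspace_continuous_measurable_fun => //; exact: measurable_itv.
  - by apply/measurable_EFinP; apply: measurable_funS mphi.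
apply: ge0_subset_integral => //; first exact/measurable_EFinP.
by move=> t _; rewrite lee_fin.
Qed.

(** After the last zero of G before b the hypothesis applies, but only from points beyond that zero;
    they are taken so close to it that G is nearly 0. *)
Lemma zero_bound (G : R -> R) K z b : z <= b -> (forall t, z <= t <= b -> {for t, continuous G}) ->
  (forall s t, z <= s -> s <= t -> t <= b -> (forall x, s <= x <= t -> G x != 0) -> (G t - G s) ^+ 2 <= K) ->
  0 <= K -> G z = 0 -> G b ^+ 2 <= K.
Proof.
move=> zb cG nz K0 Gz; have [->|Gb] := eqVneq (G b) 0; first by rewrite expr0n.
have [|s [zs sb Gs hs]] := @last_zero G z b zb cG _ Gb; first by exists z; rewrite ?lexx.
rewrite leNgt; apply/negP => h; pose A := `|G b|.
have A0 : 0 < A by rewrite normr_gt0.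
have A2 : G b ^+ 2 = A ^+ 2 by rewrite real_normK ?num_real.
(* Then (A - eta)^2 >= A^2 - 2 A eta = (A^2 + K) / 2 > K. *)
rewrite A2 in h; pose eta := (A ^+ 2 - K) / (4 * A).
have e0 : 0 < eta by rewrite divr_gt0 ?subr_gt0// mulr_gt0.
have eA : eta * (4 * A) = A ^+ 2 - K by rewrite /eta divfK// gt_eqF// mulr_gt0.
have szb : z <= s <= b by rewrite zs ltW.
have [d /= d0 hd] := proj1 (cvgrPdist_lt _ _) (cG s szb) eta e0.
pose s' := Num.min (s + d / 2) ((s + b) / 2).
have s's : s < s' by rewrite lt_min; apply/andP; split; lra.
have s'd : s' <= s + d / 2 by rewrite ge_min lexx.
have s'b : s' <= (s + b) / 2 by rewrite ge_min lexx orbT.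
have := hd s'; rewrite /= Gs sub0r normrN => /(_ _) h1.
have {}h1 : `|G s'| < eta by apply: h1; rewrite ler0_norm ?subr_le0 ?(ltW s's)//; lra.
have : (G b - G s') ^+ 2 <= K.
  apply: nz; [lra|lra|exact: lexx|].
  by move=> x /andP[x1 x2]; apply: hs; rewrite x2 andbT (lt_le_trans s's).
apply/negP; rewrite -ltNge.
have h2 : A - eta <= `|G b - G s'|.
  by have := ler_normD (G b - G s') (G s'); rewrite subrK -/A; lra.
have e4 : eta <= A.
  rewrite -(ler_pM2r (x := 4 * A)) ?mulr_gt0// eA; have := sqr_ge0 A; rewrite expr2; lra.
have : (A - eta) ^+ 2 <= (G b - G s') ^+ 2.
  by rewrite -[X in _ <= X]real_normK ?num_real// ler_pXn2r// nnegrE subr_ge0.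
apply: lt_le_trans; rewrite sqrrB; have := sqr_ge0 eta; rewrite -mulr_natr; lra.
Qed.

(* [G'] need only exist where [G] does not vanish. *)
Lemma line_energy (G G' phi : R -> R) a b e : a < b ->
  (forall t, a <= t <= b -> {for t, continuous G}) ->
  (forall t, a <= t <= b -> G t != 0 -> is_derive t (1 : R) G (G' t) /\ {for t, continuous G'}) ->
  measurable_fun (setT : set (measurableTypeR R)) phi -> (forall t, 0 <= phi t) ->
  (forall t, a <= t <= b -> G t != 0 -> G' t ^+ 2 <= phi t) -> (\int[mu]_t (phi t)%:E <= e%:E)%E ->
  forall p q, a <= p <= b -> a <= q <= b -> G p ^+ 2 <= 2 * G q ^+ 2 + 2 * (b - a) * e.
Proof.
move=> ab cG hD mphi phi0 hphi Ie p q pab qab.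
have e0 : 0 <= e.
  by rewrite -lee_fin; apply: le_trans Ie; apply: integral_ge0 => t _; rewrite lee_fin.
have nz s t : a <= s -> s <= t -> t <= b -> (forall x, s <= x <= t -> G x != 0) -> (G t - G s) ^+ 2 <= (b - a) * e.
  move=> as_; rewrite le_eqVlt => /orP[/eqP <-|st] tb h.
    by rewrite subrr expr0n /= mulr_ge0// subr_ge0 ltW.
  have D x : s <= x <= t -> is_derive x (1 : R) G (G' x) /\ {for x, continuous G'}.
    by move=> sxt; apply: hD; [case/andP: sxt => sx xt; rewrite (le_trans as_ sx) (le_trans xt tb)|exact: h].
  have Q x : s <= x <= t -> G' x ^+ 2 <= phi x.
    by move=> sxt; apply: hphi; [case/andP: sxt => sx xt; rewrite (le_trans as_ sx) (le_trans xt tb)|exact: h].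
  have := le_trans (segment_energy st D mphi phi0 Q) Ie; rewrite lee_fin ler_pdivrMr ?subr_gt0// => h1.
  by apply: (le_trans h1); rewrite mulrC ler_wpM2r//; lra.
have K0 : 0 <= (b - a) * e by rewrite mulr_ge0// subr_ge0 ltW.
have zc t z : a <= t <= b -> a <= z <= b -> G z = 0 -> G t ^+ 2 <= (b - a) * e.
  move=> /andP[at_ tb] /andP[az zb] Gz; have [zt|tz] := leP z t.
    apply: (@zero_bound G _ z t zt) => //.
    - by move=> x /andP[x1 x2]; apply: cG; rewrite (le_trans az x1) (le_trans x2 tb).
    - by move=> s x s1 s2 s3; apply: nz => //; [exact: le_trans s1|exact: le_trans tb].
  rewrite -[t]opprK; apply: (@zero_bound (fun x => G (- x)) _ (- z) (- t)); rewrite ?opprK ?lerN2 ?(ltW tz)//.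
  - move=> x /andP[x1 x2]; have mx : a <= - x <= b by apply/andP; split; lra.
    by apply: (continuous_comp (f := fun x : R => - x)); [exact: opp_continuous|exact: cG].
  - move=> s x s1 s2 s3 h; rewrite -sqrrN opprB; apply: nz; [lra|lra|lra|].
    by move=> y /andP[y1 y2]; rewrite -[y]opprK; apply: h; apply/andP; split; lra.
have Gq := sqr_ge0 (G q).
have [[z zab Gz]|nozero] := pselect (exists2 z, a <= z <= b & G z = 0).
  by have := zc p z pab zab Gz; lra.
have nG x : a <= x <= b -> G x != 0 by move=> xab; apply/eqP => Gx; apply: nozero; exists x.
have : (G p - G q) ^+ 2 <= (b - a) * e.
  case/andP: pab => ap pb; case/andP: qab => aq qb; have [pq|qp] := leP p q.
    rewrite -sqrrN opprB; apply: nz => // x /andP[x1 x2]; apply: nG.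
    by rewrite (le_trans ap x1) (le_trans x2 qb).
  apply: nz => //; first exact: ltW.
  by move=> x /andP[x1 x2]; apply: nG; rewrite (le_trans aq x1) (le_trans x2 pb).
move=> h; rewrite -subr_ge0.
have -> : 2 * G q ^+ 2 + 2 * (b - a) * e - G p ^+ 2 = (G p - 2 * G q) ^+ 2 + 2 * ((b - a) * e - (G p - G q) ^+ 2).
  by ring.
by rewrite addr_ge0 ?sqr_ge0// mulr_ge0// subr_ge0.
Qed.

End line.

Section boxes.
Context {R : realType}.
Implicit Types (Y Z : R * R) (Q : set (R * R)).

Lemma closure_box Q (xl xr yb yt : R) Y : (forall Z, Q Z -> xl < Z.1 < xr /\ yb < Z.2 < yt) -> closure Q Y ->
  xl <= Y.1 <= xr /\ yb <= Y.2 <= yt.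
Proof.
move=> hQ /closureP cY; split; apply/andP; split; apply/ler_addgt0Pr => e e0;
  have [Z /hQ[/andP[z1 z2] /andP[z3 z4]] ZY] := cY e e0;
  have := le_lt_trans (enorm1 (Z - Y)) ZY; have := le_lt_trans (enorm2 (Z - Y)) ZY;
  move: z1 z2 z3 z4; rewrite /= !ltr_norml; clear; lra.
Qed.

Lemma open_box (xl xr yb yt : R) : open [set Y | xl < Y.1 < xr /\ yb < Y.2 < yt].
Proof.
apply/openP => Y [/andP[z1 z2] /andP[z3 z4]].
exists (Num.min (Num.min (Y.1 - xl) (xr - Y.1)) (Num.min (Y.2 - yb) (yt - Y.2))).
  by rewrite !lt_min !subr_gt0 z1 z2 z3 z4.
move=> Z; rewrite /eball /= !lt_min => /andP[/andP[w1 w2] /andP[w3 w4]].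
have := enorm1 (Z - Y); have := enorm2 (Z - Y); rewrite /= !ler_norml => /andP[n1 n2] /andP[n3 n4].
by move: w1 w2 w3 w4 n1 n2 n3 n4; clear; move=> *; split; apply/andP; split; lra.
Qed.

Lemma margin_low (xl x k w m : R) : xl <= m - 2 * k + w -> w <= k -> 0 < k -> m <= x -> xl < x.
Proof. by lra. Qed.
End boxes.

(** * Energy controls the maximum *)

Section energy.
Context {R : realType}.
Implicit Types (X Y Z v : R * R) (t r e s ell m eta sg w : R).
Local Notation mu := (@lebesgue_measure R).
Context (D : set (R * R)) (u : R * R -> R) (rho : R).
Context (oD : open D) (rho0 : 0 < rho).
Let W := D `&` eball 0 rho.
Let U := ext0 D u.
Context (hU : harm U W) (Uc : forall X, eball 0 rho X -> {for X, continuous U}).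

Definition energy_density X : R := ext0 W (fun X => cn (der U X) ^+ 2) X.
Local Notation f := energy_density.

Lemma ext0_in (A : set (R * R)) (g : R * R -> R) X : A X -> ext0 A g X = g X.
Proof. by move=> AX; rewrite /ext0; case: pselect. Qed.

Lemma U_out X : ~ D X -> U X = 0.
Proof. by move=> nD; rewrite /U /ext0; case: pselect. Qed.

Lemma density_ge0 X : 0 <= f X.
Proof. by rewrite /f /ext0; case: pselect => // ?; exact: sqr_ge0. Qed.

Lemma density_measurable : measurable_fun setT f.
Proof.
apply: ext0_measurable.
- by apply: openI => //; exact: open_eball.
- move=> X WX; have [r r0 pU] := hU WX.
  have c1 : {for X, continuous (fun Y => complex.Re (1 * der U Y))} := pa_cont (half_pos r0) (pa_der_re 1 r0 pU).
  have c2 : {for X, continuous (fun Y => complex.Re ('i%C * der U Y))} := pa_cont (half_pos r0) (pa_der_re 'i%C r0 pU).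
  have -> : (fun Y => cn (der U Y) ^+ 2) = (fun Y => complex.Re (1 * der U Y) * complex.Re (1 * der U Y) + complex.Re ('i%C * der U Y) * complex.Re ('i%C * der U Y)).
    apply/funext => Y; rewrite cnE sqr_sqrtr ?addr_ge0 ?sqr_ge0//.
    by case: (der U Y) => a b; rewrite mul1r /= mul0r mul1r sub0r; ring.
  by apply: cvgD; apply: cvgM.
- by move=> X _; exact: sqr_ge0.
Qed.

Lemma cont_line (g : R * R -> R) X v t : {for (X + t *: v), continuous g} -> {for t, continuous (fun t : R => g (X + t *: v))}.
Proof.
move=> /cont_atP h; apply/cvgrPdist_le => e e0; have [d d0 hd] := h e e0.
have v0 : 0 < enorm v + 1 by rewrite ltr_wpDl ?enorm_ge0.
exists (d / (enorm v + 1)); first by rewrite /= divr_gt0.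
move=> s /= st; rewrite distrC; apply: hd; rewrite /eball /= opprD addrACA subrr add0r -scalerBl enormZ distrC.
move: st; rewrite ltr_pdivlMr// mulrDr mulr1; apply: le_lt_trans.
by rewrite lerDl.
Qed.

Lemma line_bound X v a b e : enorm v = 1 -> a < b ->
  (forall t, a <= t <= b -> eball 0 rho (X + t *: v)) ->
  (\int[mu]_t (f (X + t *: v))%:E <= e%:E)%E ->
  forall p q, a <= p <= b -> a <= q <= b -> U (X + p *: v) ^+ 2 <= 2 * U (X + q *: v) ^+ 2 + 2 * (b - a) * e.
Proof.
move=> v1 ab hb Ie.
have WP t : a <= t <= b -> U (X + t *: v) != 0 -> W (X + t *: v).
  by move=> tab n0; split; [apply: contrapT => /U_out h; move: n0; rewrite h eqxx|exact: hb].
apply: (@line_energy R (fun t => U (X + t *: v)) (fun t => complex.Re (toC v * der U (X + t *: v))) (fun t => f (X + t *: v))) => //.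
- by move=> t tab; apply: cont_line; apply: Uc; exact: hb.
- move=> t tab n0; have [r r0 pU] := hU (WP t tab n0); split.
    by have [d1 d2] := pa_dir v r0 pU; have := line_derive d1; rewrite d2 mulrC.
  exact: (@cont_line (fun Y => complex.Re (toC v * der U Y)) X v t (pa_cont (half_pos r0) (pa_der_re (toC v) r0 pU))).
- apply: (measurableT_comp density_measurable).
  have aff (x y : R) : measurable_fun (setT : set (measurableTypeR R)) (fun t : R => x + t * y : measurableTypeR R).
    apply: continuous_measurable_fun => t; apply: cvgD; first exact: cvg_cst.
    by apply: cvgM; [exact: cvg_id|exact: cvg_cst].
  by apply/measurable_fun_pairP; split; exact: aff.
- by move=> t; exact: density_ge0.
- move=> t tab n0; have WX := WP t tab n0.
  rewrite /f ext0_in//; rewrite -[X in X <= _]real_normK ?num_real//.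
  rewrite ler_pXn2r ?nnegrE ?cn_ge0//; apply: le_trans (cn_Re _) _.
  by rewrite cnM -enormE v1 mul1r.
Qed.

Lemma good_point (F : measurableTypeR R -> \bar R) a b e : a < b -> measurable_fun setT F ->
  (forall y, 0 <= F y)%E -> (\int[mu]_y F y < e%:E)%E -> exists2 x, a <= x <= b & (F x <= (e / (b - a))%:E)%E.
Proof.
move=> ab mF F0 Fe; apply: contrapT => h.
have ba : 0 < b - a by rewrite subr_gt0.
have h' x : a <= x <= b -> ((e / (b - a))%:E <= F x)%E.
  by move=> xab; rewrite leNgt; apply/negP => g; apply: h; exists x => //; exact: ltW.
have e0 : 0 < e by rewrite -lte_fin; apply: le_lt_trans Fe; apply: integral_ge0 => y _; exact: F0.
have : (e%:E <= \int[mu]_y F y)%E.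
  apply: (@le_trans _ _ (\int[mu]_(y in `[a, b]) F y)%E); last by apply: ge0_subset_integral.
  have -> : e%:E = (\int[mu]_(y in `[a, b]) (cst (e / (b - a))%:E) y)%E.
    rewrite integral_cst//= lebesgue_measure_itv /= lte_fin ab -EFinB -EFinM divfK// gt_eqF//.
  apply: ge0_le_integral => //.
  - by move=> y _ /=; rewrite lee_fin divr_ge0// ltW.
  - exact: measurable_funS mF.
by rewrite leNgt Fe.
Qed.

Definition ev (x : measurableTypeR R) : \bar R := (\int[mu]_y (f (x, y))%:E)%E.
Definition eh (y : measurableTypeR R) : \bar R := (\int[mu]_x (f (x, y))%:E)%E.

Lemma ev_measurable : measurable_fun setT ev.
Proof.
apply: (@measurable_fun_fubini_tonelli_F _ _ _ _ R mu (EFin \o f)).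
- by apply/measurable_EFinP; exact: density_measurable.
- by move=> X; rewrite lee_fin density_ge0.
Qed.

Lemma eh_measurable : measurable_fun setT eh.
Proof.
apply: (@measurable_fun_fubini_tonelli_G _ _ _ _ R mu (EFin \o f)).
- by apply/measurable_EFinP; exact: density_measurable.
- by move=> X; rewrite lee_fin density_ge0.
Qed.

Lemma ev_ge0 x : (0 <= ev x)%E. Proof. by apply: integral_ge0 => y _; rewrite lee_fin density_ge0. Qed.
Lemma eh_ge0 x : (0 <= eh x)%E. Proof. by apply: integral_ge0 => y _; rewrite lee_fin density_ge0. Qed.

Lemma ev_int : (\int[(mu \x mu)%E]_X (f X)%:E = \int[mu]_x ev x)%E.
Proof.
apply: (@fubini_tonelli1 _ _ _ _ R mu mu (EFin \o f)).
- by apply/measurable_EFinP; exact: density_measurable.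
- by move=> X; rewrite /= lee_fin density_ge0.
Qed.
Lemma eh_int : (\int[(mu \x mu)%E]_X (f X)%:E = \int[mu]_x eh x)%E.
Proof.
apply: (@fubini_tonelli2 _ _ _ _ R mu mu (EFin \o f)).
- by apply/measurable_EFinP; exact: density_measurable.
- by move=> X; rewrite /= lee_fin density_ge0.
Qed.

Lemma vert_bound x a b e : a < b -> (forall t, a <= t <= b -> eball 0 rho (x, t)) -> (ev x <= e%:E)%E ->
  forall p q, a <= p <= b -> a <= q <= b -> U (x, p) ^+ 2 <= 2 * U (x, q) ^+ 2 + 2 * (b - a) * e.
Proof.
move=> ab hb he p q pab qab.
have E t : (x, 0) + t *: e2 = (x, t) :> R * R.
  by rewrite scaleE mulr0 mulr1 -[LHS]/(x + 0, 0 + t) addr0 add0r.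
have h1 : enorm (e2 : R * R) = 1 by rewrite /e2 enorm_e2 normr1.
have h2 t : a <= t <= b -> eball 0 rho ((x, 0) + t *: e2) by rewrite E; exact: hb.
have h3 : (\int[mu]_t (f ((x, 0)%R + t *: e2)%R)%:E <= e%:E)%E.
  by rewrite (_ : (fun t => _) = (fun t => (f (x, t))%:E)); [exact: he|apply/funext => t; rewrite E].
by have := line_bound h1 ab h2 h3 pab qab; rewrite !E.
Qed.

Lemma hor_bound y a b e : a < b -> (forall t, a <= t <= b -> eball 0 rho (t, y)) -> (eh y <= e%:E)%E ->
  forall p q, a <= p <= b -> a <= q <= b -> U (p, y) ^+ 2 <= 2 * U (q, y) ^+ 2 + 2 * (b - a) * e.
Proof.
move=> ab hb he p q pab qab.
have E t : (0, y) + t *: e1 = (t, y) :> R * R.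
  by rewrite scaleE mulr0 mulr1 -[LHS]/(0 + t, y + 0) addr0 add0r.
have h1 : enorm (e1 : R * R) = 1 by rewrite /e1 enorm_e1 normr1.
have h2 t : a <= t <= b -> eball 0 rho ((0, y) + t *: e1) by rewrite E; exact: hb.
have h3 : (\int[mu]_t (f ((0, y)%R + t *: e1)%R)%:E <= e%:E)%E.
  by rewrite (_ : (fun t => _) = (fun t => (f (t, y))%:E)); [exact: he|apply/funext => t; rewrite E].
by have := line_bound h1 ab h2 h3 pab qab; rewrite !E.
Qed.

Lemma rect_max (xl xr yb yt c : R) X :
  (forall x y, xl <= x <= xr -> yb <= y <= yt -> eball 0 rho (x, y)) ->
  (forall x y, xl <= x <= xr -> yb <= y <= yt -> x = xl \/ x = xr \/ y = yb \/ y = yt -> `|U (x, y)| <= c) ->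
  0 <= c -> xl < X.1 < xr /\ yb < X.2 < yt -> `|U X| <= c.
Proof.
move=> inb hb c0 Xin.
pose Q := [set Y : R * R | D Y /\ (xl < Y.1 < xr /\ yb < Y.2 < yt)].
have clQ Y : closure Q Y -> xl <= Y.1 <= xr /\ yb <= Y.2 <= yt by apply: closure_box => Z [].
have Qb : Q `<=` eball 0 rho.
  by move=> Y [_ [/andP[z1 z2] /andP[z3 z4]]]; rewrite (surjective_pairing Y); apply: inb; rewrite !ltW.
have oQ : open Q by apply: openI => //; exact: open_box.
have bd Y : closure Q Y -> ~ Q Y -> `|U Y| <= c.
  move=> cY nQ; have [/andP[p1 p2] /andP[q1 q2]] := clQ Y cY.
  have [DY|nDY] := pselect (D Y); last by rewrite U_out// normr0.
  rewrite (surjective_pairing Y); apply: hb; rewrite ?p1 ?q1//.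
  have [->|n1] := eqVneq Y.1 xl; first by left.
  have [->|n2] := eqVneq Y.1 xr; first by right; left.
  have [->|n3] := eqVneq Y.2 yb; first by right; right; left.
  have [->|n4] := eqVneq Y.2 yt; first by right; right; right.
  by case: nQ; split=> //; rewrite !lt_neqAle p1 p2 q1 q2 n2 n4 [xl == _]eq_sym [yb == _]eq_sym n1 n3.
have [DX|nDX] := pselect (D X); last by rewrite U_out// normr0.
have QX : Q X by split.
have cl1 Y : closure Q Y -> {for Y, continuous U}.
  by move=> /clQ[p q]; apply: Uc; rewrite (surjective_pairing Y); exact: inb.
have QW Y : Q Y -> W Y by move=> QY; split; [case: QY|exact: Qb].
rewrite ler_norml; apply/andP; split.
  rewrite -subr_ge0 opprK -oppr_le0 opprD.
  apply: (@max_principle2 R Q (fun Y => - U Y - c) 0 rho oQ Qb) => // Y.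
  - by move=> cY; apply: cvgB; [apply: cvgN; exact: cl1|exact: cvg_cst].
  - by move=> QY; apply: subD; [have [] := harm_sub hU (QW Y QY)|exact: sub_cst].
  - by move=> cY nQ; have := bd Y cY nQ; rewrite ler_norml lerNl subr_le0 => /andP[].
rewrite -subr_le0; apply: (@max_principle2 R Q (fun Y => U Y - c) 0 rho oQ Qb) => // Y.
- by move=> cY; apply: cvgB; [exact: cl1|exact: cvg_cst].
- by move=> QY; apply: subD; [have [] := harm_sub hU (QW Y QY)|exact: sub_cst].
- by move=> cY nQ; have := bd Y cY nQ; rewrite ler_norml subr_le0 => /andP[].
Qed.

Lemma square_step (a b c K : R) : a <= 2 * b + K -> b <= c * K -> a <= (2 * c + 1) * K.
Proof.
move=> h1 h2; apply: le_trans h1 _; have -> : (2 * c + 1) * K = 2 * (c * K) + K by ring.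
by rewrite lerD2r ler_pM2l.
Qed.

(* [X] is enclosed in a rectangle whose sides, and a segment joining them to a
   point off [D], lie on lines carrying little energy. *)
Lemma sup_bound (E : R) X sg al w : (\int[(mu \x mu)%E]_X (f X)%:E < E%:E)%E -> 0 < sg ->
  enorm X <= rho - sg -> 0 < w -> w <= sg / 8 -> - (sg / 8) <= al -> al + w <= sg / 8 ->
  (forall x, al <= x <= al + w -> exists2 y : R, `|y| <= sg / 8 & ~ D (x, y)) ->
  U X ^+ 2 <= 28 * rho * E / w.
Proof.
move=> hE s0 Xr w0 ws al1 al2 zs; set k := sg / 8 in ws al1 al2 zs.
have E0 : 0 < E.
  by rewrite -lte_fin; apply: le_lt_trans hE; apply: integral_ge0 => Y _; rewrite lee_fin density_ge0.
have k0 : 0 < k by rewrite /k; lra.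
have goodv a : exists2 x, a <= x <= a + w & (ev x <= (E / w)%:E)%E.
  have [|//|||x xa hx] := @good_point ev a (a + w) E; [by rewrite ltrDl|exact: ev_measurable|exact: ev_ge0|by rewrite -ev_int|].
  by exists x => //; move: hx; rewrite addrAC subrr add0r.
have goodh a : exists2 x, a <= x <= a + w & (eh x <= (E / w)%:E)%E.
  have [|//|||x xa hx] := @good_point eh a (a + w) E; [by rewrite ltrDl|exact: eh_measurable|exact: eh_ge0|by rewrite -eh_int|].
  by exists x => //; move: hx; rewrite addrAC subrr add0r.
(* The rectangle has to contain X and also the point (x0, y0) off D near the origin, hence the
   minima and maxima with 0. *)
pose x1 := Num.min 0 X.1; pose x2 := Num.max 0 X.1; pose y1 := Num.min 0 X.2; pose y2 := Num.max 0 X.2.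
have mm (z : R) : [/\ Num.min 0 z <= 0, Num.min 0 z <= z, 0 <= Num.max 0 z, z <= Num.max 0 z & - `|z| <= Num.min 0 z /\ Num.max 0 z <= `|z|].
  split; rewrite ?ge_min ?le_max ?lexx ?orbT//; split; first by rewrite le_min oppr_le0 normr_ge0 lerNnormlW.
  by rewrite ge_max normr_ge0 ler_norm.
have [a1 a2 a3 a4 [a5 a6]] := mm X.1; have [b1 b2 b3 b4 [b5 b6]] := mm X.2.
have [xl /andP[xl1 xl2] hxl] := goodv (x1 - 2 * k).
have [xr /andP[xr1 xr2] hxr] := goodv (x2 + k).
have [yb /andP[yb1 yb2] hyb] := goodh (y1 - 2 * k).
have [yt /andP[yt1 yt2] hyt] := goodh (y2 + k).
have [x0 /andP[x01 x02] hx0] := goodv al.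
have [|y0 y0k nD] := zs x0; first by rewrite x01.
rewrite ler_norml in y0k; case/andP: y0k => y01 y02.
rewrite /x1 /x2 /y1 /y2 in xl1 xl2 xr1 xr2 yb1 yb2 yt1 yt2.
have Xin : xl < X.1 < xr /\ yb < X.2 < yt.
  split; apply/andP; split.
  - exact: margin_low xl2 ws k0 a2.
  - by apply: le_lt_trans a4 (lt_le_trans _ xr1); rewrite ltrDl.
  - exact: margin_low yb2 ws k0 b2.
  - by apply: le_lt_trans b4 (lt_le_trans _ yt1); rewrite ltrDl.
have inb (x y : R) : xl <= x <= xr -> yb <= y <= yt -> eball 0 rho (x, y).
  move=> /andP[p1 p2] /andP[q1 q2]; rewrite /eball /= subr0.
  have xx : `|x| <= `|X.1| + 2 * k by rewrite ler_norml; lra.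
  have yy : `|y| <= `|X.2| + 2 * k by rewrite ler_norml; lra.
  have h1 : enorm (x, y) <= enorm (`|X.1| + 2 * k, `|X.2| + 2 * k).
    rewrite -(@ler_pXn2r R 2)// ?nnegrE ?enorm_ge0// !enorm_sqr /= -[x ^+ 2]real_normK ?num_real//.
    by rewrite -[y ^+ 2]real_normK ?num_real// lerD// ler_pXn2r// nnegrE addr_ge0// mulr_ge0// ltW.
  have h2 : enorm (`|X.1| + 2 * k, `|X.2| + 2 * k) <= enorm (`|X.1|, `|X.2|) + enorm (2 * k, 2 * k).
    by have := enormD (`|X.1|, `|X.2|) (2 * k, 2 * k).
  have h3 : enorm (`|X.1|, `|X.2|) = enorm X.
    by apply/eqP; rewrite -(@eqrXn2 _ 2) ?enorm_ge0// !enorm_sqr /= !real_normK ?num_real.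
  have h4 := enorm_le12 (2 * k, 2 * k); rewrite /= gtr0_norm ?mulr_gt0// in h4.
  by move: h1 h2 h4; rewrite h3 /k; lra.
pose K := 4 * rho * (E / w); have Ew0 : 0 < E / w by rewrite divr_gt0.
have len (a b : R) : b - a <= 2 * rho -> 2 * (b - a) * (E / w) <= K.
  by move=> h; rewrite /K; apply: ler_wpM2r; [exact: ltW|lra].
have xlr : xl < xr by case: Xin => /andP[p1 p2] _; exact: lt_trans p1 p2.
have ybt : yb < yt by case: Xin => _ /andP[p1 p2]; exact: lt_trans p1 p2.
have lx : xr - xl <= 2 * rho.
  have := inb xl yb; have := inb xr yb; rewrite /eball /= !subr0 !lexx !(ltW xlr) (ltW ybt) => /(_ isT isT) h1 /(_ isT isT) h2.
  by have := enorm1 (xr, yb); have := enorm1 (xl, yb); rewrite /= !ler_norml; lra.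
have ly : yt - yb <= 2 * rho.
  have := inb xl yb; have := inb xl yt; rewrite /eball /= !subr0 !lexx !(ltW xlr) (ltW ybt) => /(_ isT isT) h1 /(_ isT isT) h2.
  by have := enorm2 (xl, yb); have := enorm2 (xl, yt); rewrite /= !ler_norml; lra.
have x0b : xl <= x0 <= xr by lra.
have y0b : yb <= y0 <= yt by lra.
have V (x p q : R) : xl <= x <= xr -> (ev x <= (E / w)%:E)%E -> yb <= p <= yt -> yb <= q <= yt -> U (x, p) ^+ 2 <= 2 * U (x, q) ^+ 2 + K.
  move=> xb hx pb qb; apply: le_trans (vert_bound ybt (fun t tb => inb x t xb tb) hx pb qb) _.
  by rewrite lerD2l; exact: len.
have Hh (y p q : R) : yb <= y <= yt -> (eh y <= (E / w)%:E)%E -> xl <= p <= xr -> xl <= q <= xr -> U (p, y) ^+ 2 <= 2 * U (q, y) ^+ 2 + K.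
  move=> yb' hy pb qb; apply: le_trans (hor_bound xlr (fun t tb => inb t y tb yb') hy pb qb) _.
  by rewrite lerD2l; exact: len.
have xlb : xl <= xl <= xr by rewrite lexx ltW.
have xrb : xl <= xr <= xr by rewrite lexx ltW.
have ybb : yb <= yb <= yt by rewrite lexx ltW.
have ytb : yb <= yt <= yt by rewrite lexx ltW.
have z0 (y : R) : yb <= y <= yt -> U (x0, y) ^+ 2 <= K.
  by move=> yy; have := V x0 y y0 x0b hx0 yy y0b; rewrite (U_out nD) expr0n /= mulr0 add0r.
(* Each change of line turns a bound c K into (2 c + 1) K: 0 at the point off D, 1 on the vertical
   line through it, 3 on the horizontal sides, 7 on the vertical ones. *)
have E3 : 3 = 2 * 1 + 1 :> R by ring.
have E7 : 7 = 2 * 3 + 1 :> R by ring.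
have top (x : R) : xl <= x <= xr -> U (x, yt) ^+ 2 <= 3 * K.
  move=> xx; rewrite E3; apply: (square_step (Hh yt x x0 ytb hyt xx x0b)).
  by rewrite mul1r; exact: z0 yt ytb.
have bot (x : R) : xl <= x <= xr -> U (x, yb) ^+ 2 <= 3 * K.
  move=> xx; rewrite E3; apply: (square_step (Hh yb x x0 ybb hyb xx x0b)).
  by rewrite mul1r; exact: z0 yb ybb.
have K0 : 0 <= K by rewrite /K mulr_ge0 ?(ltW Ew0)// mulr_ge0// ltW.
have lft (y : R) : yb <= y <= yt -> U (xl, y) ^+ 2 <= 7 * K.
  by move=> yy; rewrite E7; apply: (square_step (V xl y yt xlb hxl yy ytb)); exact: top xl xlb.
have rgt (y : R) : yb <= y <= yt -> U (xr, y) ^+ 2 <= 7 * K.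
  by move=> yy; rewrite E7; apply: (square_step (V xr y yt xrb hxr yy ytb)); exact: top xr xrb.
pose c := Num.sqrt (7 * K); have c0 : 0 <= c := sqrtr_ge0 _.
have c2 : c ^+ 2 = 7 * K by rewrite sqr_sqrtr// mulr_ge0.
have -> : 28 * rho * E / w = c ^+ 2 by rewrite c2 /K; ring.
have sqle (z : R) : z ^+ 2 <= 7 * K -> `|z| <= c.
  by rewrite -c2 -[z ^+ 2]real_normK ?num_real// ler_pXn2r// nnegrE.
have main : `|U X| <= c.
  apply: (rect_max inb _ c0 Xin) => x y xx yy [->|[->|[->|->]]]; apply: sqle.
  - exact: lft.
  - exact: rgt.
  - by apply: le_trans (bot x xx) _; rewrite ler_wpM2r// ler_nat.
  - by apply: le_trans (top x xx) _; rewrite ler_wpM2r// ler_nat.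
by rewrite -[X in X <= _]real_normK ?num_real// ler_pXn2r ?nnegrE.
Qed.

End energy.

(** * Spherical mass against maximum and energy *)

Section sphere.
Context {R : realType}.
Implicit Types (X Y Z v : R * R) (t r e s ell m eta sg w : R).
Local Notation mu := (@lebesgue_measure R).
Context (D : set (R * R)) (u : R * R -> R) (rho : R).
Context (oD : open D) (rho0 : 0 < rho).
Let W := D `&` eball 0 rho.
Let U := ext0 D u.
Context (hU : harm U W) (Uc : forall X, eball 0 rho X -> {for X, continuous U}).
Context (ub : forall X, D X -> esphere 0 rho X -> forall e, 0 < e ->
  exists2 d : R, 0 < d & forall Y, W Y -> eball X d Y -> `|U Y - U X| <= e).
Local Notation f := (energy_density D u rho).
Local Notation eh := (eh D u rho).
Local Notation ev := (ev D u rho).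

(** A point of the sphere is outside the open ball in which U is controlled; its value is recovered
    as a limit along v. *)
Lemma sphere_limit X v K : D X -> esphere 0 rho X -> enorm v = 1 ->
  (exists2 t0 : R, 0 < t0 & forall t, 0 < t < t0 -> eball 0 rho (X + t *: v) /\ U (X + t *: v) ^+ 2 <= K) ->
  U X ^+ 2 <= K.
Proof.
move=> DX Xr v1 [t0 t00 h]; have [r r0 rD] := proj1 (openP D) oD X DX.
rewrite leNgt; apply/negP => hK; pose A := `|U X|.
have A2 : U X ^+ 2 = A ^+ 2 by rewrite real_normK ?num_real.
have K0 : 0 <= K.
  have [|_ h1] := h (t0 / 2); first by apply/andP; split; lra.
  exact: le_trans (sqr_ge0 _) h1.
have A0 : 0 < A by rewrite normr_gt0; apply/eqP => E; move: hK; rewrite E expr0n /= ltNge K0.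
pose eta := (A ^+ 2 - K) / (4 * A).
have e0 : 0 < eta by rewrite divr_gt0 ?mulr_gt0// subr_gt0 -A2.
have eA : eta * (4 * A) = A ^+ 2 - K by rewrite /eta divfK// gt_eqF// mulr_gt0.
have [d d0 hd] := ub DX Xr e0.
pose t := Num.min (t0 / 2) (Num.min (r / 2) (d / 2)).
have tp : 0 < t by rewrite !lt_min !half_pos.
have t1 : t <= t0 / 2 by rewrite ge_min lexx.
have t2 : t <= r / 2 by rewrite !ge_min lexx orbT.
have t3 : t <= d / 2 by rewrite !ge_min lexx !orbT.
have [|bt ht] := h t; first by rewrite tp; lra.
have N : enorm (X + t *: v - X) = t by rewrite addrAC subrr add0r enormZ v1 mulr1 gtr0_norm.
have WY : W (X + t *: v) by split=> //; apply: rD; rewrite /eball /= N; lra.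
have := hd _ WY; rewrite /eball /= N => /(_ _) h1.
have {}h1 : `|U (X + t *: v) - U X| <= eta by apply: h1; lra.
set b := U (X + t *: v) in ht h1.
have h2 : A - eta <= `|b|.
  have := ler_normB b (b - U X); rewrite subKr -/A; lra.
have e4 : eta <= A.
  by rewrite -(ler_pM2r (x := 4 * A)) ?mulr_gt0// eA; have := sqr_ge0 A; rewrite expr2; lra.
have : (A - eta) ^+ 2 <= b ^+ 2.
  by rewrite -[b ^+ 2]real_normK ?num_real// ler_pXn2r// nnegrE subr_ge0.
have := sqr_ge0 eta; rewrite sqrrB -mulr_natr; lra.
Qed.

(** The circle is split according to which coordinate is at most 3/4 rho; the two parts cover it
    since 2 (3/4)^2 > 1. On each part the other coordinate is bounded below, so the chords in its
    direction go well inside. *)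
Lemma circle_half (x y : R) : x ^+ 2 + y ^+ 2 = rho ^+ 2 -> `|y| <= 3 / 4 * rho -> 13 / 20 * rho <= `|x|.
Proof.
move=> xy y3; have h1 : y ^+ 2 <= (3 / 4 * rho) ^+ 2.
  by rewrite -[y ^+ 2]real_normK ?num_real// ler_pXn2r ?nnegrE// mulr_ge0 ?(ltW rho0)//; lra.
have h2 : (13 / 20 * rho) ^+ 2 <= x ^+ 2.
  by rewrite exprMn in h1; rewrite exprMn; have := sqr_ge0 rho; lra.
rewrite -(@ler_pXn2r R 2)// ?nnegrE ?real_normK ?num_real//.
by rewrite mulr_ge0 ?(ltW rho0)//; lra.
Qed.

(* Moving from a point of the circle by [t] towards the nearest axis. *)
Lemma chord_in (x y t ell : R) : x ^+ 2 + y ^+ 2 = rho ^+ 2 -> `|y| <= 3 / 4 * rho -> 0 < t -> t <= 2 * ell ->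
  ell <= rho / 8 ->
  enorm (x - Num.sg x * t, y) < rho /\ (t = 2 * ell -> enorm (x - Num.sg x * t, y) <= rho - ell).
Proof.
move=> xy y3 t0 tl lr; have xh := circle_half xy y3.
have x0 : x != 0 by apply/eqP => E; move: xh; rewrite E normr0; move: rho0; lra.
have E : (x - Num.sg x * t) ^+ 2 + y ^+ 2 = rho ^+ 2 - 2 * t * `|x| + t ^+ 2.
  rewrite -xy; have : Num.sg x ^+ 2 = 1 by rewrite sqr_sg x0.
  have : x = Num.sg x * `|x| by rewrite -numEsg.
  move: (Num.sg x) (`|x|) => g a xE g2; rewrite xE; have -> : (g * a - g * t) ^+ 2 = g ^+ 2 * (a - t) ^+ 2 by ring.
  by rewrite [(g * a) ^+ 2]exprMn g2; ring.
have tx : t * (13 / 20 * rho) <= t * `|x| by rewrite ler_pM2l.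
have tt : t ^+ 2 <= t * (2 * ell) by rewrite expr2 ler_pM2l.
have tl2 : t * (2 * ell) <= t * (rho / 4) by rewrite ler_pM2l//; lra.
have tr : 0 < t * rho by rewrite mulr_gt0.
split.
  by rewrite -(@ltr_pXn2r R 2)// ?nnegrE ?enorm_ge0 ?(ltW rho0)// enorm_sqr /= E; lra.
move=> tE; rewrite -(@ler_pXn2r R 2)// ?nnegrE ?enorm_ge0//; last by move: rho0; lra.
rewrite enorm_sqr /= E; have -> : (rho - ell) ^+ 2 = rho ^+ 2 - t * rho + t ^+ 2 / 4 by rewrite tE; field.
have h : t ^+ 2 <= t * (rho / 4) by lra.
by lra.
Qed.

Context (ell m : R) (ell0 : 0 < ell) (ell8 : ell <= rho / 8) (m0 : 0 <= m).
Context (Um : forall Y, ecball 0 (rho - ell) Y -> `|U Y| <= m).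

Lemma sq_le_m Y : ecball 0 (rho - ell) Y -> U Y ^+ 2 <= m ^+ 2.
Proof. by move=> /Um h; rewrite -[U Y ^+ 2]real_normK ?num_real// ler_pXn2r// nnegrE. Qed.

Lemma esphere_eq X : esphere 0 rho X -> X.1 ^+ 2 + X.2 ^+ 2 = rho ^+ 2.
Proof. by rewrite /esphere /= subr0 -enorm_sqr => ->. Qed.

Lemma sg_sign (x : R) : x != 0 -> Num.sg x = 1 \/ Num.sg x = -1.
Proof. by case: sgrP => // _ _; [left|right]. Qed.

(** A horizontal chord of length 2 ell going inward from X ends in the disc of radius rho - ell,
    where m bounds |U|; the increase on the way is paid by the energy of that line. *)
Lemma hor_sphere X e : D X -> esphere 0 rho X -> `|X.2| <= 3 / 4 * rho -> (eh X.2 <= e%:E)%E ->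
  U X ^+ 2 <= 2 * m ^+ 2 + 4 * ell * e.
Proof.
move=> DX SX X2 he; have sE := esphere_eq SX.
have e0 : 0 <= e by rewrite -lee_fin; apply: le_trans he; exact: eh_ge0.
have x0 : X.1 != 0.
  by apply/eqP => E; have := circle_half sE X2; rewrite E normr0; move: rho0; lra.
have vE t : X + t *: (- Num.sg X.1, 0) = (X.1 - Num.sg X.1 * t, X.2).
  by rewrite [X in X + _]surjective_pairing scaleE mulr0 /= -[LHS]/(X.1 + _, X.2 + 0) addr0 mulrN mulrC.
apply: (@sphere_limit X (- Num.sg X.1, 0)) => //.
  by rewrite enorm_e1 normrN normr_sg x0.
exists (2 * ell); first by rewrite mulr_gt0.
move=> t /andP[t0 tl]; rewrite vE; have [b1 _] := chord_in sE X2 t0 (ltW tl) ell8.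
split; first by rewrite /eball /= subr0.
have [_ /(_ erefl) b2] := chord_in sE X2 (mulr_gt0 (ltr0Sn R 1) ell0) (lexx _) ell8.
have inb t' : t <= t' -> t' <= 2 * ell -> eball 0 rho (X.1 - Num.sg X.1 * t', X.2).
  move=> h1 h2; rewrite /eball /= subr0; have [] := chord_in sE X2 (lt_le_trans t0 h1) h2 ell8.
  by [].
have U2 : U (X.1 - Num.sg X.1 * (2 * ell), X.2) ^+ 2 <= m ^+ 2 by apply: sq_le_m; rewrite /ecball /= subr0.
have fin (z : R) : z <= 2 * ell -> 2 * z * e <= 4 * ell * e.
  by move=> h; apply: ler_wpM2r => //; lra.
case: (sg_sign x0) => sg; rewrite sg ?mul1r ?mulN1r ?opprK in inb U2 *.
  have := @hor_bound _ D u rho oD hU Uc X.2 (X.1 - 2 * ell) (X.1 - t) e.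
  have /[swap]/[apply] : X.1 - 2 * ell < X.1 - t by lra.
  have /[swap]/[apply] : forall t', X.1 - 2 * ell <= t' <= X.1 - t -> eball 0 rho (t', X.2).
    move=> t' /andP[h1 h2]; have := inb (X.1 - t'); rewrite mul1r subKr; apply; lra.
  move=> /(_ he (X.1 - t) (X.1 - 2 * ell)).
  have -> : X.1 - t - (X.1 - 2 * ell) = 2 * ell - t by ring.
  have i1 : X.1 - 2 * ell <= X.1 - t <= X.1 - t by lra.
  have i2 : X.1 - 2 * ell <= X.1 - 2 * ell <= X.1 - t by lra.
  have f2 : 2 * (2 * ell - t) * e <= 4 * ell * e by apply: fin; move: t0; lra.
by move=> /(_ i1 i2); rewrite -/U; move: U2 f2; lra.
have := @hor_bound _ D u rho oD hU Uc X.2 (X.1 + t) (X.1 + 2 * ell) e.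
have /[swap]/[apply] : X.1 + t < X.1 + 2 * ell by lra.
have /[swap]/[apply] : forall t', X.1 + t <= t' <= X.1 + 2 * ell -> eball 0 rho (t', X.2).
  move=> t' /andP[h1 h2]; have E : X.1 - -1 * (t' - X.1) = t' by ring.
  by have := inb (t' - X.1); rewrite E; apply; lra.
move=> /(_ he (X.1 + t) (X.1 + 2 * ell)).
have -> : X.1 + 2 * ell - (X.1 + t) = 2 * ell - t by ring.
have i1 : X.1 + t <= X.1 + t <= X.1 + 2 * ell by lra.
have i2 : X.1 + t <= X.1 + 2 * ell <= X.1 + 2 * ell by lra.
have f2 : 2 * (2 * ell - t) * e <= 4 * ell * e by apply: fin; move: t0; lra.
by move=> /(_ i1 i2); rewrite -/U; move: U2 f2; lra.
Qed.

Lemma ver_sphere X e : D X -> esphere 0 rho X -> `|X.1| <= 3 / 4 * rho -> (ev X.1 <= e%:E)%E ->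
  U X ^+ 2 <= 2 * m ^+ 2 + 4 * ell * e.
Proof.
move=> DX SX X2 he; have sE : X.2 ^+ 2 + X.1 ^+ 2 = rho ^+ 2 by rewrite addrC; exact: esphere_eq.
have sw (a b : R) : enorm (b, a) = enorm (a, b) by apply/eqP; rewrite -(@eqrXn2 _ 2) ?enorm_ge0// !enorm_sqr /= addrC.
have e0 : 0 <= e by rewrite -lee_fin; apply: le_trans he; exact: ev_ge0.
have x0 : X.2 != 0.
  by apply/eqP => E; have := circle_half sE X2; rewrite E normr0; move: rho0; lra.
have vE t : X + t *: (0, - Num.sg X.2) = (X.1, X.2 - Num.sg X.2 * t).
  by rewrite [X in X + _]surjective_pairing scaleE mulr0 /= -[LHS]/(X.1 + 0, X.2 + _) addr0 mulrN mulrC.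
apply: (@sphere_limit X (0, - Num.sg X.2)) => //.
  by rewrite enorm_e2 normrN normr_sg x0.
exists (2 * ell); first by rewrite mulr_gt0.
move=> t /andP[t0 tl]; rewrite vE; have [b1 _] := chord_in sE X2 t0 (ltW tl) ell8.
split; first by rewrite /eball /= subr0 sw.
have [_ /(_ erefl) b2] := chord_in sE X2 (mulr_gt0 (ltr0Sn R 1) ell0) (lexx _) ell8.
have inb t' : t <= t' -> t' <= 2 * ell -> eball 0 rho (X.1, X.2 - Num.sg X.2 * t').
  move=> h1 h2; rewrite /eball /= subr0 sw; have [] := chord_in sE X2 (lt_le_trans t0 h1) h2 ell8.
  by [].
have U2 : U (X.1, X.2 - Num.sg X.2 * (2 * ell)) ^+ 2 <= m ^+ 2 by apply: sq_le_m; rewrite /ecball /= subr0 sw.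
have fin (z : R) : z <= 2 * ell -> 2 * z * e <= 4 * ell * e.
  by move=> h; apply: ler_wpM2r => //; lra.
case: (sg_sign x0) => sg; rewrite sg ?mul1r ?mulN1r ?opprK in inb U2 *.
  have := @vert_bound _ D u rho oD hU Uc X.1 (X.2 - 2 * ell) (X.2 - t) e.
  have /[swap]/[apply] : X.2 - 2 * ell < X.2 - t by lra.
  have /[swap]/[apply] : forall t', X.2 - 2 * ell <= t' <= X.2 - t -> eball 0 rho (X.1, t').
    move=> t' /andP[h1 h2]; have := inb (X.2 - t'); rewrite mul1r subKr; apply; lra.
  move=> /(_ he (X.2 - t) (X.2 - 2 * ell)).
  have -> : X.2 - t - (X.2 - 2 * ell) = 2 * ell - t by ring.
  have i1 : X.2 - 2 * ell <= X.2 - t <= X.2 - t by lra.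
  have i2 : X.2 - 2 * ell <= X.2 - 2 * ell <= X.2 - t by lra.
  have f2 : 2 * (2 * ell - t) * e <= 4 * ell * e by apply: fin; move: t0; lra.
by move=> /(_ i1 i2); rewrite -/U; move: U2 f2; lra.
have := @vert_bound _ D u rho oD hU Uc X.1 (X.2 + t) (X.2 + 2 * ell) e.
have /[swap]/[apply] : X.2 + t < X.2 + 2 * ell by lra.
have /[swap]/[apply] : forall t', X.2 + t <= t' <= X.2 + 2 * ell -> eball 0 rho (X.1, t').
  move=> t' /andP[h1 h2]; have E : X.2 - -1 * (t' - X.2) = t' by ring.
  by have := inb (t' - X.2); rewrite E; apply; lra.
move=> /(_ he (X.2 + t) (X.2 + 2 * ell)).
have -> : X.2 + 2 * ell - (X.2 + t) = 2 * ell - t by ring.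
have i1 : X.2 + t <= X.2 + t <= X.2 + 2 * ell by lra.
have i2 : X.2 + t <= X.2 + 2 * ell <= X.2 + 2 * ell by lra.
have f2 : 2 * (2 * ell - t) * e <= 4 * ell * e by apply: fin; move: t0; lra.
by move=> /(_ i1 i2); rewrite -/U; move: U2 f2; lra.
Qed.

Lemma arc_lip (s y y' : R) : `|s| = 1 -> `|y| <= 3 / 4 * rho -> `|y'| <= 3 / 4 * rho ->
  enorm (s * Num.sqrt (rho ^+ 2 - y ^+ 2) - s * Num.sqrt (rho ^+ 2 - y' ^+ 2), y - y') <= 3 * `|y - y'|.
Proof.
move=> s1 hy hy'.
have sq (z : R) : `|z| <= 3 / 4 * rho -> Num.sqrt (rho ^+ 2 - z ^+ 2) ^+ 2 = rho ^+ 2 - z ^+ 2.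
  move=> hz; rewrite sqr_sqrtr// subr_ge0 -[z ^+ 2]real_normK ?num_real// ler_pXn2r ?nnegrE ?(ltW rho0)//.
  by move: hz rho0; lra.
have lo (z : R) : `|z| <= 3 / 4 * rho -> 13 / 20 * rho <= Num.sqrt (rho ^+ 2 - z ^+ 2).
  move=> hz; have := @circle_half (Num.sqrt (rho ^+ 2 - z ^+ 2)) z; rewrite sq// subrK => /(_ erefl hz).
  by rewrite ger0_norm ?sqrtr_ge0.
have := sq y hy; have := sq y' hy'; have := lo y hy; have := lo y' hy'.
rewrite -mulrBr; move: (Num.sqrt _) (Num.sqrt _) => g g' l' l q' q.
apply: le_trans (enorm_le12 _) _; rewrite /= normrM s1 mul1r.
suff : `|g - g'| <= 2 * `|y - y'| by lra.
have gg : 0 < g + g' by move: rho0; lra.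
rewrite -(ler_pM2r gg) -{1}(gtr0_norm gg) -normrM.
have -> : (g - g') * (g + g') = - ((y - y') * (y + y')).
  have -> : (g - g') * (g + g') = g ^+ 2 - g' ^+ 2 by ring.
  by rewrite q q'; ring.
rewrite normrN normrM mulrAC mulrC; apply: ler_wpM2r => //.
by apply: le_trans (ler_normD _ _) _; move: rho0; lra.
Qed.

(** Each of the two parts of the circle consists of two graphs with Lipschitz constant 3, and every
    graph contributes 12. *)
Lemma arcs (A : set (R * R)) (Z1 Z2 : set R) : (forall X, A X -> esphere 0 rho X) ->
  (forall X, A X -> `|X.2| <= 3 / 4 * rho -> Z1 X.2) ->
  (forall X, A X -> `|X.1| <= 3 / 4 * rho -> Z2 X.1) ->
  (hausdorff1 A <= 24%:E * mu Z1 + 24%:E * mu Z2)%E.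
Proof.
move=> As h1 h2; pose B := [set y : R | `|y| <= 3 / 4 * rho].
pose g1 (s y : R) : R * R := (s * Num.sqrt (rho ^+ 2 - y ^+ 2), y).
pose g2 (s y : R) : R * R := (y, s * Num.sqrt (rho ^+ 2 - y ^+ 2)).
have sgE (x y : R) : x ^+ 2 + y ^+ 2 = rho ^+ 2 -> exists2 s : R, s = 1 \/ s = -1 & x = s * Num.sqrt (rho ^+ 2 - y ^+ 2).
  move=> E; have -> : rho ^+ 2 - y ^+ 2 = x ^+ 2 by rewrite -E addrK.
  rewrite sqrtr_sqr; have [x0|x0] := leP 0 x.
    by exists 1; [left|rewrite mul1r ger0_norm].
  by exists (-1); [right|rewrite mulN1r ltr0_norm// opprK].
have sub : A `<=` (g1 1 @` (B `&` Z1) `|` g1 (-1) @` (B `&` Z1)) `|` (g2 1 @` (B `&` Z2) `|` g2 (-1) @` (B `&` Z2)).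
  move=> X AX; have E := esphere_eq (As X AX).
  have [X2|X2] := leP `|X.2| (3 / 4 * rho).
    left; have [s sE xE] := sgE _ _ E; case: sE => sE; rewrite sE in xE; [left|right]; exists X.2 => //;
      by [split => //; exact: h1|rewrite /g1 -xE -surjective_pairing].
  have X1 : `|X.1| <= 3 / 4 * rho.
    rewrite leNgt; apply/negP => X1.
    have k0 : 0 <= 3 / 4 * rho by move: rho0; lra.
    have e1 : (3 / 4 * rho) ^+ 2 < X.1 ^+ 2 by rewrite -[X in _ < X]real_normK ?num_real// ltr_pXn2r// nnegrE.
    have e2 : (3 / 4 * rho) ^+ 2 < X.2 ^+ 2 by rewrite -[X in _ < X]real_normK ?num_real// ltr_pXn2r// nnegrE.
    by move: E e1 e2; rewrite exprMn; have := sqr_ge0 rho; lra.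
  right; rewrite addrC in E; have [s sE xE] := sgE _ _ E; case: sE => sE; rewrite sE in xE; [left|right]; exists X.1 => //;
    by [split => //; exact: h2|rewrite /g2 -xE -surjective_pairing].
apply: le_trans (le_hausdorff1 sub) _.
have n1 : `|1 : R| = 1 by rewrite normr1.
have nN : `|-1 : R| = 1 by rewrite normrN normr1.
have b1 (s : R) : `|s| = 1 -> (hausdorff1 (g1 s @` (B `&` Z1)) <= 12%:E * mu Z1)%E.
  by move=> s1; apply: hausdorff1_graph => x y hx hy; exact: arc_lip.
have b2 (s : R) : `|s| = 1 -> (hausdorff1 (g2 s @` (B `&` Z2)) <= 12%:E * mu Z2)%E.
  move=> s1; apply: hausdorff1_graph => x y hx hy; apply: le_trans (arc_lip s1 hx hy).
  rewrite -(@ler_pXn2r R 2)// ?nnegrE ?enorm_ge0// !enorm_sqr /= addrC //.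
have tw (z : \bar R) : (24%:E * z = 12%:E * z + 12%:E * z)%E.
  by rewrite -ge0_muleDl// -EFinD; congr (_%:E * _)%E; rewrite -natrD.
rewrite !tw; apply: le_trans (outer_measureU2 hausdorff1_outer _ _) _.
by apply: leeD; (apply: le_trans (outer_measureU2 hausdorff1_outer _ _) _; apply: leeD); [exact: b1|exact: b1|exact: b2|exact: b2].
Qed.

(** At a point of the sphere u^2 is at most 2 m^2 + 4 ell times the energy of one line through it.
    Integrating these bounds over all lines gives 4 rho m^2 + 4 ell E, in each of the two directions
    and with the factor 24 of [arcs]. *)
Lemma sphere_mass_le E : (\int[(mu \x mu)%E]_X (f X)%:E = E%:E)%E ->
  (sphere_mass D u 0%R rho <= (192 * (rho * m ^+ 2 + ell * E))%:E)%E.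
Proof.
move=> hE.
pose I (y : measurableTypeR R) : \bar R := ((\1_`[- rho, rho] y)%:E)%E.
pose F (g : measurableTypeR R -> \bar R) (y : measurableTypeR R) := ((2 * m ^+ 2)%:E * I y + (4 * ell)%:E * g y)%E.
have I0 y : (0 <= I y)%E by rewrite /I lee_fin.
have mI : measurable_fun setT I by apply/measurable_EFinP; exact: measurable_indic.
have c1 : 0 <= 2 * m ^+ 2 by rewrite mulr_ge0// sqr_ge0.
have c2 : 0 < 4 * ell by rewrite mulr_gt0.
have mF (g : measurableTypeR R -> \bar R) : measurable_fun setT g -> measurable_fun setT (F g).
  by move=> mg; apply: emeasurable_funD; apply: emeasurable_funM => //; exact: measurable_cst.
have F0 (g : measurableTypeR R -> \bar R) : (forall y, 0 <= g y)%E -> forall y, (0 <= F g y)%E.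
  by move=> g0 y; rewrite adde_ge0// mule_ge0// lee_fin// ltW.
have FI (g : measurableTypeR R -> \bar R) : measurable_fun setT g -> (forall y, 0 <= g y)%E ->
    (\int[mu]_y g y = E%:E)%E -> (\int[mu]_y F g y = (4 * rho * m ^+ 2 + 4 * ell * E)%:E)%E.
  move=> mg g0 gE; rewrite /F ge0_integralD//; last 4 first.
  - by move=> y _; rewrite mule_ge0// lee_fin.
  - by apply: emeasurable_funM => //; exact: measurable_cst.
  - by move=> y _; rewrite mule_ge0// lee_fin ltW.
  - by apply: emeasurable_funM => //; exact: measurable_cst.
  rewrite !ge0_integralZl// ?lee_fin ?(ltW c2)// gE /I integral_indic// setIT.
  rewrite [X in (_ * X + _)%E]lebesgue_measure_itv /= lte_fin.
  have -> : - rho < rho by move: rho0; lra.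
  by rewrite -EFinB -!EFinM -EFinD; congr (_%:E); ring.
have tF (g : measurableTypeR R -> \bar R) (y t : R) : (0 <= g y)%E -> `|y| <= rho ->
    (forall e, (g y <= e%:E)%E -> t <= 2 * m ^+ 2 + 4 * ell * e) -> (t%:E <= F g y)%E.
  move=> g0 yr h; rewrite /F /I indicE mem_set; last by rewrite /= in_itv /= -ler_norml.
  rewrite mule1; case: (g y) g0 h => [e| |] // _ h; last by rewrite gt0_muley// addey// leey.
  by rewrite -EFinM -EFinD lee_fin h.
rewrite /sphere_mass; set A := (_ `&` D).
have AS X : A X -> esphere 0 rho X by case.
have ar X : A X -> `|X.1| <= rho /\ `|X.2| <= rho.
  by case=> XS _; move: XS; rewrite /esphere /= subr0 => <-; split; [exact: enorm1|exact: enorm2].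
have fin : (hausdorff1 A < +oo)%E.
  pose J : set R := [set` `[- rho, rho] ].
  apply: (@le_lt_trans _ _ (24%:E * mu J + 24%:E * mu J)%E).
    by apply: arcs => // X AX _; rewrite /J /= in_itv /= -ler_norml; have [] := ar X AX.
  rewrite /J lebesgue_measure_itv /=; case: ifP => _; rewrite -?EFinB -?EFinM -?EFinD ?ltry// mule0 adde0 ltry//.
have UE X : A X -> U X = u X by case=> _ DX; rewrite /U ext0_in.
have := @H1_layer R A (fun X => u X ^+ 2) (F eh) (F ev) 24.
have mh := mF _ (@eh_measurable _ D u rho oD hU).
have mv := mF _ (@ev_measurable _ D u rho oD hU).
have eI := FI _ (@eh_measurable _ D u rho oD hU) (@eh_ge0 _ D u rho) (etrans (esym (@eh_int _ D u rho oD hU)) hE).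
have vI := FI _ (@ev_measurable _ D u rho oD hU) (@ev_ge0 _ D u rho) (etrans (esym (@ev_int _ D u rho oD hU)) hE).
move=> /(_ (ler0n _ _) (fun X _ => sqr_ge0 _) fin mh (F0 _ (@eh_ge0 _ D u rho)) mv (F0 _ (@ev_ge0 _ D u rho))).
set K := 4 * rho * m ^+ 2 + 4 * ell * E in eI vI => H.
have step (x a b : \bar R) : a = K%:E -> b = K%:E -> (x <= 24%:E * a + 24%:E * b)%E ->
    (x <= (192 * (rho * m ^+ 2 + ell * E))%:E)%E.
  by move=> -> -> /le_trans; apply; rewrite -!EFinM -EFinD lee_fin /K; lra.
apply: (step _ _ _ eI vI); apply: H => t t0.
apply: arcs => [X [/AS]//|X [AX tX] X2|X [AX tX] X1].
  have [_ x2] := ar X AX; apply: tF => // [|e he]; first exact: eh_ge0.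
  by apply: le_trans tX _; rewrite -UE//; apply: hor_sphere => //; [case: AX|exact: AS].
have [x1 _] := ar X AX; apply: tF => // [|e he]; first exact: ev_ge0.
by apply: le_trans tX _; rewrite -UE//; apply: ver_sphere => //; [case: AX|exact: AS].
Qed.

End sphere.

Lemma freq_const (R : realType) (N : R) : 0 <= N -> 8 <= 384 * (N + 1).
Proof. by move=> N0; lra. Qed.

(** * What the frequency gives: a large interior value *)

Section frequency_bound.
Context {R : realType}.
Implicit Types (X Y : R * R).
Local Notation mu := (@lebesgue_measure R).
Context (D : set (R * R)) (u : R * R -> R) (rho : R).
Context (oD : open D) (rho0 : 0 < rho).
Let W := D `&` eball 0 rho.
Let U := ext0 D u.
Context (hU : harm U W) (Uc : forall X, eball 0 rho X -> {for X, continuous U}).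
Context (ub : forall X, D X -> esphere 0 rho X -> forall e, 0 < e ->
  exists2 d : R, 0 < d & forall Y, W Y -> eball X d Y -> `|U Y - U X| <= e).

Lemma der_ext0 X : W X -> der U X = der u X.
Proof.
move=> WX; have [r r0 pr] := hU WX; have [DX _] := WX; have [s s0 sD] := proj1 (openP D) oD X DX.
have m0 : 0 < Num.min r s by rewrite lt_min r0 s0.
apply: (der_congr m0).
  by apply: paS pr; apply: eball_sub; rewrite subrr enorm0 add0r ge_min lexx.
move=> Y hY; rewrite /U ext0_in//; apply: sD; move: hY; rewrite /eball /= lt_min => /andP[_ ->]//.
Qed.

Lemma grad_cn (g : R * R -> R) X : dot (grad g X) (grad g X) = cn (der g X) ^+ 2.
Proof. by rewrite cnE /der /= sqr_sqrtr ?addr_ge0 ?sqr_ge0// sqrrN /dot /grad /= -!expr2. Qed.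

Lemma dirichlet_density : dirichlet_energy D u 0 rho = (\int[(mu \x mu)%E]_X (energy_density D u rho X)%:E)%E.
Proof.
rewrite /dirichlet_energy integral_mkcond; apply: eq_integral => X _.
rewrite patchE; case: ifPn => [|/negP nX].
  by rewrite inE => -[bX DX]; rewrite /energy_density ext0_in// der_ext0// grad_cn.
rewrite /energy_density /ext0; case: pselect => // -[DX bX].
by case: nX; rewrite inE.
Qed.

Lemma quotient_fin (a s : \bar R) (N : R) : (0 <= a)%E -> (0 < s < +oo)%E -> (rho%:E * a / s = N%:E)%E ->
  exists E t : R, [/\ a = E%:E, s = t%:E, 0 < t, 0 <= E & rho * E = N * t].
Proof.
case: s => [t| |]; rewrite ?ltxx ?andbF// lte_fin => a0 /andP[t0 _].
rewrite inver gt_eqF//; case: a a0 => [E| |] // E0.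
  by rewrite -!EFinM => -[<-]; exists E, t; split=> //; rewrite divfK// gt_eqF.
by rewrite gt0_muley ?lte_fin// gt0_mulye// lte_fin invr_gt0.
Qed.

Lemma frequency_bound (N : R) : (0 < sphere_mass D u 0%R rho < +oo)%E -> frequency D u 0%R rho = N%:E ->
  [/\ 0 <= N & exists m Xs, [/\ 0 < m, `|U Xs| = m, D Xs, enorm Xs <= rho - rho / (384 * (N + 1)) &
    (\int[(mu \x mu)%E]_X (energy_density D u rho X)%:E < (384 * (N + 1) * m ^+ 2)%:E)%E]].
Proof.
rewrite /frequency dirichlet_density => h1 h2.
have I0 : (0 <= \int[(mu \x mu)%E]_X (energy_density D u rho X)%:E)%E.
  by apply: integral_ge0 => X _; rewrite lee_fin; exact: density_ge0.
have [E [s [EE ES s0 E0 NE']]] := quotient_fin I0 h1 h2; rewrite EE.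
have hS ell m := sphere_mass_le oD rho0 hU Uc ub (ell := ell) (m := m); move: hS; rewrite ES {h1 h2 I0} => hS.
have N0 : 0 <= N by rewrite -(ler_pM2r s0) mul0r -NE' mulr_ge0// ltW.
(* With this ell the frequency identity gives ell E <= s / 384, so the energy term 192 ell E is at
   most s / 2 and is absorbed, leaving s <= 384 rho m^2. *)
split=> //; set k := 384 * (N + 1); set ell := rho / k.
have N1 : 0 < N + 1 by apply: ltr_wpDl.
have k8 : 8 <= k := freq_const N0.
have k0 : 0 < k := lt_le_trans (ltr0Sn R 7) k8.
have l0 : 0 < ell by apply: divr_gt0.
have l8 : ell <= rho / 8 by rewrite /ell ler_pM2l// lef_pV2// posrE ltr0n.
have [|||Xs Xsb Xsm] := @compact_usc_max R (ecball 0 (rho - ell)) (fun X => `|U X|) 0.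
- exact: compact_ecball.
- rewrite /ecball /= subr0 enorm0 subr_ge0; apply: le_trans l8 _.
  by rewrite ler_pdivrMr ?ltr0n// ler_peMr ?ler1n// ltW.
- move=> X hX e e0; have bX : eball 0 rho X by apply: ecball_eball hX; rewrite ltrBlDr ltrDl.
  have [d d0 hd] := proj1 (cont_atP U X) (Uc bX) (e / 2) (half_pos e0); exists d => // Y _ /hd.
  by have := lerB_dist (U Y) (U X); move: e0; lra.
have := hS ell `|U Xs| l0 l8 (normr_ge0 _) Xsm E EE; rewrite lee_fin => hs {hS}.
have nDX : ~ D Xs -> `|U Xs| = 0 by move=> nD; rewrite /U (@U_out _ D u Xs nD) normr0.
exists `|U Xs|, Xs; move: Xsb; rewrite /ecball /= subr0 => Xsb {Xsm}.
move: (`|U Xs|) (normr_ge0 (U Xs)) nDX hs => m mge nDX hs.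
have e1 : ell * E = N * s / k by rewrite /ell -NE'; ring.
have e2 : ell * E <= s / 384.
  rewrite e1 ler_pdivrMr// /k; have -> : s / 384 * (384 * (N + 1)) = N * s + s by field.
  by rewrite lerDl ltW.
have e3 : s <= 384 * (rho * m ^+ 2) by move: hs e2; lra.
have m0 : 0 < m.
  by rewrite lt_neqAle mge andbT; apply/eqP => mE; move: e3; rewrite -mE expr0n /= !mulr0 leNgt s0.
split => //; first by apply: contrapT => nD; move: m0; rewrite nDX// ltxx.
rewrite lte_fin -(ltr_pM2l rho0) NE'; apply: (@le_lt_trans _ _ (N * (384 * (rho * m ^+ 2)))).
  exact: ler_wpM2l.
have -> : rho * (k * m ^+ 2) = N * (384 * (rho * m ^+ 2)) + 384 * (rho * m ^+ 2) by rewrite /k; ring.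
by rewrite ltrDl; apply: mulr_gt0; [rewrite ltr0n|rewrite mulr_gt0// exprn_gt0].
Qed.

End frequency_bound.

(** * Charts of Dini domains *)

Section dini_sum.
Context {R : realType}.
Local Notation mu := (@lebesgue_measure R).
Context (theta : R -> R) (th : dini_parameter theta).

Lemma theta_le s t : 0 <= s -> s <= t -> theta s <= theta t. Proof. by case: th => _ _ h _; exact: h. Qed.
Lemma theta_ge0 s : 0 <= s -> 0 <= theta s. Proof. by case: th => h _ _ _; exact: h. Qed.

(** On the interval from 32^-(k+1) to 32^-k, of length 31/32 times its right end, monotonicity
    bounds the integrand below by theta at the left end over the right end. The intervals are
    disjoint, so the sum is dominated by the integral. *)
Lemma dini_partial : exists B : R, forall n, \sum_(k < n) theta (32^-1 ^+ k.+1) <= B.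
Proof.
have [_ _ _ fin] := th.
pose q k : R := 32^-1 ^+ k; have q0 k : 0 < q k by rewrite exprn_gt0.
have qS k : q k.+1 = q k / 32 by rewrite /q exprSr.
have lt1 (a b : R) k : a * q k.+1 = a / 32 * q k by rewrite qS; ring.
pose g (k : nat) (s : R) := (theta (q k.+1) / q k) * \1_`]q k.+1, q k] s.
pose I := (\int[mu]_(s in `]0%R, 1%R]) (theta s / s)%:E)%E.
have I0 : (0 <= I)%E.
  apply: integral_ge0 => s /=; rewrite in_itv /= => /andP[s0 _].
  by rewrite lee_fin divr_ge0 ?theta_ge0 ?(ltW s0).
have g0 k s : 0 <= g k s by rewrite mulr_ge0// divr_ge0 ?theta_ge0 ?ltW.
have mg k : measurable_fun setT (EFin \o g k).
  by apply/measurable_EFinP; apply: measurable_funM => //; exact: measurable_indic.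
have gI k : (\int[mu]_s (g k s)%:E = (31 / 32 * theta (q k.+1))%:E)%E.
  rewrite /g; under eq_integral do rewrite EFinM.
  rewrite ge0_integralZl//; last 2 first.
  - by apply/measurable_EFinP; exact: measurable_indic.
  - by rewrite lee_fin divr_ge0 ?theta_ge0 ?ltW.
  rewrite integral_indic// setIT.
  have ql : q k.+1 < q k by rewrite qS; have := q0 k; lra.
  rewrite [X in (_ * X)%E]lebesgue_measure_itv /= lte_fin ql -EFinB -EFinM; congr (_%:E).
  by rewrite qS; field; rewrite gt_eqF.
have gsum n s : (\sum_(k < n) g k s) <= if s \in `]0, 1] then theta s / s else 0.
  have [sin|sout] := boolP (s \in `]0, 1]); last first.
    rewrite big1// => k _; rewrite /g indicE memNset ?mulr0//= in_itv /= => /andP[a1 a2].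
    by move/negP: sout; apply; rewrite in_itv /= (lt_trans (q0 _) a1) (le_trans a2)// exprn_ile1// ?invr_ge0 ?invf_le1 ?ler1n.
  rewrite in_itv /= in sin; have /andP[s0 s1] := sin.
  have aux k : q k.+1 < s -> s <= q k -> theta (q k.+1) / q k <= theta s / s.
    move=> a1 a2; apply: ler_pM => //; rewrite ?theta_ge0 ?invr_ge0 ?(ltW (q0 _))//.
      by apply: theta_le => //; exact: ltW.
    by rewrite lef_pV2 ?posrE.
  have dec i j : (i <= j)%N -> q j <= q i by move=> ij; apply: ler_wiXn2l => //; rewrite ?invr_ge0 ?invf_le1 ?ler1n.
  have [[j hj]|none] := pselect (exists j : nat, (q j.+1 < s) && (s <= q j)); last first.
    rewrite big1 ?divr_ge0 ?theta_ge0 ?(ltW s0)// => k _; rewrite /g indicE memNset ?mulr0//= in_itv /= => h.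
    by apply: none; exists k.
  move: hj => /andP[j1 j2].
  have gz (k : nat) : k != j -> g k s = 0.
    move=> kj; rewrite /g indicE memNset ?mulr0//= in_itv /= => /andP[k1 k2].
    move: kj; rewrite neq_ltn => /orP[/dec d|/dec d].
      by move: (lt_le_trans k1 (le_trans j2 d)); rewrite ltxx.
    by move: (lt_le_trans j1 (le_trans k2 d)); rewrite ltxx.
  have gj : g j s <= theta s / s.
    by rewrite /g indicE; case: (s \in _) => /=; rewrite ?mulr1 ?mulr0 ?aux// divr_ge0 ?theta_ge0 ?(ltW s0).
  have [jn|nj] := ltnP j n.
    by rewrite (bigD1 (Ordinal jn))//= big1 ?addr0// => k kj; apply: gz; apply: contra kj => /eqP E; apply/eqP/val_inj.
  rewrite big1 ?divr_ge0 ?theta_ge0 ?(ltW s0)// => k _; apply: gz; rewrite neq_ltn (leq_trans (ltn_ord k) nj)//.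
have key n : ((\sum_(k < n) 31 / 32 * theta (q k.+1))%:E <= I)%E.
  rewrite -sumEFin; under eq_bigr do rewrite -gI.
  rewrite -ge0_integral_sum//; last 2 first.
  - by move=> k; exact: mg.
  - by move=> k s _; rewrite lee_fin.
  (* The integrals are compared as suprema over simple functions, which asks no measurability of the
     integrand. *)
  rewrite /I [leRHS]integral_mkcond ge0_integralTE; last by move=> s; apply: sume_ge0 => k _; rewrite lee_fin.
  rewrite ge0_integralTE; last first.
    move=> s; rewrite patchE; case: ifPn => //; rewrite inE /= in_itv /= => /andP[s0 _].
    by rewrite lee_fin divr_ge0 ?theta_ge0 ?(ltW s0).
  apply: le_ereal_sup => _ [h hle <-]; exists h => // s /=.
  apply: le_trans (hle s) _; rewrite sumEFin patchE; have := gsum n s.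
  have -> : (s \in [set` `]0%R, 1%R]]) = (s \in `]0%R, 1%R]) by apply/idP/idP => h'; [exact: (set_mem h')|exact: mem_set].
  by case: ifP => _ h'; rewrite -?[point]/(0%:E) lee_fin.
have Ifin : I \is a fin_num by rewrite ge0_fin_numE.
pose B := fine I; have IB : I = B%:E by rewrite fineK.
exists (32 / 31 * B) => n.
have := key n; rewrite IB lee_fin -mulr_sumr.
rewrite (eq_bigr (fun k : 'I_n => theta (q k.+1)))//.
by move: (\sum_(_ < _) _) B {IB} => a b; lra.
Qed.

(** The tail of a convergent series; 1/2048 is the amount that [hopf_iter] tolerates. *)
Lemma dini_sum : exists2 r1 : R, 0 < r1 & forall n, \sum_(k < n) theta (r1 / 32 ^+ k) <= 1 / 2048.
Proof.
have [B hB] := dini_partial; pose S n := \sum_(k < n) theta (32^-1 ^+ k.+1).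
have q0 k : 0 < (32^-1 : R) ^+ k by rewrite exprn_gt0.
have hs : has_sup [set S n | n in setT].
  by split; [exists (S 0), 0|exists B => _ [n _ <-]; exact: hB].
have [_ [m _ <-] hm] := sup_adherent (ltr0Sn R 0 : 0 < 1) hs.
have e0 : 0 < (1 / 2048 : R) by lra.
have [_ [{}m _ <-] {}hm] := sup_adherent e0 hs.
exists (32^-1 ^+ m.+1) => // n.
have -> : \sum_(k < n) theta (32^-1 ^+ m.+1 / 32 ^+ k) = S (m + n)%N - S m.
  rewrite /S big_split_ord /= addrAC subrr add0r; apply: eq_bigr => k _.
  by rewrite -exprVn -exprD addSn.
have : S (m + n)%N <= sup [set S n | n in setT] by apply: ub_le_sup; [case: hs|exists (m + n)%N].
by move: hm; lra.
Qed.

Lemma theta_small e : 0 < e -> exists2 r1 : R, 0 < r1 & theta r1 <= e.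
Proof.
move=> e0; have [B hB] := dini_partial; apply: contrapT => h.
have lo k : e <= theta (32^-1 ^+ k.+1).
  rewrite leNgt; apply/negP => lt; apply: h; exists (32^-1 ^+ k.+1); last exact: ltW.
  by rewrite exprn_gt0.
have [n hn] : exists n, B < e *+ n.
  have h0 : 0 <= `|B| / e by rewrite divr_ge0// ltW.
  exists (Num.bound (`|B| / e)); have := archi_boundP h0; rewrite ltr_pdivrMr// mulr_natl.
  by apply: le_lt_trans; exact: ler_norm.
have := hB n; rewrite leNgt => /negP; apply; apply: lt_le_trans hn _.
have -> : e *+ n = \sum_(k < n) e by rewrite sumr_const card_ord.
by apply: ler_sum => k _; exact: lo.
Qed.
End dini_sum.

(* The largest tilt of a boundary that the normalized domains of [cone_domain]
   accommodate. *)
Definition tilt {R : realType} : R := 1 / 2048.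

Lemma tilt_gt0 (R : realType) : 0 < tilt :> R. Proof. by rewrite /tilt; lra. Qed.
Lemma tilt_ge0 (R : realType) : 0 <= tilt :> R. Proof. exact: ltW (tilt_gt0 R). Qed.
Lemma tilt_le (R : realType) : tilt <= 1 / 2048 :> R. Proof. exact: lexx. Qed.
Lemma tilt_64 (R : realType) : tilt <= 64^-1 :> R. Proof. by rewrite /tilt; lra. Qed.

Lemma tiltM (R : realType) (X : R * R) : tilt * enorm X <= enorm X / 64.
Proof. by rewrite mulrC; apply: ler_wpM2l; [exact: enorm_ge0|exact: tilt_64]. Qed.

(** * Charts as cone conditions *)

Section charts.
Context {R : realType}.
Implicit Types (D : set (R * R)) (X Y Z p q n v : R * R) (r s t eps rho : R).

(** Lying above a graph in the form of stability under a cone of directions about n. Neither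
    coordinates nor a graph function appear, so charts at different points and in different frames
    can be compared directly. *)
Definition chart D p n rho eps : Prop := forall X Y, eball p rho X -> eball p rho Y -> D X ->
  eps * enorm (Y - X) < dot (Y - X) n -> D Y.

Lemma dotC X Y : dot X Y = dot Y X. Proof. by rewrite /dot mulrC [X.2 * _]mulrC. Qed.
Lemma dotDl X Y Z : dot (X + Y) Z = dot X Z + dot Y Z. Proof. by rewrite /dot /=; ring. Qed.
Lemma dotNl X Z : dot (- X) Z = - dot X Z. Proof. by rewrite /dot /=; ring. Qed.
Lemma dotBl X Y Z : dot (X - Y) Z = dot X Z - dot Y Z. Proof. by rewrite dotDl dotNl. Qed.
Lemma dotZl t X Z : dot (t *: X) Z = t * dot X Z. Proof. by rewrite /dot /= /GRing.scale /=; ring. Qed.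
Lemma dot_enorm X : dot X X = enorm X ^+ 2. Proof. by rewrite enorm_sqr /dot -!expr2. Qed.

Lemma dot_le X n : dot n n = 1 -> `|dot X n| <= enorm X.
Proof.
move=> n1; rewrite -(@ler_pXn2r R 2)// ?nnegrE ?enorm_ge0// real_normK ?num_real//.
have -> : enorm X ^+ 2 = dot X X * dot n n by rewrite n1 mulr1 dot_enorm.
rewrite -subr_ge0; have -> : dot X X * dot n n - dot X n ^+ 2 = (X.1 * n.2 - X.2 * n.1) ^+ 2 by rewrite /dot; ring.
exact: sqr_ge0.
Qed.

Definition dchart (theta : R -> R) D p rho : Prop :=
  exists2 n, dot n n = 1 & forall r, 0 < r -> r <= rho -> chart D p n r (theta r).

(** n is the unit normal of the graph over the projection of p. In a ball of radius r about p the
    slope differs from the one there by at most theta r, and the mean value theorem turns this into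
    the cone condition. *)
Lemma dini_chart theta D p0 rho0 p rho : dini_parameter theta -> dini_graph theta D p0 rho0 ->
  eball p rho `<=` eball p0 rho0 -> dchart theta D p rho.
Proof.
move=> th [e [f [phi [C0 [[ee ff ef] [_ dphi _ _] hth hD]]]]] sub.
pose a0 := dot (p - p0) e; pose m := derive1 phi a0; pose k := Num.sqrt (1 + m ^+ 2).
have k2 : k ^+ 2 = 1 + m ^+ 2 by rewrite sqr_sqrtr// addr_ge0// sqr_ge0.
have k1 : 1 <= k.
  rewrite -(@ler_pXn2r R 2)// ?nnegrE ?sqrtr_ge0// k2 expr1n lerDl sqr_ge0 //.
have k0 : 0 < k by apply: lt_le_trans k1.
exists (k^-1 *: (f - m *: e)).
  rewrite dotZl dotC dotZl dotBl !dotZl [dot f _]dotC [dot e _]dotC !dotBl !dotZl ff ee ef [dot f e]dotC ef.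
  have -> : 1 - m * 0 - m * (0 - m * 1) = k ^+ 2 by rewrite k2; ring.
  by rewrite expr2 mulKf ?mulVf ?gt_eqF.
move=> r r0 rr X Y hX hY DX; set q := dot _ _.
have qE : k * q = dot (Y - X) f - m * dot (Y - X) e.
  transitivity ((k * k^-1) * (dot (Y - X) f - m * dot (Y - X) e)).
    by rewrite /q /dot /= /GRing.scale /=; ring.
  by rewrite divff ?gt_eqF// mul1r.
have sb Z : eball p r Z -> eball p0 rho0 Z by move=> h; apply: sub; apply: lt_le_trans h rr.
move=> hq; apply/(hD _ (sb _ hY)); have := proj1 (hD _ (sb _ hX)) DX.
set a := dot (X - p0) e; set b := dot (Y - p0) e.
have abe : dot (Y - X) e = b - a by rewrite /a /b -dotBl opprB addrA subrK.
have fe : dot (Y - X) f = dot (Y - p0) f - dot (X - p0) f by rewrite -dotBl opprB addrA subrK.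
have shift Z : dot (Z - p0) e - a0 = dot (Z - p) e by rewrite /a0 -dotBl opprB addrA subrK.
have ar : `|a - a0| < r by rewrite shift; apply: le_lt_trans (dot_le _ ee) hX.
have br : `|b - a0| < r by rewrite shift; apply: le_lt_trans (dot_le _ ee) hY.
have : `|(phi b - m * b) - (phi a - m * a)| <= theta r * `|b - a|.
  apply: (@mvt_bound R (fun t => phi t - m * t) (fun t => derive1 phi t - m)) => t /andP[t1 t2].
  split.
    have d1 : is_derive t (1 : R) phi (derive1 phi t).
      by rewrite derive1E; exact: derivableP (dphi t).
    have d2 : is_derive t (1 : R) (fun s : R => m * s) m.
      have := @is_deriveZ R R^o R^o (@id R^o) m t 1 1 (is_derive_id _ _).
      by rewrite /GRing.scale /= mulr1.
    exact: is_deriveB.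
  apply: le_trans (hth t a0) _; case: th => _ _ mono _; apply: mono => //.
  rewrite ler_norml; move: ar br t1 t2; rewrite !ltr_norml => /andP[a1 a2] /andP[b1 b2].
  by rewrite ge_min le_max => /orP[] h1 /orP[] h2; apply/andP; split; lra.
move=> h1 h2; have h3 : theta r * `|b - a| <= theta r * enorm (Y - X).
  by apply: ler_wpM2l; [case: th => h _ _ _; apply: h; exact: ltW|rewrite -abe; exact: dot_le].
have q0 : 0 <= q.
  by apply/ltW/(le_lt_trans _ hq)/mulr_ge0; [case: th => h _ _ _; apply: h; exact: ltW|exact: enorm_ge0].
have h4 : q <= k * q by rewrite ler_peMl.
by move: h1; rewrite ler_norml => /andP[_ h1]; move: qE; rewrite abe fe; move: hq h2 h3 h4; lra.
Qed.

Lemma chartS D p n rho rho' eps : rho' <= rho -> chart D p n rho eps -> chart D p n rho' eps.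
Proof. by move=> h c X Y hX hY; apply: c; apply: lt_le_trans h. Qed.

Lemma chart_le D p n rho eps eps' : eps <= eps' -> chart D p n rho eps -> chart D p n rho eps'.
Proof.
move=> h c X Y hX hY DX hd; apply: (c X Y hX hY DX); apply: le_lt_trans hd.
by apply: ler_wpM2r => //; exact: enorm_ge0.
Qed.

Lemma chart_closure D p n rho eps X Y : dot n n = 1 -> 0 <= eps -> chart D p n rho eps ->
  eball p rho X -> eball p rho Y -> closure D X -> eps * enorm (Y - X) < dot (Y - X) n -> D Y.
Proof.
move=> n1 e0 c hX hY cX hd.
pose g := dot (Y - X) n - eps * enorm (Y - X); have g0 : 0 < g by rewrite subr_gt0.
pose d := Num.min (g / (eps + 1)) (rho - enorm (X - p)).
have ep : 0 < eps + 1 by rewrite ltr_wpDl.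
have d0 : 0 < d by rewrite lt_min divr_gt0//= subr_gt0.
have [X' DX' X'X] := proj1 (closureP D X) cX d d0.
rewrite /eball /= lt_min in X'X; case/andP: X'X => x1 x2.
apply: (c X' Y) => //.
  by rewrite /eball /=; have := enorm_tri X X' p; move: x2; lra.
have := dot_le (X' - X) n1; rewrite ler_norml => /andP[_ h1].
have h2 := enorm_tri X Y X'; rewrite [enorm (X - X')]enormC in h2.
have -> : dot (Y - X') n = dot (Y - X) n - dot (X' - X) n by rewrite -dotBl opprB addrA subrK.
move: x1; rewrite ltr_pdivlMr// /g => x1.
have : eps * enorm (Y - X') <= eps * (enorm (Y - X) + enorm (X' - X)) by exact: ler_wpM2l.
by move: x1 h1; rewrite !mulrDr mulr1 [enorm (X' - X) * eps]mulrC; lra.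
Qed.

Lemma chart_above D p n rho eps Y : dot n n = 1 -> 0 <= eps -> chart D p n rho eps -> boundary D p ->
  eball p rho Y -> eps * enorm (Y - p) < dot (Y - p) n -> D Y.
Proof.
move=> n1 e0 c [cp _] hY; apply: (chart_closure n1 e0 c) => //.
by rewrite /eball /= subrr enorm0; apply: le_lt_trans hY; exact: enorm_ge0.
Qed.

Lemma chart_below D p n rho eps Y : dot n n = 1 -> 0 <= eps -> chart D p n rho eps -> boundary D p ->
  eball p rho Y -> dot (Y - p) n < - (eps * enorm (Y - p)) -> ~ D Y.
Proof.
move=> n1 e0 c [_ ip] hY hd DY; apply: ip; rewrite /interior /=; apply/nbhs_eball.
have r0 : 0 < rho by apply: le_lt_trans hY; exact: enorm_ge0.
pose g := - dot (Y - p) n - eps * enorm (Y - p); have g0 : 0 < g by rewrite /g; lra.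
have ep : 0 < eps + 1 by rewrite ltr_wpDl.
exists (Num.min rho (g / (eps + 1))); first by rewrite lt_min r0 divr_gt0.
move=> Z; rewrite /eball /= lt_min => /andP[z1 z2]; apply: (c Y Z) => //.
have := dot_le (Z - p) n1; rewrite ler_norml => /andP[h1 _].
have h2 := enorm_tri p Z Y; rewrite [enorm (p - Y)]enormC in h2.
have -> : dot (Z - Y) n = dot (Z - p) n - dot (Y - p) n by rewrite -dotBl opprB addrA subrK.
move: z2; rewrite ltr_pdivlMr// /g => z2.
have : eps * enorm (Z - Y) <= eps * (enorm (Z - p) + enorm (Y - p)) by exact: ler_wpM2l.
by move: z2 h1; rewrite !mulrDr mulr1 [enorm (Z - p) * eps]mulrC; lra.
Qed.

(** From q, moving in a direction of the first cone stays in D, hence cannot lead below the second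
    chart. So n' is almost nonnegative on the first cone; testing n itself and two nearly tangential
    directions forces n' close to n. *)
Lemma chart_normals D p q n n' rho rho' eps : dot n n = 1 -> dot n' n' = 1 -> 0 < eps -> eps <= 64^-1 ->
  0 < rho' -> chart D p n rho eps -> chart D q n' rho' eps -> boundary D q -> eball p rho q -> 1 / 2 <= dot n' n.
Proof.
move=> n1 n1' e0 e64 r0' c c' bq pq.
have key v : enorm v <= 2 -> eps * enorm v < dot v n -> - (2 * eps) <= dot v n'.
  move=> v2 hv; rewrite leNgt; apply/negP => lt.
  pose t := Num.min (rho' / 4) ((rho - enorm (q - p)) / 4).
  have t0 : 0 < t by rewrite lt_min !divr_gt0// subr_gt0.
  have t1 : t <= rho' / 4 by rewrite ge_min lexx.
  have t2 : t <= (rho - enorm (q - p)) / 4 by rewrite ge_min lexx orbT.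
  have N : enorm (q + t *: v - q) = t * enorm v by rewrite addrAC subrr add0r enormZ gtr0_norm.
  have tv : t * enorm v <= t * 2 by rewrite ler_pM2l.
  have b' : eball q rho' (q + t *: v) by rewrite /eball /= N; lra.
  have b : eball p rho (q + t *: v).
    by rewrite /eball /=; have := enorm_tri q (q + t *: v) p; rewrite N; move: pq; rewrite /eball /=; lra.
  have D1 : D (q + t *: v).
    apply: (chart_closure n1 (ltW e0) c pq b); first by case: bq.
    by rewrite N addrAC subrr add0r dotZl mulrCA ltr_pM2l.
  apply: (chart_below n1' (ltW e0) c' bq b') => //.
  rewrite N addrAC subrr add0r dotZl mulrCA -mulrN ltr_pM2l//.
  by apply: lt_le_trans lt _; rewrite lerN2 mulrC ler_pM2r.
pose b := n.1 * n'.2 - n.2 * n'.1; set a := dot n' n.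
have ab : a ^+ 2 + b ^+ 2 = 1.
  by transitivity (dot n n * dot n' n'); [rewrite /a /b /dot; ring|rewrite n1 n1' mulr1].
have en : enorm n = 1.
  by apply/eqP; rewrite -(@eqrXn2 _ 2) ?enorm_ge0// -dot_enorm n1 expr1n.
have a0 : - (2 * eps) <= a by rewrite /a dotC; apply: key; rewrite en ?n1; lra.
have [b1 b2] : - b <= 4 * eps /\ b <= 4 * eps.
  have a1 : `|a| <= 1 by have := dot_le n' n1; rewrite -/a; have -> : enorm n' = 1 by apply/eqP; rewrite -(@eqrXn2 _ 2) ?enorm_ge0// -dot_enorm n1' expr1n.
  have a2 : eps * a <= eps by rewrite -[leRHS]mulr1 ler_pM2l//; move: a1; rewrite ler_norml => /andP[].
  (* For s = 1 and s = -1 these are the two nearly tangential vectors 2 eps n plus or minus the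
     normal turned by a right angle, just inside the first cone because their length is below 2. *)
  pose w s : R * R := (2 * eps * n.1 - s * n.2, 2 * eps * n.2 + s * n.1).
  have w1 s : s ^+ 2 = 1 -> enorm (w s) < 2.
    move=> s1; rewrite -(@ltr_pXn2r R 2)// ?nnegrE ?enorm_ge0// enorm_sqr /=.
    have -> : (2 * eps * n.1 - s * n.2) ^+ 2 + (2 * eps * n.2 + s * n.1) ^+ 2 = ((2 * eps) ^+ 2 + s ^+ 2) * dot n n by rewrite /dot; ring.
    have : eps ^+ 2 <= 64^-1 ^+ 2 by rewrite ler_pXn2r// nnegrE ?(ltW e0)// invr_ge0.
    by rewrite n1 s1 exprMn; lra.
  have w2 s : dot (w s) n = 2 * eps.
    by transitivity (2 * eps * dot n n); [rewrite /dot /=; ring|rewrite n1 mulr1].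
  have w3 s : dot (w s) n' = 2 * eps * a + s * b by rewrite /a /b /dot /=; ring.
  have w4 s : s ^+ 2 = 1 -> - (2 * eps) <= 2 * eps * a + s * b.
    move=> s1; rewrite -w3; apply: key; first exact/ltW/w1.
    by rewrite w2 mulrC ltr_pM2r// w1.
  have := w4 1 (expr1n _ _); have := w4 (-1); rewrite sqrrN expr1n => /(_ erefl).
  by split; lra.
rewrite leNgt; apply/negP => a1.
have b3 : b ^+ 2 <= (1 / 16) ^+ 2.
  by rewrite -[b ^+ 2]real_normK ?num_real// ler_pXn2r// ?nnegrE// ler_norml; lra.
have a3 : a ^+ 2 <= (1 / 2) ^+ 2.
  by rewrite -[a ^+ 2]real_normK ?num_real// ler_pXn2r// ?nnegrE// ler_norml; lra.
by move: ab a3 b3; rewrite !expr2; lra.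
Qed.
End charts.

Section affine.
Context {R : realType}.
Implicit Types (D : set (R * R)) (u : R * R -> R) (X Y Z p q n v z : R * R) (d r s t eps rho : R).

Definition rotation n : R[i] := (n.2 -i* n.1)%C.
(** The similarity of ratio d that sends the origin to p and the upward vertical direction to n. *)
Definition aff p n d z : R * R := p + d *: (z.1 * n.2 + z.2 * n.1, z.2 * n.2 - z.1 * n.1).
Definition affi p n d X : R * R := (d^-1 * dot (X - p) (n.2, - n.1), d^-1 * dot (X - p) n).

Lemma toC_aff p n d z : toC (aff p n d z) = d%:C%C * rotation n * toC z + toC p.
Proof.
case: z p n => [z1 z2] [p1 p2] [n1 n2].
by apply/eqP; rewrite eq_complex /aff /rotation /toC /= /GRing.scale /=; apply/andP; split; apply/eqP; ring.
Qed.

Lemma cn_rotation n : dot n n = 1 -> cn (rotation n) = 1.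
Proof. by move=> n1; rewrite cnE /= sqrrN addrC !expr2 -/(dot n n) n1 sqrtr1. Qed.

Lemma aff_dist p n d z z' : dot n n = 1 -> 0 < d -> enorm (aff p n d z - aff p n d z') = d * enorm (z - z').
Proof.
move=> n1 d0; rewrite !enormE !toCB !toC_aff opprD addrACA subrr addr0 -mulrBr !cnM cn_real cn_rotation//.
by rewrite mulr1 gtr0_norm.
Qed.

Lemma aff0 p n d : aff p n d 0 = p.
Proof. by rewrite /aff /= !mul0r subr0 addr0 scaler0 addr0. Qed.

Lemma affiK p n d X : dot n n = 1 -> 0 < d -> aff p n d (affi p n d X) = X.
Proof.
move=> n1 d0; set z := affi p n d X.
suff E : d *: (z.1 * n.2 + z.2 * n.1, z.2 * n.2 - z.1 * n.1) = X - p by rewrite /aff E addrC subrK.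
rewrite /z /affi /=; case: (X - p) => a b; have dd : d * d^-1 = 1 by rewrite divff// gt_eqF.
have sE (x y : R) : d *: (x, y) = (d * x, d * y) by [].
rewrite sE; congr pair.
  transitivity ((d * d^-1) * a * dot n n); first by rewrite /dot /=; ring.
  by rewrite n1 mulr1 dd mul1r.
transitivity ((d * d^-1) * b * dot n n); first by rewrite /dot /=; ring.
by rewrite n1 mulr1 dd mul1r.
Qed.

Lemma aff_dot p n d z z' : dot n n = 1 -> dot (aff p n d z - aff p n d z') n = d * (z.2 - z'.2).
Proof.
move=> n1; transitivity (d * (z.2 - z'.2) * dot n n); last by rewrite n1 mulr1.
by rewrite /aff /dot /= /GRing.scale /=; ring.
Qed.

Lemma aff_eball p n d z z' r : dot n n = 1 -> 0 < d -> eball (aff p n d z) (d * r) (aff p n d z') <-> eball z r z'.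
Proof. by move=> n1 d0; rewrite /eball /= aff_dist// ltr_pM2l. Qed.

Lemma aff_comp p n d q n' z : aff p n d (aff q n' 1 z) =
  aff (aff p n d q) (n'.1 * n.2 + n'.2 * n.1, n'.2 * n.2 - n'.1 * n.1) d z.
Proof.
case: z p n q n' => [z1 z2] [p1 p2] [n1 n2] [q1 q2] [m1 m2].
by apply: injective_projections; rewrite /aff /= /GRing.scale /=; ring.
Qed.

Lemma aff_poly p n d : exists P : {poly R[i]}, (forall z, toC (aff p n d z) = P.[toC z]) /\ P^`() = (d%:C%C * rotation n)%:P.
Proof.
exists ((d%:C%C * rotation n) *: 'X + (toC p)%:P); split.
  by move=> z; rewrite hornerD hornerZ hornerX hornerC toC_aff.
by rewrite derivD derivZ derivX derivC addr0 alg_polyC.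
Qed.

Lemma pa_aff u p n d z s : dot n n = 1 -> 0 < d -> pa u (eball (aff p n d z) (d * s)) ->
  pa (fun y => u (aff p n d y)) (eball z s).
Proof.
move=> n1 d0 pu e e0; have [q hq] := pu e e0; have [P [hP _]] := aff_poly p n d.
exists (q \Po P) => y hy; rewrite /rep horner_comp -hP; apply: hq.
by apply/aff_eball.
Qed.

Lemma der_aff u p n d z s : dot n n = 1 -> 0 < d -> 0 < s -> pa u (eball (aff p n d z) (d * s)) ->
  der (fun y => u (aff p n d y)) z = der u (aff p n d z) * (d%:C%C * rotation n).
Proof.
move=> n1 d0 s0 pu; have [P [hP dP]] := aff_poly p n d.
have E (y : R * R) : ((aff p n d y).1 +i* (aff p n d y).2)%C = P.[toC y] by rewrite -hP.
have cP : ca (fun y => (aff p n d y).1 +i* (aff p n d y).2)%C (eball z s).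
  by move=> e e0; exists P => y _; rewrite E subrr cn0 ltW.
have bz : eball (aff p n d z) (d * s) ((aff p n d z).1, (aff p n d z).2).
  by rewrite -surjective_pairing /eball /= subrr enorm0 mulr_gt0.
have := der_comp s0 cP pu bz; rewrite -surjective_pairing.
rewrite (_ : (fun Y => _) = (fun y => u (aff p n d y))); last by apply/funext => y; rewrite -surjective_pairing.
move=> ->; congr (_ * _).
have pk : pa (fun y => (aff p n d y).1) (eball z s).
  by move=> e e0; exists P => y _; rewrite /rep -E subrr normr0 ltW.
have [_ h _] := pa_der_all s0 pk; have := h P 0 (lexx _).
have h0 Y : eball z s Y -> `|(aff p n d Y).1 - rep P Y| <= 0 by rewrite /rep -E subrr normr0.
move=> /(_ h0); rewrite mulr0 mul0r dP hornerC => h1.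
by apply/eqP; rewrite -subr_eq0; apply/eqP/cn_eq0/le_anti; rewrite h1 cn_ge0.
Qed.
End affine.

(** * Normalised domains and local estimates at a boundary point *)

Section normal_domain.
Context {R : realType}.
Implicit Types (X Y Z v z : R * R).
Context (D : set (R * R)) (p n : R * R) (d eps rho : R).
Context (oD : open D) (n1 : dot n n = 1) (d0 : 0 < d) (dr : 5 * d <= rho) (ch : chart D p n rho eps).
Context (bp : boundary D p) (e0 : 0 <= eps) (e1 : eps <= 1 / 2048).
Local Notation A := (aff p n d).
Local Notation c := (256^-1 : R).

(** The rescaled domain near p, completed so that the cone condition holds in the whole plane:
    upward cones over its points in the ball of radius 5, the half plane above c, and a cut at
    -c. *)
Definition normal_domain : set (R * R) := [set z | - c < z.2 /\ (c < z.2 \/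
  exists2 y, D (A y) /\ eball 0 5 y & 64^-1 * `|z.1 - y.1| <= z.2 - y.2)].
Local Notation G := normal_domain.

Lemma A_dist0 z : enorm (A z - p) = d * enorm z.
Proof. by have := aff_dist p z 0 n1 d0; rewrite aff0 subr0. Qed.

Lemma A_dot0 z : dot (A z - p) n = d * z.2.
Proof. by have := aff_dot p d z 0 n1; rewrite aff0 subr0. Qed.

Lemma A_ball5 z : eball 0 5 z -> eball p rho (A z).
Proof.
rewrite /eball /= subr0 A_dist0 => h; apply: lt_le_trans dr.
by rewrite mulrC ltr_pM2r.
Qed.

Lemma A_upper z : eball 0 5 z -> eps * enorm z < z.2 -> D (A z).
Proof.
move=> hz h; apply: (chart_above n1 e0 ch bp (A_ball5 hz)).
by rewrite A_dist0 A_dot0 mulrCA ltr_pM2l.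
Qed.

Lemma A_lower z : eball 0 5 z -> z.2 < - (eps * enorm z) -> ~ D (A z).
Proof.
move=> hz h; apply: (chart_below n1 e0 ch bp (A_ball5 hz)).
by rewrite A_dist0 A_dot0 mulrCA -mulrN ltr_pM2l.
Qed.

Lemma open_preaff X : D (A X) -> exists2 r : R, 0 < r & forall Y, eball X r Y -> D (A Y).
Proof.
move=> DX; have [r r0 rD] := proj1 (openP D) oD _ DX.
exists (r / d); first by rewrite divr_gt0.
move=> Y hY; apply: rD; have -> : r = d * (r / d) by rewrite mulrC divfK// gt_eqF.
exact/aff_eball.
Qed.

Lemma normal_domain_cone : cone_domain G 64^-1 c.
Proof.
split.
- apply/openP => z [z1 [z2|[y [Dy y5] zy]]].
    exists (z.2 - c); first by rewrite subr_gt0.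
    move=> z' hz; have := enorm2 (z' - z); move: hz; rewrite /eball /= ler_norml => h /andP[h1 h2].
    by split; [|left]; lra.
  have [s s0 sD] := open_preaff Dy.
  exists (Num.min (Num.min s (5 - enorm y)) (z.2 + c)).
    by rewrite !lt_min s0 subr_gt0 -[z.2]opprK addrC subr_gt0 ltrNl z1 andbT; move: y5; rewrite /eball /= subr0.
  move=> z'; rewrite /eball /= !lt_min => /andP[/andP[h1 h2] h3].
  have h4 := enorm2 (z' - z); rewrite /= ler_norml in h4; case/andP: h4 => h4 h5.
  split; first by lra.
  right; exists (y + (z' - z)).
    split; first by apply: sD; rewrite /eball /= addrAC subrr add0r.
    by rewrite /eball /= subr0; have := enormD y (z' - z); lra.
  rewrite /=; have -> : z'.1 - (y.1 + (z'.1 - z.1)) = z.1 - y.1 by ring.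
  by have -> : z'.2 - (y.2 + (z'.2 - z.2)) = z.2 - y.2 by ring.
- by lra.
- by lra.
- move=> z v [z1 z2] hv; have v2 : 0 <= v.2 by apply: le_trans hv; rewrite mulr_ge0.
  split; first by rewrite /=; lra.
  case: z2 => [z2|[y Dy zy]]; [by left; rewrite /=; lra|right; exists y => //=].
  have -> : z.1 + v.1 - y.1 = (z.1 - y.1) + v.1 by ring.
  by have := ler_normD (z.1 - y.1) v.1; move: zy hv; lra.
- split=> [z zc|z []//]; split; [by lra|by left].
Qed.

(** A tilt of at most 1/2048 over radius 4 keeps the boundary within height 1/512, so neither the
    half plane nor the cut interferes there; the added cones are narrower than those of the chart,
    which is valid up to radius 5. *)
Lemma normal_domainE z : eball 0 4 z -> G z <-> D (A z).
Proof.
move=> z4; have zz : enorm z < 4 by move: z4; rewrite /eball /= subr0.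
have z5 : eball 0 5 z by rewrite /eball /= subr0; lra.
have ez : eps * enorm z <= 1 / 2048 * 4.
  by apply: ler_pM => //; [exact: enorm_ge0|exact: ltW].
split=> [[_ [zc|[y [Dy y5] zy]]]|Dz].
- by apply: A_upper => //; lra.
- have [->//|zny] := eqVneq z y.
  apply: (ch (A_ball5 y5) (A_ball5 z5) Dy).
  rewrite aff_dist// aff_dot// mulrCA ltr_pM2l//.
  set a := `|z.1 - y.1| in zy; set b := z.2 - y.2 in zy *; have a0 : 0 <= a := normr_ge0 _.
  have h1 : enorm (z - y) <= a + `|b| by exact: enorm_le12.
  have b0 : 0 <= b by lra.
  rewrite ger0_norm// in h1.
  have b1 : 0 < b.
    rewrite lt_neqAle b0 andbT; apply/eqP => bE; move/eqP: zny; apply; apply/eqP.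
    rewrite -subr_eq0; apply/eqP/enorm_eq0/le_anti; rewrite enorm_ge0 andbT; lra.
  have : eps * enorm (z - y) <= 1 / 2048 * (a + b) by apply: ler_pM => //; exact: enorm_ge0.
  by lra.
split; last by right; exists z => //; rewrite !subrr normr0 mulr0.
rewrite ltNge; apply/negP => zc; apply: (@A_lower z) => //; lra.
Qed.

(** The Hopf iteration runs in the frame of the normal [nn] at the boundary point itself, where the
    tilt tends to 0 summably with the scale; in the fixed frame of the chart it would not. *)
Lemma hopf_dini theta z nn rq : dini_parameter theta -> enorm z <= 1 / 16 -> boundary D (A z) ->
  dot nn nn = 1 -> 1 / 2 <= dot nn n -> 0 < rq ->
  (forall r, 0 < r -> r <= rq -> chart D (A z) nn r (theta r)) -> hopf G c z.
Proof.
move=> th z16 bz m1 mn rq0 chz.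
pose m : R * R := (nn.1 * n.2 - nn.2 * n.1, dot nn n).
have mm : dot m m = 1.
  by transitivity (dot nn nn * dot n n); [rewrite /m /dot /=; ring|rewrite n1 m1 mulr1].
have AE Y : A (aff z m 1 Y) = aff (A z) nn d Y.
  rewrite aff_comp; congr (aff _ _ _ _).
  have -> : nn = (nn.1 * dot n n, nn.2 * dot n n) by rewrite n1 !mulr1 -surjective_pairing.
  by rewrite /m /dot; apply: injective_projections; rewrite /=; ring.
have Gd := normal_domain_cone; have c256 : c <= 256^-1 := lexx _; have e64 : (64^-1 : R) <= 64^-1 := lexx _.
have [r1 r10 hr1] := dini_sum th.
pose B := aff z m 1; have Bd Y Z : enorm (B Y - B Z) = enorm (Y - Z) by rewrite aff_dist// mul1r.
pose W := [set Y | G (B Y)]; pose h Y := perron G c (B Y).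
have [oG _ _ _ _] := Gd.
have oW : open W.
  apply/openP => Y WY; have [r r0 rG] := proj1 (openP G) oG _ WY.
  by exists r => // Z hZ; apply: rG; rewrite /eball /= Bd.
have hc : continuous h.
  move=> Y; apply/cont_atP => e ep; have [r r0 hr] := proj1 (cont_atP (perron G c) (B Y)) (@perron_cont _ _ _ _ Gd (B Y)) e ep.
  by exists r => // Z hZ; apply: hr; rewrite /eball /= Bd.
have h0 Y : 0 <= h Y by exact: (perron_ge0 Gd).
have hh : harm h W.
  move=> Y WY; have [r r0 pr] := perron_harm Gd WY; exists r => //.
  by apply: (pa_aff mm ltr01); rewrite mul1r.
pose r0 := Num.min 1 (Num.min (rq / (2 * d)) (r1 / (2 * d))).
have d2 : 0 < 2 * d by rewrite mulr_gt0.
have r00 : 0 < r0 by rewrite !lt_min ltr01 !divr_gt0.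
have rr1 : r0 <= 1 by rewrite ge_min lexx.
have rr2 : 2 * d * r0 <= rq by rewrite mulrC -ler_pdivlMr// !ge_min lexx orbT.
have rr3 : 2 * d * r0 <= r1 by rewrite mulrC -ler_pdivlMr// !ge_min lexx !orbT.
have k0 k : 0 < r0 / 32 ^+ k by rewrite divr_gt0// exprn_gt0.
have kr k : r0 / 32 ^+ k <= r0.
  by rewrite ler_pdivrMr ?exprn_gt0// ler_peMr ?(ltW r00)// exprn_ege1// ler1n.
(* The radius is doubled because charts live on open balls whereas the iteration uses closed discs;
   d is the ratio of the normalisation. *)
pose b k := theta (2 * d * (r0 / 32 ^+ k)).
have b0 k : 0 <= b k by apply: (theta_ge0 th); rewrite ltW// mulr_gt0.
have bs nb : \sum_(k < nb) b k <= 1 / 2048.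
  apply: le_trans (hr1 nb); apply: ler_sum => k _; apply: (theta_le th); first by rewrite ltW// mulr_gt0.
  by rewrite mulrA ler_pM2r// invr_gt0 exprn_gt0.
have loc k Y : enorm Y <= r0 / 32 ^+ k -> [/\ W Y <-> D (aff (A z) nn d Y),
    chart D (A z) nn (2 * d * (r0 / 32 ^+ k)) (b k), eball (A z) (2 * d * (r0 / 32 ^+ k)) (aff (A z) nn d Y),
    enorm (aff (A z) nn d Y - A z) = d * enorm Y & dot (aff (A z) nn d Y - A z) nn = d * Y.2].
  move=> Yk; have N : enorm (aff (A z) nn d Y - A z) = d * enorm Y.
    by have := aff_dist (A z) Y 0 m1 d0; rewrite aff0 subr0.
  split=> //.
  - rewrite -AE; apply: normal_domainE; rewrite /eball /= subr0.
    have := enorm_tri z (B Y) 0; rewrite !subr0; have := Bd Y 0; rewrite /B aff0 subr0 => ->.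
    by have := kr k; move: z16 Yk rr1; lra.
  - apply: chz; first by rewrite mulr_gt0.
    by apply: le_trans rr2; rewrite ler_pM2l.
  - rewrite /eball /= N; apply: (@le_lt_trans _ _ (d * (r0 / 32 ^+ k))); first by rewrite ler_pM2l.
    by rewrite -mulrA ltr_pMl ?ltr1n// mulr_gt0.
  - by have := aff_dot (A z) d Y 0 m1; rewrite aff0 subr0.
have c1 k Y : enorm Y <= r0 / 32 ^+ k -> W Y -> - b k * (r0 / 32 ^+ k) <= Y.2.
  move=> Yk; have [WE chk bY N dt] := loc k Y Yk; move=> /WE DY; rewrite leNgt; apply/negP => lt.
  apply: (chart_below m1 (b0 k) chk bz bY _ DY); rewrite N dt mulrCA -mulrN ltr_pM2l//.
  by apply: lt_le_trans lt _; rewrite mulNr lerN2; exact: ler_wpM2l.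
have c2 k Y : enorm Y <= r0 / 32 ^+ k -> ~ W Y -> Y.2 <= b k * (r0 / 32 ^+ k).
  move=> Yk; have [WE chk bY N dt] := loc k Y Yk; move=> nW; rewrite leNgt; apply/negP => lt; apply/nW/WE.
  apply: (chart_above m1 (b0 k) chk bz bY); rewrite N dt mulrCA ltr_pM2l//.
  by apply: le_lt_trans lt; exact: ler_wpM2l.
have hp Y : W Y -> 0 < h Y by move=> WY; apply: (perron_gt0 Gd).
(* The vertical direction of the normalised domain, read in the frame of m. *)
pose v : R * R := (- m.1, m.2).
have v1 : enorm v <= 1.
  rewrite -(@ler_pXn2r R 2)// ?nnegrE ?enorm_ge0// enorm_sqr /= sqrrN !expr2 -/(dot m m) mm mulr1//.
have [a a0 ha] := hopf_iter oW hc h0 hh r00 b0 bs c1 c2 hp v1 mn.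
exists a => // t t0; have [s st hs] := ha t t0; exists s => //; move: hs; rewrite /h.
suff -> : B (s *: v) = z + s *: e2 by [].
have -> : (e2 : R * R) = (0, dot m m) by rewrite mm.
by apply: injective_projections; rewrite /B /aff /v /dot /= /GRing.scale /=; ring.
Qed.

Lemma boundary_local (U : R * R -> R) M mu (s : seq (R * R)) : 0 < M ->
  (forall X, eball p (4 * d) X -> {for X, continuous U}) -> (forall X, ~ D X -> U X = 0) ->
  harm U (D `&` eball p (4 * d)) -> (forall X, eball p (4 * d) X -> `|U X| <= M) ->
  (exists Y, [/\ D Y, enorm (Y - p) <= d / 16 & mu <= `|U Y|]) -> uniq s ->
  (forall X, X \in s -> [/\ closure D X, enorm (X - p) <= d / 16, crit_at U D X &
     ~ D X -> hopf G c (affi p n d X)]) ->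
  mu <= (4 / 7) ^+ size s * (8 * M).
Proof.
move=> M0 Uc U0 hU UM [Y0 [DY0 Y0p mY0]] us hs.
have Gd := normal_domain_cone; have c256 : c <= 256^-1 := lexx _; have e64 : (64^-1 : R) <= 64^-1 := lexx _.
pose w z := U (A z); have AK X : A (affi p n d X) = X by exact: affiK.
have iN X : enorm (affi p n d X) = enorm (X - p) / d.
  by rewrite -{2}(AK X) A_dist0 mulrC mulKf// gt_eqF.
have i16 X : enorm (X - p) <= d / 16 -> enorm (affi p n d X) <= 1 / 16.
  by move=> h; rewrite iN ler_pdivrMr//; lra.
have b4 z : eball 0 4 z -> eball p (4 * d) (A z).
  by move=> h; rewrite -{1}(aff0 p n d) mulrC; apply/aff_eball.
rewrite -(size_map (affi p n d)); apply: (boundary_count Gd e64 c256 (w := w)) => //.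
- move=> z z4; apply/cont_atP => e ep; have [r r0 hr] := proj1 (cont_atP _ _) (Uc _ (b4 _ z4)) e ep.
  exists (r / d); first by rewrite divr_gt0.
  move=> y hy; apply: hr; have -> : r = d * (r / d) by rewrite mulrC divfK// gt_eqF.
  exact/aff_eball.
- by move=> z z4 nG; apply: U0 => DA; apply/nG/normal_domainE.
- move=> z [Gz z4]; have [|r r0 pr] := @hU (A z); first by split; [exact/normal_domainE|exact: b4].
  exists (r / d); first by rewrite divr_gt0.
  by apply: (pa_aff n1 d0); rewrite mulrC divfK// gt_eqF.
- by move=> z z4; apply/UM/b4.
- exists (affi p n d Y0); rewrite /w AK; split=> //; last exact: i16.
  by apply/normal_domainE; [rewrite /eball /= subr0; have := i16 _ Y0p; lra|rewrite AK].
- by rewrite map_inj_uniq// => X Y E; rewrite -(AK X) E AK.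
move=> _ /mapP[X Xs ->]; have [cX Xp crX hX] := hs X Xs; set z := affi p n d X.
have z16 : enorm z <= 1 / 16 by exact: i16.
have zE : A z = X by exact: AK.
have z4 y : enorm (y - z) < 1 -> eball 0 4 y.
  by move=> h; rewrite /eball /= subr0; have := enorm_tri z y 0; rewrite !subr0; lra.
split=> //.
- apply/closureP => r r0; have m0 : 0 < Num.min r 1 by rewrite lt_min r0 ltr01.
  have [Y DY YX] := proj1 (closureP D X) cX _ (mulr_gt0 d0 m0).
  have yz : eball z (Num.min r 1) (affi p n d Y).
    by apply/(aff_eball p _ _ _ n1 d0); rewrite zE AK.
  rewrite /eball /= lt_min in yz; case/andP: yz => y1 y2; exists (affi p n d Y) => //.
  by apply/normal_domainE; [exact: z4|rewrite AK].
- move=> e ep; have [r r0 hr] := crX (e / d) (divr_gt0 ep d0).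
  exists (Num.min (r / d) 1); first by rewrite lt_min divr_gt0// ltr01.
  move=> y Gy hy; have /andP[y1 y2] : (enorm (y - z) < r / d) && (enorm (y - z) < 1) by rewrite -lt_min.
  have DA : D (A y) by apply/normal_domainE => //; exact: z4.
  have bA : eball X r (A y).
    by rewrite -zE; have -> : r = d * (r / d) by [rewrite mulrC divfK// gt_eqF]; apply/aff_eball.
  have [|q q0 pq] := @hU (A y); first by split=> //; apply/b4/z4.
  rewrite /w (der_aff n1 d0 (divr_gt0 q0 d0)); last by rewrite mulrC divfK// gt_eqF.
  rewrite !cnM cn_real cn_rotation// mulr1 gtr0_norm// -ler_pdivlMr//.
  exact: hr.
- move=> nG; apply: hX => DX; apply: nG; apply/normal_domainE; last by rewrite zE.
  by apply: z4; rewrite subrr enorm0.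
Qed.

(** [decay_iter] is applied to |U|, written as a maximum of U and -U so that [sub_max] applies in
    the domain; off the domain |U| has a minimum and [sub_pos] applies. *)
Lemma decay_local (U : R * R -> R) M k X : 0 <= M ->
  (forall X, eball p (4 * d) X -> {for X, continuous U}) -> (forall X, ~ D X -> U X = 0) ->
  harm U (D `&` eball p (4 * d)) -> (forall X, eball p (4 * d) X -> `|U X| <= M) ->
  enorm (X - p) <= d * 16^-1 ^+ k -> `|U X| <= M * 2^-1 ^+ k.
Proof.
move=> M0 Uc U0 hU UM hX; pose V z := U (A z).
have b4 z : eball 0 4 z -> eball p (4 * d) (A z).
  by move=> h; rewrite -{1}(aff0 p n d) mulrC; apply/aff_eball.
have eb z : ecball 0 1 z -> eball 0 4 z by rewrite /ecball /eball /= => h; apply: le_lt_trans h _; lra.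
have Vc z : eball 0 4 z -> {for z, continuous V}.
  move=> z4; apply/cont_atP => e ep; have [r r0 hr] := proj1 (cont_atP _ _) (Uc _ (b4 _ z4)) e ep.
  exists (r / d); first by rewrite divr_gt0.
  move=> y hy; apply: hr; have -> : r = d * (r / d) by rewrite mulrC divfK// gt_eqF.
  exact/aff_eball.
pose w z := Num.max (V z) (- V z).
have wE z : w z = `|V z| by rewrite /w; have [h|h] := leP 0 (V z); [rewrite ger0_norm// max_l//|rewrite ltr0_norm// max_r//]; lra.
have -> : `|U X| = w (affi p n d X) by rewrite wE /V affiK.
apply: (@decay_iter _ w 0 1 16^-1 M k) => //.
- move=> Y /eb Y4; rewrite (_ : w = fun z => `|V z|); last by apply/funext => z; exact: wE.
  exact: cvg_norm (Vc Y Y4).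
- move=> Y Y1; have Y4 : eball 0 4 Y by apply: lt_trans Y1 _; lra.
  have [DY|nDY] := pselect (D (A Y)).
    have [|r r0 pr] := @hU (A Y); first by split=> //; exact: b4.
    have rd : 0 < r / d by rewrite divr_gt0.
    have pV : pa V (eball Y (r / d)) by apply: (pa_aff n1 d0); rewrite mulrC divfK// gt_eqF.
    by apply: sub_max; apply: (pa_sub rd) => //; exact: paN.
  apply: sub_pos; first by move=> z; rewrite wE.
  by rewrite wE /V U0 ?normr0.
- move=> Y /eb Y4; rewrite !subr0 => hY; rewrite wE /V U0 ?normr0//.
  have [->|Y0] := eqVneq Y 0.
    by rewrite aff0 => Dp; case: bp => _; apply; rewrite /interior /=; apply/open_nbhs_nbhs.
  have h1 := enorm_le12 Y; have h3 : Y.2 <= 0 by have := normr_ge0 Y.1; lra.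
  rewrite (ler0_norm h3) in h1.
  have h4 : Y.2 < 0.
    rewrite lt_neqAle h3 andbT; apply/eqP => E; move/eqP: Y0; apply; apply/enorm_eq0/le_anti.
    by rewrite enorm_ge0 andbT; have := normr_ge0 Y.1; lra.
  apply: A_lower; first by move: Y4; rewrite /eball /= => h; apply: lt_trans h _; lra.
  have h5 : enorm Y <= - 17 * Y.2 by lra.
  have : eps * enorm Y <= 1 / 2048 * (- 17 * Y.2) by apply: ler_pM => //; exact: enorm_ge0.
  by lra.
- by move=> Y /eb Y4; rewrite wE; apply/UM/b4.
rewrite /ecball /= subr0 mul1r.
have := aff_dist p (affi p n d X) 0 n1 d0; rewrite aff0 subr0 affiK// => E.
by rewrite -(ler_pM2l d0) -E.
Qed.

End normal_domain.

(** * Critical points in an interior disc *)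

Section interior_local.
Context {R : realType}.

(** Critical points are zeros of the holomorphic function [der u], so many of them make the gradient
    small. This bounds the oscillation of u and not its size: u may be close to a nonzero
    constant. *)
Lemma interior_local (u : R * R -> R) X0 Y0 r M (s : seq (R * R)) : 0 < r -> pa u (eball X0 r) ->
  (forall Y, eball X0 r Y -> `|u Y| <= M) -> uniq s ->
  (forall X, X \in s -> enorm (X - X0) <= r / 10 /\ der u X = 0) -> enorm (Y0 - X0) <= r / 10 ->
  `|u Y0 - u X0| <= (4 / 7) ^+ size s * (2 * M).
Proof.
move=> r0 pu uM us hs hY.
pose n : R * R := (0, 1); have n1 : dot n n = 1 by rewrite /dot /= mulr0 mulr1 add0r.
have d0 := half_pos r0; pose d := r / 2; pose A := aff X0 n d; pose f z := der u (A z).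
have M0 : 0 <= M by apply: le_trans (uM X0 (eball_center X0 r0)).
have b1 z : eball 0 1 z -> eball X0 (r / 2) (A z).
  by move=> h; rewrite -{1}(aff0 X0 n d) -[r / 2]mulr1; apply/aff_eball.
have cf : ca f (eball 0 1).
  move=> e ep; have [q hq] := der_ca r0 pu ep; have [P [hP _]] := aff_poly X0 n d.
  by exists (q \Po P) => z z1; rewrite horner_comp -hP; apply/hq/b1.
have sub Y : eball X0 (r / 2) Y -> eball Y (r / 2) `<=` eball X0 r.
  by move=> hY'; apply: eball_sub; move: hY'; rewrite /eball /=; lra.
have fB z : eball 0 1 z -> cn (f z) <= 8 * M / (r / 2).
  move=> /b1 hz; apply: (der_bound d0) => [|Y hY']; first exact: paS (sub _ hz) pu.
  exact/uM/(sub _ hz).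
have iN X : enorm (affi X0 n d X) = enorm (X - X0) / d.
  have := aff_dist X0 (affi X0 n d X) 0 n1 d0; rewrite aff0 subr0 affiK// => ->.
  by rewrite mulrC mulKf// gt_eqF.
have i5 X : enorm (X - X0) <= r / 10 -> enorm (affi X0 n d X) <= 1 / 5.
  by move=> h; rewrite iN ler_pdivrMr// /d; lra.
have bound X : enorm (X - X0) <= r / 10 -> cn (der u X) <= (4 / 7) ^+ size s * (8 * M / (r / 2)).
  move=> hX; have := @zero_count _ f (8 * M / (r / 2)) (map (affi X0 n d) s).
  rewrite size_map map_inj_uniq; last by move=> x y E; rewrite -(affiK X0 x n1 d0) E affiK.
  move=> /(_ us _ _ cf fB _ (i5 _ hX)); rewrite /f /A affiK//; apply => z /mapP[x xs ->].
    by apply: i5; case: (hs x xs).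
  by rewrite affiK//; case: (hs x xs).
set K := (4 / 7) ^+ size s in bound *.
have K0 : 0 <= K by rewrite exprn_ge0// divr_ge0.
pose v := Y0 - X0.
have pt t : 0 <= t <= 1 -> enorm (X0 + t *: v - X0) <= r / 10.
  move=> /andP[t0 t1]; rewrite addrAC subrr add0r enormZ ger0_norm//.
  by apply: le_trans hY; rewrite ler_piMl// enorm_ge0.
have [|t /andP[t0 t1]] := @line_MVT _ u X0 v (fun t => complex.Re (der u (X0 + t *: v) * toC v)).
  move=> t tb; have bt : eball X0 (r / 2) (X0 + t *: v) by rewrite /eball /=; have := pt t tb; lra.
  by apply: (pa_dir v d0); apply: paS (sub _ bt) pu.
have -> : X0 + v = Y0 by rewrite /v addrCA subrr addr0.
move=> ->; apply: le_trans (cn_Re _) _; rewrite cnM -enormE.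
have tb : 0 <= t <= 1 by rewrite !ltW.
apply: (@le_trans _ _ (K * (8 * M / (r / 2)) * (r / 10))).
  by apply: ler_pM; rewrite ?cn_ge0 ?enorm_ge0//; apply/bound/pt.
have -> : K * (8 * M / (r / 2)) * (r / 10) = K * (8 / 5 * M) by field; rewrite gt_eqF.
by apply: ler_wpM2l => //; lra.
Qed.

End interior_local.

(** * Propagation of smallness and counting *)

Section propagation.
Context {R : realType}.
Implicit Types (X Y Z : R * R).

(** The point p is the first exit from D on the segment from X to Z. *)
Lemma near_boundary (D : set (R * R)) X Z : open D -> closure D X -> ~ D Z ->
  exists2 p, boundary D p & enorm (p - X) <= enorm (Z - X).
Proof.
move=> oD cX nZ; have [DX|nX] := pselect (D X); last first.
  exists X; last by rewrite subrr enorm0 enorm_ge0.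
  by split=> // /interior_subset.
pose v := Z - X; pose S := [set t : R | 0 <= t <= 1 /\ forall s, 0 <= s <= t -> D (X + s *: v)].
have S0 : S 0.
  split=> [|s /andP[s0 s1]]; first by rewrite lexx ler01.
  by have -> : s = 0 by [apply/le_anti; rewrite s0 s1]; rewrite scale0r addr0.
have hS : has_sup S by split; [exists 0|exists 1 => t [/andP[]]].
have T0 : 0 <= sup S by apply: ub_le_sup => //; case: hS.
have T1 : sup S <= 1 by apply: ge_sup; [exists 0|move=> t [/andP[]]].
pose p := X + sup S *: v.
have dp (s : R) : enorm (X + s *: v - p) = `|s - sup S| * enorm v.
  by rewrite /p opprD addrACA subrr add0r -scalerBl enormZ.
have below (s : R) : 0 <= s -> s < sup S -> D (X + s *: v).
  move=> s0 sT; have [t [_ ht] st] := sup_gt (ltac:(by exists 0) : S !=set0) sT.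
  by apply: ht; rewrite s0 ltW.
have nDp : ~ D p.
  move=> Dp; have [r r0 rD] := proj1 (openP D) oD _ Dp.
  have [T1'|T1'] := eqVneq (sup S) 1.
    by apply: nZ; move: Dp; rewrite /p T1' scale1r /v addrCA subrr addr0.
  have Tlt : sup S < 1 by rewrite lt_neqAle T1' T1.
  pose e := Num.min (1 - sup S) (r / (2 * (enorm v + 1))).
  have v0 : 0 < enorm v + 1 by rewrite ltr_wpDl ?enorm_ge0.
  have e0 : 0 < e by rewrite lt_min subr_gt0 Tlt divr_gt0// mulr_gt0.
  have e1 : e <= 1 - sup S by rewrite ge_min lexx.
  have e2 : e * (2 * (enorm v + 1)) <= r by rewrite -ler_pdivlMr ?mulr_gt0// ge_min lexx orbT.
  have : S (sup S + e).
    split=> [|s /andP[s0 s1]]; first by apply/andP; split; lra.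
    have [sT|sT] := ltP s (sup S); first exact: below.
    apply: rD; rewrite /eball /= dp ger0_norm ?subr_ge0//.
    apply: (@le_lt_trans _ _ (e * enorm v)); first by apply: ler_wpM2r; [exact: enorm_ge0|lra].
    by have := mulr_ge0 (ltW e0) (enorm_ge0 v); move: e2; rewrite !mulrDr mulr1; lra.
  by move/(ub_le_sup (proj2 hS)); lra.
exists p; last first.
  by rewrite /p addrAC subrr add0r enormZ ger0_norm// ler_piMl ?enorm_ge0.
split; last by move=> /interior_subset.
have [T00|Tn0] := eqVneq (sup S) 0.
  by exfalso; apply: nDp; rewrite /p T00 scale0r addr0.
have Tp : 0 < sup S by rewrite lt_neqAle eq_sym Tn0 T0.
apply/closureP => r r0.
have v0 : 0 < enorm v + 1 by rewrite ltr_wpDl ?enorm_ge0.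
pose e := Num.min (sup S) (r / (2 * (enorm v + 1))).
have e0 : 0 < e by rewrite lt_min Tp divr_gt0// mulr_gt0.
have e1 : e <= sup S by rewrite ge_min lexx.
have e2 : e * (2 * (enorm v + 1)) <= r by rewrite -ler_pdivlMr ?mulr_gt0// ge_min lexx orbT.
exists (X + (sup S - e) *: v); first by apply: below; lra.
rewrite /eball /= dp addrAC subrr add0r normrN gtr0_norm//.
by have := mulr_ge0 (ltW e0) (enorm_ge0 v); move: e2; rewrite !mulrDr mulr1; lra.
Qed.

(** A step of length s / 16 keeps the disc of radius s / 8 about the next centre within the quarter
    disc on which [smallness] has just given control; hence k = 1/8 from the second step on. *)
Lemma chain_small (n : nat) (k t : R) : 0 < k -> k <= 1 -> 0 < t -> exists2 h : R, 0 < h &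
  forall (V : R * R -> R) (z : nat -> R * R) s M, 0 < s -> 0 <= M ->
    (forall i, (i <= n)%N -> pa V (eball (z i) s) /\ forall Y, eball (z i) s Y -> `|V Y| <= M) ->
    (forall i, (i < n)%N -> enorm (z i.+1 - z i) <= s / 16) ->
    (forall Y, eball (z 0%N) (k * s) Y -> `|V Y| <= h * M) ->
    `|V (z n)| <= t * M.
Proof.
elim: n k t => [|n IH] k t k0 k1 t0.
  have [h h0 hh] := smallness k0 k1 t0; exists h => // V z s M s0 M0 hz _ hsm.
  have [pV VM] := hz 0%N (leqnn _).
  by apply: (hh V (z 0%N) s M s0 M0 pV VM hsm); rewrite /ecball /= subrr enorm0 divr_ge0// ltW.
have k8 : 0 < (8^-1 : R) by rewrite invr_gt0.
have k81 : (8^-1 : R) <= 1 by lra.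
have [h1 h10 H1] := IH _ _ k8 k81 t0.
have [h h0 hh] := smallness k0 k1 h10; exists h => // V z s M s0 M0 hz hst hsm.
have [pV VM] := hz 0%N (leq0n _).
have loc := hh V (z 0%N) s M s0 M0 pV VM hsm.
apply: (H1 V (fun i => z i.+1) s M s0 M0) => [i hi|i hi|Y hY]; [exact: hz|exact: hst|].
apply: loc; rewrite /ecball /=; have := enorm_tri (z 1%N) Y (z 0%N).
by have := hst 0%N (ltn0Sn _); move: hY; rewrite /eball /=; lra.
Qed.

Lemma decay_count (c K : R) : 0 < c -> exists n : nat, forall k : nat, c <= (4 / 7) ^+ k * K -> (k <= n)%N.
Proof.
move=> c0; have q0 : 0 < (4 / 7 : R) by lra.
have [n hn] : exists n : nat, (4 / 7) ^+ n * `|K| < c.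
  have a0 : 0 <= 2 * `|K| / c by rewrite divr_ge0 ?mulr_ge0// ltW.
  exists (Num.bound (2 * `|K| / c)); have := archi_boundP a0; set m := Num.bound _ => hm.
  have pw (j : nat) : (4 / 7 : R) ^+ j * (j%:R / 2 + 1) <= 1.
    elim: j => [|j IH]; first by rewrite expr0 mul0r add0r mulr1.
    rewrite exprSr -[j.+1%:R]natr1; have := exprn_ge0 j (ltW q0).
    by have := mulr_ge0 (exprn_ge0 j (ltW q0)) (ler0n R j); move: IH; lra.
  have h1 := pw m; rewrite ltr_pdivrMr// in hm.
  have qm : 0 < (4 / 7 : R) ^+ m by rewrite exprn_gt0.
  have h2 : (4 / 7) ^+ m * (2 * `|K|) < (4 / 7) ^+ m * (m%:R * c) by rewrite ltr_pM2l.
  have h3 : (4 / 7) ^+ m * (m%:R / 2 + 1) * c <= 1 * c by rewrite ler_pM2r.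
  have h4 := mulr_gt0 qm c0.
  by move: h2 h3 h4; rewrite !mulrDr; lra.
exists n => k hk; rewrite leqNgt; apply/negP => nk; move: hk; rewrite leNgt => /negP; apply.
apply: le_lt_trans hn; apply: (@le_trans _ _ ((4 / 7) ^+ k * `|K|)).
  by apply: ler_wpM2l; [rewrite exprn_ge0// ltW|exact: ler_norm].
apply: ler_wpM2r => //; apply: ler_wiXn2l; [exact: ltW|lra|exact: ltnW].
Qed.

Lemma half_pow (K e : R) : 0 < e -> exists k : nat, K * 2^-1 ^+ k <= e.
Proof.
move=> e0; have a0 : 0 <= `|K| / e by rewrite divr_ge0// ltW.
exists (Num.bound (`|K| / e)); have := archi_boundP a0; set k := Num.bound _ => hk.
have k2 : (k%:R : R) <= 2 ^+ k by rewrite -natrX ler_nat ltnW// ltn_expl.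
rewrite exprVn ler_pdivrMr ?exprn_gt0//; apply: le_trans (ler_norm K) _.
rewrite ltr_pdivrMr// in hk; apply: le_trans (ltW hk) _.
by rewrite mulrC; apply: ler_wpM2l => //; exact: ltW.
Qed.

Lemma card_le_seq (T : choiceType) (A : set T) n :
  (forall s : seq T, uniq s -> (forall x, x \in s -> A x) -> (size s <= n)%N) -> A #<= `I_n.
Proof.
move=> h.
pose P (m : nat) := `[< exists s : seq T, [/\ uniq s, forall x, x \in s -> A x & size s = m] >].
have P0 : exists m, P m by exists 0%N; apply/asboolP; exists [::].
have Pn m : P m -> (m <= n)%N by move=> /asboolP[s [us sA <-]]; exact: h.
case: (ex_maxnP P0 Pn) => m /asboolP[s [us sA sm]] mx.
have As x : A x -> x \in s.
  move=> Ax; apply/negPn/negP => xs; have : P m.+1.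
    apply/asboolP; exists (x :: s); split; [by rewrite /= xs us| |by rewrite /= sm].
    by move=> y; rewrite inE => /orP[/eqP->//|/sA].
  by move/mx; rewrite ltnn.
case: s us sA sm As => [|x0 s] us sA sm As.
  by rewrite (_ : A = set0) ?card_ge0//; apply/seteqP; split=> x // /As.
have h1 : A #<= nth x0 (x0 :: s) @` `I_m.
  apply: subset_card_le => x Ax; exists (index x (x0 :: s)); last exact/nth_index/As.
  by have := As x Ax; rewrite -index_mem sm.
have h3 : `I_m #<= `I_n by rewrite card_le_II; apply: Pn; apply/asboolP; exists (x0 :: s).
exact: card_le_trans (card_le_trans h1 (card_image_le _ _)) h3.
Qed.

Lemma cover_count (T S : eqType) (P : S -> pred T) (l : seq S) (s : seq T) n :
  (forall x, x \in s -> exists2 c, c \in l & P c x) ->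
  (forall c, c \in l -> (size [seq x <- s | P c x] <= n)%N) -> (size s <= size l * n)%N.
Proof.
elim: l s => [|c l IH] s cov cnt.
  by case: s cov cnt => // x s /(_ x (mem_head _ _)) [].
rewrite -(count_predC (P c) s) -!size_filter /= mulSn leq_add//; first by apply: cnt; exact: mem_head.
apply: IH => [x|c' c'l].
  rewrite mem_filter => /andP[/= nP xs]; have [c' c'l Pc'] := cov x xs.
  by exists c' => //; move: c'l; rewrite inE => /orP[/eqP E|//]; move: nP; rewrite -E Pc'.
apply: leq_trans (cnt c' _); last by rewrite inE c'l orbT.
by rewrite !size_filter count_filter; apply: sub_count => x /andP[].
Qed.

End propagation.

(** * Estimates in the original domain *)

Section counting.
Context {R : realType}.
Implicit Types (X Y Z p n q : R * R) (d M k eps rho sg : R).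
Local Notation mu := (@lebesgue_measure R).
Context (theta : R -> R) (th : dini_parameter theta).
Context (D : set (R * R)) (u : R * R -> R) (rho : R).
Context (oD : open D) (rho0 : 0 < rho).
Let Om := D `&` eball 0 rho.
Let U := ext0 D u.
Context (hU : harm U Om) (Uc : forall X, eball 0 rho X -> {for X, continuous U}).

Lemma dchart_le p d eps : 0 < d -> theta d <= eps -> dchart theta D p d ->
  exists2 n, dot n n = 1 & chart D p n d eps.
Proof. by move=> d0 te [n n1 hn]; exists n => //; apply: (chart_le te); exact: hn. Qed.

(** Under the boundary point 0 a disc around -d n lies off D. It meets every vertical line of a
    strip of width d / 2, which supplies the points off D that [sup_bound] needs. *)
Lemma hole n d sg X E : dot n n = 1 -> boundary D 0 -> chart D 0 n (2 * d) tilt ->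
  0 < d -> 16 * d <= sg -> (\int[(mu \x mu)%E]_X (energy_density D u rho X)%:E < E%:E)%E ->
  enorm X <= rho - sg -> U X ^+ 2 <= 56 * rho * E / d.
Proof.
move=> n1 b0 ch d0 ds hE hX.
have [k1 k2] : `|n.1| <= 1 /\ `|n.2| <= 1.
  have en : enorm n = 1 by apply/eqP; rewrite -(@eqrXn2 _ 2) ?enorm_ge0// -dot_enorm n1 expr1n.
  by rewrite -en; split; [exact: enorm1|exact: enorm2].
have dn (x : R) : `|x| <= 1 -> - d <= d * x <= d.
  move=> h; rewrite -ler_norml normrM gtr0_norm// -[leRHS]mulr1 ler_pM2l//.
have /andP[a1 a2] := dn _ k1; have /andP[a3 a4] := dn _ k2.
have -> : 56 * rho * E / d = 28 * rho * E / (d / 2) by field; rewrite gt_eqF.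
apply: (@sup_bound _ D u rho oD rho0 hU Uc E X sg (- (d * n.1) - d / 4) (d / 2)) => //; try lra.
move=> x hx; exists (- (d * n.2)); first by rewrite normrN ler_norml; lra.
set Y := (x, _).
have YE : Y = - (d *: n) + (x + d * n.1, 0) by apply: injective_projections; rewrite /= /GRing.scale /=; ring.
have en : enorm (d *: n) = d.
  by rewrite enormZ gtr0_norm// (_ : enorm n = 1) ?mulr1//; apply/eqP; rewrite -(@eqrXn2 _ 2) ?enorm_ge0// -dot_enorm n1 expr1n.
have h1 : enorm (x + d * n.1, 0 : R) <= d / 4 by rewrite enorm_e1 ler_norml; lra.
have h2 : enorm Y <= 5 / 4 * d.
  by rewrite YE; apply: le_trans (enormD _ _) _; rewrite enormN en; lra.
apply: (chart_below n1 (tilt_ge0 R) ch b0); first by rewrite /eball /= subr0; lra.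
rewrite subr0; have -> : dot Y n = - d + dot (x + d * n.1, 0) n.
  by rewrite YE dotDl dotNl dotZl n1 mulr1.
have := dot_le (x + d * n.1, 0) n1; rewrite ler_norml => /andP[_ h3].
have := tiltM Y.
by lra.
Qed.

Lemma U_off X : ~ D X -> U X = 0. Proof. by move=> nD; exact: U_out. Qed.

Lemma ball_Om p d : enorm p + 4 * d <= rho -> eball p (4 * d) `<=` eball 0 rho.
Proof. by move=> h; apply: eball_sub; rewrite subr0. Qed.

Lemma harm_sub_ball p d : enorm p + 4 * d <= rho -> harm U (D `&` eball p (4 * d)).
Proof. by move=> h; apply: harmS hU => X [DX Xp]; split=> //; exact: ball_Om Xp. Qed.

Lemma near_small p d M (k : nat) X : 0 < d -> 0 <= M -> boundary D p -> dchart theta D p (5 * d) -> theta (5 * d) <= tilt ->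
  enorm p + 4 * d <= rho -> (forall Y, eball p (4 * d) Y -> `|U Y| <= M) ->
  enorm (X - p) <= d * 16^-1 ^+ k -> `|U X| <= M * 2^-1 ^+ k.
Proof.
move=> d0 M0 bp dc te pr UM hX; have d50 : 0 < 5 * d by rewrite mulr_gt0.
have [n n1 ch] := dchart_le d50 te dc.
apply: (decay_local oD n1 d0 (lexx _) ch bp (tilt_ge0 R) (tilt_le R) M0 _ _ _ UM hX) => [Y hY||].
- by apply/Uc/(ball_Om pr).
- exact: U_off.
- exact: harm_sub_ball.
Qed.

(** The flattening uses the chart at p, but the Hopf property of a critical boundary point uses the
    chart at that point; [chart_normals] relates their normals. *)
Lemma near_count p d M m (s : seq (R * R)) : 0 < d -> 0 < M -> boundary D p -> dchart theta D p (5 * d) ->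
  theta (5 * d) <= tilt -> enorm p + 4 * d <= rho -> (forall Y, eball p (4 * d) Y -> `|U Y| <= M) ->
  (forall X, boundary D X -> enorm (X - p) <= d / 16 -> exists2 d' : R, 0 < d' & dchart theta D X d') ->
  (exists Y, [/\ D Y, enorm (Y - p) <= d / 16 & m <= `|U Y|]) -> uniq s ->
  (forall X, X \in s -> [/\ closure D X, enorm (X - p) <= d / 16 & crit_at U D X]) ->
  m <= (4 / 7) ^+ size s * (8 * M).
Proof.
move=> d0 M0 bp dc te pr UM charts Yex us hs; have d50 : 0 < 5 * d by rewrite mulr_gt0.
have [n n1 ch] := dchart_le d50 te dc.
apply: (boundary_local oD n1 d0 (lexx _) ch bp (tilt_ge0 R) (tilt_le R) M0 _ _ _ UM Yex us) => [Y hY|||X Xs].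
- by apply/Uc/(ball_Om pr).
- exact: U_off.
- exact: harm_sub_ball.
have [cX Xp crX] := hs X Xs; split=> // nX.
have bX : boundary D X by split=> // /interior_subset.
have [d' d'0 [nn nn1 hnn]] := charts X bX Xp.
pose d2 := Num.min d' (5 * d).
have d20 : 0 < d2 by rewrite lt_min d'0.
have AX : aff p n d (affi p n d X) = X by exact: affiK.
apply: (hopf_dini oD n1 d0 (lexx _) ch bp (tilt_ge0 R) (tilt_le R) (nn := nn) (rq := d2) th) => //.
- have := aff_dist p (affi p n d X) 0 n1 d0; rewrite aff0 subr0 AX => E.
  by rewrite -(ler_pM2l d0) -E; lra.
- by rewrite AX.
- apply: (chart_normals n1 nn1 (tilt_gt0 R) (tilt_64 R) d20 ch _ bX).
    apply: (@chart_le _ D X nn d2 (theta d2)); last by apply: hnn => //; rewrite ge_min lexx.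
    by apply: le_trans te; apply: (theta_le th); [exact: ltW|rewrite ge_min lexx orbT].
  by rewrite /eball /=; lra.
- by move=> r r0 rr; rewrite AX; apply: hnn => //; apply: le_trans rr _; rewrite ge_min lexx.
Qed.

Lemma crit_der0 X : Om X -> crit_at U D X -> der U X = 0.
Proof.
move=> OX cr; have [r r0 pr] := hU OX; have [DX _] := OX.
apply/cn_eq0/le_anti; rewrite cn_ge0 andbT; apply/ler_addgt0Pr => e e0; rewrite add0r.
by have [d d0 hd] := cr e e0; apply: hd => //; exact: eball_center.
Qed.

End counting.

Section counting_steps.
Context {R : realType}.
Implicit Types (X Y Z W p n q : R * R) (s : seq (R * R)).
Local Notation mu := (@lebesgue_measure R).
Context (theta : R -> R) (th : dini_parameter theta) (D : set (R * R)) (u : R * R -> R) (r m : R) (Xs : R * R).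
Context (oD : open D) (r0 : 0 < r) (b0 : boundary D 0).
Let Om := D `&` eball 0 (2 * r).
Let U := ext0 D u.
Context (hU : harm U Om) (Uc : forall X, eball 0 (2 * r) X -> {for X, continuous U}).
Context (m0 : 0 < m) (Um : `|U Xs| = m) (DXs : D Xs).

Lemma scale_r (a b : R) : a <= b -> a * r <= b * r. Proof. by move=> h; rewrite ler_pM2r. Qed.

Lemma growth_const (k kp : R) : 0 < k -> 0 < kp -> 56 * (2 * r) * (k * m ^+ 2) / (kp * r) <= ((1 + 112 * k / kp) * m) ^+ 2.
Proof.
move=> k0 kp0; have -> : 56 * (2 * r) * (k * m ^+ 2) / (kp * r) = (112 * k / kp) * m ^+ 2.
  by field; rewrite !gt_eqF.
have x0 : 0 <= 112 * k / kp by rewrite divr_ge0 ?ltW// mulr_gt0// ltr0n.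
rewrite exprMn; apply: ler_wpM2r; first exact: sqr_ge0.
by move: (112 * k / kp) x0 => x x0; have := sqr_ge0 x; rewrite sqrrD expr1n mul1r -mulr_natr; lra.
Qed.

Lemma growth n (d k kp sg : R) X : dot n n = 1 -> chart D 0 n (d * r) tilt -> 0 < k -> 0 < kp -> kp <= d / 2 -> kp <= sg / 16 ->
  (\int[(mu \x mu)%E]_X (energy_density D u (2 * r) X)%:E < (k * m ^+ 2)%:E)%E ->
  enorm X <= (2 - sg) * r -> `|U X| <= (1 + 112 * k / kp) * m.
Proof.
move=> n1 ch k0 kp0 kd ks hE hX.
have rho0 : 0 < 2 * r by rewrite mulr_gt0.
have kr : 0 < kp * r by rewrite mulr_gt0.
have c1 : 2 * (kp * r) <= d * r by rewrite mulrA ler_pM2r//; lra.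
have c2 : 16 * (kp * r) <= sg * r by rewrite mulrA ler_pM2r//; lra.
have hX' : enorm X <= 2 * r - sg * r by lra.
have := hole oD rho0 hU Uc n1 b0 (chartS c1 ch) kr c2 hE hX'.
move=> /le_trans/(_ (growth_const k0 kp0)) h.
have k1 : 0 <= 1 + 112 * k / kp by rewrite addr_ge0// divr_ge0 ?ltW// mulr_gt0// ltr0n.
by rewrite -(@ler_pXn2r R 2)// ?nnegrE ?mulr_ge0 ?(ltW m0)// real_normK ?num_real.
Qed.

Context (F : R -> R) (F1 : forall sg, 0 < sg -> 1 < F sg).
Context (supU : forall sg X, 0 < sg -> enorm X <= (2 - sg) * r -> `|U X| <= F sg * m).

Lemma F_gt0 sg : 0 < sg -> 0 < F sg. Proof. by move=> /F1; apply: lt_trans. Qed.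

Lemma in_Om Z : enorm Z < 2 * r -> D Z -> Om Z. Proof. by move=> h DZ; split=> //; rewrite /eball /= subr0. Qed.

(** If a point off D were close to Xs, so would be a boundary point, and decay from there would give
    |U Xs| <= m / 2, against |U Xs| = m. *)
Lemma deep (lam d k1 : R) (k : nat) : 0 < lam -> enorm Xs <= (2 - lam) * r -> 0 < d -> d <= lam / 40 ->
  F (lam / 4) * 2^-1 ^+ k <= 1 / 2 -> theta (5 * (d * r)) <= tilt ->
  (forall p, boundary D p -> enorm p <= (2 - lam / 2) * r -> dchart theta D p (5 * (d * r))) ->
  k1 <= d * 16^-1 ^+ k -> k1 <= lam / 4 -> eball Xs (k1 * r) `<=` Om.
Proof.
move=> l0 Xsr d0 dl Fk te ch kd kl Z hZ; have := scale_r kl; have := scale_r dl; have lr : 0 < lam * r by rewrite mulr_gt0.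
rewrite /eball /= in hZ => dlr klr.
have Zr : enorm Z < 2 * r by have := enorm_tri Xs Z 0; rewrite !subr0; lra.
apply: in_Om => //; apply: contrapT => nD; have [p bp pX] := near_boundary oD (subset_closure DXs) nD.
have pn : enorm p <= (2 - 3 / 4 * lam) * r by have := enorm_tri Xs p 0; rewrite !subr0; lra.
have pn' : enorm p <= (2 - lam / 2) * r by lra.
have dr : 0 < d * r by rewrite mulr_gt0.
have l4 : 0 < lam / 4 by rewrite divr_gt0.
have Fm : 0 <= F (lam / 4) * m by rewrite mulr_ge0 ?ltW// F_gt0.
have pr : enorm p + 4 * (d * r) <= 2 * r by lra.
have UM Y : eball p (4 * (d * r)) Y -> `|U Y| <= F (lam / 4) * m.
  move=> hY; apply: supU => //; rewrite /eball /= in hY.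
  by have := enorm_tri p Y 0; rewrite !subr0; lra.
have hX : enorm (Xs - p) <= d * r * 16^-1 ^+ k.
  by rewrite enormC; apply: le_trans pX _; apply: le_trans (ltW hZ) _; rewrite mulrAC; exact: scale_r.
have := near_small oD hU Uc dr Fm bp (ch p bp pn') te pr UM hX; rewrite -/U Um.
have -> : F (lam / 4) * m * 2^-1 ^+ k = F (lam / 4) * 2^-1 ^+ k * m by ring.
have : F (lam / 4) * 2^-1 ^+ k * m <= 1 / 2 * m by rewrite ler_pM2r.
by move: m0; lra.
Qed.

(** A reference point with room around it inside D, yet so close to the boundary point 0 that u is
    small at it. It is what distinguishes u from a constant in [inner]. *)
Lemma pole n (d dq : R) (k : nat) : dot n n = 1 -> chart D 0 n (5 * (d * r)) tilt -> dchart theta D 0 (5 * (d * r)) ->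
  theta (5 * (d * r)) <= tilt -> 0 < d -> d <= 1 / 20 -> F 1 * 2^-1 ^+ k <= 1 / 4 -> dq = d * 16^-1 ^+ k / 4 ->
  exists2 q, eball q (dq * r) `<=` Om & `|U q| <= 1 / 4 * m.
Proof.
move=> n1 ch dc te d0 dl Fk dqE.
have en : enorm n = 1 by apply/eqP; rewrite -(@eqrXn2 _ 2) ?enorm_ge0// -dot_enorm n1 expr1n.
have dq0 : 0 < dq by rewrite dqE divr_gt0// mulr_gt0// exprn_gt0.
have dqr : 0 < dq * r by rewrite mulr_gt0.
have dqd : 4 * (dq * r) <= d * r.
  rewrite mulrA; apply: scale_r; rewrite dqE mulrC divfK// ler_piMr ?(ltW d0)// exprn_ile1//; lra.
have dr := scale_r dl; have drp : 0 < d * r by rewrite mulr_gt0.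
pose q := (2 * (dq * r)) *: n.
have eq : enorm q = 2 * (dq * r) by rewrite /q enormZ en mulr1 gtr0_norm// mulr_gt0.
have l1 : 0 < (1 : R) by [].
exists q => [Y hY|].
  rewrite /eball /= in hY; have Y3 : enorm Y <= 3 * (dq * r).
    by have := enorm_tri q Y 0; rewrite !subr0 eq; lra.
  apply: in_Om; first by lra.
  apply: (chart_above n1 (tilt_ge0 R) ch b0); first by rewrite /eball /= subr0; lra.
  rewrite subr0; have -> : dot Y n = 2 * (dq * r) + dot (Y - q) n by rewrite dotBl /q dotZl n1; ring.
  by have := dot_le (Y - q) n1; rewrite ler_norml => /andP[h _]; have := tiltM Y; lra.
have Fm : 0 <= F 1 * m by rewrite mulr_ge0 ?ltW// F_gt0.
have pr : enorm (0 : R * R) + 4 * (d * r) <= 2 * r by rewrite enorm0; lra.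
have UM Y : eball 0 (4 * (d * r)) Y -> `|U Y| <= F 1 * m.
  by rewrite /eball /= subr0 => hY; apply: supU => //; lra.
have hq : enorm (q - 0) <= d * r * 16^-1 ^+ k.
  by rewrite subr0 eq (_ : d * r * 16^-1 ^+ k = 4 * (dq * r)); [lra|rewrite dqE; field].
apply: le_trans (near_small oD hU Uc drp Fm b0 dc te pr UM hq) _.
have -> : F 1 * m * 2^-1 ^+ k = F 1 * 2^-1 ^+ k * m by ring.
by rewrite ler_pM2r.
Qed.

(** Too many critical points make u - u(Z) small near Z, and propagation makes it at most m / 8 both
    at Xs and at q. But u is of size m at the first and at most m / 4 at the second. *)
Lemma inner Z q (be di si ti hi : R) s : enorm Z <= r -> 0 < be -> 40 * be <= 1 -> di <= 10 * be -> 0 < si ->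
  ti * (F si + F (1 / 4)) = 1 / 8 -> 0 < hi -> eball Z (20 * (be * r)) `<=` D ->
  (forall Y V M, eball Z (di * r) `<=` Om -> eball Y (di * r) `<=` Om -> harm V Om -> 0 <= M ->
    (forall Z, Om Z -> enorm Z <= (2 - si) * r -> `|V Z| <= M) ->
    (forall W, eball Z (be * r) W -> `|V W| <= hi * M) -> `|V Y| <= ti * M) ->
  eball Xs (di * r) `<=` Om -> eball q (di * r) `<=` Om -> `|U q| <= 1 / 4 * m -> uniq s ->
  (forall X, X \in s -> crit_at U D X /\ eball Z (be * r) X) ->
  hi * (F si + F (1 / 4)) <= (4 / 7) ^+ size s * (2 * F (1 / 4)).
Proof.
move=> Zr be0 be40 dib si0 tE hi0 inD prop XsO qO Uq us hs; rewrite leNgt; apply/negP => lt.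
have ber : 0 < be * r by rewrite mulr_gt0.
have b40 := scale_r be40; have dir := scale_r dib.
have ecO : ecball Z (10 * (be * r)) `<=` Om.
  move=> Y hY; apply: in_Om; last by apply: inD; apply: ecball_eball hY; lra.
  by rewrite /ecball /= in hY; have := enorm_tri Z Y 0; rewrite !subr0; lra.
have ar : 0 < 10 * (be * r) by rewrite mulr_gt0.
have q4 : 0 < (1 / 4 : R) by lra.
have pZ := harm_eball hU ar ecO.
have UM Y : eball Z (10 * (be * r)) Y -> `|U Y| <= F (1 / 4) * m.
  move=> hY; apply: supU => //; rewrite /eball /= in hY.
  by have := enorm_tri Z Y 0; rewrite !subr0; lra.
have crit X : X \in s -> enorm (X - Z) <= 10 * (be * r) / 10 /\ der U X = 0.
  move=> /hs[cr XZ]; have XZ' : enorm (X - Z) <= be * r by exact: ltW.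
  split; first by lra.
  by apply: (crit_der0 hU) => //; apply: ecO; rewrite /ecball /=; lra.
set Mi := F si + F (1 / 4) in lt tE; have Mi0 : 0 < Mi by rewrite addr_gt0// F_gt0.
pose V Y := U Y - U Z.
have small Y : eball Z (be * r) Y -> `|V Y| <= hi * (Mi * m).
  move=> hY; have hY' : enorm (Y - Z) <= 10 * (be * r) / 10 by move: hY; rewrite /eball /=; lra.
  apply: le_trans (interior_local ar pZ UM us crit hY') _.
  have -> : (4 / 7) ^+ size s * (2 * (F (1 / 4) * m)) = (4 / 7) ^+ size s * (2 * F (1 / 4)) * m by ring.
  by rewrite mulrA; apply: ler_wpM2r; exact: ltW.
have hV : harm V Om by exact: harmB hU (@harm_cst _ _ _).
have VM Y : Om Y -> enorm Y <= (2 - si) * r -> `|V Y| <= Mi * m.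
  move=> _ hY; rewrite /V /Mi mulrDl; apply: le_trans (ler_normB _ _) _.
  by apply: lerD; [exact: supU|apply: supU => //; move: r0; lra].
have Mm : 0 <= Mi * m by rewrite mulr_ge0// ltW.
have tE' : ti * (Mi * m) = 1 / 8 * m by rewrite mulrA tE.
have Zdi : eball Z (di * r) `<=` Om.
  by move=> Y hY; apply: ecO; move: hY; rewrite /eball /ecball /=; lra.
have p1 := prop Xs V _ Zdi XsO hV Mm VM small.
have p2 := prop q V _ Zdi qO hV Mm VM small.
have : `|U Xs| <= `|V Xs| + (`|V q| + `|U q|).
  have -> : U Xs = V Xs - V q + U q by rewrite /V; ring.
  by have := ler_normD (V Xs - V q) (U q); have := ler_normB (V Xs) (V q); lra.
by rewrite Um; move: m0; lra.
Qed.

(** Near a boundary point u itself must reach the size hb F sb m somewhere in D: otherwise it would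
    be small on a disc inside D close to p, and smallness would spread to Xs. This is the lower
    bound for [near_count]. *)
Lemma outer p (d db sb tb hb : R) s : boundary D p -> enorm p <= 11 / 10 * r -> 0 < d -> d <= 1 / 40 ->
  theta (5 * (d * r)) <= tilt ->
  (forall p, boundary D p -> enorm p <= (2 - 1 / 2) * r -> dchart theta D p (5 * (d * r))) ->
  db <= d / 64 -> 0 < sb -> tb * F sb = 1 / 2 -> 0 < hb ->
  (forall X Y V M, eball X (db * r) `<=` Om -> eball Y (db * r) `<=` Om -> harm V Om -> 0 <= M ->
    (forall Z, Om Z -> enorm Z <= (2 - sb) * r -> `|V Z| <= M) ->
    (forall W, eball X (d / 64 * r) W -> `|V W| <= hb * M) -> `|V Y| <= tb * M) ->
  eball Xs (db * r) `<=` Om -> uniq s ->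
  (forall X, X \in s -> [/\ closure D X, enorm (X - p) <= d * r / 16 & crit_at U D X]) ->
  hb * F sb <= (4 / 7) ^+ size s * (8 * F (1 / 4)).
Proof.
move=> bp pr d0 d40 te ch dbd sb0 tE hb0 prop XO us hs.
have d3r : 0 < d * r by rewrite mulr_gt0. have dr := scale_r d40; have dbr := scale_r dbd.
have pr' : enorm p <= (2 - 1 / 2) * r by move: r0; lra.
have q4 : 0 < (1 / 4 : R) by lra.
have UM Y : eball p (4 * (d * r)) Y -> `|U Y| <= F (1 / 4) * m.
  move=> hY; apply: supU => //; rewrite /eball /= in hY.
  by have := enorm_tri p Y 0; rewrite !subr0; lra.
have Fm : 0 < F (1 / 4) * m by rewrite mulr_gt0// F_gt0.
have room : enorm p + 4 * (d * r) <= 2 * r by move: r0; lra.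
have charts X : boundary D X -> enorm (X - p) <= d * r / 16 -> exists2 d' : R, 0 < d' & dchart theta D X d'.
  move=> bX Xp; exists (5 * (d * r)); first by rewrite mulr_gt0.
  by apply: ch => //; have := enorm_tri p X 0; rewrite !subr0; lra.
have Yex : exists Y, [/\ D Y, enorm (Y - p) <= d * r / 16 & hb * (F sb * m) <= `|U Y|].
  apply: contrapT => none.
  have small Y : D Y -> enorm (Y - p) <= d * r / 16 -> `|U Y| <= hb * (F sb * m).
    by move=> DY Yp; rewrite leNgt; apply/negP => lt; apply: none; exists Y; split=> //; exact: ltW.
  have dh0 : 0 < 5 * (d * r) by rewrite mulr_gt0.
  have [n n1' chn] := dchart_le dh0 te (ch p bp pr').
  have en : enorm n = 1 by apply/eqP; rewrite -(@eqrXn2 _ 2) ?enorm_ge0// -dot_enorm n1' expr1n.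
  pose q' := p + (d * r / 32) *: n.
  have q'p : enorm (q' - p) = d * r / 32.
    by rewrite /q' addrAC subrr add0r enormZ en mulr1 gtr0_norm// divr_gt0.
  have inb Y : eball q' (d / 64 * r) Y -> D Y /\ enorm (Y - p) <= d * r / 16.
    rewrite /eball /= => hY; have Yp : enorm (Y - p) <= 3 / 64 * (d * r).
      by have := enorm_tri q' Y p; rewrite q'p; lra.
    split; last by lra.
    apply: (chart_above n1' (tilt_ge0 R) chn bp); first by rewrite /eball /=; lra.
    have -> : dot (Y - p) n = d * r / 32 + dot (Y - q') n.
      have -> : Y - p = (q' - p) + (Y - q') by rewrite [RHS]addrC addrA subrK.
      by rewrite dotDl /q' [p + _ - p]addrAC subrr add0r dotZl n1' mulr1.
    by have := dot_le (Y - q') n1'; rewrite ler_norml => /andP[h _]; have := tiltM (Y - p); lra.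
  have q'Om : eball q' (db * r) `<=` Om.
    move=> Y hY; have hY' : eball q' (d / 64 * r) Y by apply: lt_le_trans hY _.
    have [DY Yp] := inb Y hY'; apply: in_Om => //.
    by have := enorm_tri p Y 0; rewrite !subr0; lra.
  have Fsm : 0 <= F sb * m by rewrite mulr_ge0 ?ltW// F_gt0.
  have b1 Y : Om Y -> enorm Y <= (2 - sb) * r -> `|U Y| <= F sb * m by move=> _ hY; exact: supU.
  have b2 Y : eball q' (d / 64 * r) Y -> `|U Y| <= hb * (F sb * m) by move=> /inb[DY Yp]; exact: small.
  have := prop q' Xs U (F sb * m) q'Om XO hU Fsm b1 b2.
  by rewrite mulrA tE Um; move: m0; lra.
have := near_count th oD hU Uc d3r Fm bp (ch p bp pr') te room UM charts Yex us hs.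
by move=> h; rewrite -(ler_pM2r m0) -!mulrA.
Qed.

End counting_steps.

(** * The count for domains with given geometric data *)

Section critical_count.
Context {R : realType}.
Implicit Types (X Y Z p n q : R * R).
Local Notation mu := (@lebesgue_measure R).

(** [dd] gives the chart radius in terms of the distance to the sphere of radius 2 r; [ss] and [hh]
    give the margin and the threshold for propagating smallness between points with room delta. All
    lengths are in units of r, so one triple can serve a whole class of domains. *)
Definition regular (theta dd ss : R -> R) (hh : R -> R -> R -> R) (D : set (R * R)) (r : R) : Prop :=
  [/\ boundary D 0, 0 < r,
    forall tau, 0 < tau -> theta (dd tau * r) <= tilt /\
      forall p, boundary D p -> enorm p <= (2 - tau) * r -> dchart theta D p (dd tau * r) &
    forall delta kappa t, 0 < delta -> 0 < kappa -> 0 < t -> forall X Y V M,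
      eball X (delta * r) `<=` D `&` eball 0 (2 * r) -> eball Y (delta * r) `<=` D `&` eball 0 (2 * r) ->
      harm V (D `&` eball 0 (2 * r)) -> 0 <= M ->
      (forall Z, (D `&` eball 0 (2 * r)) Z -> enorm Z <= (2 - ss delta) * r -> `|V Z| <= M) ->
      (forall Z, eball X (kappa * r) Z -> `|V Z| <= hh delta kappa t * M) -> `|V Y| <= t * M].

Lemma near_hole D c X (be : R) : open D -> closure D X -> eball c be X -> ~ (eball c (20 * be) `<=` D) ->
  exists2 p, boundary D p & enorm (p - X) <= 21 * be /\ forall Y, eball c be Y -> enorm (Y - p) <= 23 * be.
Proof.
move=> oD cX Xc nin; have [W [Wc nW]] : exists W, eball c (20 * be) W /\ ~ D W.
  by apply: contrapT => h; apply: nin => W Wc; apply: contrapT => nW; apply: h; exists W.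
have [p bp pX] := near_boundary oD cX nW; rewrite /eball /= in Xc Wc *.
have pX' : enorm (p - X) <= 21 * be.
  by have := enorm_tri c W X; rewrite [enorm (c - X)]enormC; lra.
exists p => //; split=> // Y Yc; have := enorm_tri X Y p; have := enorm_tri c Y X.
by rewrite [enorm (X - p)]enormC [enorm (c - X)]enormC; lra.
Qed.

(** Every constant is chosen from [dd], [ss], [hh] and N before the domain, the function and r
    appear; this order of quantifiers is the uniformity of the count. *)
Lemma critical_count (dd ss : R -> R) (hh : R -> R -> R -> R) (N : R) :
  (forall tau, 0 < tau -> 0 < dd tau /\ dd tau <= tau / 4) -> (forall delta, 0 < delta -> 0 < ss delta) ->
  (forall delta kappa t, 0 < delta -> 0 < kappa -> 0 < t -> 0 < hh delta kappa t) -> 0 <= N ->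
  exists n : nat, forall theta D u r, dini_parameter theta -> open D -> regular theta dd ss hh D r ->
    harm (ext0 D u) (D `&` eball 0 (2 * r)) -> (forall X, eball 0 (2 * r) X -> {for X, continuous (ext0 D u)}) ->
    (exists m Xs, [/\ 0 < m, `|ext0 D u Xs| = m, D Xs, enorm Xs <= 2 * r - 2 * r / (384 * (N + 1)) &
      (\int[(mu \x mu)%E]_X (energy_density D u (2 * r) X)%:E < (384 * (N + 1) * m ^+ 2)%:E)%E]) ->
    forall s, uniq s ->
      (forall X, X \in s -> [/\ closure D X, crit_at (ext0 D u) D X & eball 0 r X]) -> (size s <= n)%N.
Proof.
move=> hdd hss hhh N0.
have k0p : 0 < 384 * (N + 1) := lt_le_trans (ltr0Sn R 7) (freq_const N0).
set k0 := 384 * (N + 1) in k0p *.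
have [lam lam0 lamE] : exists2 lam, 0 < lam & forall r, 2 * r - 2 * r / k0 = (2 - lam) * r.
  by exists (2 / k0); [rewrite divr_gt0|move=> r; ring].
have [l2 l4] : 0 < lam / 2 /\ 0 < lam / 4 by rewrite !divr_gt0.
have [q4 h2] : 0 < (1 / 4 : R) /\ 0 < (1 / 2 : R) by split; lra.
have two1 : 0 <= 2 - 1 :> R by lra.
have lt1 : 0 < (1 : R) by [].
(* F is the growth factor of [growth]: at distance sg r from the sphere, |u| is at most F sg times
   its value at Xs. The width [kap] must fit the chart at 0 and the margin sg. *)
pose kap sg := Num.min (dd 1 / 2) (sg / 16); pose F sg := 1 + 112 * k0 / kap sg.
have kap0 sg : 0 < sg -> 0 < kap sg.
  by move=> s0; rewrite lt_min !divr_gt0 ?ltr0n//; case: (hdd 1 lt1).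
have kap1 sg : kap sg <= dd 1 / 2 by rewrite ge_min lexx.
have kap2 sg : kap sg <= sg / 16 by rewrite ge_min lexx orbT.
have F1 sg : 0 < sg -> 1 < F sg.
  by move=> s0; rewrite ltrDl; apply: divr_gt0 (kap0 _ s0); apply: mulr_gt0 k0p; rewrite ltr0n.
have F0 sg : 0 < sg -> 0 < F sg by move=> s0; apply: lt_trans (F1 _ s0).
have FE sg : F sg = 1 + 112 * k0 / kap sg by [].
move: F F1 F0 FE => F F1 F0 FE.
have scal (tau : R) : 0 < tau -> exists d, [/\ 0 < d, d <= tau / 20 & forall r, 5 * (d * r) = dd tau * r].
  move=> t0; have [a1 a2] := hdd tau t0; exists (dd tau / 5); split; first by rewrite divr_gt0.
    by rewrite ler_pdivrMr//; move: a2; lra.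
  by move=> r; field.
have [d1 [d10 d1l d1E]] := scal _ l2; have [d2 [d20 d2l d2E]] := scal _ lt1; have [d3 [d30 d3l d3E]] := scal _ h2.
have {}d1l : d1 <= lam / 40 by move: d1l; lra.
have {}d3l : d3 <= 1 / 40 by move: d3l; lra.
have [k1 hk1] := half_pow (F (lam / 4)) h2; have [k2 hk2] := half_pow (F 1) q4.
have pw (k : nat) : 0 < (16^-1 : R) ^+ k by rewrite exprn_gt0.
have mn (a b : R) : 0 < a -> 0 < b -> exists c, [/\ 0 < c, c <= a & c <= b].
  by move=> a0 b0; exists (Num.min a b); rewrite lt_min a0 b0 !ge_min !lexx orbT.
have [dst [dst0 dst1 dst2]] := mn _ _ (mulr_gt0 d10 (pw k1)) l4.
have dq0 : 0 < d2 * 16^-1 ^+ k2 / 4 by rewrite divr_gt0// mulr_gt0.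
have d364 : 0 < d3 / 64 by rewrite divr_gt0.
have [db [db0 db1 db2]] := mn _ _ d364 dst0.
have sb0 := hss _ db0.
have tf (x : R) : 0 < x -> 0 < 1 / (2 * x) /\ 1 / (2 * x) * x = 1 / 2.
  by move=> x0; rewrite divr_gt0 ?mulr_gt0//; split=> //; field; rewrite gt_eqF.
have [tb0 tbE] := tf _ (F0 _ sb0); move: (1 / _) tb0 tbE => tb tb0 tbE.
have hb0 := hhh _ _ _ db0 d364 tb0.
have [n1 hn1] := @decay_count R (hh db (d3 / 64) tb * F (ss db)) (8 * F (1 / 4)) (mulr_gt0 hb0 (F0 _ sb0)).
(* 368 is 16 times 23: all points of a covering disc that comes near the boundary are within 23 be r
   of one boundary point, by [near_hole], and this has to be at most d3 r / 16. *)
have [be [be0 beE be40]] : exists be, [/\ 0 < be, forall r, 368 * (be * r) = d3 * r & 40 * be <= 1].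
  by exists (d3 / 368); split; [apply: (divr_gt0 d30); rewrite ltr0n|move=> r; field|move: d3l; clear; lra].
have be10 : 0 < 10 * be by rewrite mulr_gt0.
have [di' [di'0 di'1 di'2]] := mn _ _ dst0 dq0.
have [di [di0 di1 di2]] := mn _ _ be10 di'0.
have si0 := hss _ di0.
have Mi0 : 0 < 4 * (F (ss di) + F (1 / 4)) by rewrite mulr_gt0// addr_gt0// F0.
have [ti0 tiE] := tf _ Mi0; move: (1 / _) ti0 tiE => ti ti0 tiE.
have {}tiE : ti * (F (ss di) + F (1 / 4)) = 1 / 8.
  by move: (F _ + F _) tiE => x; rewrite mulrCA => h; rewrite -[LHS](mulKf (_ : 4 != 0)) ?h//; field.
have hi0 := hhh _ _ _ di0 be0 ti0.
have [n2 hn2] := @decay_count R (hh di be ti * (F (ss di) + F (1 / 4))) (2 * F (1 / 4)) (mulr_gt0 hi0 (addr_gt0 (F0 _ si0) (F0 _ q4))).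
have [l lK lcov] := @compact_gauge R (ecball 0 1) (fun=> be) (@compact_ecball R 0 1) (fun _ _ => be0).
exists (size l * maxn n1 n2)%N => theta D u r th oD [b0 r0 charts prop] hU Uc [m [Xs [m0 Um DXs Xsr hE]]] s us hs.
rewrite lamE in Xsr.
have [te1 ch1] := charts _ lt1; have [te2 ch2] := charts _ l2; have [te3 ch3] := charts _ h2.
have z1 : enorm (0 : R * R) <= (2 - 1) * r by rewrite enorm0 mulr_ge0// ltW.
have dd1r : 0 < dd 1 * r by rewrite -d2E mulr_gt0// mulr_gt0.
have [n0 n01 chn0] := dchart_le dd1r te1 (ch1 0 b0 z1).
have supU sg X : 0 < sg -> enorm X <= (2 - sg) * r -> `|ext0 D u X| <= F sg * m.
  by move=> s0 hX; rewrite FE; apply: (growth oD r0 b0 hU Uc m0 n01 chn0 k0p (kap0 _ s0) (kap1 _) (kap2 _) hE hX).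
have XsO : eball Xs (dst * r) `<=` D `&` eball 0 (2 * r).
  apply: (deep oD r0 hU Uc m0 Um DXs F1 supU lam0 Xsr d10 d1l hk1 _ _ dst1 dst2); rewrite d1E; [exact: te2|exact: ch2].
have [q qO Uq] : exists2 q, eball q (d2 * 16^-1 ^+ k2 / 4 * r) `<=` D `&` eball 0 (2 * r) & `|ext0 D u q| <= 1 / 4 * m.
  have d2l' : d2 <= 1 / 20 by exact: d2l.
  apply: (pole oD r0 b0 hU Uc m0 F1 supU n01 _ _ _ d20 d2l' hk2 erefl); rewrite d2E; [exact: chn0|exact: ch1|exact: te1].
have shrink (W : R * R) (a b : R) : a <= b -> eball W (b * r) `<=` D `&` eball 0 (2 * r) -> eball W (a * r) `<=` D `&` eball 0 (2 * r).
  by move=> ab; apply: subset_trans => Y hY; apply: lt_le_trans hY _; rewrite ler_pM2r.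
have ber : 0 < be * r by rewrite mulr_gt0.
apply: (@cover_count _ _ (fun c X => `[< eball (r *: c) (be * r) X >]) l) => [X Xs'|c cl].
  have [_ _ Xr] := hs X Xs'; have [|c cl Xc] := lcov (r^-1 *: X).
    rewrite /ecball /= subr0 enormZ gtr0_norm ?invr_gt0// mulrC ler_pdivrMr// mul1r.
    by move: Xr; rewrite /eball /= subr0 => /ltW.
  exists c => //; apply/asboolP; move: Xc; rewrite /eball /= => Xc.
  have -> : X - r *: c = r *: (r^-1 *: X - c) by rewrite scalerBr scalerA divff ?gt_eqF// scale1r.
  by rewrite enormZ gtr0_norm// mulrC ltr_pM2r.
set s' := [seq X <- s | _]; have us' : uniq s' by exact: filter_uniq.
have hs' X : X \in s' -> [/\ closure D X, crit_at (ext0 D u) D X, eball 0 r X & eball (r *: c) (be * r) X].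
  by rewrite mem_filter => /andP[/asboolP h /hs[]].
set Z := r *: c in hs'.
have Zr : enorm Z <= r.
  by rewrite /Z enormZ gtr0_norm// ler_piMr ?(ltW r0)//; have := lK _ cl; rewrite /ecball /= subr0.
(* Each covering disc either has twenty times its radius of room in D, an interior case, or lies
   near a boundary point. *)
have [inD|nin] := pselect (eball Z (20 * (be * r)) `<=` D).
  apply: leq_trans (leq_maxr _ _); apply: hn2.
  apply: (inner r0 hU m0 Um F1 supU Zr be0 be40 di1 si0 tiE hi0 inD _ _ _ Uq us').
  - by move=> Y V M; exact: (prop _ _ _ di0 be0 ti0 Z Y V M).
  - by apply: shrink XsO; exact: le_trans di2 di'1.
  - by apply: shrink qO; exact: le_trans di2 di'2.
  - by move=> X /hs'[].
apply: leq_trans (leq_maxl _ _).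
case: (pselect (exists X1, X1 \in s')) => [[X1 X1s]|none]; last first.
  by case: (s') none => // X1 ? none; exfalso; apply: none; exists X1; exact: mem_head.
have [cX1 _ X1r X1Z] := hs' _ X1s.
have [p bp [pX1 near]] := near_hole oD cX1 X1Z nin.
apply: hn1; apply: (outer th oD r0 hU Uc m0 Um F1 supU bp _ d30 d3l _ _ db1 sb0 tbE hb0 _ _ us').
- rewrite /eball /= subr0 in X1r; have := enorm_tri X1 p 0; rewrite !subr0.
  have := beE r; have : d3 * r <= 1 / 40 * r by rewrite ler_pM2r.
  by move: X1r pX1 r0; clear; lra.
- by rewrite d3E.
- by move=> p' bp' hp'; rewrite d3E; exact: ch3.
- by move=> X Y V M; exact: (prop _ _ _ db0 d364 tb0 X Y V M).
- exact: shrink db2 XsO.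
move=> X Xs1; have [c1 c2 _ c4] := hs' _ Xs1; split=> //.
by have := near X c4; rewrite -beE; move: ber; clear; lra.
Qed.

End critical_count.

(** * Geometric data of an arbitrary ball, by compactness *)

Section general_data.
Context {R : realType}.
Implicit Types (X Y Z W p q : R * R) (A B K : set (R * R)).

Lemma list_min (T : eqType) (f : T -> R) (l : seq T) : (forall x, x \in l -> 0 < f x) ->
  exists2 d : R, 0 < d & forall x, x \in l -> d <= f x.
Proof.
elim: l => [|x l IH] h; first by exists 1.
have [y yl|d d0 hd] := IH; first by apply: h; rewrite inE yl orbT.
exists (Num.min d (f x)); first by rewrite lt_min d0 h// mem_head.
by move=> y; rewrite inE => /orP[/eqP->|/hd h']; rewrite ge_min ?lexx ?orbT// h'.
Qed.

Lemma closed_boundary (D : set (R * R)) : closed (boundary D).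
Proof.
rewrite /boundary setDE; apply: closedI; first exact: closed_closure.
by apply: open_closedC; exact: open_interior.
Qed.

Lemma charts_general (theta : R -> R) (D : set (R * R)) (r tau : R) : dini_parameter theta -> dini_domain theta D ->
  0 < r -> 0 < tau ->
  exists d : R, [/\ 0 < d, d <= tau / 4, theta (d * r) <= tilt &
    forall p, boundary D p -> enorm p <= (2 - tau) * r -> dchart theta D p (d * r)].
Proof.
move=> th [_ _ hg] r0 t0.
have [g gP] := choice (fun p => (ltac:(have [b|nb] := pselect (boundary D p);
  [have [s s0 hs] := hg p b; exists s => _; by split|exists 1 => b; by []]) :
  exists s : R, boundary D p -> 0 < s /\ dini_graph theta D p s)).
pose K := boundary D `&` ecball 0 ((2 - tau) * r).
have cK : compact K.
  apply: (@subclosed_compact _ _ (ecball 0 ((2 - tau) * r))); [|exact: compact_ecball|by move=> X []].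
  by apply: closedI; [exact: closed_boundary|exact: closed_ecball].
have [|l lK lcov] := @compact_gauge R K (fun p => g p / 2) cK.
  by move=> X [/gP[g0 _] _]; exact: half_pos.
have [|d d0 hd] := @list_min _ (fun p => g p / 2 / r) l.
  by move=> X /lK[/gP[g0 _] _]; rewrite divr_gt0// half_pos.
have [r1 r10 hr1] := theta_small th (tilt_gt0 R).
have t40 : 0 < tau / 4 by rewrite divr_gt0.
exists (Num.min d (Num.min (tau / 4) (r1 / r))); split.
- by rewrite !lt_min d0 t40 divr_gt0.
- by rewrite !ge_min lexx orbT.
- apply: le_trans hr1; apply: (theta_le th); first by rewrite mulr_ge0 ?(ltW r0)// !le_min (ltW d0) (ltW t40) divr_ge0// ltW.
  by rewrite -ler_pdivlMr// !ge_min lexx !orbT.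
move=> p bp pr; have [|q ql pq] := lcov p; first by split=> //; rewrite /ecball /= subr0.
have [bq _] := lK q ql; have [g0 gq] := gP q bq.
apply: (dini_chart th gq); apply: eball_sub.
have : Num.min d (Num.min (tau / 4) (r1 / r)) * r <= g q / 2.
  by rewrite -ler_pdivlMr// ge_min hd.
by move: pq; rewrite /eball /=; lra.
Qed.

Context (r : R) (Om : set (R * R)) (oO : open Om) (Ob : Om `<=` eball 0 (2 * r)).

(* Smallness near a point of [A] forces smallness near any point of [B],
   uniformly over bounded harmonic functions. *)
Definition spreads A B : Prop := exists eta sg : R, [/\ 0 < eta, 0 < sg &
  forall kappa t : R, 0 < kappa -> 0 < t -> exists2 h : R, 0 < h & forall X Y V M, A X -> B Y -> harm V Om -> 0 <= M ->
    (forall Z, Om Z -> enorm Z <= 2 * r - sg -> `|V Z| <= M) ->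
    (forall Z, eball X kappa Z -> `|V Z| <= h * M) -> forall Z, eball Y eta Z -> `|V Z| <= t * M].

Lemma spreads_sub A A' B B' : A' `<=` A -> B' `<=` B -> spreads A B -> spreads A' B'.
Proof.
move=> AA BB [eta [sg [e0 s0 H]]]; exists eta, sg; split=> // kappa t k0 t0.
by have [h h0 hh] := H kappa t k0 t0; exists h => // X Y V M /AA AX /BB BY; exact: hh.
Qed.

(** The radius eta reached does not depend on kappa or t, so the disc around Z obtained first can
    serve as the starting disc of the second propagation. *)
Lemma spreads_trans A B Z : spreads A [set Z] -> spreads [set Z] B -> spreads A B.
Proof.
move=> [eta1 [sg1 [e1 s1 H1]]] [eta2 [sg2 [e2 s2 H2]]].
exists eta2, (Num.min sg1 sg2); split=> //; first by rewrite lt_min s1.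
move=> kappa t k0 t0; have [h2 h20 hh2] := H2 eta1 t e1 t0; have [h1 h10 hh1] := H1 kappa h2 k0 h20.
exists h1 => // X Y V M AX BY hV M0 VM sm.
have m1 : Num.min sg1 sg2 <= sg1 by rewrite ge_min lexx.
have m2 : Num.min sg1 sg2 <= sg2 by rewrite ge_min lexx orbT.
apply: (hh2 Z Y V M) => //; first by move=> W OW Wr; apply: VM => //; lra.
by apply: (hh1 X Z V M) => // W OW Wr; apply: VM => //; lra.
Qed.

Lemma spreads_listr (T : eqType) A (B : T -> set (R * R)) (l : seq T) : (forall w, w \in l -> spreads A (B w)) ->
  spreads A [set Y | exists2 w, w \in l & B w Y].
Proof.
elim: l => [|w l IH] h; first by exists 1, 1; split=> // k t _ _; exists 1 => // X Y V M _ [].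
have [eta1 [sg1 [e1 s1 H1]]] := h w (mem_head _ _).
have [w' wl|eta2 [sg2 [e2 s2 H2]]] := IH; first by apply: h; rewrite inE wl orbT.
exists (Num.min eta1 eta2), (Num.min sg1 sg2); split; [by rewrite lt_min e1|by rewrite lt_min s1|].
have m1 : Num.min sg1 sg2 <= sg1 by rewrite ge_min lexx.
have m2 : Num.min sg1 sg2 <= sg2 by rewrite ge_min lexx orbT.
move=> k t k0 t0; have [h1 h10 hh1] := H1 k t k0 t0; have [h2 h20 hh2] := H2 k t k0 t0.
exists (Num.min h1 h2); first by rewrite lt_min h10.
have hm (M : R) : 0 <= M -> Num.min h1 h2 * M <= h1 * M /\ Num.min h1 h2 * M <= h2 * M.
  by move=> M0; split; apply: ler_wpM2r => //; rewrite ge_min lexx ?orbT.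
move=> X Y V M AX [w' + BY] hV M0 VM sm Z; rewrite /eball /= lt_min => + /andP[Z1 Z2].
have [u1 u2] := hm M M0.
rewrite inE => /orP[/eqP wE|wl].
  rewrite wE in BY; apply: (hh1 X Y V M) => //; first by move=> W OW Wr; apply: VM => //; lra.
  by move=> W /sm h'; exact: le_trans h' u1.
apply: (hh2 X Y V M) => //; first by exists w'.
- by move=> W OW Wr; apply: VM => //; lra.
- by move=> W /sm h'; exact: le_trans h' u2.
Qed.

Lemma spreads_listl (T : eqType) (A : T -> set (R * R)) B (l : seq T) : (forall w, w \in l -> spreads (A w) B) ->
  spreads [set X | exists2 w, w \in l & A w X] B.
Proof.
elim: l => [|w l IH] h; first by exists 1, 1; split=> // k t _ _; exists 1 => // X Y V M [].
have [eta1 [sg1 [e1 s1 H1]]] := h w (mem_head _ _).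
have [w' wl|eta2 [sg2 [e2 s2 H2]]] := IH; first by apply: h; rewrite inE wl orbT.
exists (Num.min eta1 eta2), (Num.min sg1 sg2); split; [by rewrite lt_min e1|by rewrite lt_min s1|].
have m1 : Num.min sg1 sg2 <= sg1 by rewrite ge_min lexx.
have m2 : Num.min sg1 sg2 <= sg2 by rewrite ge_min lexx orbT.
move=> k t k0 t0; have [h1 h10 hh1] := H1 k t k0 t0; have [h2 h20 hh2] := H2 k t k0 t0.
exists (Num.min h1 h2); first by rewrite lt_min h10.
have hm (M : R) : 0 <= M -> Num.min h1 h2 * M <= h1 * M /\ Num.min h1 h2 * M <= h2 * M.
  by move=> M0; split; apply: ler_wpM2r => //; rewrite ge_min lexx ?orbT.
move=> X Y V M [w' + AX] BY hV M0 VM sm Z; rewrite /eball /= lt_min => + /andP[Z1 Z2].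
have [u1 u2] := hm M M0.
rewrite inE => /orP[/eqP wE|wl].
  rewrite wE in AX; apply: (hh1 X Y V M) => //; first by move=> W OW Wr; apply: VM => //; lra.
  by move=> W /sm h'; exact: le_trans h' u1.
apply: (hh2 X Y V M) => //; first by exists w'.
- by move=> W OW Wr; apply: VM => //; lra.
- by move=> W /sm h'; exact: le_trans h' u2.
Qed.

Lemma spreads_local Z : Om Z -> exists2 s : R, 0 < s & eball Z s `<=` Om /\ spreads (eball Z s) (eball Z s).
Proof.
move=> OZ; have [r1 r10 hr1] := proj1 (openP Om) oO Z OZ.
have Zr : enorm Z < 2 * r by have := Ob OZ; rewrite /eball /= subr0.
pose a := Num.min r1 (2 * r - enorm Z); have a0 : 0 < a by rewrite lt_min r10 subr_gt0.
have aO : eball Z a `<=` Om by move=> Y hY; apply: hr1; apply: lt_le_trans hY _; rewrite ge_min lexx.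
have ar : enorm Z + a <= 2 * r by have : a <= 2 * r - enorm Z by [rewrite ge_min lexx orbT]; lra.
exists (a / 64); first by rewrite divr_gt0.
split; first by move=> Y hY; apply: aO; apply: lt_trans hY _; lra.
exists (a / 64), (a / 2); split; [by rewrite divr_gt0|by rewrite divr_gt0|].
move=> kappa t k0 t0; have s0 : 0 < a / 4 by rewrite divr_gt0.
pose k := Num.min 1 (kappa / (a / 4)); have kp : 0 < k by rewrite lt_min ltr01 divr_gt0.
have k1 : k <= 1 by rewrite ge_min lexx.
have ks : k * (a / 4) <= kappa by rewrite -ler_pdivlMr// ge_min lexx orbT.
have [h h0 hh] := smallness kp k1 t0; exists h => // X Y V M XZ YZ hV M0 VM sm W WY.
have loc Q : enorm (Q - X) <= a / 4 -> Om Q /\ enorm Q <= 2 * r - a / 2.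
  move=> hQ; have := enorm_tri X Q Z; have := enorm_tri Z Q 0; rewrite !subr0 => h1 h2.
  have h3 : enorm (Q - Z) <= a / 4 + a / 64 by move: XZ; rewrite /eball /=; lra.
  by split; [apply: aO; rewrite /eball /=; lra|lra].
apply: (hh V X (a / 4) M s0 M0).
- by apply: (harm_eball hV s0) => Q /loc[].
- by move=> Q hQ; have [|OQ Qr] := loc Q; [exact: ltW|exact: VM].
- by move=> Q hQ; apply: sm; apply: lt_le_trans hQ ks.
rewrite /ecball /=; have := enorm_tri Y W X; have := enorm_tri Z Y X; rewrite [enorm (Z - X)]enormC.
by move: XZ YZ WY; rewrite /eball /=; lra.
Qed.

(** The set of points reached from Z0 is open and so is its complement in Om, both by
    [spreads_local]; connectedness does the rest. *)
Lemma spreads_points Z0 Z : connected Om -> Om Z0 -> Om Z -> spreads [set Z0] [set Z].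
Proof.
move=> cO O0 OZ; pose B := [set W | Om W /\ spreads [set Z0] [set W]].
have self W : Om W -> spreads [set W] [set W].
  by move=> /spreads_local[s s0 [_ h]]; apply: spreads_sub h => Y ->; exact: eball_center.
have oB : open B.
  apply/openP => W [OW hW]; have [s s0 [sO hs]] := spreads_local OW; exists s => // Y hY; split; first exact: sO.
  apply: spreads_trans hW _; apply: spreads_sub hs => Q ->; [exact: eball_center|exact: hY].
have oE : open (Om `\` B).
  apply/openP => W [OW nW]; have [s s0 [sO hs]] := spreads_local OW; exists s => // Y hY; split; first exact: sO.
  move=> [OY hY']; apply: nW; split=> //; apply: spreads_trans hY' _.
  by apply: spreads_sub hs => Q ->; [exact: hY|exact: eball_center].
suff E : B = Om by have [] : B Z by rewrite E.
apply: cO.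
- by exists Z0; split=> //; exact: self.
- by exists B => //; apply/seteqP; split=> [W [OW hW]|W []//]; split.
exists (~` (Om `\` B)); first exact: open_closedC.
apply/seteqP; split=> [W BW|W [OW nW]].
  by split; [case: BW|move=> [_]].
by apply: contrapT => nB; apply: nW; split.
Qed.

Lemma spreads_compact K : connected Om -> compact K -> K `<=` Om -> spreads K K.
Proof.
move=> cO cK KO; have [[Z0 KZ0]|none] := pselect (exists Z, K Z); last first.
  by exists 1, 1; split=> // k t _ _; exists 1 => // X Y V M KX; exfalso; apply: none; exists X.
have [g gP] := choice (fun Z => (ltac:(have [yes|no] := pselect (Om Z);
  [have [s s0 hs] := spreads_local yes; exists s => _; by split|exists 1 => o; by []]) :
  exists s : R, Om Z -> 0 < s /\ (eball Z s `<=` Om /\ spreads (eball Z s) (eball Z s)))).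
have [|l lK lcov] := @compact_gauge R K g cK; first by move=> X /KO /gP[].
have O0 := KO _ KZ0.
apply: (@spreads_trans _ _ Z0).
  apply: (spreads_sub (A := [set X | exists2 w, w \in l & eball w (g w) X]) (B := [set Z0])) => [X /lcov//|//|].
  apply: spreads_listl => w wl; have Ow := KO _ (lK w wl); have [g0 [_ hg]] := gP w Ow.
  apply: (@spreads_trans _ _ w); last exact: spreads_points.
  by apply: spreads_sub hg => // Y ->; exact: eball_center.
apply: (spreads_sub (A := [set Z0]) (B := [set X | exists2 w, w \in l & eball w (g w) X])) => [//|X /lcov//|].
apply: spreads_listr => w wl; have Ow := KO _ (lK w wl); have [g0 [_ hg]] := gP w Ow.
apply: (@spreads_trans _ _ w); first exact: spreads_points.
by apply: spreads_sub hg => // Y ->; exact: eball_center.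
Qed.
End general_data.

(** Points with room delta r form a compact subset of the connected open set, so [spreads_compact]
    gives one margin and one threshold for all pairs; these depend on D and r. *)
Lemma general_regular (R : realType) (theta : R -> R) (D : set (R * R)) (r : R) : dini_parameter theta ->
  dini_domain theta D -> boundary D 0 -> 0 < r -> connected (D `&` eball 0 (2 * r)) ->
  exists (dd ss : R -> R) (hh : R -> R -> R -> R),
  [/\ forall tau, 0 < tau -> 0 < dd tau /\ dd tau <= tau / 4, forall delta, 0 < delta -> 0 < ss delta,
    forall delta kappa t, 0 < delta -> 0 < kappa -> 0 < t -> 0 < hh delta kappa t & regular theta dd ss hh D r].
Proof.
move=> th dD b0 r0 cO; have [oD _ _] := dD.
have [dd ddP] := choice (fun tau : R => (ltac:(have [t0|nt] := pselect (0 < tau);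
  [have [d hd] := charts_general th dD r0 t0; exists d => _; exact: hd|exists 1 => t0; by []]) :
  exists d : R, 0 < tau -> [/\ 0 < d, d <= tau / 4, theta (d * r) <= tilt &
    forall p, boundary D p -> enorm p <= (2 - tau) * r -> dchart theta D p (d * r)])).
set Om := D `&` eball 0 (2 * r) in cO *.
have oO : open Om by apply: openI => //; exact: open_eball.
have Ob : Om `<=` eball 0 (2 * r) by move=> X [].
pose K (delta : R) := [set X : R * R | eball X (delta * r) `<=` Om].
have KO delta : 0 < delta -> K delta `<=` Om by move=> d0 X; apply; apply: eball_center; rewrite mulr_gt0.
have cK delta : 0 < delta -> compact (K delta).
  move=> d0; apply: (@subclosed_compact _ _ (ecball 0 (2 * r))); [|exact: compact_ecball|].
    move=> X cX Y hY; have [|X' KX' XX'] := proj1 (closureP _ X) cX (delta * r - enorm (Y - X)).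
      by rewrite subr_gt0.
    apply: KX'; rewrite /eball /=; have := enorm_tri X Y X'; rewrite [enorm (X - X')]enormC.
    by move: XX'; rewrite /eball /=; lra.
  by move=> X /(KO _ d0)/Ob/ltW.
pose P delta (sh : R * (R -> R -> R)) := [/\ 0 < sh.1, forall kappa t, 0 < kappa -> 0 < t -> 0 < sh.2 kappa t &
  forall kappa t, 0 < kappa -> 0 < t -> forall X Y V M, K delta X -> K delta Y -> harm V Om -> 0 <= M ->
    (forall Z, Om Z -> enorm Z <= (2 - sh.1) * r -> `|V Z| <= M) ->
    (forall Z, eball X (kappa * r) Z -> `|V Z| <= sh.2 kappa t * M) -> `|V Y| <= t * M].
have exP (delta : R) : exists sh, 0 < delta -> P delta sh.
  have [d0|nd] := pselect (0 < delta); last by exists (1, fun _ _ => 1) => d0.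
  have [eta [sg [e0 s0 H]]] := spreads_compact oO Ob cO (cK _ d0) (KO _ d0).
  have ex (kt : R * R) : exists h : R, 0 < kt.1 -> 0 < kt.2 -> 0 < h /\ forall X Y V M, K delta X -> K delta Y ->
      harm V Om -> 0 <= M -> (forall Z, Om Z -> enorm Z <= 2 * r - sg -> `|V Z| <= M) ->
      (forall Z, eball X (kt.1 * r) Z -> `|V Z| <= h * M) -> forall Z, eball Y eta Z -> `|V Z| <= kt.2 * M.
    have [k0|nk] := pselect (0 < kt.1); last by exists 1 => k0.
    have [t0|nt] := pselect (0 < kt.2); last by exists 1 => _ t0.
    by have [h h0 hh] := H (kt.1 * r) kt.2 (mulr_gt0 k0 r0) t0; exists h => _ _; split.
  have [h hP] := choice ex.
  exists (sg / r, fun kappa t => h (kappa, t)) => _; split=> [|kappa t k0 t0|kappa t k0 t0 X Y V M KX KY hV M0 VM sm] /=.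
  - by rewrite divr_gt0.
  - by have [] := hP (kappa, t) k0 t0.
  have [_ hh] := hP (kappa, t) k0 t0; apply: (hh X Y V M KX KY hV M0 _ sm); last exact: eball_center.
  by move=> Z OZ Zr; apply: VM => //=; rewrite mulrBl divfK ?gt_eqF.
have [sh shP] := choice exP.
exists dd, (fun delta => (sh delta).1), (fun delta => (sh delta).2); split.
- by move=> tau /ddP[].
- by move=> delta /shP[].
- by move=> delta kappa t /shP[_ h _]; exact: h.
split=> //; first by move=> tau /ddP[].
by move=> delta kappa t /shP[_ _ h] k0 t0 X Y V M; exact: h.
Qed.

(** * Universal geometric data when the ball is one chart *)

Section uniform_data.
Context {R : realType}.
Implicit Types (X Y Z W p q n v : R * R) (r t s : R).

Lemma ball_room Y s r : 0 < s -> eball Y s `<=` eball 0 r -> enorm Y + s <= r.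
Proof.
move=> s0 sub; rewrite leNgt; apply/negP => lt.
have [v v1 vY] : exists2 v, enorm v = 1 & Y = enorm Y *: v.
  have [->|Yn0] := eqVneq Y 0.
    by exists e1; [rewrite /e1 enorm_e1 normr1|rewrite enorm0 scale0r].
  have Y0 : 0 < enorm Y.
    by rewrite lt_neqAle enorm_ge0 andbT eq_sym; apply/eqP => /enorm_eq0 E; move: Yn0; rewrite E eqxx.
  exists ((enorm Y)^-1 *: Y); first by rewrite enormZ gtr0_norm ?invr_gt0// mulVf ?gt_eqF.
  by rewrite scalerA divff ?gt_eqF// scale1r.
pose a := Num.max 0 (r - enorm Y).
have a0 : 0 <= a by rewrite le_max lexx.
have a1 : r - enorm Y <= a by rewrite le_max lexx orbT.
have as_ : a < s by rewrite gt_max s0; lra.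
have : eball 0 r (Y + a *: v).
  by apply: sub; rewrite /eball /= addrAC subrr add0r enormZ v1 mulr1 ger0_norm.
rewrite /eball /= subr0 {1}vY -scalerDl enormZ v1 mulr1 ger0_norm ?addr_ge0 ?enorm_ge0//.
by lra.
Qed.

Section star.
Context (D : set (R * R)) (n : R * R) (r : R) (oD : open D) (r0 : 0 < r) (n1 : dot n n = 1).
Context (b0 : boundary D 0) (ch : chart D 0 n (2 * r) tilt).
Let Om := D `&` eball 0 (2 * r).
Let P := r *: n.

Lemma pole_dot Z : eball P (r / 4) Z -> 3 / 4 * r <= dot Z n /\ enorm Z <= 5 / 4 * r.
Proof.
move=> hZ; have en : enorm n = 1 by apply/eqP; rewrite -(@eqrXn2 _ 2) ?enorm_ge0// -dot_enorm n1 expr1n.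
have eP : enorm P = r by rewrite /P enormZ en mulr1 gtr0_norm.
have -> : dot Z n = r + dot (Z - P) n by rewrite dotBl /P dotZl n1 mulr1 addrC subrK.
have := dot_le (Z - P) n1; rewrite ler_norml => /andP[h _].
have := enorm_tri P Z 0; rewrite !subr0 eP.
by move: hZ; rewrite /eball /=; split; lra.
Qed.

Lemma high_Om Z : r / 2 <= dot Z n -> enorm Z < 2 * r -> Om Z.
Proof.
move=> h1 h2; split; last by rewrite /eball /= subr0.
apply: (chart_above n1 (tilt_ge0 R) ch b0); rewrite ?subr0; first by rewrite /eball /= subr0.
by have := tiltM Z; move: r0; lra.
Qed.

(** The domain in the ball is star-shaped about every point of a disc around P = r n. Either the
    segment from Z is steep and stays in the cone above Z, or Z is already so high that the whole
    segment stays above the boundary. *)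
Lemma star Z Z' t : Om Z -> eball P (r / 4) Z' -> 0 <= t <= 1 -> Om (Z + t *: (Z' - Z)).
Proof.
move=> [DZ Zr] hZ' /andP[t0 t1]; have [d1 d2] := pole_dot hZ'.
rewrite /eball /= subr0 in Zr.
have yE : Z + t *: (Z' - Z) = (1 - t) *: Z + t *: Z'.
  by apply: injective_projections; rewrite /= /GRing.scale /=; ring.
have yr : enorm (Z + t *: (Z' - Z)) < 2 * r.
  rewrite yE; apply: le_lt_trans (enormD _ _) _; rewrite !enormZ !ger0_norm ?subr_ge0//.
  have [->|tn0] := eqVneq t 0; first by rewrite subr0 mul1r mul0r addr0.
  have tp : 0 < t by rewrite lt_neqAle eq_sym tn0.
  have h1 : (1 - t) * enorm Z <= (1 - t) * (2 * r) by apply: ler_wpM2l; [rewrite subr_ge0|exact: ltW].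
  have h2 : t * enorm Z' < t * (2 * r) by rewrite ltr_pM2l//; move: r0; lra.
  by lra.
have [->|tn0] := eqVneq t 0; first by rewrite scale0r addr0; split=> //; rewrite /eball /= subr0.
have tp : 0 < t by rewrite lt_neqAle eq_sym tn0.
have [h|h] := ltP (tilt * enorm (Z' - Z)) (dot (Z' - Z) n).
  split; last by rewrite /eball /= subr0.
  apply: (ch _ _ DZ); rewrite ?/eball /= ?subr0//.
  by rewrite addrAC subrr add0r enormZ gtr0_norm// dotZl mulrCA ltr_pM2l.
apply: high_Om => //; rewrite yE dotDl !dotZl.
have h3 : enorm (Z' - Z) <= 4 * r by have := enormB Z' Z; move: r0; lra.
have h4 : r / 2 <= dot Z n by move: h; rewrite dotBl; have := tiltM (Z' - Z); move: r0; lra.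
have h5 : (1 - t) * (r / 2) <= (1 - t) * dot Z n by apply: ler_wpM2l => //; rewrite subr_ge0.
have h6 : t * (r / 2) <= t * dot Z' n by apply: ler_wpM2l => //; move: r0; lra.
by lra.
Qed.

Lemma star_ball X s t : eball X s `<=` Om -> s <= r / 4 -> 0 <= t <= 1 -> eball (X + t *: (P - X)) s `<=` Om.
Proof.
move=> sub sr ht Y hY; set w := Y - (X + t *: (P - X)).
have ws : enorm w < s by exact: hY.
have -> : Y = (X + w) + t *: ((P + w) - (X + w)).
  by apply: injective_projections; rewrite /w /= /GRing.scale /=; ring.
apply: star => //; first by apply: sub; rewrite /eball /= addrAC subrr add0r.
by rewrite /eball /= addrAC subrr add0r; lra.
Qed.

(** K equal steps from X to the pole P and K equal steps from P to Y; both formulas give P at the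
    turn, and K steps suffice uniformly since every segment is shorter than 3 r. *)
Definition path X Y (K i : nat) : R * R :=
  if (i <= K)%N then X + (i%:R / K%:R) *: (P - X) else Y + ((2 * K - i)%N%:R / K%:R) *: (P - Y).

Lemma path_ball X Y s K i : (0 < K)%N -> eball X s `<=` Om -> eball Y s `<=` Om -> s <= r / 4 -> (i <= 2 * K)%N ->
  eball (path X Y K i) s `<=` Om.
Proof.
move=> K0 hX hY sr iK; have Kp : 0 < (K%:R : R) by rewrite ltr0n.
rewrite /path; case: ifPn => ik; apply: star_ball => //; apply/andP; split; rewrite ?divr_ge0//.
  by rewrite ler_pdivrMr// mul1r ler_nat.
by rewrite ler_pdivrMr// mul1r ler_nat; lia.
Qed.

Lemma path_end X Y K : (0 < K)%N -> path X Y K (2 * K) = Y.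
Proof.
move=> K0; rewrite /path ifF; last by apply/negbTE; lia.
by rewrite subnn mul0r scale0r addr0.
Qed.

Lemma path_start X Y K : path X Y K 0 = X.
Proof. by rewrite /path leq0n mul0r scale0r addr0. Qed.

Lemma path_step X Y K i a : (0 < K)%N -> Om X -> Om Y -> 3 * r <= a * K%:R ->
  enorm (path X Y K i.+1 - path X Y K i) <= a.
Proof.
move=> K0 OX OY hK; have Kp : 0 < (K%:R : R) by rewrite ltr0n.
have en : enorm n = 1 by apply/eqP; rewrite -(@eqrXn2 _ 2) ?enorm_ge0// -dot_enorm n1 expr1n.
have eP : enorm P = r by rewrite /P enormZ en mulr1 gtr0_norm.
have len Z : Om Z -> enorm (P - Z) / K%:R <= a.
  move=> [_]; rewrite /eball /= subr0 => Zr; rewrite ler_pdivrMr//.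
  by have := enormB P Z; rewrite eP; lra.
have seg Z (c c' : R) : Om Z -> `|c - c'| = 1 -> enorm (Z + (c / K%:R) *: (P - Z) - (Z + (c' / K%:R) *: (P - Z))) <= a.
  move=> OZ h; rewrite opprD addrACA subrr add0r -scalerBl enormZ -mulrBl normrM h mul1r.
  by rewrite gtr0_norm ?invr_gt0// mulrC; exact: len.
rewrite /path; case: (ltnP i K) => iK.
  by rewrite ltnW//; apply: seg => //; rewrite -natr1 addrAC subrr add0r normr1.
case: (leqP i K) => iK'.
  have -> : i = K by apply/eqP; rewrite eqn_leq iK iK'.
  have -> : X + (K%:R / K%:R) *: (P - X) = Y + (K%:R / K%:R) *: (P - Y).
    by rewrite divff ?gt_eqF// !scale1r ![_ + (P - _)]addrC !subrK.
  apply: seg => //; rewrite (_ : (2 * K - K.+1)%N = K.-1); last by lia.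
  by rewrite -{2}(prednK K0) -natr1 opprD addrA subrr add0r normrN normr1.
have [i2|i2] := ltnP i (2 * K)%N.
  apply: seg => //; rewrite (_ : (2 * K - i)%N = (2 * K - i.+1).+1); last by lia.
  by rewrite -natr1 opprD addrA subrr add0r normrN normr1.
have z1 : (2 * K - i)%N = 0%N by lia. have z2 : (2 * K - i.+1)%N = 0%N by lia.
rewrite z1 z2 subrr enorm0.
by have := len Y OY; apply: le_trans; rewrite divr_ge0 ?enorm_ge0// ltW.
Qed.
End star.

(** Smallness travels along the chain through the pole; star-shapedness about a disc preserves the
    room of its centres. The number of steps depends on delta only, whence functions independent of
    theta, D and r. *)
Lemma uniform_regular : exists (dd ss : R -> R) (hh : R -> R -> R -> R),
  [/\ forall tau, 0 < tau -> 0 < dd tau /\ dd tau <= tau / 4, forall delta, 0 < delta -> 0 < ss delta,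
    forall delta kappa t, 0 < delta -> 0 < kappa -> 0 < t -> 0 < hh delta kappa t &
    forall theta D r, dini_parameter theta -> open D -> boundary D 0 -> 0 < r -> theta (2 * r) <= tilt ->
      dini_graph theta D 0 (2 * r) -> regular theta dd ss hh D r].
Proof.
pose dd tau : R := Num.min (tau / 4) (1 / 4); pose sd delta : R := Num.min delta (1 / 4).
have sd0 delta : 0 < delta -> 0 < sd delta by move=> d0; rewrite lt_min d0; lra.
(* A step is at most 3 r / K, and it must not exceed S / 16 with S = sd r / 2; this asks for K >= 96
   / sd. *)
pose Kn delta := (Num.bound (96 / sd delta)).+1.
pose chain (x : nat * (R * R)) (h : R) := 0 < h /\
  forall (V : R * R -> R) (z : nat -> R * R) s M, 0 < s -> 0 <= M ->
    (forall i, (i <= x.1)%N -> pa V (eball (z i) s) /\ forall Y, eball (z i) s Y -> `|V Y| <= M) ->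
    (forall i, (i < x.1)%N -> enorm (z i.+1 - z i) <= s / 16) ->
    (forall Y, eball (z 0%N) (x.2.1 * s) Y -> `|V Y| <= h * M) ->
    `|V (z x.1)| <= x.2.2 * M.
have ex x : exists h : R, 0 < x.2.1 -> x.2.1 <= 1 -> 0 < x.2.2 -> chain x h.
  case: x => m [k t]; have [k0|n0] := pselect (0 < k); last by exists 1.
  have [k1|n1] := pselect (k <= 1); last by exists 1.
  have [t0|n2] := pselect (0 < t); last by exists 1.
  by have [h h0 hh] := @chain_small R m k t k0 k1 t0; exists h => _ _ _; split.
have [hc hcP] := choice ex.
(* The radius kappa r of the starting disc, expressed in units of the chain radius S and capped by
   one. *)
pose kk delta kappa : R := Num.min 1 (2 * kappa / sd delta).
pose hh delta kappa t := hc ((2 * Kn delta)%N, (kk delta kappa, t)).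
have kk0 delta kappa : 0 < delta -> 0 < kappa -> 0 < kk delta kappa.
  by move=> d0 k0; rewrite lt_min ltr01 divr_gt0 ?sd0// mulr_gt0.
have kk1 delta kappa : kk delta kappa <= 1 by rewrite ge_min lexx.
exists dd, (fun delta => sd delta / 2), hh; split.
- by move=> tau t0; rewrite ge_min lexx lt_min divr_gt0//; split=> //; lra.
- by move=> delta d0; rewrite divr_gt0// sd0.
- by move=> delta kappa t d0 k0 t0; have [] := hcP ((2 * Kn delta)%N, (kk delta kappa, t)) (kk0 _ _ d0 k0) (kk1 _ _) t0.
move=> theta D r th oD b0 r0 te gr; have r20 : 0 < 2 * r by rewrite mulr_gt0.
have [n n1 ch] := dchart_le r20 te (dini_chart th gr (fun _ h => h)).
split=> //.
  move=> tau t0; have d0 : 0 < dd tau by rewrite lt_min divr_gt0//; lra.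
  have d1 : dd tau * r <= 1 / 4 * r by rewrite ler_pM2r// ge_min lexx orbT.
  have d2 : dd tau * r <= tau / 4 * r by rewrite ler_pM2r// ge_min lexx.
  have tr : 0 < tau * r by rewrite mulr_gt0.
  split; first by apply: le_trans te; apply: (theta_le th); [rewrite mulr_ge0// ltW|lra].
  by move=> p bp pr; apply: (dini_chart th gr); apply: eball_sub; rewrite subr0; lra.
move=> delta kappa t d0 k0 t0 X Y V M hX hY hV M0 VM sm.
have s0 := sd0 _ d0; pose S := sd delta / 2 * r.
have S0 : 0 < S by rewrite mulr_gt0// divr_gt0.
have S2 : 2 * S = sd delta * r by rewrite /S; field.
have s4 : 2 * S <= r / 4.
  by rewrite S2; have : sd delta * r <= 1 / 4 * r by [rewrite ler_pM2r// ge_min lexx orbT]; lra.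
have sS (W : R * R) : eball W (delta * r) `<=` D `&` eball 0 (2 * r) -> eball W (2 * S) `<=` D `&` eball 0 (2 * r).
  by move=> h; apply: subset_trans h => Q hQ; apply: lt_le_trans hQ _; rewrite S2 ler_pM2r// ge_min lexx.
have KX := sS X hX; have KY := sS Y hY.
have S20 : 0 < 2 * S by rewrite mulr_gt0.
have [_ H] := hcP ((2 * Kn delta)%N, (kk delta kappa, t)) (kk0 _ _ d0 k0) (kk1 _ _) t0.
have K0 : (0 < Kn delta)%N by [].
have := H V (path n r X Y (Kn delta)) S M S0 M0.
rewrite /= path_start path_end// => /(_ _ _ _); apply.
- move=> i iK; have bi : eball (path n r X Y (Kn delta) i) (2 * S) `<=` D `&` eball 0 (2 * r).
    by apply: (path_ball r0 n1 b0 ch).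
  have ec : ecball (path n r X Y (Kn delta) i) S `<=` D `&` eball 0 (2 * r).
    by apply: subset_trans bi; apply: ecball_eball; lra.
  split; first exact: harm_eball hV S0 ec.
  move=> W hW; apply: VM; first by apply: ec; exact: ltW.
  have room : enorm (path n r X Y (Kn delta) i) + 2 * S <= 2 * r by apply: ball_room => // Q /bi[].
  have := enorm_tri (path n r X Y (Kn delta) i) W 0; rewrite !subr0.
  by move: hW; rewrite /eball /= -/S mulrBl -/S; lra.
- have OX : (D `&` eball 0 (2 * r)) X by apply: KX; exact: eball_center.
  have OY : (D `&` eball 0 (2 * r)) Y by apply: KY; exact: eball_center.
  move=> i _; apply: (path_step r0 n1 i K0 OX OY).
  have a0 : 0 <= 96 / sd delta by rewrite divr_ge0 ?ler0n// ltW.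
  have := archi_boundP a0; rewrite ltr_pdivrMr// => h.
  have hK : 96 <= (Kn delta)%:R * sd delta.
    apply: le_trans (ltW h) _; apply: ler_wpM2r; first exact: ltW.
    by rewrite ler_nat.
  have -> : S / 16 * (Kn delta)%:R = (Kn delta)%:R * sd delta * r / 32 by rewrite /S; field.
  by have : 96 * r <= (Kn delta)%:R * sd delta * r by [rewrite ler_pM2r]; lra.
move=> W hW; apply: sm; apply: lt_le_trans hW _.
have kl : kk delta kappa <= 2 * kappa / sd delta by rewrite ge_min lexx orbT.
apply: (@le_trans _ _ (2 * kappa / sd delta * S)); first by rewrite ler_pM2r.
by rewrite /S le_eqVlt; apply/orP; left; apply/eqP; field; rewrite gt_eqF.
Qed.
End uniform_data.

(** * From the given solution to its extension by zero *)

Section transfer.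
Context {R : realType}.
Implicit Types (X Y : R * R) (D : set (R * R)).

Lemma within_contw (S : set (R * R)) (g : R * R -> R) : {within S, continuous g} -> contw g S.
Proof.
move=> /subspace_continuousP h X SX e e0.
have /cvgrPdist_le/(_ e e0) := h X SX; rewrite near_withinE => /nbhs_eball[d d0 hd].
by exists d => // Y SY hY; have := hd Y hY SY; rewrite distrC.
Qed.

Context (D : set (R * R)) (u : R * R -> R) (r : R) (oD : open D) (r0 : 0 < r).
Let Om := D `&` eball 0 (2 * r).
Let U := ext0 D u.
Context (hu : harmonic_on u Om)
  (cu : {within (closure D `&` eball 0 (2 * r)) `|` (D `&` ecball 0 (2 * r)), continuous u})
  (zu : forall X, boundary D X -> eball 0 (2 * r) X -> u X = 0).

Lemma ext0_harm : harm U Om.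
Proof.
have oO : open Om by apply: openI => //; exact: open_eball.
move=> X OX; have [s s0 ps] := harmonic_on_harm oO hu OX.
have [t t0 tD] := proj1 (openP D) oD X (proj1 OX).
exists (Num.min s t); first by rewrite lt_min s0.
apply: (@pa_eq _ u) => [Y hY|].
  by rewrite /U ext0_in//; apply: tD; apply: lt_le_trans hY _; rewrite ge_min lexx orbT.
by apply: paS ps => Y hY; apply: lt_le_trans hY _; rewrite ge_min lexx.
Qed.

(** Interior points are covered by harmonicity and points off the closure by local vanishing; at a
    boundary point the continuity of u up to the closure and its zero value are used. *)
Lemma ext0_cont X : eball 0 (2 * r) X -> {for X, continuous U}.
Proof.
move=> bX; have [DX|nX] := pselect (D X); first by apply: (harm_cont ext0_harm); split.
have UX : U X = 0 by exact: U_out.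
apply/cont_atP => e e0; rewrite UX.
have [cX|ncX] := pselect (closure D X); last first.
  have : (~` closure D) X by []. move/(proj1 (openP _) (closed_openC (@closed_closure _ D))) => [s s0 hs].
  exists s => // Y hY; have -> : U Y = 0 by apply: U_out => DY; exact: hs Y hY (subset_closure DY).
  by rewrite subrr normr0 ltW.
have uX : u X = 0 by apply: zu => //; split=> // /interior_subset.
have [|d d0 hd] := within_contw cu _ e0 (X := X); first by left.
have [s s0 hs] := proj1 (openP _) (@open_eball R 0 (2 * r)) X bX.
exists (Num.min d s); first by rewrite lt_min d0.
move=> Y; rewrite /eball /= lt_min => /andP[Y1 Y2].
have [DY|nY] := pselect (D Y); last by rewrite /U U_out// subrr normr0 ltW.
by have := hd Y; rewrite uX /U ext0_in//; apply=> //; left; split; [exact: subset_closure|exact: hs].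
Qed.

Lemma ext0_sphere X : D X -> esphere 0 (2 * r) X -> forall e, 0 < e ->
  exists2 d : R, 0 < d & forall Y, Om Y -> eball X d Y -> `|U Y - U X| <= e.
Proof.
move=> DX SX e e0; have [|d d0 hd] := within_contw cu _ e0 (X := X).
  by right; split=> //; move: SX; rewrite /esphere /ecball /= => ->.
exists d => // Y [DY Yr] hY; rewrite /U !ext0_in//; apply: hd => //.
by right; split=> //; exact: ltW.
Qed.

Lemma critical_crit_at X : critical_set D u X -> eball 0 (2 * r) X -> closure D X /\ crit_at U D X.
Proof.
move=> [cX gX] bX; split=> // e e0.
have /cvgrPdist_le/(_ _ (half_pos e0)) := gX; rewrite near_withinE => /nbhs_eball[d d0 hd].
have [s s0 hs] := proj1 (openP _) (@open_eball R 0 (2 * r)) X bX.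
exists (Num.min d s); first by rewrite lt_min d0.
move=> Y DY hY; have /andP[Y1 Y2] : (enorm (Y - X) < d) && (enorm (Y - X) < s) by rewrite -lt_min.
have OY : Om Y by split=> //; exact: hs.
rewrite (der_ext0 oD ext0_harm OY).
have -> : cn (der u Y) = enorm (grad u Y).
  by apply/eqP; rewrite -(@eqrXn2 _ 2) ?enorm_ge0 ?cn_ge0// -dot_enorm grad_cn.
have h : `|0 - grad u Y| <= e / 2 by exact: (hd Y Y1 DY).
apply: le_trans (enorm_leN _) _; move: h; rewrite sub0r normrN; lra.
Qed.

End transfer.

(** * The counting theorem *)

Definition counts {R : realType} (dd ss : R -> R) (hh : R -> R -> R -> R) (N : R) (n : nat) : Prop :=
  forall theta D u r, dini_parameter theta -> open D -> regular theta dd ss hh D r ->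
    harm (ext0 D u) (D `&` eball 0 (2 * r)) -> (forall X, eball 0 (2 * r) X -> {for X, continuous (ext0 D u)}) ->
    (exists m Xs, [/\ 0 < m, `|ext0 D u Xs| = m, D Xs, enorm Xs <= 2 * r - 2 * r / (384 * (N + 1)) &
      (\int[(@lebesgue_measure R \x @lebesgue_measure R)%E]_X (energy_density D u (2 * r) X)%:E <
        (384 * (N + 1) * m ^+ 2)%:E)%E]) ->
    forall s, uniq s ->
      (forall X, X \in s -> [/\ closure D X, crit_at (ext0 D u) D X & eball 0 r X]) -> (size s <= n)%N.

Lemma counts_ex {R : realType} (dd ss : R -> R) (hh : R -> R -> R -> R) :
  (forall tau, 0 < tau -> 0 < dd tau /\ dd tau <= tau / 4) -> (forall delta, 0 < delta -> 0 < ss delta) ->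
  (forall delta kappa t, 0 < delta -> 0 < kappa -> 0 < t -> 0 < hh delta kappa t) ->
  exists C : R -> nat, forall N, 0 <= N -> counts dd ss hh N (C N).
Proof.
move=> h1 h2 h3; suff ex N : exists n, 0 <= N -> counts dd ss hh N n by have [C hC] := choice ex; exists C.
have [N0|nN] := pselect (0 <= N); last by exists 0%N.
by have [n hn] := critical_count h1 h2 h3 N0; exists n => _; exact: hn.
Qed.

Theorem theorem1p6 (R : realType) (theta : R -> R) :
  dini_parameter theta ->
  exists (r0 : R) (C : R -> nat), 0 < r0 /\
  forall (D : set (R * R)) (r : R),
    dini_domain theta D -> boundary D 0 -> 0 < r ->
    connected (D `&` eball 0 (2 * r)) ->
    exists C' : R -> nat,
      (r <= r0 -> dini_graph theta D 0 (2 * r) -> C' = C) /\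
      forall (u : R * R -> R) (N : R),
        harmonic_on u (D `&` eball 0 (2 * r)) ->
        {within (closure D `&` eball 0 (2 * r)) `|` (D `&` ecball 0 (2 * r)),
          continuous u} ->
        (forall X, boundary D X -> eball 0 (2 * r) X -> u X = 0) ->
        (exists2 X, (D `&` eball 0 (2 * r)) X & u X != 0) ->
        (0 < sphere_mass D u 0%R (2 * r)%R < +oo)%E ->
        frequency D u 0 (2 * r) = N%:E ->
        critical_set D u `&` eball 0 r #<= `I_(C' N).
Proof.
move=> th; have [r1 r10 hr1] := theta_small th (tilt_gt0 R).
have [dd [ss [hh [h1 h2 h3 hreg]]]] := uniform_regular (R := R).
have [C hC] := counts_ex h1 h2 h3.
(* r <= r1 / 2 gives theta (2 r) <= [tilt], the requirement of [uniform_regular]; C was obtained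
   before D and r were introduced. *)
exists (r1 / 2), C; split; first exact: half_pos.
move=> D r dD b0 r0 cO; have [oD _ _] := dD.
have [dd' [ss' [hh' [h1' h2' h3' reg']]]] := general_regular th dD b0 r0 cO.
have [C2 hC2] := counts_ex h1' h2' h3'.
have main d s h (c : R -> nat) : regular theta d s h D r -> (forall N, 0 <= N -> counts d s h N (c N)) ->
    forall (u : R * R -> R) (N : R),
      harmonic_on u (D `&` eball 0 (2 * r)) ->
      {within (closure D `&` eball 0 (2 * r)) `|` (D `&` ecball 0 (2 * r)), continuous u} ->
      (forall X, boundary D X -> eball 0 (2 * r) X -> u X = 0) ->
      (0 < sphere_mass D u 0%R (2 * r)%R < +oo)%E -> frequency D u 0 (2 * r) = N%:E ->
      critical_set D u `&` eball 0 r #<= `I_(c N).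
  move=> reg hc u N hu cu zu mass freq; have r20 : 0 < 2 * r by rewrite mulr_gt0.
  have hU := ext0_harm oD hu; have Uc := ext0_cont oD hu cu zu.
  have [N0 bound] := frequency_bound oD r20 hU Uc (ext0_sphere cu) mass freq.
  apply: card_le_seq => t ut ht; apply: (hc N N0 theta D u r th oD reg hU Uc bound t ut) => X /ht[cX bX].
  have bX' : eball 0 (2 * r) X by apply: lt_trans bX _; lra.
  by have [cl cr] : closure D X /\ crit_at (ext0 D u) D X by [apply: (critical_crit_at (r := r))]; split.
(* The universal constant whenever the ball is one chart of small radius, otherwise the one built
   from the data of this D and r. *)
exists (if `[< r <= r1 / 2 /\ dini_graph theta D 0 (2 * r) >] then C else C2); split.
  by move=> hr hg; case: asboolP => // -[].
move=> u N hu cu zu _; case: asboolP => [[hr hg]|_]; last exact: (main _ _ _ _ reg' hC2).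
apply: (main _ _ _ _ (hreg theta D r th oD b0 r0 _ hg) hC) => //.
by apply: le_trans hr1; apply: (theta_le th); [rewrite mulr_ge0// ltW|lra].
Qed.
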